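(* Let $n$ and $m$ be natural integers. There is an isomorphism $$\mathrm{Ext}^{*}_{\mathcal F(\mathbf{gr})}(T^n\circ\mathfrak a,\,T^m\circ\mathfrak a)\;\simeq\;\begin{cases}\mathbb Z[\mathrm{Surj}(m,n)] & \text{if } *=m-n,\\ 0 & \text{otherwise.}\end{cases}$$ Via this isomorphism, the following hold, where $[f]$ denotes the basis element corresponding to a surjection $f$. (1) (Actions of the symmetric groups.) The actions of $\mathfrak S_m$ and $\mathfrak S_n$ on $\mathrm{Ext}^{*}_{\mathcal F(\mathbf{gr})}(T^n\circ\mathfrak a,T^m\circ\mathfrak a)$ are induced by the composition of surjections, up to a sign. Precisely, for $f\in\mathrm{Surj}(m,n)$, $\sigma\in\mathfrak S_m$, and $\tau_{k,l}\in\mathfrak S_n$ the transposition of $k$ and $l$, where $k,l\in\{1,\dots,n\}$, $$[f].\sigma=\prod_{1\le i\le n}\epsilon\big(\overline{\sigma_{|(f\circ\sigma)^{-1}(i)}}\big)\,[f\circ\sigma],$$ where $\sigma_{|(f\circ\sigma)^{-1}(i)}:(f\circ\sigma)^{-1}(i)\to\sigma\big((f\circ\sigma)^{-1}(i)\big)$ is the restriction of $\sigma$, and $$\tau_{k,l}.[f]=(-1)^{(|f^{-1}(k)|-1)(|f^{-1}(l)|-1)}\,[\tau_{k,l}\circ f].$$ (2) (Yoneda product.) The Yoneda product $$\mathrm{Ext}^{m-l}_{\mathcal F(\mathbf{gr})}(T^l\circ\mathfrak a,T^m\circ\mathfrak a)\otimes\mathrm{Ext}^{n-m}_{\mathcal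 F(\mathbf{gr})}(T^m\circ\mathfrak a,T^n\circ\mathfrak a)\to\mathrm{Ext}^{n-l}_{\mathcal F(\mathbf{gr})}(T^l\circ\mathfrak a,T^n\circ\mathfrak a)$$ is induced by the composition of surjections, up to a sign. Precisely, it is induced by the map $Y:\mathbb Z[\mathrm{Surj}(m,l)]\otimes\mathbb Z[\mathrm{Surj}(n,m)]\to\mathbb Z[\mathrm{Surj}(n,l)]$ given by $$Y([g]\otimes[f])=\prod_{k=1}^{l}\epsilon\big(\overline{{\tau_{i,j}}_{|g^{-1}(k)}}\big)\,(-1)^{(|f^{-1}(i)|-1)(|f^{-1}(j)|-1)}\,[g\circ f]$$ where $f\in\mathrm{Surj}(n,m)$ and $g\in\mathrm{Surj}(m,l)$ is of the form $g=s\circ\tau_{i,j}$, with $s$ an order preserving surjection and $\tau_{i,j}\in\mathfrak S_m$ the transposition of $i$ and $j$. (3) (External product.) The external product $$\mathrm{Ext}^{m-l}_{\mathcal F(\mathbf{gr})}(T^l\circ\mathfrak a,T^m\circ\mathfrak a)\otimes\mathrm{Ext}^{n-p}_{\mathcal F(\mathbf{gr})}(T^p\circ\mathfrak a,T^n\circ\mathfrak a)\to\mathrm{Ext}^{m+n-l-p}_{\mathcal F(\mathbf{gr})}(T^{l+p}\circ\mathfrak a,T^{m+n}\circ\mathfrak a)$$ is induced by the disjoint union of sets.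
   Context: $\mathbf{gr}$ is a small skeleton of the category of finitely generated free groups, and $\mathcal F(\mathbf{gr})$ is the abelian category of functors from $\mathbf{gr}$ to abelian groups. $\mathfrak a$ is the abelianization functor on $\mathbf{gr}$, and $T^n$ is the $n$-th tensor power functor for abelian groups (with $T^0=\mathbb Z$), so $(T^n\circ\mathfrak a)(G)=\mathfrak a(G)^{\otimes n}$. $\mathrm{Surj}(m,n)$ is the set of surjections from a set having $m$ elements, $\{1,\dots,m\}$, to a set having $n$ elements, $\{1,\dots,n\}$; $\mathbb Z[X]$ is the free abelian group on a set $X$. The symmetric group $\mathfrak S_m$ acts on $T^m$ by permuting the factors of the tensor product; by functoriality $\mathfrak S_m$ and $\mathfrak S_n$ act on $\mathrm{Ext}^*_{\mathcal F(\mathbf{gr})}(T^n\circ\mathfrak a,T^m\circ\mathfrak a)$, the first through the second variable (written on the right) and the second through the first variable (written on the left). $\epsilon$ is the signature. For a bijection $h:A\to B$ between finite ordered sets of the same cardinality, $\overline h:B\to B$ is the unique permutation of $B$ such that $\overline h\circ u=h$, where $u:A\to B$ is the unique order preserving bijection. Subsets of $\{1,\dots,m\}$ carry the induced order, and the restriction of a permutation to a subset is regarded as a bijection onto its image. The external product is the one induced by the pointwise tensor product of functors, using $(T^l\circ\mathfrak a)\otimes(T^p\circ\mathfrak a)=T^{l+p}\circ\mathfrak a$. The disjoint union of surjections $g:\{1,\dots,m\}\to\{1,\dots,l\}$ and $f:\{1,\dots,n\}\to\{1,\dots,p\}$ is the surjection $\{1,\dots,m+n\}\to\{1,\dots,l+p\}$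 equal to $g$ on the first $m$ elements and to $i\mapsto l+f(i-m)$ on the others.
   Formalization: With d_q=|f^{-1}(q)|-1, the printed sign of τ_{k,l}.[f] (k<l) is multiplied by (-1)^{(d_k+d_l)·Σ_{k<q<l}d_q}, and that of Y([g]⊗[f]) by the same factor for i<j and by the sign of [s],[τ_{i,j}∘f] for order preserving s; the printed signs contradict functoriality. *)

(* Defs.v *)
From HB Require Import structures.
From mathcomp Require Import all_boot all_algebra fingroup perm.
From mathcomp Require Import generic_quotient ring_quotient.
From mathcomp Require Import boolp classical_sets.
From mathcomp.multinomials Require Import freeg.

Set Implicit Arguments.
Unset Strict Implicit.
Unset Printing Implicit Defensive.

Import GRing.Theory.
Local Open Scope ring_scope.
Local Open Scope quotient_scope.

Section FreeGroup.
Variable k : nat.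
Implicit Types (a b : 'I_k * bool) (s t u : seq ('I_k * bool)).

(* The letter (i, false) is the i-th generator, (i, true) its inverse. *)
Definition linv a := (a.1, ~~ a.2).

Definition reduced_word s := sorted (fun a b => b != linv a) s.

Definition fcons a s :=
  if s is b :: s' then if b == linv a then s' else a :: s else [:: a].

Definition fmul s t := foldr fcons t s.

Definition finvw s := rev (map linv s).

Lemma linvK : involutive linv.
Proof. by case=> i b; rewrite /linv /= negbK. Qed.

Lemma reduced_fcons a s : reduced_word s -> reduced_word (fcons a s).
Proof.
case: s => [|b s] //= h; case: ifPn => [_|bP]; first exact: path_sorted h.
by rewrite /= bP.
Qed.

Lemma reduced_fmul s t : reduced_word t -> reduced_word (fmul s t).
Proof. by move=> h; elim: s => //= a s IHs; apply: reduced_fcons. Qed.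

Lemma fconsK a s : reduced_word s -> fcons a (fcons (linv a) s) = s.
Proof.
case: s => [|b s] /= h; first by rewrite eqxx.
rewrite linvK; case: eqP => [e | _] /=; last by rewrite eqxx.
by subst b; case: s h => //= c s /andP[/negbTE ->].
Qed.

Lemma fmulA s t u : reduced_word s -> reduced_word t -> reduced_word u ->
  fmul (fmul s t) u = fmul s (fmul t u).
Proof.
move=> rs rt ru; have E a v : fmul (fcons a v) u = fcons a (fmul v u).
  case: v => [|b v] //=; case: eqP => [-> |//].
  by rewrite fconsK //; apply: reduced_fmul.
by elim: s {rs} => //= a s IHs; rewrite E IHs.
Qed.

Lemma fmuls0 s : reduced_word s -> fmul s [::] = s.
Proof.
elim: s => //= a s IHs h; rewrite IHs; last exact: path_sorted h.
by case: s h {IHs} => //= b s /andP[/negbTE ->].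
Qed.

Lemma fmulVs s : fmul (finvw s) s = [::].
Proof.
elim: s => //= a s IHs; rewrite /finvw /= rev_cons /fmul foldr_rcons /=.
by rewrite linvK eqxx.
Qed.

Lemma finvwK s : finvw (finvw s) = s.
Proof. by rewrite /finvw map_rev revK mapK //; apply: linvK. Qed.

Lemma reduced_finvw s : reduced_word s -> reduced_word (finvw s).
Proof.
rewrite /reduced_word /finvw rev_sorted sorted_map.
by apply: sub_sorted => a b /=; apply: contraNneq => /(can_inj linvK) ->; rewrite linvK.
Qed.

Record freegrp := FreeGrp { fword : seq ('I_k * bool); _ : reduced_word fword }.

HB.instance Definition _ := [isSub for fword].
HB.instance Definition _ := [Choice of freegrp by <:].

Definition fg_one := FreeGrp (isT : reduced_word [::]).
Definition fg_mul (x y : freegrp) := FreeGrp (reduced_fmul (fword x) (valP y)).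
Definition fg_inv (x : freegrp) := FreeGrp (reduced_finvw (valP x)).

Lemma fg_mulA : associative fg_mul.
Proof. by move=> x y z; apply: val_inj; rewrite /= fmulA //; apply: valP. Qed.
Lemma fg_mul1 : left_id fg_one fg_mul.
Proof. by move=> x; apply: val_inj. Qed.
Lemma fg_mulr1 : right_id fg_one fg_mul.
Proof. by move=> x; apply: val_inj; apply: fmuls0; apply: valP. Qed.
Lemma fg_mulV : left_inverse fg_one fg_inv fg_mul.
Proof. by move=> x; apply: val_inj; apply: fmulVs. Qed.
Lemma fg_mulrV : right_inverse fg_one fg_inv fg_mul.
Proof. by move=> x; apply: val_inj; rewrite /= -{1}(finvwK (fword x)) fmulVs. Qed.

HB.instance Definition _ :=
  isGroup.Build freegrp fg_mulA fg_mul1 fg_mulr1 fg_mulV fg_mulrV.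

End FreeGroup.

(* The category gr: its objects are the natural numbers k, standing for the   *)
(* free group of rank k.                                                      *)
Definition grhom (k l : nat) := {multiplicative freegrp k -> freegrp l}.

Section Abelianization.
Local Open Scope group_scope.
Variable G : groupType.
Implicit Types x y z : G.

Inductive derived : G -> Prop :=
| derived1 : derived 1
| derivedM x y : derived x -> derived y -> derived (x * y)
| derivedV x : derived x -> derived x^-1
| derivedR x y : derived [~ x, y].

Lemma derivedJ x y : derived x -> derived (x ^ y).
Proof.
by move=> dx; rewrite -[x ^ y](mulKg x^-1) invgK mulgA -mulgA; exact: derivedM dx (derivedR x y).
Qed.

Definition ab_equiv x y := `[< derived (x / y) >].

Lemma ab_equiv_class : equiv_class_of ab_equiv.
Proof.
split=> [x|x y|y x z]; rewrite /ab_equiv.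
- by apply/asboolP; rewrite divgg; apply: derived1.
- by apply/asboolP/asboolP => /derivedV; rewrite invgF.
- move=> /asboolP d1 /asboolP d2; apply/asboolP.
  by rewrite -[x](divgK y) -mulgA; exact: derivedM d1 d2.
Qed.

Canonical ab_equiv_equiv := EquivRelPack ab_equiv_class.
Canonical ab_equiv_encModRel := defaultEncModRel ab_equiv.

Definition abelianized := {eq_quot ab_equiv}.

HB.instance Definition _ := EqQuotient.on abelianized.
HB.instance Definition _ := Choice.on abelianized.

Definition ab_pi x : abelianized := \pi_abelianized x.

Lemma ab_piP x y : ab_pi x = ab_pi y <-> derived (x / y).
Proof.
rewrite /ab_pi; split => [/eqP|h]; first by rewrite piE => /asboolP.
by apply/eqP; rewrite piE; apply/asboolP.
Qed.

Lemma ab_ind (P : abelianized -> Prop) : (forall x, P (ab_pi x)) -> forall a, P a.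
Proof. by move=> h a; rewrite -[a]reprK; apply: h. Qed.

Lemma derived_repr x : derived (repr (ab_pi x) / x).
Proof. by apply/ab_piP; rewrite /ab_pi reprK. Qed.

Definition ab_zero := ab_pi 1.
Definition ab_opp (a : abelianized) := ab_pi (repr a)^-1.
Definition ab_add (a b : abelianized) := ab_pi (repr a * repr b).

Lemma ab_addE x y : ab_add (ab_pi x) (ab_pi y) = ab_pi (x * y).
Proof.
apply/ab_piP; move: (derived_repr x) (derived_repr y).
set x' := repr _; set y' := repr _ => dx dy.
suff -> : (x' * y') / (x * y) = (y' / y) ^ x'^-1 * (x' / x).
  by apply: derivedM => //; apply: derivedJ.
by rewrite /conjg invgK invgM !mulgA mulgKV.
Qed.

Lemma ab_oppE x : ab_opp (ab_pi x) = ab_pi x^-1.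
Proof.
apply/ab_piP; move: (derived_repr x); set x' := repr _ => dx.
have -> : x'^-1 / x^-1 = ((x' / x)^-1) ^ x'.
  by rewrite /conjg invgK invgF !mulgA mulgVK.
by apply/derivedJ/derivedV.
Qed.

Lemma ab_addA : associative ab_add.
Proof.
by elim/ab_ind=> x; elim/ab_ind=> y; elim/ab_ind=> z; rewrite !ab_addE mulgA.
Qed.

Lemma ab_addC : commutative ab_add.
Proof.
elim/ab_ind=> x; elim/ab_ind=> y; rewrite !ab_addE; apply/ab_piP.
suff -> : x * y / (y * x) = [~ x^-1, y^-1] by apply: derivedR.
by rewrite /commg /conjg !invgK invgM !mulgA.
Qed.

Lemma ab_add0 : left_id ab_zero ab_add.
Proof. by elim/ab_ind=> x; rewrite ab_addE mul1g. Qed.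

Lemma ab_addN : left_inverse ab_zero ab_opp ab_add.
Proof. by elim/ab_ind=> x; rewrite ab_oppE ab_addE mulVg. Qed.

HB.instance Definition _ :=
  GRing.isZmodule.Build abelianized ab_addA ab_addC ab_add0 ab_addN.

Lemma ab_piM x y : ab_pi (x * y) = (ab_pi x + ab_pi y)%R.
Proof. by rewrite -ab_addE. Qed.

End Abelianization.

Section AbelianizationMap.
Variables (G H : groupType) (f : {multiplicative G -> H}).

Lemma mult1 : f 1%g = 1%g.
Proof. by apply: (mulgI (f 1%g)); rewrite -gmulfM !mulg1. Qed.

Lemma multV x : f (x^-1)%g = ((f x)^-1)%g.
Proof. by apply: (mulgI (f x)); rewrite -gmulfM !mulgV mult1. Qed.

Lemma derived_mult x : derived x -> derived (f x).
Proof.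
elim=> [|y z _ dy _ dz|y _ dy|y z].
- by rewrite mult1; apply: derived1.
- by rewrite gmulfM; apply: derivedM.
- by rewrite multV; apply: derivedV.
- by rewrite /commg /conjg !gmulfM !multV; apply: derivedR.
Qed.

Definition ab_map (a : abelianized G) : abelianized H := ab_pi (f (repr a)).

Lemma ab_mapE x : ab_map (ab_pi x) = ab_pi (f x).
Proof.
by apply/ab_piP; rewrite -multV -gmulfM; apply/derived_mult/derived_repr.
Qed.

Lemma ab_map_additive : zmod_morphism ab_map.
Proof.
elim/ab_ind=> x; elim/ab_ind=> y.
have -> : ab_pi x - ab_pi y = ab_pi (x / y)%g by rewrite ab_piM -ab_oppE.
by rewrite !ab_mapE gmulfM multV ab_piM -ab_oppE.
Qed.

HB.instance Definition _ := GRing.isZmodMorphism.Build _ _ ab_map ab_map_additive.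

End AbelianizationMap.

Section QuotZ.
Variables (A : zmodType) (R : A -> Prop).

Inductive zspan : A -> Prop :=
| zspan0 : zspan 0
| zspanB x y : zspan x -> zspan y -> zspan (x - y)
| zspan_gen x : R x -> zspan x.

Definition zspanb : {pred A} := fun x => `[< zspan x >].

Lemma zspanb_closed : zmod_closed zspanb.
Proof.
split=> [|x y /asboolP dx /asboolP dy]; first exact/asboolP/zspan0.
exact/asboolP/zspanB.
Qed.

HB.instance Definition _ := GRing.isZmodClosed.Build A zspanb zspanb_closed.

Definition quotz : Type := Quotient.quot zspanb.

HB.instance Definition _ := GRing.Zmodule.on quotz.

Definition qpi (x : A) : quotz := \pi_(Quotient.quot zspanb) x.

Lemma qpi_additive : zmod_morphism qpi.
Proof. by move=> x y; rewrite /qpi raddfB. Qed.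

HB.instance Definition _ := GRing.isZmodMorphism.Build A quotz qpi qpi_additive.

Lemma qpiP x y : qpi x = qpi y <-> zspan (x - y).
Proof.
split=> [/eqP|h]; first by rewrite /qpi -Quotient.idealrBE => /asboolP.
by apply/eqP; rewrite /qpi -Quotient.idealrBE; apply/asboolP.
Qed.

Lemma qpi_ind (P : quotz -> Prop) : (forall x, P (qpi x)) -> forall a, P a.
Proof. by move=> h a; rewrite -[a]reprK; apply: h. Qed.

Definition qrepr (a : quotz) : A := repr a.

Lemma qreprK : cancel qrepr qpi.
Proof. by move=> a; rewrite /qpi /qrepr reprK. Qed.

Section Lift.
Variables (B : zmodType) (f : {additive A -> B}).
Hypothesis fR : forall x, R x -> f x = 0.

Lemma zspan_ker x : zspan x -> f x = 0.
Proof.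
elim=> [|y z _ fy _ fz|y /fR //]; first exact: raddf0.
by rewrite raddfB /= fy fz subr0.
Qed.

Definition qlift_fun (a : quotz) : B := f (qrepr a).

Lemma qlift_funE x : qlift_fun (qpi x) = f x.
Proof.
apply/eqP; rewrite -subr_eq0 -raddfB; apply/eqP/zspan_ker/qpiP.
exact: qreprK.
Qed.

Lemma qlift_additive : zmod_morphism qlift_fun.
Proof.
by elim/qpi_ind=> x; elim/qpi_ind=> y; rewrite -raddfB !qlift_funE raddfB.
Qed.

Definition qlift : {additive quotz -> B} :=
  HB.pack qlift_fun (GRing.isZmodMorphism.Build _ _ qlift_fun qlift_additive).

Lemma qliftE x : qlift (qpi x) = f x.
Proof. exact: qlift_funE. Qed.

End Lift.
End QuotZ.
Arguments qlift : simpl never.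

Section FreeLift.
Variables (X : choiceType) (B : zmodType) (f : X -> B).

Definition zlift_fun (D : {freeg X}) : B := fglift (f : X -> zmodule B) D.

Lemma zlift_additive : zmod_morphism zlift_fun.
Proof. exact: (lift_is_additive (f : X -> zmodule B)). Qed.

HB.instance Definition _ := GRing.isZmodMorphism.Build _ _ zlift_fun zlift_additive.

Definition zlift : {additive {freeg X} -> B} := zlift_fun.

Lemma zlift_funE x : zlift_fun << x >> = f x.
Proof. by rewrite /zlift_fun liftU scale1r. Qed.

Lemma zliftE x : zlift << x >> = f x.
Proof. exact: zlift_funE. Qed.

End FreeLift.
Arguments zlift : simpl never.
Arguments zlift_fun : simpl never.

Lemma freeg_ext (X : choiceType) (B : zmodType) (f g : {additive {freeg X} -> B}) :
  (forall x : X, f << x >> = g << x >>) -> f =1 g.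
Proof.
move=> fg D; rewrite -[D]freeg_sumE !raddf_sum; apply: eq_bigr => x _.
have -> : << coeff x D *g x >> = << x >> *~ coeff x D.
  by rewrite freeg_mulz intz.
by rewrite !raddfMz fg.
Qed.

(* The abelian group with generators X and relators R.                        *)
Definition pres (X : choiceType) (R : {freeg X} -> Prop) : zmodType := quotz R.

Section Presentation.
Variables (X : choiceType) (R : {freeg X} -> Prop).

Definition pgen (x : X) : pres R := qpi R << x >>.

Lemma pgen_rel (x y z : X) : R (<< z >> - << x >> - << y >>) ->
  pgen z = pgen x + pgen y.
Proof.
move=> Rz; rewrite /pgen -raddfD; apply/qpiP; apply: zspan_gen.
by rewrite opprD addrA.
Qed.

Section PresLift.
Variables (B : zmodType) (f : X -> B).
Hypothesis fR : forall r, R r -> zlift f r = 0.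

Definition pres_lift : {additive pres R -> B} := qlift fR.

Lemma pres_liftE x : pres_lift (pgen x) = f x.
Proof. by rewrite /pres_lift qliftE zliftE. Qed.
End PresLift.

Lemma pres_ext (B : zmodType) (f g : {additive pres R -> B}) :
  (forall x, f (pgen x) = g (pgen x)) -> f =1 g.
Proof.
move=> fg; elim/qpi_ind => D.
have := @freeg_ext X B (f \o qpi R) (g \o qpi R) fg D; exact.
Qed.

Lemma pres_ind (P : pres R -> Prop) : P 0 ->
  (forall a b, P a -> P b -> P (a - b)) -> (forall x, P (pgen x)) -> forall a, P a.
Proof.
move=> P0 PB Pg; have PN a : P a -> P (- a) by move=> Pa; rewrite -sub0r; apply: PB.
have PD a b : P a -> P b -> P (a + b) by move=> Pa /PN Pb; rewrite -[b]opprK; apply: PB.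
have PM a n : P a -> P (a *+ n).
  by move=> Pa; elim: n => [|n IHn]; rewrite ?mulr0n // mulrS; apply: PD.
elim/qpi_ind => D; rewrite -[D]freeg_sumE raddf_sum; apply: big_ind => // x _.
have -> : << coeff x D *g x >> = << x >> *~ coeff x D by rewrite freeg_mulz intz.
rewrite raddfMz; case: (coeff x D) => n; first by rewrite -pmulrn; apply/PM/Pg.
by rewrite NegzE mulrNz -pmulrn; apply/PN/PM/Pg.
Qed.

End Presentation.
Arguments pres_lift : simpl never.

Section Hom.
Variables A B : zmodType.

Definition homZ : Type := {additive A -> B}.

Lemma homP (f g : homZ) : (f : A -> B) =1 g -> f = g.
Proof.
case: f g => [f [[Hf]]] [g [[Hg]]] /= /funext E; subst g.
by congr (GRing.Additive.Pack (GRing.Additive.Class _)); congr (_ _); apply: Prop_irrelevance.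
Qed.

HB.instance Definition _ := gen_eqMixin homZ.
HB.instance Definition _ := gen_choiceMixin homZ.

Definition hom_zero : homZ := (\0 : A -> B)%R.
Definition hom_opp (f : homZ) : homZ := (\- f)%R.
Definition hom_add (f g : homZ) : homZ := (f \+ g)%R.

Lemma hom_addA : associative hom_add.
Proof. by move=> f g h; apply: homP => x /=; rewrite addrA. Qed.
Lemma hom_addC : commutative hom_add.
Proof. by move=> f g; apply: homP => x /=; rewrite addrC. Qed.
Lemma hom_add0 : left_id hom_zero hom_add.
Proof. by move=> f; apply: homP => x /=; rewrite add0r. Qed.
Lemma hom_addN : left_inverse hom_zero hom_opp hom_add.
Proof. by move=> f; apply: homP => x /=; rewrite addNr. Qed.

HB.instance Definition _ :=
  GRing.isZmodule.Build homZ hom_addA hom_addC hom_add0 hom_addN.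

End Hom.

Record functor := Functor {
  fob :> nat -> zmodType;
  fmap : forall k l, grhom k l -> {additive fob k -> fob l};
  fmap_id : forall k x, fmap (idfun : grhom k k) x = x;
  fmap_comp : forall k l m (u : grhom l m) (v : grhom k l) x,
    fmap (u \o v : grhom k m) x = fmap u (fmap v x)
}.
Arguments fmap F {k l} u : rename.

Record nattrans (F G : functor) := NatTrans {
  ntapp :> forall k, {additive F k -> G k};
  nt_natural : forall k l (u : grhom k l) x,
    ntapp l (fmap F u x) = fmap G u (ntapp k x)
}.

Lemma nattransP (F G : functor) (a b : nattrans F G) :
  (forall k x, a k x = b k x) -> a = b.
Proof.
case: a b => [a na] [b nb] /= ab.
have E : a = b by apply/functional_extensionality_dep => k; apply: homP => x.
by subst b; congr NatTrans; apply: Prop_irrelevance.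
Qed.

Section NatTransZmod.
Variables F G : functor.

HB.instance Definition _ := gen_eqMixin (nattrans F G).
HB.instance Definition _ := gen_choiceMixin (nattrans F G).

Lemma nt_zero_natural k l (u : grhom k l) x :
  (0 : homZ (F l) (G l)) (fmap F u x) = fmap G u ((0 : homZ (F k) (G k)) x).
Proof. by rewrite /= raddf0. Qed.
Definition nt_zero := NatTrans nt_zero_natural.

Lemma nt_opp_natural (a : nattrans F G) k l (u : grhom k l) x :
  (- (a l : homZ _ _)) (fmap F u x) = fmap G u ((- (a k : homZ _ _)) x).
Proof. by rewrite /= nt_natural raddfN. Qed.
Definition nt_opp a := NatTrans (nt_opp_natural a).

Lemma nt_add_natural (a b : nattrans F G) k l (u : grhom k l) x :
  ((a l : homZ _ _) + (b l : homZ _ _)) (fmap F u x)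
  = fmap G u (((a k : homZ _ _) + (b k : homZ _ _)) x).
Proof. by rewrite /= !nt_natural raddfD. Qed.
Definition nt_add a b := NatTrans (nt_add_natural a b).

Lemma nt_addA : associative nt_add.
Proof. by move=> a b c; apply: nattransP => k x /=; rewrite addrA. Qed.
Lemma nt_addC : commutative nt_add.
Proof. by move=> a b; apply: nattransP => k x /=; rewrite addrC. Qed.
Lemma nt_add0 : left_id nt_zero nt_add.
Proof. by move=> a; apply: nattransP => k x /=; rewrite add0r. Qed.
Lemma nt_addN : left_inverse nt_zero nt_opp nt_add.
Proof. by move=> a; apply: nattransP => k x /=; rewrite addNr. Qed.

HB.instance Definition _ :=
  GRing.isZmodule.Build (nattrans F G) nt_addA nt_addC nt_add0 nt_addN.

Lemma nt_addE (a b : nattrans F G) k x : (a + b) k x = a k x + b k x.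
Proof. by []. Qed.
Lemma nt_oppE (a : nattrans F G) k x : (- a) k x = - a k x.
Proof. by []. Qed.
Lemma nt_zeroE k x : (0 : nattrans F G) k x = 0.
Proof. by []. Qed.

End NatTransZmod.

Section NatTransId.
Variable F : functor.

Definition nt_id : nattrans F F :=
  @NatTrans F F (fun k => idfun : {additive F k -> F k}) (fun k l u x => erefl).
End NatTransId.

Section NatTransComp.
Variables (F G H : functor) (b : nattrans G H) (a : nattrans F G).

Lemma nt_comp_natural k l (u : grhom k l) x :
  (b l \o a l) (fmap F u x) = fmap H u ((b k \o a k) x).
Proof. by rewrite /= !nt_natural. Qed.

Definition nt_comp : nattrans F H := NatTrans nt_comp_natural.
End NatTransComp.

Definition nt_surj (F G : functor) (a : nattrans F G) :=
  forall k (y : G k), exists x, a k x = y.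

(* Epimorphisms of F(gr) are the pointwise surjective ones.                   *)
Definition projective (P : functor) :=
  forall (A B : functor) (e : nattrans A B) (f : nattrans P B),
    nt_surj e -> exists g : nattrans P A, nt_comp e g = f.

Record projres (F : functor) := ProjRes {
  pr_ob :> nat -> functor;
  pr_d : forall i, nattrans (pr_ob i.+1) (pr_ob i);
  pr_aug : nattrans (pr_ob 0%N) F;
  pr_proj : forall i, projective (pr_ob i);
  pr_surj : nt_surj pr_aug;
  pr_exact0 : forall k x, pr_aug k x = 0 <-> exists y, x = pr_d 0%N k y;
  pr_exact : forall i k x, pr_d i k x = 0 <-> exists y, x = pr_d i.+1 k y
}.

Section FreeCover.
Variable F : functor.

(* The direct sum, over all k and all x in F k, of the functors Z[gr(k, -)].  *)
Definition cover_gen (l : nat) : choiceType := {classic {k : nat & (F k * grhom k l)%type}}.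

Definition cover_ob (l : nat) : zmodType := {freeg (cover_gen l)}.

Definition mkgen l k (x : F k) (u : grhom k l) : cover_gen l :=
  existT (fun k => (F k * grhom k l)%type) k (x, u).

Definition cover_map_gen l m (v : grhom l m) (g : cover_gen l) : cover_ob m :=
  let: existT k (x, u) := g in << mkgen x (v \o u : grhom k m) >>.

Definition cover_map l m (v : grhom l m) : {additive cover_ob l -> cover_ob m} :=
  zlift (cover_map_gen v).

Lemma grhomP k l (u v : grhom k l) : (u : freegrp k -> freegrp l) =1 v -> u = v.
Proof.
case: u v => [u [[Hu]]] [v [[Hv]]] /= /funext E; subst v.
congr (Multiplicative.Pack (Multiplicative.Class _)); congr (_ _); exact: Prop_irrelevance.
Qed.

Lemma cover_map_id k x : cover_map (idfun : grhom k k) x = x.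
Proof.
apply: (@freeg_ext _ _ _ (idfun : {additive _ -> _})) x => -[j [x u]] /=.
rewrite ?(zliftE, zlift_funE) /=; congr << mkgen _ _ >>; exact: grhomP.
Qed.

Lemma cover_map_comp k l m (u : grhom l m) (v : grhom k l) x :
  cover_map (u \o v : grhom k m) x = cover_map u (cover_map v x).
Proof.
apply: (@freeg_ext _ _ _ (cover_map u \o cover_map v : {additive _ -> _})) x.
move=> -[j [x w]] /=; rewrite ?(zliftE, zlift_funE) /= ?(zliftE, zlift_funE) /=.
congr << mkgen _ _ >>; exact: grhomP.
Qed.

Definition cover : functor := Functor cover_map_id cover_map_comp.

Definition cover_aug_gen l (g : cover_gen l) : F l :=
  let: existT k (x, u) := g in fmap F u x.

Definition cover_aug_app l : {additive cover l -> F l} := zlift (@cover_aug_gen l).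

Lemma cover_aug_natural k l (u : grhom k l) x :
  cover_aug_app l (fmap cover u x) = fmap F u (cover_aug_app k x).
Proof.
apply: (@freeg_ext _ _ (cover_aug_app l \o cover_map u : {additive _ -> _})
  (fmap F u \o cover_aug_app k : {additive _ -> _})) x.
move=> -[j [x w]] /=; rewrite ?(zliftE, zlift_funE) /= ?(zliftE, zlift_funE) /=.
exact: fmap_comp.
Qed.

Definition cover_aug : nattrans cover F := NatTrans cover_aug_natural.

Lemma cover_aug_surj : nt_surj cover_aug.
Proof.
move=> k y; exists << mkgen y (idfun : grhom k k) >>.
by rewrite /= (zliftE, zlift_funE) /= fmap_id.
Qed.

Lemma cover_proj : projective cover.
Proof.
move=> A B e f es.
have s (kx : {k : nat & F k}) : {a : A (tag kx) |
    e _ a = f _ << mkgen (tagged kx) (idfun : grhom _ _) >>}.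
  by apply: cid; apply: es.
pose g0 l (g : cover_gen l) : A l :=
  let: existT k (x, u) := g in fmap A u (sval (s (Tagged (fun k => F k : Type) x))).
have gn k l (u : grhom k l) x :
    zlift (@g0 l) (fmap cover u x) = fmap A u (zlift (@g0 k) x).
  apply: (@freeg_ext _ _ (zlift (@g0 l) \o cover_map u : {additive _ -> _})
    (fmap A u \o zlift (@g0 k) : {additive _ -> _})) x.
  move=> -[j [x w]] /=; rewrite ?(zliftE, zlift_funE) /= ?(zliftE, zlift_funE) /=.
  exact: fmap_comp.
exists (NatTrans gn); apply: nattransP => k x.
apply: (@freeg_ext _ _ (e k \o zlift (@g0 k) : {additive _ -> _}) (f k)) x.
move=> -[j [x w]]; have /= E := svalP (s (Tagged (fun k => F k : Type) x)).
rewrite /= ?(zliftE, zlift_funE) /= nt_natural E -(nt_natural f w) /=.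
rewrite ?(zliftE, zlift_funE) /=; congr (f k << mkgen _ _ >>); exact: grhomP.
Qed.

End FreeCover.

Section Kernel.
Variables (F G : functor) (a : nattrans F G).

Definition ker_pred k : {pred F k} := fun x => a k x == 0.

Lemma ker_closed k : zmod_closed (@ker_pred k).
Proof.
split=> [|x y]; rewrite /in_mem /= /ker_pred ?raddf0 //.
by move=> /eqP ax /eqP ay; rewrite raddfB /= ax ay subr0.
Qed.

HB.instance Definition _ k := GRing.isZmodClosed.Build (F k) (@ker_pred k) (@ker_closed k).

Record ker_ob k := KerOb { ker_val : F k; _ : ker_val \in @ker_pred k }.

HB.instance Definition _ k := [isSub for @ker_val k].
HB.instance Definition _ k := [Choice of ker_ob k by <:].
HB.instance Definition _ k := [SubChoice_isSubZmodule of ker_ob k by <:].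

Lemma ker_map_subproof k l (u : grhom k l) (x : ker_ob k) :
  fmap F u (val x) \in @ker_pred l.
Proof.
case: x => x /= /eqP ax; apply/eqP; rewrite nt_natural.
by have -> : a k x = 0 by []; rewrite raddf0.
Qed.

Definition ker_map_fun k l (u : grhom k l) (x : ker_ob k) : ker_ob l :=
  KerOb (ker_map_subproof u x).

Lemma ker_map_additive k l (u : grhom k l) : zmod_morphism (ker_map_fun u).
Proof. by move=> x y; apply: val_inj; rewrite /= !raddfB. Qed.

HB.instance Definition _ k l (u : grhom k l) :=
  GRing.isZmodMorphism.Build _ _ (ker_map_fun u) (ker_map_additive u).

Definition ker_map k l (u : grhom k l) : {additive ker_ob k -> ker_ob l} :=
  ker_map_fun u.

Lemma ker_map_id k x : ker_map (idfun : grhom k k) x = x.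
Proof. by apply: val_inj; rewrite /= fmap_id. Qed.

Lemma ker_map_comp k l m (u : grhom l m) (v : grhom k l) x :
  ker_map (u \o v : grhom k m) x = ker_map u (ker_map v x).
Proof. by apply: val_inj; rewrite /= fmap_comp. Qed.

Definition kernel : functor := Functor ker_map_id ker_map_comp.

Definition ker_incl_app k : {additive kernel k -> F k} := (val : ker_ob k -> F k).

Lemma ker_incl_natural k l (u : grhom k l) x :
  ker_incl_app l (fmap kernel u x) = fmap F u (ker_incl_app k x).
Proof. by []. Qed.

Definition ker_incl : nattrans kernel F := NatTrans ker_incl_natural.

Lemma ker_inclP k x : a k x = 0 <-> exists y, x = ker_incl k y.
Proof.
split=> [/eqP ax|[[y /= /eqP ay] ->]]; last exact: ay.
by exists (@KerOb k x ax).
Qed.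

End Kernel.

Section StandardResolution.
Variable F : functor.

Fixpoint syzygy (i : nat) : functor :=
  if i is j.+1 then kernel (cover_aug (syzygy j)) else F.

Definition std_ob i := cover (syzygy i).

Definition std_d i : nattrans (std_ob i.+1) (std_ob i) :=
  nt_comp (ker_incl (cover_aug (syzygy i))) (cover_aug (syzygy i.+1)).

Lemma std_exact_gen i k (x : std_ob i k) :
  cover_aug (syzygy i) k x = 0 <-> exists y, x = std_d i k y.
Proof.
rewrite ker_inclP; split=> [[y ->]|[y ->]]; last by exists (cover_aug (syzygy i.+1) k y).
by have [z <-] := @cover_aug_surj (syzygy i.+1) k y; exists z.
Qed.

Lemma std_exact i k (x : std_ob i.+1 k) :
  std_d i k x = 0 <-> exists y, x = std_d i.+1 k y.
Proof.
rewrite -std_exact_gen; split=> [d0|x0].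
  by apply: val_inj; rewrite raddf0; exact: d0.
have -> : std_d i k x = ker_incl (cover_aug (syzygy i)) k (cover_aug (syzygy i.+1) k x) by [].
by rewrite x0 raddf0.
Qed.

Definition std_res : projres F :=
  @ProjRes F std_ob std_d (cover_aug F) (fun i => @cover_proj (syzygy i))
    (@cover_aug_surj F) (@std_exact_gen 0%N) std_exact.

End StandardResolution.

Section Cohomology.
Variables (F : functor) (P : projres F) (i : nat) (G : functor).

Definition cocycle_pred : {pred nattrans (P i) G} :=
  fun a => `[< forall k x, a k (pr_d P i k x) = 0 >].

Lemma cocycle_closed : zmod_closed cocycle_pred.
Proof.
split=> [|a b /asboolP a0 /asboolP b0]; apply/asboolP => k x //.
by rewrite nt_addE nt_oppE a0 b0 subr0.
Qed.

HB.instance Definition _ :=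
  GRing.isZmodClosed.Build (nattrans (P i) G) cocycle_pred cocycle_closed.

Record cocycle := Cocycle { cocycle_val :> nattrans (P i) G; _ : cocycle_val \in cocycle_pred }.

HB.instance Definition _ := [isSub for cocycle_val].
HB.instance Definition _ := [Choice of cocycle by <:].
HB.instance Definition _ := [SubChoice_isSubZmodule of cocycle by <:].

Definition coboundary (a : nattrans (P i) G) : Prop :=
  match i return nattrans (P i) G -> Prop with
  | 0%N => fun a => a = 0
  | j.+1 => fun a => exists b : nattrans (P j) G, a = nt_comp b (pr_d P j)
  end a.

Definition cohomology : zmodType := quotz (fun a : cocycle => coboundary a).

(* The class of a cocycle; the value at a non-cocycle is irrelevant.          *)
Definition ext_class (a : nattrans (P i) G) : cohomology :=
  qpi _ (insubd (0 : cocycle) a).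

Definition ext_repr (x : cohomology) : nattrans (P i) G := qrepr x : cocycle.

Lemma ext_reprP x k y : ext_repr x k (pr_d P i k y) = 0.
Proof. by move: y; rewrite /ext_repr; case: (qrepr x) => a aP; move: k; apply/asboolP. Qed.

Lemma ext_reprK : cancel ext_repr ext_class.
Proof. by move=> x; rewrite /ext_class /ext_repr (valKd _ (qrepr x)) qreprK. Qed.

End Cohomology.

Definition Ext (i : nat) (F G : functor) : zmodType := cohomology (std_res F) i G.

Section ChainLift.
Variables (C : nat -> functor) (d : forall j, nattrans (C j.+1) (C j)).
Variables (G : functor) (Q : projres G) (a : nattrans (C 0%N) G).
Local Open Scope classical_set_scope.

Definition is_chain_lift : set (forall j, nattrans (C j) (Q j)) :=
  [set h : forall j, nattrans (C j) (Q j) | nt_comp (pr_aug Q) (h 0%N) = a /\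
           forall j, nt_comp (pr_d Q j) (h j.+1) = nt_comp (h j) (d j)].

(* A chain map chosen among those lying over a. When C consists of projective *)
(* functors such chain maps exist (chain_lift_exists), and they are unique up *)
(* to homotopy.                                                               *)
Definition chain_lift : forall j, nattrans (C j) (Q j) := xget (fun=> 0) is_chain_lift.

End ChainLift.
Arguments is_chain_lift [C] d [G] Q a.
Arguments chain_lift [C] d [G] Q a j.

Section KernelFactor.
Variables (A B D : functor) (e' : nattrans B D) (e : nattrans A B).
Hypothesis e'e : forall k x, e' k (e k x) = 0.

Lemma ker_factor_subproof k x : e k x \in @ker_pred B D e' k.
Proof. by rewrite unfold_in /ker_pred e'e. Qed.

Definition ker_factor_fun k x : kernel e' k := KerOb (ker_factor_subproof x).

Lemma ker_factor_additive k : zmod_morphism (@ker_factor_fun k).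
Proof. by move=> x y; apply: val_inj; rewrite /= raddfB. Qed.

HB.instance Definition _ k :=
  GRing.isZmodMorphism.Build _ _ (@ker_factor_fun k) (@ker_factor_additive k).

Definition ker_factor_app k : {additive A k -> kernel e' k} := @ker_factor_fun k.

Lemma ker_factor_natural k l (u : grhom k l) x :
  ker_factor_app l (fmap A u x) = fmap (kernel e') u (ker_factor_app k x).
Proof. by apply: val_inj; rewrite /= nt_natural. Qed.

Definition ker_factor : nattrans A (kernel e') := NatTrans ker_factor_natural.
End KernelFactor.

Lemma projective_lift (P A B D : functor) (e : nattrans A B) (e' : nattrans B D)
    (f : nattrans P B) : projective P ->
    (forall k x, e' k x = 0 <-> exists y, x = e k y) ->
    (forall k x, e' k (f k x) = 0) -> exists g : nattrans P A, nt_comp e g = f.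
Proof.
move=> pP ex ef; have ee k x : e' k (e k x) = 0 by apply/ex; exists x.
have [g gP] : exists g, nt_comp (ker_factor ee) g = ker_factor ef.
  apply: pP => k [y /= yP]; have /ex[x yE] : e' k y = 0 by apply/eqP.
  by exists x; apply: val_inj.
exists g; apply: nattransP => k x.
by have /(congr1 val) := congr1 (fun h : nattrans P (kernel e') => h k x) gP.
Qed.

Section ChainLiftExists.
Variables (C : nat -> functor) (d : forall j, nattrans (C j.+1) (C j)).
Variables (G : functor) (Q : projres G) (a : nattrans (C 0%N) G).
Hypothesis projC : forall j, projective (C j).
Hypothesis dd : forall j k x, d j k (d j.+1 k x) = 0.
Hypothesis ad : forall k x, a k (d 0%N k x) = 0.

Let stage j := {h : nattrans (C j.+1) (Q j.+1) & {h' : nattrans (C j) (Q j) |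
  nt_comp (pr_d Q j) h = nt_comp h' (d j)}}.

Let next j (s : stage j) : {s' : stage j.+1 | sval (projT2 s') = projT1 s}.
Proof.
apply: cid; case: s => h [h' hh'] /=.
have [h2 h2P] : exists h2, nt_comp (pr_d Q j.+1) h2 = nt_comp h (d j.+1).
  apply: projective_lift => //; first exact: pr_exact.
  move=> k x; have := congr1 (fun u : nattrans _ _ => u k (d j.+1 k x)) hh'.
  by rewrite /= dd raddf0.
by exists (existT _ h2 (exist _ h h2P)).
Qed.

Let start : {s : stage 0%N | nt_comp (pr_aug Q) (sval (projT2 s)) = a}.
Proof.
apply: cid; have [h0 h0P] : exists h0, nt_comp (pr_aug Q) h0 = a.
  by apply: projC; apply: pr_surj.
have [h1 h1P] : exists h1, nt_comp (pr_d Q 0%N) h1 = nt_comp h0 (d 0%N).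
  apply: projective_lift => //; first exact: pr_exact0.
  move=> k x; have := congr1 (fun u : nattrans _ _ => u k (d 0%N k x)) h0P.
  by rewrite /= ad.
by exists (existT _ h1 (exist _ h0 h1P)).
Qed.

Let stages := fix st j : stage j :=
  if j is j'.+1 then sval (next (st j')) else sval start.

Lemma chain_lift_exists : exists h, is_chain_lift d Q a h.
Proof.
exists (fun j => sval (projT2 (stages j))); split; first exact: svalP start.
move=> j; have -> : sval (projT2 (stages j.+1)) = projT1 (stages j).
  exact: (svalP (next (stages j))).
exact: (svalP (projT2 (stages j))).
Qed.

Lemma chain_liftP : is_chain_lift d Q a (chain_lift d Q a).
Proof. exact: xgetPex chain_lift_exists. Qed.

End ChainLiftExists.

Lemma pr_dd (F : functor) (P : projres F) j k x : pr_d P j k (pr_d P j.+1 k x) = 0.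
Proof. by apply/pr_exact; exists x. Qed.

Definition yoneda (i j : nat) (F G H : functor) (x : Ext i F G) (y : Ext j G H) :
    Ext (j + i) F H :=
  ext_class (nt_comp (ext_repr y)
    (chain_lift (C := fun j => std_res F (j + i)) (fun j => pr_d (std_res F) (j + i))
       (std_res G) (ext_repr x) j)).

Definition ext_push (i : nat) (F G G' : functor) (b : nattrans G G') (x : Ext i F G) :
    Ext i F G' :=
  ext_class (nt_comp b (ext_repr x)).

Definition ext_pull (i : nat) (F' F G : functor) (b : nattrans F' F) (x : Ext i F G) :
    Ext i F' G :=
  ext_class (nt_comp (ext_repr x)
    (chain_lift (pr_d (std_res F')) (std_res F) (nt_comp b (pr_aug (std_res F'))) i)).

Section Tensor.
Variables A B : zmodType.

Inductive tens_rel : {freeg (A * B)%type} -> Prop :=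
| tens_relDl a a' b : tens_rel (<< (a + a', b) >> - << (a, b) >> - << (a', b) >>)
| tens_relDr a b b' : tens_rel (<< (a, b + b') >> - << (a, b) >> - << (a, b') >>).

Definition tens : zmodType := pres tens_rel.

Definition tensor (a : A) (b : B) : tens := pgen tens_rel (a, b).

Lemma tensorDl a a' b : tensor (a + a') b = tensor a b + tensor a' b.
Proof. exact/pgen_rel/tens_relDl. Qed.

Lemma tensorDr a b b' : tensor a (b + b') = tensor a b + tensor a b'.
Proof. exact/pgen_rel/tens_relDr. Qed.

Section TensorLift.
Variables (M : zmodType) (f : A -> B -> M).
Hypothesis fDl : forall a a' b, f (a + a') b = f a b + f a' b.
Hypothesis fDr : forall a b b', f a (b + b') = f a b + f a b'.

Lemma tens_lift_subproof r : tens_rel r -> zlift (fun ab => f ab.1 ab.2) r = 0.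
Proof.
by case=> [a a' b|a b b']; rewrite !raddfB /= !zlift_funE /= ?fDl ?fDr addrAC addrK subrr.
Qed.

Definition tens_lift : {additive tens -> M} := pres_lift tens_lift_subproof.

Lemma tens_liftE a b : tens_lift (tensor a b) = f a b.
Proof. exact: pres_liftE. Qed.
End TensorLift.
End Tensor.

Lemma tens_ext (A B M : zmodType) (f g : {additive tens A B -> M}) :
  (forall a b, f (tensor a b) = g (tensor a b)) -> f =1 g.
Proof. by move=> fg; apply: pres_ext => -[a b]; exact: fg. Qed.

Section TensorMap.
Variables (A A' B B' : zmodType) (f : {additive A -> A'}) (g : {additive B -> B'}).

Lemma tens_map_Dl a a' b :
  tensor (f (a + a')) (g b) = tensor (f a) (g b) + tensor (f a') (g b).
Proof. by rewrite raddfD tensorDl. Qed.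

Lemma tens_map_Dr a b b' :
  tensor (f a) (g (b + b')) = tensor (f a) (g b) + tensor (f a) (g b').
Proof. by rewrite raddfD tensorDr. Qed.

Definition tens_map : {additive tens A B -> tens A' B'} :=
  tens_lift (f := fun a b => tensor (f a) (g b)) tens_map_Dl tens_map_Dr.

Lemma tens_mapE a b : tens_map (tensor a b) = tensor (f a) (g b).
Proof. exact: tens_liftE. Qed.
End TensorMap.

Section TensorPower.
Variables (n : nat) (A : zmodType).

(* The relators express additivity in each of the n variables; for n = 0 there *)
(* are none, and the single generator makes the group isomorphic to Z.        *)
Inductive tpow_rel : {freeg {ffun 'I_n -> A}} -> Prop :=
| tpow_relD i (x y z : {ffun 'I_n -> A}) : z i = x i + y i ->
    (forall j, j != i -> x j = z j /\ y j = z j) ->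
    tpow_rel (<< z >> - << x >> - << y >>).

Definition tpow : zmodType := pres tpow_rel.

Definition tpure (x : {ffun 'I_n -> A}) : tpow := pgen tpow_rel x.

Lemma tpureD i (x y z : {ffun 'I_n -> A}) : z i = x i + y i ->
  (forall j, j != i -> x j = z j /\ y j = z j) -> tpure z = tpure x + tpure y.
Proof. by move=> zi xyz; apply: pgen_rel; apply: (tpow_relD zi). Qed.

Section TPowLift.
Variables (M : zmodType) (f : {ffun 'I_n -> A} -> M).
Hypothesis fD : forall i (x y z : {ffun 'I_n -> A}), z i = x i + y i ->
  (forall j, j != i -> x j = z j /\ y j = z j) -> f z = f x + f y.

Lemma tpow_lift_subproof r : tpow_rel r -> zlift f r = 0.
Proof.
case=> i x y z zi xyz; rewrite !raddfB /= !zlift_funE (fD zi xyz).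
by rewrite addrAC addrK subrr.
Qed.

Definition tpow_lift : {additive tpow -> M} := pres_lift tpow_lift_subproof.

Lemma tpow_liftE x : tpow_lift (tpure x) = f x.
Proof. exact: pres_liftE. Qed.
End TPowLift.

Lemma tpow_ext (M : zmodType) (f g : {additive tpow -> M}) :
  (forall x, f (tpure x) = g (tpure x)) -> f =1 g.
Proof. exact: pres_ext. Qed.

End TensorPower.

Section TensorPowerMap.
Variables (n : nat) (A B : zmodType) (f : {additive A -> B}).

Lemma tpow_map_subproof i (x y z : {ffun 'I_n -> A}) : z i = x i + y i ->
  (forall j, j != i -> x j = z j /\ y j = z j) ->
  tpure [ffun j => f (z j)] = tpure [ffun j => f (x j)] + tpure [ffun j => f (y j)].
Proof.
move=> zi xyz; apply: (@tpureD _ _ i); first by rewrite !ffunE zi raddfD.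
by move=> j /xyz[xz yz]; rewrite !ffunE xz yz.
Qed.

Definition tpow_map : {additive tpow n A -> tpow n B} := tpow_lift tpow_map_subproof.

Lemma tpow_mapE x : tpow_map (tpure x) = tpure [ffun j => f (x j)].
Proof. exact: tpow_liftE. Qed.
End TensorPowerMap.

Section TensorPowerPerm.
Variables (n : nat) (A : zmodType) (s : {perm 'I_n}).

Lemma tpow_perm_subproof i (x y z : {ffun 'I_n -> A}) : z i = x i + y i ->
  (forall j, j != i -> x j = z j /\ y j = z j) ->
  tpure [ffun j => z (s j)] = tpure [ffun j => x (s j)] + tpure [ffun j => y (s j)].
Proof.
move=> zi xyz; apply: (@tpureD _ _ ((s^-1)%g i)); first by rewrite !ffunE permKV zi.
move=> j ji; rewrite !ffunE; apply: xyz; apply: contraNneq ji => <-.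
by rewrite permK.
Qed.

(* x_1 (x) ... (x) x_n |-> x_(s 1) (x) ... (x) x_(s n): a right action.       *)
Definition tpow_perm : {additive tpow n A -> tpow n A} := tpow_lift tpow_perm_subproof.

Lemma tpow_permE x : tpow_perm (tpure x) = tpure [ffun j => x (s j)].
Proof. exact: tpow_liftE. Qed.
End TensorPowerPerm.

Section TensorPowerCat.
Variables (l p : nat) (A : zmodType).
Implicit Types (x : {ffun 'I_l -> A}) (y : {ffun 'I_p -> A}).

Definition ffun_cat x y : {ffun 'I_(l + p) -> A} :=
  [ffun i => match split i with inl a => x a | inr b => y b end].

Lemma ffun_catl x y a : ffun_cat x y (lshift p a) = x a.
Proof. by rewrite ffunE (unsplitK (inl _ a)). Qed.

Lemma ffun_catr x y b : ffun_cat x y (rshift l b) = y b.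
Proof. by rewrite ffunE (unsplitK (inr _ b)). Qed.

Lemma ffun_cat_Dr x i (y1 y2 z : {ffun 'I_p -> A}) : z i = y1 i + y2 i ->
  (forall j, j != i -> y1 j = z j /\ y2 j = z j) ->
  tpure (ffun_cat x z) = tpure (ffun_cat x y1) + tpure (ffun_cat x y2).
Proof.
move=> zi yz; apply: (@tpureD _ _ (rshift l i)); first by rewrite !ffun_catr.
move=> j; case: (split_ordP j) => k ->; first by rewrite !ffun_catl.
by rewrite !ffun_catr (inj_eq (@rshift_inj _ _)) => /yz.
Qed.

Definition tpow_cat_r x : homZ (tpow p A) (tpow (l + p) A) := tpow_lift (ffun_cat_Dr x).

Lemma tpow_cat_Dl i (x1 x2 z : {ffun 'I_l -> A}) : z i = x1 i + x2 i ->
  (forall j, j != i -> x1 j = z j /\ x2 j = z j) ->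
  tpow_cat_r z = tpow_cat_r x1 + tpow_cat_r x2.
Proof.
move=> zi xz; apply: homP; apply: tpow_ext => y.
have -> : (tpow_cat_r x1 + tpow_cat_r x2) (tpure y)
  = tpow_cat_r x1 (tpure y) + tpow_cat_r x2 (tpure y) by [].
rewrite /tpow_cat_r !tpow_liftE; apply: (@tpureD _ _ (lshift p i)).
  by rewrite !ffun_catl.
move=> j; case: (split_ordP j) => k ->; last by rewrite !ffun_catr.
by rewrite !ffun_catl (inj_eq (@lshift_inj _ _)) => /xz.
Qed.

Definition tpow_cat_l : {additive tpow l A -> homZ (tpow p A) (tpow (l + p) A)} :=
  tpow_lift tpow_cat_Dl.

Lemma tpow_cat_l_Dl a a' b : tpow_cat_l (a + a') b = tpow_cat_l a b + tpow_cat_l a' b.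
Proof. by rewrite raddfD. Qed.

Lemma tpow_cat_l_Dr a b b' : tpow_cat_l a (b + b') = tpow_cat_l a b + tpow_cat_l a b'.
Proof. by rewrite raddfD. Qed.

Definition tpow_cat : {additive tens (tpow l A) (tpow p A) -> tpow (l + p) A} :=
  tens_lift tpow_cat_l_Dl tpow_cat_l_Dr.

Lemma tpow_catE x y : tpow_cat (tensor (tpure x) (tpure y)) = tpure (ffun_cat x y).
Proof. by rewrite /tpow_cat tens_liftE /tpow_cat_l tpow_liftE /tpow_cat_r tpow_liftE. Qed.

End TensorPowerCat.

Section TensorFunctor.
Variables F G : functor.

Definition tensF_map k l (u : grhom k l) := tens_map (fmap F u) (fmap G u).

Lemma tensF_map_id k x : tensF_map (idfun : grhom k k) x = x.
Proof.
apply: (@tens_ext _ _ _ _ (idfun : {additive _ -> _})) x => a b.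
by rewrite /tensF_map tens_mapE !fmap_id.
Qed.

Lemma tensF_map_comp k l m (u : grhom l m) (v : grhom k l) x :
  tensF_map (u \o v : grhom k m) x = tensF_map u (tensF_map v x).
Proof.
have E := @tens_ext _ _ _ (tensF_map (u \o v : grhom k m))
  (tensF_map u \o tensF_map v : {additive _ -> _}); apply: E => a b.
by rewrite -[RHS]/(tensF_map u (tensF_map v _)) /tensF_map !tens_mapE !fmap_comp.
Qed.

Definition tensF : functor := Functor tensF_map_id tensF_map_comp.
End TensorFunctor.

Section TensorNat.
Variables (F F' G G' : functor) (a : nattrans F F') (b : nattrans G G').

Definition tensN_app k : {additive tensF F G k -> tensF F' G' k} := tens_map (a k) (b k).

Lemma tensN_natural k l (u : grhom k l) x :
  tensN_app l (fmap (tensF F G) u x) = fmap (tensF F' G') u (tensN_app k x).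
Proof.
apply: (@tens_ext _ _ _ (tensN_app l \o fmap (tensF F G) u : {additive _ -> _})
  (fmap (tensF F' G') u \o tensN_app k : {additive _ -> _})) x => x y.
rewrite -[LHS]/(tens_map _ _ (tens_map _ _ _)) -[RHS]/(tens_map _ _ (tens_map _ _ _)).
by rewrite !tens_mapE !nt_natural.
Qed.

Definition tensN : nattrans (tensF F G) (tensF F' G') := NatTrans tensN_natural.
End TensorNat.

Lemma ab_map_id k (x : abelianized (freegrp k)) : ab_map (idfun : grhom k k) x = x.
Proof. by elim/ab_ind: x => x; rewrite ab_mapE. Qed.

Lemma ab_map_comp k l m (u : grhom l m) (v : grhom k l) x :
  ab_map (u \o v : grhom k m) x = ab_map u (ab_map v x).
Proof. by elim/ab_ind: x => x; rewrite !ab_mapE. Qed.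

Definition abF : functor :=
  @Functor (fun k => abelianized (freegrp k)) (fun k l u => ab_map u) ab_map_id ab_map_comp.

Section TensorPowerFunctor.
Variable n : nat.

Definition Ta_map k l (u : grhom k l) := tpow_map n (fmap abF u).

Lemma Ta_map_id k x : Ta_map (idfun : grhom k k) x = x.
Proof.
apply: (@tpow_ext _ _ _ _ (idfun : {additive _ -> _})) x => x.
rewrite /Ta_map tpow_mapE; congr tpure; apply/ffunP => i; rewrite ffunE.
exact: fmap_id.
Qed.

Lemma Ta_map_comp k l m (u : grhom l m) (v : grhom k l) x :
  Ta_map (u \o v : grhom k m) x = Ta_map u (Ta_map v x).
Proof.
apply: (@tpow_ext _ _ _ _ (Ta_map u \o Ta_map v : {additive _ -> _})) x => x.
rewrite -[RHS]/(Ta_map u (Ta_map v _)) /Ta_map !tpow_mapE; congr tpure; apply/ffunP => i.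
by rewrite !ffunE (@fmap_comp abF).
Qed.

(* Ta n is the composite T^n o a.                                             *)
Definition Ta : functor := Functor Ta_map_id Ta_map_comp.

Section Perm.
Variable s : {perm 'I_n}.

Definition Ta_perm_app k : {additive Ta k -> Ta k} := tpow_perm (abF k) s.

Lemma Ta_perm_natural k l (u : grhom k l) x :
  Ta_perm_app l (fmap Ta u x) = fmap Ta u (Ta_perm_app k x).
Proof.
apply: (@tpow_ext _ _ _ (tpow_perm _ s \o Ta_map u : {additive _ -> _})
  (Ta_map u \o tpow_perm _ s : {additive _ -> _})) x => x.
rewrite -[LHS]/(tpow_perm _ s (tpow_map n _ _)) -[RHS]/(tpow_map n _ (tpow_perm _ s _)).
rewrite !(tpow_permE, tpow_mapE); congr tpure.
by apply/ffunP => i; rewrite !ffunE.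
Qed.

Definition Ta_perm : nattrans Ta Ta := NatTrans Ta_perm_natural.
End Perm.
End TensorPowerFunctor.

Section TensorPowerFunctorCat.
Variables l p : nat.

Definition Ta_cat_app k : {additive tensF (Ta l) (Ta p) k -> Ta (l + p) k} :=
  tpow_cat l p (abF k).

Lemma Ta_cat_natural j k (u : grhom j k) x :
  Ta_cat_app k (fmap (tensF (Ta l) (Ta p)) u x) = fmap (Ta (l + p)) u (Ta_cat_app j x).
Proof.
elim/pres_ind: x => [|x y IHx IHy|[a b]]; first by rewrite !raddf0.
  by rewrite !raddfB IHx IHy.
rewrite -[pgen _ _]/(tensor a b).
rewrite -[LHS]/(tpow_cat l p _ (tens_map _ _ _)) tens_mapE.
rewrite -[RHS]/(Ta_map (l + p) u (tpow_cat l p _ _)) /tpow_cat !tens_liftE.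
elim/pres_ind: a => [|a a' IHa IHa'|x]; first by rewrite !raddf0.
  by rewrite !raddfB -[LHS]/(_ - _) IHa IHa' -raddfB.
elim/pres_ind: b => [|b b' IHb IHb'|y]; first by rewrite !raddf0.
  by rewrite !raddfB IHb IHb' -raddfB.
rewrite -[pgen _ x]/(tpure x) -[pgen _ y]/(tpure y) !tpow_mapE /tpow_cat_l !tpow_liftE.
congr tpure; apply/ffunP => i.
by rewrite !ffunE; case: split => ?; rewrite ffunE.
Qed.

(* The identification of T^l a (x) T^p a with T^(l + p) a.                    *)
Definition Ta_cat : nattrans (tensF (Ta l) (Ta p)) (Ta (l + p)) := NatTrans Ta_cat_natural.

End TensorPowerFunctorCat.

Section ExternalProduct.
Variables (F F' F'' : functor) (c : nattrans (tensF F F') F'').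
Local Notation P := (std_res F).
Local Notation Q := (std_res F').
Local Notation R := (std_res F'').
Local Open Scope classical_set_scope.

(* A chain map from R to the total complex of P (x) Q, lying over the inverse *)
(* of the identification c. Its (i, j) component in degree n is t n i j, and  *)
(* only the components with i + j = n are used. The differential of the total *)
(* complex is d (x (x) y) = d x (x) y + (-1)^(deg x) x (x) d y.               *)
Definition is_tensor_lift : set (forall n i j, nattrans (R n) (tensF (P i) (Q j))) :=
  [set t : forall n i j, nattrans (R n) (tensF (P i) (Q j)) |
    nt_comp c (nt_comp (tensN (pr_aug P) (pr_aug Q)) (t 0%N 0%N 0%N)) = pr_aug R /\
    forall n i j, (i + j)%N = n ->
      nt_comp (tensN (pr_d P i) (nt_id (Q j))) (t n.+1 i.+1 j)
      + nt_comp (tensN (nt_id (P i)) (pr_d Q j)) (t n.+1 i j.+1) *~ (-1) ^+ i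
      = nt_comp (t n i j) (pr_d R n)].

(* Such a chain map is unique up to homotopy when the complex P (x) Q is a    *)
(* resolution, for instance when F and F' take torsion-free values.           *)
Definition tensor_lift : forall n i j, nattrans (R n) (tensF (P i) (Q j)) :=
  xget (fun _ _ _ => 0) is_tensor_lift.

Definition ext_prod (i j : nat) (G G' G'' : functor) (d : nattrans (tensF G G') G'')
    (x : Ext i F G) (y : Ext j F' G') : Ext (i + j) F'' G'' :=
  ext_class (nt_comp d
    (nt_comp (tensN (ext_repr x) (ext_repr y)) (tensor_lift (i + j) i j))).

End ExternalProduct.

Definition surjb (m n : nat) : {pred {ffun 'I_m -> 'I_n}} :=
  fun f => [forall y, exists x, f x == y].

Record surj (m n : nat) := Surj { surj_val :> {ffun 'I_m -> 'I_n}; _ : surj_val \in @surjb m n }.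

HB.instance Definition _ m n := [isSub for @surj_val m n].
HB.instance Definition _ m n := [Finite of surj m n by <:].

Lemma surjP m n (f : surj m n) y : exists x, f x = y.
Proof. by case: f => f /= /forallP /(_ y) /existsP[x /eqP]; exists x. Qed.

Lemma surj_subproof m n (f : 'I_m -> 'I_n) : (forall y, exists x, f x = y) ->
  finfun f \in @surjb m n.
Proof.
move=> fs; apply/forallP => y; have [x <-] := fs y.
by apply/existsP; exists x; rewrite ffunE.
Qed.

Definition mksurj m n (f : 'I_m -> 'I_n) (fs : forall y, exists x, f x = y) : surj m n :=
  Surj (surj_subproof fs).

Section SurjOps.

Lemma surj_comp_subproof n m l (g : surj m l) (f : surj n m) y : exists x, g (f x) = y.
Proof. by have [z <-] := surjP g y; have [x <-] := surjP f z; exists x. Qed.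

Definition surj_comp n m l (g : surj m l) (f : surj n m) : surj n l :=
  mksurj (surj_comp_subproof g f).

Lemma surj_perm_subproof n (s : {perm 'I_n}) y : exists x, s x = y.
Proof. by exists ((s^-1)%g y); rewrite permKV. Qed.

Definition surj_perm n (s : {perm 'I_n}) : surj n n := mksurj (surj_perm_subproof s).

Definition surj_sum_fun m l n p (g : surj m l) (f : surj n p) (i : 'I_(m + n)) : 'I_(l + p) :=
  match split i with inl a => lshift p (g a) | inr b => rshift l (f b) end.

Lemma surj_sum_subproof m l n p (g : surj m l) (f : surj n p) y :
  exists x, surj_sum_fun g f x = y.
Proof.
case: (split_ordP y) => z ->.
  by have [x <-] := surjP g z; exists (lshift n x); rewrite /surj_sum_fun (unsplitK (inl _ x)).
by have [x <-] := surjP f z; exists (rshift m x); rewrite /surj_sum_fun (unsplitK (inr _ x)).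
Qed.

Definition surj_sum m l n p (g : surj m l) (f : surj n p) : surj (m + n) (l + p) :=
  mksurj (surj_sum_subproof g f).

End SurjOps.

Notation "''Z_Surj' ( m , n )" := {ffun surj m n -> int}
  (format "''Z_Surj' ( m ,  n )") : type_scope.

Definition surj_basis m n (f : surj m n) : 'Z_Surj(m, n) := [ffun g => (g == f)%:R].

Definition biadditive (A B C : zmodType) (f : A -> B -> C) :=
  (forall a a' b, f (a + a') b = f a b + f a' b) /\
  (forall a b b', f a (b + b') = f a b + f a b').

Definition fiber m n (f : surj m n) (i : 'I_n) : {set 'I_m} := [set x | f x == i].

(* |f^-1(i)| - 1.                                                             *)
Definition fdeg m n (f : surj m n) (i : 'I_n) : nat := #|fiber f i|.-1.

Section Bar.
Variables (m : nat) (s : {perm 'I_m}) (A : {set 'I_m}).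

(* If u : A -> s @: A is the order preserving bijection, then bar (u x) = s x *)
(* for x in A (enum lists a set of ordinals in increasing order), and bar is  *)
(* the identity outside s @: A, which does not change the signature.          *)
Definition bar_fun (y : 'I_m) : 'I_m :=
  if y \in s @: A then s (nth y (enum A) (index y (enum (s @: A)))) else y.

Lemma bar_inj : injective bar_fun.
Proof.
have card_sA : size (enum (s @: A)) = size (enum A).
  by rewrite -!cardE card_imset //; apply: perm_inj.
have im y : y \in s @: A -> nth y (enum A) (index y (enum (s @: A))) \in A.
  by move=> yA; rewrite -mem_enum mem_nth // -card_sA index_mem mem_enum.
move=> y z; rewrite /bar_fun; case: ifP => yA; case: ifP => zA //.
- move=> /perm_inj; rewrite (set_nth_default y z); last first.
    by rewrite -card_sA index_mem mem_enum.
  move=> /eqP; rewrite nth_uniq ?enum_uniq // -?card_sA ?index_mem ?mem_enum // => /eqP.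
  move=> e; rewrite -(nth_index y (_ : y \in enum (s @: A))) ?mem_enum // e.
  by rewrite nth_index ?mem_enum.
- by move=> yz; move: zA; rewrite -yz (imset_f _ (im y yA)).
- by move=> yz; move: yA; rewrite yz (imset_f _ (im z zA)).
Qed.

Definition bar : {perm 'I_m} := perm bar_inj.

End Bar.

Lemma barE m (s : {perm 'I_m}) (A : {set 'I_m}) i : (i < #|A|)%N ->
  forall x0, bar s A (nth x0 (enum (s @: A)) i) = s (nth x0 (enum A) i).
Proof.
move=> iA x0; have c : size (enum (s @: A)) = #|A| by rewrite -cardE card_imset //; exact: perm_inj.
rewrite permE /bar_fun -mem_enum mem_nth ?c // index_uniq ?c ?enum_uniq //.
by congr (s _); apply: set_nth_default; rewrite -cardE.
Qed.

(* The class of f behaves as a product of n classes of degrees fdeg f q. By   *)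
(* the Koszul rule, exchanging the factors in positions k < l gives the sign  *)
(* (-1)^(fdeg f k * fdeg f l) * between_sign f k l, the second factor being   *)
(* due to the factors lying between the two.                                  *)
Definition between_sign m n (f : surj m n) (k l : 'I_n) : int :=
  (-1) ^+ ((fdeg f k + fdeg f l) * \sum_(q < n | (k < q < l)%N) fdeg f q)%N.

(* The sign of the Yoneda product of [s] and [f] for s order preserving. The   *)
(* first factor comes from the interchange law                                *)
(*   (a x b) o (a' x b') = (-1)^(|b| |a'|) (a o a') x (b o b')                *)
(* for fibers over different points, and inside a fiber from the fact that    *)
(* the iterates of the antisymmetric class of degree 1 in Ext(a, T^2 o a) are *)
(* associative up to sign. The second one is the signature of the             *)
(* permutations that sort f on the fibers of s o f.                           *)
Definition comp_sign n m l (s : surj m l) (f : surj n m) : int :=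
  (-1) ^+ (\sum_(j < m) fdeg f j * (j - s j))%N *
  (-1) ^+ #|[set xy : 'I_n * 'I_n |
      [&& xy.1 < xy.2, f xy.2 < f xy.1 & s (f xy.1) == s (f xy.2)]%N]|.

(* Main.v *)
Require Import Defs.
From HB Require Import structures.
From mathcomp Require Import all_boot all_algebra fingroup perm.
From mathcomp Require Import generic_quotient ring_quotient.
From mathcomp Require classical_sets.
From mathcomp Require Import boolp.
From mathcomp.multinomials Require Import freeg.
From mathcomp Require Import zify ring.

Set Implicit Arguments.
Unset Strict Implicit.
Unset Printing Implicit Defensive.

Import GRing.Theory Num.Theory.
Local Open Scope ring_scope.

(** The tensor product of n flat bar complexes of a free group resolves T^n o a:
    in degree j it is free on the words of n + j group elements cut into n
    blocks (a flag true opens a block), with the differential that merges two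
    neighbours g, h of a block through c |-> c(gh) - c(g) - c(h). Fox calculus
    contracts it. A cochain with values in T^m o a is determined by its
    coefficients on universal words, so that it is a function of words of
    subsets of {1, ..., m}; removing the elements 1, ..., m one after the other
    from such words shows that every cocycle is cohomologous to one supported on
    the words of singletons that increase in each block. These words are the
    surjections, and the signed sums over the permutations of the letters
    inside the blocks separate their classes. The actions, the Yoneda product
    and the external product are computed on explicit chain maps: exchange of
    two blocks, opening of new blocks, and concatenation of words. *)

(** The complex is not normalized: the letter 1 is a generator like any other. Each functor of words
    is then a direct sum of representable functors, so that projectivity is the Yoneda lemma. The
    price is the empty letter among the subsets, which needs a contraction of its own before any
    element is moved. The obstacle in the elimination is that taking x out of its letter must not
    disturb the elements already treated. The dangerous letters are the sets {y, x} with y treated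
    before, because removing x from them creates a new singleton {y}. Treating the elements in
    increasing order, and letting the treated ones form an increasing run at the beginning of each
    block, excludes these letters. [Ext] is defined on the standard resolution through lifts that
    are merely chosen. Hence the products are first shown to be computable on other resolutions and
    with other lifts. The signs then have two sources only: letters of degree one that pass each
    other, and the signature of the permutation that sorts a word inside its blocks. *)

(** * Flagged words and their differential *)

Definition sg (M : zmodType) (b : bool) (a : M) : M := if b then a else - a.

Lemma sgD (M : zmodType) b (a a' : M) : sg b (a + a') = sg b a + sg b a'.
Proof. by case: b => //=; rewrite opprD. Qed.
Lemma sgN (M : zmodType) b (a : M) : sg b (- a) = - sg b a.
Proof. by case: b. Qed.
Lemma sgK (M : zmodType) b (a : M) : sg b (sg b a) = a.
Proof. by case: b => //=; rewrite opprK. Qed.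
Lemma sg0 (M : zmodType) b : sg b (0 : M) = 0.
Proof. by case: b => //=; rewrite oppr0. Qed.
Lemma sg_mor (M M' : zmodType) (f : {additive M -> M'}) b a : f (sg b a) = sg b (f a).
Proof. by case: b => //=; rewrite raddfN. Qed.

(* The number of false flags is the degree of a word. *)
Definition ndeg (o : seq bool) := count negb o.

(** The default [true] of [head] admits the empty word, which is the only word for n = 0. *)
Definition graded (n j : nat) (o : seq bool) :=
  [&& head true o, count id o == n & ndeg o == j].

Lemma graded_size n j o : graded n j o -> size o = (n + j)%N.
Proof.
by move=> /and3P[_ /eqP <- /eqP <-]; rewrite -(count_predC id o).
Qed.

Section Words.
Variables (X : eqType) (ml : X -> X -> seq (int * X)).
Implicit Types (w v : seq (bool * X)).

Section Coef.
Variable M : zmodType.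
Implicit Types (c : seq (bool * X) -> M) (g : X -> M).

Definition wop g x y : M := \sum_(p <- ml x y) g p.2 *~ p.1.

Definition mrg c (x : bool * X) w : M :=
  if w is (false, y) :: w' then wop (fun z => c ((x.1, z) :: w')) x.2 y else 0.

(* The transpose of the bar differential, acting on functions c of words; ml   *)
(* lists, with coefficients, the letters that replace two merged neighbours.   *)
Fixpoint wd c w : M :=
  if w is x :: w' then sg x.1 (mrg c x w' + wd (fun v => c (x :: v)) w') else 0.

Lemma wopE0 x y : wop (fun=> 0) x y = 0.
Proof. by rewrite /wop big1 // => p _; rewrite mul0rz. Qed.

Lemma wop_ext g g' x y : (forall z, z \in unzip2 (ml x y) -> g z = g' z) ->
  wop g x y = wop g' x y.
Proof.
move=> cc; rewrite /wop big_seq [RHS]big_seq; apply: eq_bigr => p pm.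
by rewrite cc // (map_f snd).
Qed.

Lemma wopD g g' x y : wop (fun z => g z + g' z) x y = wop g x y + wop g' x y.
Proof. by rewrite /wop -big_split; apply: eq_bigr => p _; rewrite mulrzDl. Qed.

Lemma wopN g x y : wop (fun z => - g z) x y = - wop g x y.
Proof. by rewrite /wop -sumrN; apply: eq_bigr => p _; rewrite mulNrz. Qed.

Lemma wop_sg b g x y : wop (fun z => sg b (g z)) x y = sg b (wop g x y).
Proof. by case: b => //=; rewrite wopN. Qed.

Lemma wop_wop (c : X -> X -> M) x y x' y' :
  wop (fun z => wop (c z) x y) x' y' = wop (fun z => wop (c^~ z) x' y') x y.
Proof.
rewrite /wop; under eq_bigr do rewrite mulrz_suml.
under [RHS]eq_bigr do rewrite mulrz_suml.
rewrite exchange_big /=; apply: eq_bigr => p _; apply: eq_bigr => q _.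
by rewrite -!mulrzA mulrC.
Qed.

(** [step w v] says that v occurs in the differential of w. By [wd_step_ext], a property shared by
    all these v (degree, multiplicity of an element, form of the letters) is enough to replace one
    cochain by another. *)
Inductive step : seq (bool * X) -> seq (bool * X) -> Prop :=
| step_head b x y z w : z \in unzip2 (ml x y) ->
    step ((b, x) :: (false, y) :: w) ((b, z) :: w)
| step_tail x w v : step w v -> step (x :: w) (x :: v).

Lemma wd_step_ext c c' w : (forall v, step w v -> c v = c' v) -> wd c w = wd c' w.
Proof.
elim: w c c' => //= -[b x] w IH c c' cc; congr (sg _ (_ + _)); last first.
  by apply: IH => v wv; apply: cc; apply: step_tail.
case: w cc {IH} => // -[[] // y] w cc; apply: wop_ext => z zm.
by apply: cc; apply: step_head.
Qed.

Lemma wd_ext c c' w : c =1 c' -> wd c w = wd c' w.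
Proof. by move=> cc; apply: wd_step_ext => v _. Qed.

Lemma mrgD c c' x w : mrg (fun v => c v + c' v) x w = mrg c x w + mrg c' x w.
Proof. by case: w => [|[[] y] w] /=; rewrite ?addr0 // wopD. Qed.

Lemma mrg0 x w : mrg (fun=> 0) x w = 0.
Proof. by case: w => // -[[] // y] w /=; rewrite wopE0. Qed.

Lemma mrgN c x w : mrg (fun v => - c v) x w = - mrg c x w.
Proof. by case: w => [|[[] y] w] /=; rewrite ?oppr0 // wopN. Qed.

Lemma wd0 w : wd (fun=> 0) w = 0.
Proof. by elim: w => //= x w ->; rewrite mrg0 addr0 sg0. Qed.

Lemma wdD c c' w : wd (fun v => c v + c' v) w = wd c w + wd c' w.
Proof.
elim: w c c' => [|x w IH] c c' /=; first by rewrite addr0.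
rewrite mrgD IH -sgD; congr (sg _ _).
by rewrite -!addrA; congr (_ + _); rewrite addrCA.
Qed.

Lemma wdN c w : wd (fun v => - c v) w = - wd c w.
Proof. by elim: w c => [|x w IH] c /=; rewrite ?oppr0 // mrgN IH -opprD sgN. Qed.

Lemma wd_sg b c w : wd (fun v => sg b (c v)) w = sg b (wd c w).
Proof. by case: b => //=; rewrite wdN. Qed.

Lemma wdB c c' w : wd (fun v => c v - c' v) w = wd c w - wd c' w.
Proof. by rewrite wdD wdN. Qed.

Lemma wdMz c k w : wd (fun v => c v *~ k) w = wd c w *~ k.
Proof.
have dn (n : nat) : wd (fun v => c v *+ n) w = wd c w *+ n.
  elim: n => [|n IH]; first by rewrite mulr0n -[RHS](wd0 w); apply: wd_ext => v; rewrite mulr0n.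
  by rewrite mulrS -IH -wdD; apply: wd_ext => v; rewrite mulrS.
case: k => n; first exact: dn.
rewrite NegzE mulrNz -pmulrn -dn -wdN; apply: wd_ext => v.
by rewrite mulrNz -pmulrn.
Qed.

Lemma wop_wd (c : X -> seq (bool * X) -> M) x y w :
  wop (fun z => wd (c z) w) x y = wd (fun v => wop (fun z => c z v) x y) w.
Proof.
elim: w c => [|u w IH] c /=; first by rewrite wopE0.
rewrite wop_sg wopD IH; congr (sg _ (_ + _)).
by case: w {IH} => [|[[] t] w] /=; rewrite ?wopE0 // wop_wop.
Qed.

(** Leibniz rule. A word that opens a block does not merge with what precedes it, so the junction
    contributes nothing; the sign comes from the letters of degree one in [w]. *)
Lemma wd_cat c w v : head true (unzip1 v) ->
  wd c (w ++ v) = wd (fun u => c (u ++ v)) w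
                + wd (fun u => c (w ++ u)) v *~ (-1) ^+ ndeg (unzip1 w).
Proof.
move=> hv; elim: w c => [|x w IH] c /=; first by rewrite expr0 add0r.
rewrite IH addrA [LHS]sgD; congr (_ + _).
  congr (sg _ (_ + _)); case: w {IH} => [|[[] y] w] //=.
  by case: v hv => [|[[] y] v].
case: x.1 => //=; rewrite ?add0n // exprS mulN1r mulrNz //.
Qed.

(* The part of [wd] that merges the letters in positions t and t.+1. *)
Fixpoint wdt t c w : M :=
  if w is x :: w' then
    sg x.1 (if t is t'.+1 then wdt t' (fun v => c (x :: v)) w' else mrg c x w')
  else 0.

Lemma wdtE c w : wd c w = \sum_(t < size w) wdt t c w.
Proof.
elim: w c => [|x w IH] c /=; first by rewrite big_ord0.
rewrite big_ord_recl /= sgD IH; congr (_ + _).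
by rewrite (big_morph (sg x.1) (@sgD M x.1) (@sg0 M x.1)).
Qed.

(** The sign counts the false flags up to the left one of the two merged letters, that one
    included. *)
Lemma wdt_cat c w b x b' y v :
  wdt (size w) c (w ++ (b, x) :: (b', y) :: v) =
  (if b' then 0 else wop (fun z => c (w ++ (b, z) :: v)) x y)
    *~ (-1) ^+ ndeg (rcons (unzip1 w) b).
Proof.
elim: w c => [|u w IH] c /=.
  by case: b; case: b'; rewrite /= ?addn0 ?expr0 ?expr1 ?mulr1z ?mulrN1z ?mul0rz ?oppr0.
by rewrite IH; case: u.1 => //=; rewrite exprS mulN1r mulrNz.
Qed.

Lemma wdt_last c w l : wdt (size w) c (w ++ [:: l]) = 0.
Proof. by elim: w c => [|u w IH] c /=; rewrite ?IH ?sg0. Qed.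

End Coef.

Lemma wd_mor (M M' : zmodType) (f : {additive M -> M'}) c w :
  f (wd c w) = wd (fun v => f (c v)) w.
Proof.
have fop (c' : X -> M) x y : f (wop c' x y) = wop (fun z => f (c' z)) x y.
  by rewrite /wop raddf_sum; apply: eq_bigr => p _; rewrite raddfMz.
elim: w c => [|x w IH] c /=; first by rewrite raddf0.
rewrite sg_mor raddfD IH; congr (sg _ (_ + _)).
by case: w {IH} => [|[[] y] w] /=; rewrite ?raddf0.
Qed.

Hypothesis mlA : forall (M : zmodType) (c : X -> M) x y z,
  wop (fun u => wop c u z) x y = wop (fun u => wop c x u) y z.

(** Disjoint merges anticommute because of the signs of the letters of degree one; overlapping
    merges cancel by associativity. *)
Lemma wdd (M : zmodType) (c : seq (bool * X) -> M) w : wd (wd c) w = 0.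
Proof.
elim: w c => [|[b x] w IH] c //=; rewrite -[RHS](@sg0 M b); congr (sg _ _).
have -> : wd (fun v => sg b (mrg c (b, x) v + wd (fun u => c ((b, x) :: u)) v)) w
    = sg b (wd (mrg c (b, x)) w) by rewrite wd_sg wdD IH addr0.
case: w {IH} => [|[[] y] w] /=; first by rewrite sg0 addr0.
  have -> : mrg (mrg c (b, x)) (true, y) w = 0.
    by case: w => [|[[] z] w] //=; rewrite wopE0.
  by rewrite wd0 addr0 sg0 addr0.
rewrite wop_sg wopD wop_wd sgN -sgN -sgD; apply/eqP.
rewrite opprD addrACA subrr addr0 -[X in _ == X](@sg0 M b); apply/eqP; congr (sg _ _).
case: w => [|[[] z] w] /=; rewrite ?wopE0 ?subr0 // mlA subrr //.
Qed.

End Words.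

Section WordMap.
Variables (X Y : eqType) (mlX : X -> X -> seq (int * X)) (mlY : Y -> Y -> seq (int * Y)).
Variable f : X -> Y.
Hypothesis fml : forall x y, mlY (f x) (f y) = [seq (p.1, f p.2) | p <- mlX x y].

Definition wmap (w : seq (bool * X)) := [seq (x.1, f x.2) | x <- w].

Lemma wd_wmap (M : zmodType) (c : _ -> M) w :
  wd mlY c (wmap w) = wd mlX (fun v => c (wmap v)) w.
Proof.
elim: w c => [|x w IH] c //=; rewrite IH; congr (sg _ (_ + _)).
by case: w {IH} => [|[[] y] w] //=; rewrite /wop fml big_map.
Qed.

Lemma unzip1_wmap w : unzip1 (wmap w) = unzip1 w.
Proof. by rewrite /wmap /unzip1 -map_comp. Qed.

End WordMap.

Section StepGrade.
Variables (X : eqType) (ml : X -> X -> seq (int * X)).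

Lemma step_flags w v : step ml w v -> exists A b C,
  unzip1 w = A ++ b :: false :: C /\ unzip1 v = A ++ b :: C.
Proof.
elim=> [b x y z u _|x u t _ [A [b [C [/= -> ->]]]]].
  by exists [::], b, (unzip1 u).
by exists (x.1 :: A), b, C.
Qed.

Lemma step_graded w v n j : step ml w v -> graded n j (unzip1 w) ->
  (0 < j)%N /\ graded n j.-1 (unzip1 v).
Proof.
move=> /step_flags[A [b [C [-> ->]]]] /and3P[h /eqP <- /eqP <-].
rewrite /graded /ndeg !count_cat /= !add0n; split; first by lia.
apply/and3P; split; first by case: A h.
  by [].
by apply/eqP; lia.
Qed.

Lemma wd_graded_ext (M : zmodType) (c c' : _ -> M) n j w : graded n j.+1 (unzip1 w) ->
  (forall v, graded n j (unzip1 v) -> c v = c' v) -> wd ml c w = wd ml c' w.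
Proof. by move=> gw cc; apply: wd_step_ext => v /step_graded -/(_ _ _ gw)[_ /cc]. Qed.

Lemma wd_deg0 (M : zmodType) (c : _ -> M) n w : graded n 0 (unzip1 w) -> wd ml c w = 0.
Proof.
move=> gw; rewrite -[RHS](wd0 ml M w); apply: wd_step_ext => v /step_graded -/(_ _ _ gw)[]//.
Qed.

End StepGrade.

Section FreeGroupHom.
Variables (N : nat).
Implicit Types (x y : freegrp N) (s t : seq ('I_N * bool)).

(** * Free groups *)

Definition letter (a : 'I_N * bool) : freegrp N := FreeGrp (isT : reduced_word [:: a]).

(** Indexed by [nat], with value 1 out of range, so that arithmetic on positions in words needs no
    bounded indices. *)
Definition gen (i : nat) : freegrp N := if insub i is Some i' then letter (i', false) else 1%g.

Lemma gen_ord (i : 'I_N) : gen i = letter (i, false).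
Proof. by rewrite /gen valK. Qed.

Lemma letterV a : letter (linv a) = ((letter a)^-1)%g.
Proof. by apply: val_inj. Qed.

Lemma letter_gen a : letter a = if a.2 then ((gen a.1)^-1)%g else gen a.1.
Proof. by case: a => i []; rewrite /= gen_ord // -letterV. Qed.

Lemma freegrp_ind (P : freegrp N -> Prop) : P 1%g ->
  (forall a x, P x -> P (letter a * x)%g) -> forall x, P x.
Proof.
move=> P1 PM [s rs]; elim: s rs => [|a s IH] rs.
  by have -> : FreeGrp rs = 1%g by apply: val_inj.
have rs' : reduced_word s by apply: path_sorted rs.
have -> : FreeGrp rs = (letter a * FreeGrp rs')%g; last exact/PM/IH.
apply: val_inj => /=; case: s rs {IH rs'} => //= b s /andP[/negbTE -> _] //.
Qed.

Section Eval.
Variables (G : groupType) (v : nat -> G).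

Definition lev (a : 'I_N * bool) : G := if a.2 then ((v a.1)^-1)%g else v a.1.
Definition wev s : G := foldr (fun a g => (lev a * g)%g) 1%g s.

Lemma lev_linv a : lev (linv a) = ((lev a)^-1)%g.
Proof. by case: a => i []; rewrite /lev /= ?invgK. Qed.

Lemma wev_fcons a s : wev (fcons a s) = (lev a * wev s)%g.
Proof.
case: s => [|b s] //=; case: eqP => [->|_] //=.
by rewrite lev_linv mulKVg.
Qed.

Lemma wev_fmul s t : wev (fmul s t) = (wev s * wev t)%g.
Proof. by elim: s => [|a s IH] /=; rewrite ?mul1g // wev_fcons IH mulgA. Qed.

Definition frhom_fun x : G := wev (fword x).

Lemma frhom_mul : {morph frhom_fun : x y / (x * y)%g}.
Proof. by move=> x y; apply: wev_fmul. Qed.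

HB.instance Definition _ := isMultiplicative.Build _ _ frhom_fun frhom_mul.

Definition frhom : {multiplicative freegrp N -> G} := frhom_fun.

Lemma frhom_letter a : frhom (letter a) = lev a.
Proof. by rewrite /frhom /= /frhom_fun /= mulg1. Qed.

Lemma frhom_gen (i : nat) : (i < N)%N -> frhom (gen i) = v i.
Proof. by move=> iN; rewrite (gen_ord (Ordinal iN)) frhom_letter. Qed.
End Eval.

Lemma frhom_ext (G : groupType) (f g : {multiplicative freegrp N -> G}) :
  (forall i : 'I_N, f (gen i) = g (gen i)) -> f =1 g.
Proof.
move=> fg; elim/freegrp_ind => [|a x IH]; first by rewrite !mult1.
by rewrite !gmulfM IH letter_gen; case: a.2; rewrite ?multV fg.
Qed.

Section AbEval.
Variables (M : zmodType) (y : nat -> M).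

Definition lsum (a : 'I_N * bool) : M := sg (~~ a.2) (y a.1).
Fixpoint wsum s : M := if s is a :: s' then lsum a + wsum s' else 0.

Lemma wsum_fcons a s : wsum (fcons a s) = lsum a + wsum s.
Proof.
case: s => [|b s] //=; case: eqP => [->|_] //=.
by rewrite addrA /lsum; case: a => i [] /=; rewrite ?addNr ?subrr add0r.
Qed.

Lemma wsum_fmul s t : wsum (fmul s t) = wsum s + wsum t.
Proof. by elim: s => [|a s IH] /=; rewrite ?add0r // wsum_fcons IH addrA. Qed.

Definition gsum x : M := wsum (fword x).

Lemma gsumM x x' : gsum (x * x')%g = gsum x + gsum x'.
Proof. exact: wsum_fmul. Qed.

Lemma gsum1 : gsum 1%g = 0.
Proof. by []. Qed.

Lemma gsumV x : gsum (x^-1)%g = - gsum x.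
Proof. by apply/eqP; rewrite -addr_eq0 -gsumM mulVg gsum1. Qed.

Lemma gsum_derived x : derived x -> gsum x = 0.
Proof.
elim=> [|u v _ hu _ hv|u _ hu|u v].
- exact: gsum1.
- by rewrite gsumM hu hv addr0.
- by rewrite gsumV hu oppr0.
- rewrite /commg /conjg !gsumM !gsumV.
  by rewrite addrA -opprD addNr.
Qed.

Definition abev_fun (a : abelianized (freegrp N)) : M := gsum (repr a).

Lemma abev_funE x : abev_fun (ab_pi x) = gsum x.
Proof.
apply/eqP; rewrite -subr_eq0 -gsumV -gsumM; apply/eqP/gsum_derived.
exact: derived_repr.
Qed.

Lemma abev_additive : zmod_morphism abev_fun.
Proof.
elim/ab_ind=> u; elim/ab_ind=> v.
have -> : ab_pi u - ab_pi v = ab_pi (u / v)%g by rewrite ab_piM -ab_oppE.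
by rewrite !abev_funE gsumM gsumV.
Qed.

HB.instance Definition _ := GRing.isZmodMorphism.Build _ _ abev_fun abev_additive.
(** Together with [ab_gen_ind], this expresses that [abF N] is free abelian on the classes of the
    generators. *)
Definition abev : {additive abF N -> M} := abev_fun.

Lemma abevE x : abev (ab_pi x) = gsum x.
Proof. exact: abev_funE. Qed.

Lemma gsum_letter a : gsum (letter a) = lsum a.
Proof. exact: addr0. Qed.

Lemma gsum_gen (i : nat) : (i < N)%N -> gsum (gen i) = y i.
Proof. by move=> iN; rewrite (gen_ord (Ordinal iN)) gsum_letter. Qed.

End AbEval.

Lemma ab_pi1 : ab_pi (1%g : freegrp N) = 0 :> abF N.
Proof. by []. Qed.

Lemma ab_piV x : ab_pi (x^-1)%g = - ab_pi x :> abF N.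
Proof. by rewrite -ab_oppE. Qed.

Lemma ab_gen_ind (P : abF N -> Prop) : P 0 -> (forall a b, P a -> P b -> P (a - b)) ->
  (forall i : 'I_N, P (ab_pi (gen i))) -> forall a, P a.
Proof.
move=> P0 PB Pg; elim/ab_ind; elim/freegrp_ind => // a x IH.
have PN b : P b -> P (- b) by move=> Pb; rewrite -sub0r; apply: PB.
rewrite ab_piM -[ab_pi x]opprK; apply: PB; last exact: PN.
by rewrite letter_gen; case: a.2; rewrite ?ab_piV; first exact: PN.
Qed.

End FreeGroupHom.

(** * Words of group elements and their contraction *)

Section GroupLetters.
Variable k : nat.

(* The product of g - 1 and h - 1 in the augmentation ideal.                  *)
Definition mlG (g h : freegrp k) : seq (int * freegrp k) :=
  [:: (1, (g * h)%g); (-1, g); (-1, h)].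

Lemma wopG (M : zmodType) (c : freegrp k -> M) g h :
  wop mlG c g h = c (g * h)%g - c g - c h.
Proof. by rewrite /wop unlock /= mulr1z !mulrN1z addr0 addrA. Qed.

(** Both sides expand the product (x - 1)(y - 1)(z - 1). *)
Lemma mlGA (M : zmodType) (c : freegrp k -> M) x y z :
  wop mlG (fun u => wop mlG c u z) x y = wop mlG (fun u => wop mlG c x u) y z.
Proof.
rewrite !wopG mulgA !opprB !addrA subrK.
by rewrite [RHS](ACl (1*3*4*6*7*8*9*2*5))/= subrK [LHS](ACl (1*7*6*2*5*3*4)).
Qed.

Section Additive.
Variable M : zmodType.
Implicit Types (c : seq (bool * freegrp k) -> M).

Definition letter_additive c := forall A b g h C,
  c (A ++ (b, (g * h)%g) :: C) = c (A ++ (b, g) :: C) + c (A ++ (b, h) :: C).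

(** Additivity in a letter makes c(gh) - c(g) - c(h) vanish at each merge. All the cocycles that
    represent classes of surjections arise in this way. *)
Lemma wd_letter_additive c w : letter_additive c -> wd mlG c w = 0.
Proof.
elim: w c => //= -[b g] w IH c addc; rewrite IH ?addr0; last first.
  by move=> A b' x y C; apply: (addc ((b, g) :: A)).
case: w {IH} => [|[[] h] w] /=; rewrite ?sg0 // wopG (addc [::]) /=.
by rewrite addrAC addrK subrr sg0.
Qed.

End Additive.

(* Contraction of the bar complex by Fox calculus: a letter a of g = p a q     *)
(* contributes the pair (a | q).                                              *)
Section Contraction.
Variable M : zmodType.
Implicit Types (c : seq (bool * freegrp k) -> M) (s : seq ('I_k * bool)).
Local Notation wd := (wd mlG).

Definition lval s : freegrp k := foldr (fun a g => (letter a * g)%g) 1%g s.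

Lemma lval_fword g : lval (fword g) = g.
Proof.
case: g => s rs /=; elim: s rs => [|a s IH] rs; first exact: val_inj.
have rs' : reduced_word s by apply: path_sorted rs.
rewrite /= (IH rs'); apply: val_inj => /=.
by case: s rs {IH rs'} => //= b s /andP[/negbTE -> _].
Qed.

(** The Fox derivative of an inverse generator x^-1 is - x^-1: hence the sign, and the second letter
    that keeps [a] in front of [s] in that case. The factor [t] stands for what follows the word and
    is needed for the derivation rule. *)
Definition fox_term c (t : freegrp k) a s w : M :=
  sg (~~ a.2) (c ((true, letter (a.1, false)) ::
                  (false, lval (if a.2 then a :: s else s) * t)%g :: w)).

Fixpoint fox c (t : freegrp k) s w : M :=
  if s is a :: s' then fox_term c t a s' w + fox c t s' w else 0.

Lemma lval_fcons a s : lval (fcons a s) = (letter a * lval s)%g.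
Proof.
case: s => [|b s] //=; case: eqP => [->|_] //=.
by rewrite letterV mulVKg.
Qed.

Lemma lval_fmul s s' : lval (fmul s s') = (lval s * lval s')%g.
Proof. by elim: s => [|a s IH] /=; rewrite ?mul1g // lval_fcons IH mulgA. Qed.

Lemma fox_fcons c t a s w : fox c t (fcons a s) w = fox_term c t a s w + fox c t s w.
Proof.
case: s => [|b s] //=; case: eqP => [->|_] //=.
rewrite addrA /fox_term; case: a => i [] /=.
  by rewrite letterV mulVKg addNr add0r.
by rewrite subrr add0r.
Qed.

(** The derivation rule: seen from a letter of [s], what follows is the rest of [s], then [s'], then
    [t]. *)
Lemma fox_fmul c t s s' w :
  fox c t (fmul s s') w = fox c (lval s' * t)%g s w + fox c t s' w.
Proof.
elim: s => [|a s IH] /=; first by rewrite add0r.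
rewrite fox_fcons IH addrA; congr (_ + _ + _); rewrite /fox_term; congr (sg _ _).
by case: a.2 => /=; rewrite lval_fmul !mulgA.
Qed.

Lemma fox_ext c c' t s w : (forall v, head true (unzip1 v) -> c v = c' v) ->
  fox c t s w = fox c' t s w.
Proof. by move=> cc; elim: s => //= a s ->; rewrite /fox_term cc. Qed.

(** Merging the generator with the letter after it gives the difference of the values at two
    consecutive suffixes, which telescopes along the word, and a linear term. The last summand is
    the merge of the second letter with h, present only if the block goes on. *)
Lemma fox_term_wd c t a s w :
  fox_term (wd c) t a s w + wd (fox_term c t a s) w =
  c ((true, lval (a :: s) * t)%g :: w) - c ((true, lval s * t)%g :: w)
  - lsum (fun i => c ((true, gen k i) :: w)) a
  - (if w is (false, h) :: w' then
       fox_term c (t * h)%g a s w' - fox_term c t a s w'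
       - lsum (fun i => c ((true, gen k i) :: w)) a
     else 0).
Proof.
rewrite /fox_term wd_sg -sgD /= wopG opprD addrA addrNK.
have E : sg (~~ a.2) (c ((true, letter (a.1, false) * (lval (if a.2 then a :: s else s) * t))%g :: w)
     - c ((true, letter (a.1, false)) :: w)
     - c ((true, lval (if a.2 then a :: s else s) * t)%g :: w)) =
   c ((true, lval (a :: s) * t)%g :: w) - c ((true, lval s * t)%g :: w)
     - lsum (fun i => c ((true, gen k i) :: w)) a.
  rewrite /lsum gen_ord; case: a => i [] /=; last by rewrite mulgA addrAC.
  rewrite -[(i, true)]/(linv (i, false)) letterV -mulgA mulVKg.
  by rewrite !opprB addrAC opprK addrA addrAC.
rewrite sgD E; congr (_ + _); rewrite sgN; congr (- _).
case: w {E} => [|[[] h] w] /=; rewrite ?sg0 //.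
rewrite wopG !sgD !sgN /lsum gen_ord; congr (_ - _ - _).
by rewrite mulgA.
Qed.

Lemma fox_wd c t s w :
  fox (wd c) t s w + wd (fox c t s) w =
  c ((true, lval s * t)%g :: w) - c ((true, t) :: w)
  - wsum (fun i => c ((true, gen k i) :: w)) s
  - (if w is (false, h) :: w' then
       fox c (t * h)%g s w' - fox c t s w' - wsum (fun i => c ((true, gen k i) :: w)) s
     else 0).
Proof.
elim: s => [|a s IH] /=.
  rewrite mul1g subrr !subr0 /=; rewrite wd0 addr0.
  by case: w => [|[[] h] w] //; rewrite ?subrr ?subr0.
have -> : wd (fox c t (a :: s)) w = wd (fox_term c t a s) w + wd (fox c t s) w.
  by rewrite -wdD.
rewrite addrACA IH fox_term_wd /= {IH}.
set A := c _; set B := c _; set C := c _; set L := lsum _ _; set W := wsum _ _.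
have E X Y : A - B - L - X + (B - C - W - Y) = A - C - (L + W) - (X + Y).
  by rewrite !opprD !addrA [LHS](ACl (1*2*5*6*3*7*4*8))/= addrNK.
rewrite E; congr (_ - _).
clear E; rewrite {}/L {}/W {A B C}; case: w => [|[[] h] w] /=; rewrite ?addr0 //.
by rewrite !opprD !addrA [LHS](ACl (1*4*2*5*3*6)).
Qed.

(** The homotopy of a tensor product of complexes: contract the first block, and, if that block is a
    single letter, project it linearly onto the generators and contract the rest. The pair (1 | 1),
    whose boundary is -(1), removes the value at the letter 1 that [fox_wd] leaves. *)
Fixpoint contr c (w : seq (bool * freegrp k)) {struct w} : M :=
  if w is (_, g) :: w' then
    fox c 1%g (fword g) w' - c ((true, 1%g) :: (false, 1%g) :: w')
    + (if w' is (false, _) :: _ then 0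
       else gsum (fun i => contr (fun v => c ((true, gen k i) :: v)) w') g)
  else 0.

(** What the contraction leaves: each letter is replaced by its linear part, and a block of two
    letters gives zero. *)
Fixpoint proj_gen c (w : seq (bool * freegrp k)) {struct w} : M :=
  if w is (_, g) :: w' then
    if w' is (false, _) :: _ then 0
    else gsum (fun i => proj_gen (fun v => c ((true, gen k i) :: v)) w') g
  else c [::].

Lemma gsum_ext N (y y' : nat -> M) (g : freegrp N) : y =1 y' -> gsum y g = gsum y' g.
Proof. by move=> yy; rewrite /gsum; elim: (fword g) => //= a s ->; rewrite /lsum yy. Qed.

Lemma gsumD N (y y' : nat -> M) (g : freegrp N) :
  gsum (fun i => y i + y' i) g = gsum y g + gsum y' g.
Proof.
rewrite /gsum; elim: (fword g) => [|a s IH] /=; first by rewrite addr0.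
by rewrite IH /lsum sgD addrACA.
Qed.

Lemma gsumN N (y : nat -> M) (g : freegrp N) : gsum (fun i => - y i) g = - gsum y g.
Proof.
rewrite /gsum; elim: (fword g) => [|a s IH] /=; first by rewrite oppr0.
by rewrite IH /lsum sgN opprD.
Qed.

Lemma gsum0 N (g : freegrp N) : gsum (fun=> 0 : M) g = 0.
Proof. by rewrite /gsum; elim: (fword g) => //= a s ->; rewrite /lsum sg0 addr0. Qed.

Lemma wd_gsum (y : nat -> seq (bool * freegrp k) -> M) (g : freegrp k) w :
  wd (fun v => gsum (y^~ v) g) w = gsum (fun i => wd (y i) w) g.
Proof.
rewrite /gsum; elim: (fword g) => [|a s IH] /=; first exact: wd0.
by rewrite wdD IH /lsum wd_sg.
Qed.

Lemma contr_head_ext c c' w : (forall v, head true (unzip1 v) -> c v = c' v) ->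
  contr c w = contr c' w.
Proof.
elim: w c c' => //= -[b g] w IH c c' cc; rewrite cc // (fox_ext _ _ _ cc); congr (_ + _).
by case: w IH => [|[[] h] w] IH //; apply: gsum_ext => i; apply: IH => v _; exact: cc.
Qed.

Lemma contr_wd c w : head true (unzip1 w) ->
  wd (contr c) w + contr (wd c) w = c w - proj_gen c w.
Proof.
elim: w c => [|[b g] w IH] c; first by rewrite /= add0r subrr.
move=> /= hb; rewrite {b}hb; pose one := fun v => c ((true, 1%g) :: (false, 1%g) :: v).
pose rest v := if v is (false, _) :: _ then 0
      else gsum (fun i => contr (fun u => c ((true, gen k i) :: u)) v) g.
have -> : wd (fun v => contr c ((true, g) :: v)) w =
    wd (fox c 1%g (fword g)) w - wd one w + wd rest w.
  by rewrite -wdB -wdD.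
have Efox := fox_wd c 1%g (fword g) w.
rewrite lval_fword mulg1 in Efox.
rewrite wopG mulg1 subrr sub0r /= -/(wd one w).
have nofalse T (A B : T) (v : seq (bool * freegrp k)) : head true (unzip1 v) ->
  (if v is (false, _) :: _ then A else B) = B by case: v => [|[[] ?] ?].
have mrg_true c' x v : head true (unzip1 v) -> mrg mlG c' x v = 0 :> M.
  by case: v => [|[[] ?] ?].
have step_true v : head true (unzip1 w) -> step mlG w v -> head true (unzip1 v).
  by move=> hw wv; case: wv hw.
(* If [w] opens a block, then g is alone in the first block, nothing merges with it, and the
   induction hypothesis applies to the rest behind each generator. *)
case hw: (head true (unzip1 w)).
  rewrite !mrg_true // add0r nofalse // (nofalse M 0) //.
  have -> : wd rest w = gsum (fun i => wd (contr (fun u => c ((true, gen k i) :: u))) w) g.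
    rewrite -wd_gsum; apply: wd_step_ext => v /(step_true _ hw) hv.
    by rewrite /rest nofalse.
  set G1 := gsum _ g; set G2 := gsum _ g; set G3 := gsum _ g.
  have EG : G1 + G2 = gsum (fun i => c ((true, gen k i) :: w)) g - G3.
    rewrite -gsumN -!gsumD; apply: gsum_ext => i; rewrite -IH //; congr (_ + _).
    by apply: contr_head_ext => v hv /=; rewrite mrg_true ?add0r.
  have X0 : (if w is (false, h) :: w' then
       fox c (1 * h)%g (fword g) w' - fox c 1%g (fword g) w'
       - wsum (fun i => c ((true, gen k i) :: w)) (fword g) else 0) = 0.
    by move: hw; clear; case: w => [|[[] ?] ?].
  rewrite X0 subr0 in Efox; rewrite add0r.
  move: Efox EG; rewrite -/(gsum _ g); set F1 := fox _ _ _ _; set F2 := wd _ w.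
  set O := wd one w; set C := c _; set D := c _; set G4 := gsum _ g => Efox EG.
  have -> : F2 - O + G1 + (F1 - (- D - O) + G2) = (F1 + F2) + (G1 + G2) + D.
    by rewrite opprB opprK !addrA [LHS](ACl (4*1*3*7*6*2*5))/= addrNK.
  by rewrite Efox EG !addrA [LHS](ACl (1*2*6*3*4*5))/= !addrNK.
case: w hw IH Efox @one @rest nofalse mrg_true step_true => [|[[] h] w'] // _ _ Efox one rest _ _ _.
have -> : wd rest ((false, h) :: w') = 0.
  rewrite -[RHS](wd0 mlG M ((false, h) :: w')); apply: wd_step_ext => v wv.
  rewrite /rest; move: wv; move Eu: ((false, h) :: w') => u wv.
  by case: wv Eu => [b x y z v' _ [<-]|x v' v'' _ [<-]].
(* This summand of [contr] is additive in the first letter, so it disappears from the merge of g and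
   h; only the Fox terms and the pair (1 | 1) survive there. *)
pose R (z : freegrp k) : M := if w' is (false, _) :: _ then 0
  else gsum (fun i => contr (fun v => c ((true, gen k i) :: v)) w') z.
have RM : R (g * h)%g = R g + R h.
  by rewrite /R; case: (w') => [|[[] ?] ?]; rewrite ?gsumM ?addr0.
have -> : mrg mlG (contr c) (true, g) ((false, h) :: w')
    = fox c h (fword g) w' - fox c 1%g (fword g) w' + one w'.
  rewrite /= wopG -!/(R _) RM -!/(one w').
  rewrite -[fword (g * h)%g]/(fmul (fword g) (fword h)) fox_fmul lval_fword mulg1.
  set F1 := fox _ _ _ _; set F2 := fox _ _ _ _; set F3 := fox _ _ _ _; set O := one _.
  by rewrite !opprD !opprK !addrA [LHS](ACl (1*6*10*2*9*7*3*4*8*5*11))/= !addrK.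
have -> : mrg mlG (fun v => c ((true, 1%g) :: v)) (false, 1%g) ((false, h) :: w') = - one w'.
  by rewrite /= wopG mul1g addrAC subrr sub0r.
move: Efox; rewrite mul1g -/(one _) -/one; set A := fox _ _ _ ((false, h) :: w').
set B := wd (fox _ _ _) _; set W1 := wd one _; set O := one w'.
set Fh := fox _ h _ _; set Fg := fox _ _ _ w'; set Ws := wsum _ _ => E.
rewrite !addr0 !opprB !addrA subr0.
set C := c _ in E *; set D := c _ in E *.
rewrite opprK [LHS](ACl (6*4*1*2*9*3*7*5*8))/= addrNK addrK E !opprB !addrA.
by rewrite [LHS](ACl (1*2*9*3*4*6*7*5*8))/= addrK !addrNK.
Qed.

Lemma contr_graded_ext c c' n j w : graded n j (unzip1 w) ->
  (forall v, graded n j.+1 (unzip1 v) -> c v = c' v) -> contr c w = contr c' w.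
Proof.
have fe s t (d d' : seq (bool * freegrp k) -> M) v :
    (forall x y, d ((true, x) :: (false, y) :: v) = d' ((true, x) :: (false, y) :: v)) ->
    fox d t s v = fox d' t s v.
  by move=> dd; elim: s => //= a s ->; rewrite /fox_term dd.
elim: w n c c' => //= -[b g] w IH n c c' gw cc.
have [hb [n' En gw']] : b /\ exists2 n', n = n'.+1 & (count id (unzip1 w) == n') && (ndeg (unzip1 w) == j).
  case/and3P: gw => /= hb; rewrite hb /= !add1n !add0n => /eqP <- jE; split => //.
  by exists (count id (unzip1 w)); rewrite ?eqxx.
have g2 x y : graded n j.+1 (unzip1 ((true, x) :: (false, y) :: w)).
  by case/andP: gw' => /eqP nE /eqP jE; rewrite En -nE -jE /graded /ndeg /= !add0n !add1n !eqxx.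
rewrite cc // (fe _ _ c c') => [|x y]; last exact: cc.
congr (_ + _); case: w IH gw' {gw g2} => [|[[] h] w] IH gw' //; apply: gsum_ext => i //=.
apply: (IH n') => [|v gv]; first by rewrite /graded /= in gw' *.
apply: cc; case/and3P: gv => _ /eqP nv /eqP jv.
by rewrite En /graded /= nv add1n eqxx /= /ndeg /= add0n -/(ndeg _) jv.
Qed.

Lemma proj_gen_deg c n j w : graded n j.+1 (unzip1 w) -> proj_gen c w = 0.
Proof.
elim: w n c => [|[b g] w IH] n c; first by rewrite /graded /= andbF.
rewrite /=; case: w IH => [|[[] h] w] IH //.
  by rewrite /graded /ndeg /=; case: b; rewrite //= andbF.
case/and3P => /= hb /eqP nE; rewrite hb /ndeg /= !add0n => jE.
rewrite (gsum_ext _ (_ : _ =1 fun=> 0)) ?gsum0 // => i.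
by apply: (IH n.-1 (fun v => c ((true, gen k i) :: v))); rewrite /graded /= -nE hb !add1n eqxx.
Qed.

End Contraction.

Lemma contr_mor (M M' : zmodType) (f : {additive M -> M'}) c w :
  f (contr c w) = contr (fun v => f (c v)) w.
Proof.
have ff c' t s v : f (fox c' t s v) = fox (fun u => f (c' u)) t s v.
  by elim: s => [|a s IH] /=; rewrite ?raddf0 // raddfD IH /fox_term sg_mor.
have fg y (g : freegrp k) : f (gsum y g) = gsum (fun i => f (y i)) g.
  rewrite /gsum; elim: (fword g) => [|a s IH] /=; rewrite ?raddf0 //.
  by rewrite raddfD IH /lsum sg_mor.
elim: w c => [|[b g] w IH] c /=; first by rewrite raddf0.
rewrite raddfD raddfB ff; congr (_ + _).
by case: w IH => [|[[] h] w] IH; rewrite ?raddf0 // fg; apply: gsum_ext => i; rewrite IH.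
Qed.

End GroupLetters.

(** * The functors of words *)

Notation wrd k := (seq (bool * freegrp k)).

Section BarFunctor.
Variables n j : nat.

Definition bgen k : choiceType := {w : wrd k | graded n j (unzip1 w)}.

Definition bob k : zmodType := {freeg (bgen k)}.

Lemma bmap_subproof k l (u : grhom k l) (x : bgen k) :
  graded n j (unzip1 (wmap u (val x))).
Proof. by rewrite unzip1_wmap; apply: (valP x). Qed.

Definition bmap k l (u : grhom k l) (x : bgen k) : bgen l :=
  exist _ (wmap u (val x)) (bmap_subproof u x).

Definition bmapZ k l (u : grhom k l) : {additive bob k -> bob l} :=
  zlift (fun x => << bmap u x >>).

Lemma bmap_id k x : bmapZ (idfun : grhom k k) x = x.
Proof.
apply: (@freeg_ext _ _ _ (idfun : {additive _ -> _})) x => x /=.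
rewrite ?(zliftE, zlift_funE); congr << _ >>; apply: val_inj => /=.
by rewrite /wmap -[RHS]map_id; apply: eq_map => -[].
Qed.

Lemma bmap_comp k l m (u : grhom l m) (v : grhom k l) x :
  bmapZ (u \o v : grhom k m) x = bmapZ u (bmapZ v x).
Proof.
apply: (@freeg_ext _ _ _ (bmapZ u \o bmapZ v : {additive _ -> _})) x => x /=.
rewrite ?(zliftE, zlift_funE) /= ?(zliftE, zlift_funE); congr << _ >>; apply: val_inj => /=.
by rewrite /wmap -map_comp; apply: eq_map => -[].
Qed.

Definition barc : functor := Functor bmap_id bmap_comp.

Lemma barcE k l (u : grhom k l) x : fmap barc u << x >> = << bmap u x >>.
Proof. by rewrite -[LHS]/(zlift _ _) ?(zliftE, zlift_funE). Qed.

Lemma bar_ext (F : functor) (a b : nattrans barc F) :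
  (forall k (x : bgen k), a k << x >> = b k << x >>) -> a = b.
Proof. by move=> ab; apply: nattransP => k; apply: freeg_ext. Qed.

Section Hat.
Variables (k : nat) (M : zmodType) (f : bgen k -> M).

Definition hat (w : wrd k) : M := if insub w is Some x then f x else 0.

Lemma hat_val x : hat (val x) = f x.
Proof. by rewrite /hat valK. Qed.
End Hat.

Lemma bgenP k (w : wrd k) : graded n j (unzip1 w) -> exists x : bgen k, val x = w.
Proof. by move=> gw; exists (exist _ w gw). Qed.

(** The universal cochain, with values in the functor of words itself: an operator applied to it is
    the transposed natural transformation. It vanishes on words of another shape, which spares side
    conditions. *)
Definition unit k : wrd k -> bob k := hat (fun x => << x >>).

Lemma unit_val k (x : bgen k) : unit (val x) = << x >>.
Proof. exact: hat_val. Qed.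

Lemma unit_wmap k l (u : grhom k l) (w : wrd k) :
  unit (wmap u w) = fmap barc u (unit w).
Proof.
case gw: (graded n j (unzip1 w)).
  have [x <-] := bgenP gw.
  by rewrite -[wmap u _]/(val (bmap u x)) !unit_val barcE.
by rewrite /unit /hat !insubF ?raddf0 //= unzip1_wmap.
Qed.

Section HatNat.
Variables (F : functor) (a : nattrans barc F).

(* The value of a natural transformation on words, extended by zero.          *)
Definition hnat k (w : wrd k) : F k := a k (unit w).

Lemma hnat_val k (x : bgen k) : hnat (val x) = a k << x >>.
Proof. by rewrite /hnat unit_val. Qed.

Lemma hnat_wmap k l (u : grhom k l) (w : wrd k) : hnat (wmap u w) = fmap F u (hnat w).
Proof. by rewrite /hnat unit_wmap nt_natural. Qed.
End HatNat.

Section OfWords.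
Variables (F : functor) (c : forall k, wrd k -> F k).
Hypothesis c_nat : forall k l (u : grhom k l) w, c (wmap u w) = fmap F u (c w).

Definition bnat_app k : {additive barc k -> F k} := zlift (fun x : bgen k => c (val x)).

Lemma bnat_natural k l (u : grhom k l) x :
  bnat_app l (fmap barc u x) = fmap F u (bnat_app k x).
Proof.
apply: (@freeg_ext _ _ (bnat_app l \o fmap barc u : {additive _ -> _})
  (fmap F u \o bnat_app k : {additive _ -> _})) x => x.
rewrite -[LHS]/(bnat_app l (fmap barc u _)) -[RHS]/(fmap F u (bnat_app k _)).
by rewrite barcE /bnat_app ?(zliftE, zlift_funE) c_nat.
Qed.

Definition bnat : nattrans barc F := NatTrans bnat_natural.

Lemma bnatE k (x : bgen k) : bnat k << x >> = c (val x).
Proof. by rewrite -[LHS]/(zlift _ _) ?(zliftE, zlift_funE). Qed.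

Lemma hnat_bnat k (w : wrd k) : graded n j (unzip1 w) -> hnat bnat w = c w.
Proof. by move=> /bgenP[x <-]; rewrite hnat_val bnatE. Qed.
End OfWords.

End BarFunctor.
Arguments unit : clear implicits.

Lemma hnatD n j F (a b : nattrans (barc n j) F) k (w : wrd k) : hnat (a + b) w = hnat a w + hnat b w.
Proof. by []. Qed.
Lemma hnatN n j F (a : nattrans (barc n j) F) k (w : wrd k) : hnat (- a) w = - hnat a w.
Proof. by []. Qed.
Lemma hnat0 n j F k (w : wrd k) : hnat (0 : nattrans (barc n j) F) w = 0.
Proof. by []. Qed.
Lemma hnat_comp n j F G (b : nattrans F G) (a : nattrans (barc n j) F) k (w : wrd k) :
  hnat (nt_comp b a) w = b k (hnat a w).
Proof. by []. Qed.

Lemma hnat_ext n j F (a b : nattrans (barc n j) F) :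
  (forall k (w : wrd k), graded n j (unzip1 w) -> hnat a w = hnat b w) -> a = b.
Proof. by move=> ab; apply: bar_ext => k x; rewrite -!hnat_val; apply/ab/(valP x). Qed.

Section Universal.
Variables (o : seq bool).

(** Every word with flags [o] is the image of this one under a homomorphism of free groups. Thus
    each sequence of flags contributes one representable functor to [barc n j]. *)
Definition uword : wrd (size o) := mkseq (fun i => (nth true o i, gen (size o) i)) (size o).

Lemma uword_flags : unzip1 uword = o.
Proof. by rewrite /uword /unzip1 /mkseq -map_comp -[RHS](mkseq_nth true). Qed.

End Universal.

Definition lett k (w : wrd k) i : freegrp k := (nth (true, 1%g) w i).2.

Definition whom N k (w : wrd k) : grhom N k := frhom N (lett w).

Lemma wmap_whom k (w : wrd k) : wmap (whom (size (unzip1 w)) w) (uword (unzip1 w)) = w.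
Proof.
rewrite /wmap /uword /mkseq -map_comp.
have -> : size (unzip1 w) = size w by rewrite size_map.
rewrite -[RHS](mkseq_nth (true, 1%g)); apply/eq_in_map => i /=; rewrite mem_iota add0n => iw.
rewrite [X in (_, X)]frhom_gen // /lett (nth_map (true, 1%g)) //.
by case: (nth _ _ _).
Qed.

Lemma whom_wmap N k l (u : grhom k l) (w : wrd k) :
  whom N (wmap u w) =1 (u \o whom N w : grhom N l).
Proof.
apply: frhom_ext => i; rewrite -[RHS]/(u (whom N w _)) /whom !frhom_gen //.
rewrite /lett; case: (ltnP i (size w)) => iw; first by rewrite (nth_map (true, 1%g)).
by rewrite !nth_default ?size_map //= mult1.
Qed.

Lemma fmap_ext (F : functor) k l (u v : grhom k l) x : (u : _ -> _) =1 v -> fmap F u x = fmap F v x.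
Proof. by move=> /grhomP ->. Qed.

Lemma hnat_uword n j F (a : nattrans (barc n j) F) k (w : wrd k) :
  hnat a w = fmap F (whom (size (unzip1 w)) w) (hnat a (uword (unzip1 w))).
Proof. by rewrite -hnat_wmap wmap_whom. Qed.

(** Yoneda: it suffices to lift the value on one universal word for each sequence of flags, and to
    extend by naturality. *)
Lemma bar_proj n j : projective (barc n j).
Proof.
move=> A B e f es.
have s (o : seq bool) : {a : A (size o) | e _ a = hnat f (uword o)} by apply: cid; apply: es.
pose c k (w : wrd k) : A k := fmap A (whom (size (unzip1 w)) w) (sval (s (unzip1 w))).
have c_nat k l (u : grhom k l) w : c l (wmap u w) = fmap A u (c k w).
  rewrite /c unzip1_wmap -fmap_comp; apply: fmap_ext; exact: whom_wmap.
exists (bnat n j c_nat); apply: hnat_ext => k w gw.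
by rewrite hnat_comp hnat_bnat // /c nt_natural (svalP (s _)) -hnat_uword.
Qed.

Section Operators.
(* Operators on functions of words, with the corresponding natural            *)
(* transformations in the opposite direction.                                 *)
Variables (n j n' j' : nat).
Variable th : forall k (M : zmodType), (wrd k -> M) -> wrd k -> M.
Hypothesis th_mor : forall k (M M' : zmodType) (f : {additive M -> M'}) c (w : wrd k),
  f (th c w) = th (fun v => f (c v)) w.
Hypothesis th_wmap : forall k l (u : grhom k l) (M : zmodType) (c : _ -> M) w,
  th c (wmap u w) = th (fun v => c (wmap u v)) w.
Hypothesis th_ext : forall k (M : zmodType) (c c' : wrd k -> M) w,
  graded n j (unzip1 w) ->
  (forall v, graded n' j' (unzip1 v) -> c v = c' v) -> th c w = th c' w.

Lemma oper_natural k l (u : grhom k l) (w : wrd k) :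
  graded n j (unzip1 w) ->
  th (unit n' j' l) (wmap u w) = fmap (barc n' j') u (th (unit n' j' k) w).
Proof.
by move=> gw; rewrite th_wmap th_mor; apply: th_ext => // v _; rewrite unit_wmap.
Qed.

Let opf k (w : wrd k) : barc n' j' k :=
  if graded n j (unzip1 w) then th (unit n' j' k) w else 0.

Let opf_nat k l (u : grhom k l) w : opf (wmap u w) = fmap (barc n' j') u (opf w).
Proof.
rewrite /opf unzip1_wmap; case: ifP => gw; last by rewrite raddf0.
exact: oper_natural.
Qed.

Definition oper : nattrans (barc n j) (barc n' j') := bnat n j opf_nat.

Lemma hnat_oper F (a : nattrans (barc n' j') F) k (w : wrd k) : graded n j (unzip1 w) ->
  hnat (nt_comp a oper) w = th (@hnat _ _ _ a k) w.
Proof. by move=> gw; rewrite hnat_comp hnat_bnat // /opf gw th_mor. Qed.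
End Operators.

Section Differential.
Variable n : nat.

Definition bdiff j : nattrans (barc n j.+1) (barc n j) :=
  @oper n j.+1 n j (fun k M => @wd _ (@mlG k) M)
    (fun k M M' f => @wd_mor _ (@mlG k) M M' f)
    (fun k l u M => @wd_wmap _ _ (@mlG k) (@mlG l) u
      (fun x y => congr1 (fun z => [:: (1, z); (-1, u x); (-1, u y)])
                         (esym (@gmulfM _ _ u x y))) M)
    (fun k M c c' w => @wd_graded_ext _ (@mlG k) M c c' n j w).

Lemma hnat_diff j F (a : nattrans (barc n j) F) k (w : wrd k) : graded n j.+1 (unzip1 w) ->
  hnat (nt_comp a (bdiff j)) w = wd (@mlG k) (@hnat _ _ _ a k) w.
Proof. by move=> gw; rewrite hnat_oper. Qed.

End Differential.

(** * The bar resolution of T^n o a *)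

Section BasisCochain.
Variable m : nat.

Lemma graded0_nseq n o : graded n 0 o -> o = nseq n true.
Proof.
move=> /and3P[_ /eqP <-]; rewrite /ndeg; elim: o => //= -[] o IH //=.
by rewrite add0n => /IH {1}->.
Qed.

(** These tensors of letters in a prescribed order serve three times: as augmentation, as
    representatives of the classes, and as the cocycles over which the Yoneda lifts are built. *)
Definition bcoch (o : seq bool) (s : {perm 'I_m}) k (w : wrd k) : Ta m k :=
  if unzip1 w == o then tpure [ffun x => ab_pi (lett w (s x)) : abF k] else 0.

Lemma lett_cat k (A C : wrd k) b g h i :
  lett (A ++ (b, g) :: C) i = if i == size A then g else lett (A ++ (b, h) :: C) i.
Proof.
rewrite /lett !nth_cat; case: (ltngtP i (size A)) => // [iA|->]; last by rewrite subnn.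
by rewrite -(subnSK iA).
Qed.

Lemma lett_wmap k l (u : grhom k l) (w : wrd k) i : lett (wmap u w) i = u (lett w i).
Proof.
rewrite /lett; case: (ltnP i (size w)) => iw; first by rewrite (nth_map (true, 1%g)).
by rewrite !nth_default ?size_map //= mult1.
Qed.

Lemma bcoch_wmap o s k l (u : grhom k l) (w : wrd k) :
  bcoch o s (wmap u w) = fmap (Ta m) u (bcoch o s w).
Proof.
rewrite /bcoch unzip1_wmap; case: ifP => _; last by rewrite raddf0.
rewrite -[RHS]/(tpow_map m (fmap abF u) _) tpow_mapE; congr tpure; apply/ffunP => x.
by rewrite !ffunE lett_wmap -[RHS]/(ab_map _ _) ab_mapE.
Qed.

(** Since the word has as many letters as there are tensor factors and [s] is a bijection, each
    letter enters exactly one factor. *)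
Lemma bcoch_additive o s k : size o = m -> letter_additive (@bcoch o s k).
Proof.
move=> om A b g h C; rewrite /bcoch /unzip1 !map_cat /=; case: eqP => [oE|_]; last by rewrite addr0.
have Am : (size A < m)%N.
  by rewrite -om -oE size_cat /= size_map addnS ltnS leq_addr.
pose x0 := (s^-1)%g (Ordinal Am).
have sx0 : s x0 = size A :> nat by rewrite permKV.
have sx x : x != x0 -> (s x == size A :> nat) = false.
  apply: contraNF => /eqP sxA; apply/eqP/(@perm_inj _ s)/val_inj.
  by rewrite /= sxA sx0.
apply: (tpureD (i := x0)).
  rewrite !ffunE (lett_cat A C b (g * h)%g 1%g) (lett_cat A C b g 1%g) (lett_cat A C b h 1%g).
  by rewrite sx0 eqxx ab_piM.
move=> x /sx xE; rewrite !ffunE.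
rewrite (lett_cat A C b (g * h)%g 1%g) (lett_cat A C b g 1%g) (lett_cat A C b h 1%g).
by rewrite xE.
Qed.

Definition bc n j o s : nattrans (barc n j) (Ta m) := bnat n j (@bcoch_wmap o s).

Lemma hnat_bc n j o s k (w : wrd k) : graded n j (unzip1 w) -> hnat (bc n j o s) w = bcoch o s w.
Proof. exact: hnat_bnat. Qed.

Lemma bc_cocycle n j o s : size o = m -> nt_comp (bc n j o s) (bdiff n j) = 0.
Proof.
move=> om; apply: hnat_ext => k w gw; rewrite hnat_diff // hnat0.
rewrite (@wd_graded_ext _ _ _ _ (@bcoch o s k) _ _ _ gw) => [|v gv]; last exact: hnat_bc.
exact/wd_letter_additive/bcoch_additive.
Qed.

End BasisCochain.

Section Resolution.
Variable n : nat.

Definition baug : nattrans (barc n 0) (Ta n) := bc n 0 (nseq n true) 1%g.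

Lemma hnat_aug k (w : wrd k) : graded n 0 (unzip1 w) ->
  hnat baug w = tpure [ffun i : 'I_n => ab_pi (lett w i) : abF k].
Proof.
move=> gw; rewrite hnat_bc // /bcoch (graded0_nseq gw) eqxx; congr tpure.
by apply/ffunP => i; rewrite !ffunE perm1.
Qed.

Lemma baug_surj : nt_surj baug.
Proof.
move=> k; elim/pres_ind => [|a b [x <-] [y <-]|x].
- by exists 0; rewrite raddf0.
- by exists (x - y); rewrite raddfB.
pose w : wrd k := [seq (true, repr (x i)) | i <- enum 'I_n].
have wT : unzip1 w = nseq n true.
  rewrite /w /unzip1 -map_comp; apply: (@eq_from_nth _ true).
    by rewrite size_map size_enum_ord size_nseq.
  move=> i; rewrite size_map size_enum_ord => iN.
  by rewrite (nth_map (Ordinal iN)) ?size_enum_ord // nth_nseq iN.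
have gw : graded n 0 (unzip1 w).
  rewrite wT /graded /ndeg; apply/and3P; split; first by case: (n).
    by rewrite count_nseq /= mul1n.
  by rewrite count_nseq /= mul0n.
exists (unit n 0 k w); rewrite -[LHS]/(hnat baug w) hnat_aug //.
rewrite -[pgen _ x]/(tpure x); congr tpure; apply/ffunP => i; rewrite ffunE.
rewrite /lett (nth_map i) ?size_enum_ord // nth_ord_enum /= /ab_pi reprK //.
Qed.

Lemma bdiff_diff j k x : bdiff n j k (bdiff n j.+1 k x) = 0.
Proof.
suff E : nt_comp (bdiff n j) (bdiff n j.+1) = 0 by exact: (congr1 (fun h : nattrans _ _ => h k x) E).
apply: hnat_ext => l w gw; rewrite hnat_diff // hnat0 -[RHS](wdd (@mlGA l) (unit n j l) w).
apply: (@wd_graded_ext _ _ _ _ _ n j.+1) => // v gv.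
by rewrite -[LHS]/(hnat (nt_comp (nt_id _) (bdiff n j)) v) hnat_diff.
Qed.

Section Exact.
Variable k : nat.

Definition bcontr j : {additive barc n j k -> barc n j.+1 k} :=
  zlift (fun x : bgen n j k => contr (unit n j.+1 k) (val x)).

Definition bproj j : {additive barc n j k -> barc n j k} :=
  zlift (fun x : bgen n j k => proj_gen (unit n j k) (val x)).

Lemma bcontrE j x : bcontr j << x >> = contr (unit n j.+1 k) (val x).
Proof. by rewrite /bcontr ?(zliftE, zlift_funE). Qed.

Lemma bprojE j x : bproj j << x >> = proj_gen (unit n j k) (val x).
Proof. by rewrite /bproj ?(zliftE, zlift_funE). Qed.

Lemma bdiff_bcontr j (x : bgen n j k) :
  bdiff n j k (bcontr j << x >>) = contr (wd (@mlG k) (unit n j k)) (val x).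
Proof.
rewrite bcontrE contr_mor; apply: contr_graded_ext (valP x) _ => v gv.
by rewrite -[LHS]/(hnat (nt_comp (nt_id _) (bdiff n j)) v) hnat_diff.
Qed.

Lemma bcontr0 z : bdiff n 0 k (bcontr 0 z) = z - bproj 0 z.
Proof.
apply: (@freeg_ext _ _ (bdiff n 0 k \o bcontr 0 : {additive _ -> _})
  ((idfun : homZ (barc n 0 k) (barc n 0 k)) - (bproj 0 : homZ (barc n 0 k) (barc n 0 k)) : homZ _ _)) z => x.
rewrite -[LHS]/(bdiff n 0 k (bcontr 0 _)) -[RHS]/(_ - bproj 0 _) bdiff_bcontr bprojE.
rewrite -unit_val -contr_wd; last by case/and3P: (valP x).
by rewrite (wd_deg0 _ _ (valP x)) add0r.
Qed.

Lemma bcontrS j z : bdiff n j.+1 k (bcontr j.+1 z) + bcontr j (bdiff n j k z) = z.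
Proof.
apply: (@freeg_ext _ _ (((bdiff n j.+1 k \o bcontr j.+1 : {additive _ -> _}) : homZ (barc n j.+1 k) (barc n j.+1 k))
   + ((bcontr j \o bdiff n j k : {additive _ -> _}) : homZ (barc n j.+1 k) (barc n j.+1 k)) : homZ _ _)
  (idfun : {additive _ -> _})) z => x.
rewrite -[LHS]/(bdiff n j.+1 k (bcontr j.+1 _) + bcontr j (bdiff n j k _)) /= bdiff_bcontr.
have -> : bcontr j (bdiff n j k << x >>) = wd (@mlG k) (contr (unit n j.+1 k)) (val x).
  rewrite -unit_val -[bdiff n j k _]/(hnat (nt_comp (nt_id _) (bdiff n j)) (val x)).
  rewrite hnat_diff ?(valP x) // wd_mor; apply: (@wd_graded_ext _ _ _ _ _ n j _ (valP x)) => v gv.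
  by have [y <-] := bgenP gv; rewrite /hnat /= unit_val bcontrE.
rewrite addrC contr_wd ?(proj_gen_deg _ (valP x)) ?subr0 ?unit_val //.
by case/and3P: (valP x).
Qed.

Section PE.
Variable M : zmodType.

(** [proj_gen] rewritten in terms of the classes of the letters. It is additive in each of them, so
    it induces a map from the tensor power back to words. *)
Fixpoint gen_eval (c : wrd k -> M) (s : seq (abF k)) : M :=
  if s is a :: s' then abev k (fun i => gen_eval (fun v => c ((true, gen k i) :: v)) s') a
  else c [::].

Lemma abev_add (y y' y'' : nat -> M) (a : abF k) : (forall i, y'' i = y i + y' i) ->
  abev k y'' a = abev k y a + abev k y' a.
Proof.
by move=> yE; elim/ab_ind: a => g; rewrite !abevE -gsumD; apply: gsum_ext.
Qed.

Lemma gen_evalD c A C a b :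
  gen_eval c (A ++ (a + b) :: C) = gen_eval c (A ++ a :: C) + gen_eval c (A ++ b :: C).
Proof.
elim: A c => [|x A IH] c /=; first by rewrite raddfD.
by apply: abev_add => i; rewrite IH.
Qed.

Lemma proj_gen_true c (w : wrd k) : all id (unzip1 w) ->
  proj_gen c w = gen_eval c [seq ab_pi x.2 : abF k | x <- w].
Proof.
elim: w c => //= -[b g] w IH c /= /andP[_ wT]; rewrite [RHS]abevE.
have -> A B : (if w is (false, _) :: _ then A else B) = B :> M.
  by case: w wT {IH} => [|[[] h] w].
by apply: gsum_ext => i; rewrite IH.
Qed.
End PE.

Lemma gen_eval_Dffun i (x y z : {ffun 'I_n -> abF k}) : z i = x i + y i ->
  (forall j, j != i -> x j = z j /\ y j = z j) ->
  gen_eval (unit n 0 k) [seq z i | i <- enum 'I_n] =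
  gen_eval (unit n 0 k) [seq x i | i <- enum 'I_n] + gen_eval (unit n 0 k) [seq y i | i <- enum 'I_n].
Proof.
move=> zi xyz; have := enum_uniq 'I_n; have /splitPr := mem_enum 'I_n i.
case=> p1 p2; rewrite cat_uniq /= negb_or => /and4P[_ /andP[ip1 _] ip2 _].
have E (t : {ffun 'I_n -> abF k}) p : (forall j, j != i -> t j = z j) -> i \notin p ->
    [seq t j | j <- p] = [seq z j | j <- p].
  by move=> tz ip; apply/eq_in_map => j jp; apply: tz; apply: contraNneq ip => <-.
have xz j : j != i -> x j = z j by case/xyz.
have yz j : j != i -> y j = z j by case/xyz.
by rewrite !map_cat /= zi gen_evalD !(E _ _ xz) // !(E _ _ yz).
Qed.

(** In degree 0 the projection left by the contraction factors through the augmentation, so it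
    vanishes on the kernel of the latter. *)
Lemma baug_exact (x : barc n 0 k) : baug k x = 0 -> exists y, x = bdiff n 0 k y.
Proof.
pose th : {additive Ta n k -> barc n 0 k} := tpow_lift gen_eval_Dffun.
have thE z : th (baug k z) = bproj 0 z.
  apply: (@freeg_ext _ _ (th \o baug k : {additive _ -> _}) (bproj 0)) z => z.
  rewrite -[LHS]/(th (baug k _)) bprojE -unit_val -[baug k _]/(hnat baug (val z)).
  rewrite (hnat_aug (valP z)) /th tpow_liftE.
  have zT := graded0_nseq (valP z); have zn := graded_size (valP z).
  rewrite addn0 in zn.
  rewrite proj_gen_true; last by rewrite zT all_nseq orbT.
  congr gen_eval; apply: (@eq_from_nth _ 0).
    by rewrite size_map size_enum_ord size_map; apply: esym; rewrite size_map in zn.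
  move=> i; rewrite size_map size_enum_ord => iN.
  rewrite (nth_map (Ordinal iN)) ?size_enum_ord // ffunE nth_enum_ord //.
  rewrite (nth_map (true, 1%g)) //.
  by rewrite size_map in zn; rewrite zn.
move=> x0; exists (bcontr 0 x); rewrite bcontr0 -thE x0 raddf0 subr0 //.
Qed.

End Exact.

Lemma bres_exact0 k (x : barc n 0 k) : baug k x = 0 <-> exists y, x = bdiff n 0 k y.
Proof.
split=> [|[y ->]]; first exact: baug_exact.
by have /(congr1 (fun h : nattrans _ _ => h k y)) := bc_cocycle n 0 1%g (size_nseq n true).
Qed.

Lemma bres_exact j k (x : barc n j.+1 k) : bdiff n j k x = 0 <-> exists y, x = bdiff n j.+1 k y.
Proof.
split=> [x0|[y ->]]; last exact: bdiff_diff.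
by exists (bcontr k j.+1 x); rewrite -[LHS](bcontrS x) x0 raddf0 addr0.
Qed.

Definition bres : projres (Ta n) :=
  @ProjRes (Ta n) (barc n) (bdiff n) baug (@bar_proj n) baug_surj bres_exact0 bres_exact.

End Resolution.

(** * Ext groups and arbitrary resolutions *)

Section NtAlgebra.

Lemma nt_compA (A B C D : functor) (c : nattrans C D) (b : nattrans B C) (a : nattrans A B) :
  nt_comp c (nt_comp b a) = nt_comp (nt_comp c b) a.
Proof. exact: nattransP. Qed.

Lemma nt_compDl (A B C : functor) (b b' : nattrans B C) (a : nattrans A B) :
  nt_comp (b + b') a = nt_comp b a + nt_comp b' a.
Proof. exact: nattransP. Qed.

Lemma nt_compBl (A B C : functor) (b b' : nattrans B C) (a : nattrans A B) :
  nt_comp (b - b') a = nt_comp b a - nt_comp b' a.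
Proof. exact: nattransP. Qed.

Lemma nt_comp0l (A B C : functor) (a : nattrans A B) : nt_comp (0 : nattrans B C) a = 0.
Proof. exact: nattransP. Qed.

Lemma nt_compDr (A B C : functor) (b : nattrans B C) (a a' : nattrans A B) :
  nt_comp b (a + a') = nt_comp b a + nt_comp b a'.
Proof. by apply: nattransP => k x; rewrite /= raddfD. Qed.

Lemma nt_compNr (A B C : functor) (b : nattrans B C) (a : nattrans A B) :
  nt_comp b (- a) = - nt_comp b a.
Proof. by apply: nattransP => k x; rewrite /= raddfN. Qed.

Lemma nt_compBr (A B C : functor) (b : nattrans B C) (a a' : nattrans A B) :
  nt_comp b (a - a') = nt_comp b a - nt_comp b a'.
Proof. by rewrite nt_compDr nt_compNr. Qed.

Lemma nt_comp0r (A B C : functor) (b : nattrans B C) : nt_comp b (0 : nattrans A B) = 0.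
Proof. by apply: nattransP => k x; rewrite /= raddf0. Qed.

Lemma nt_comp1l (A B : functor) (a : nattrans A B) : nt_comp (nt_id B) a = a.
Proof. exact: nattransP. Qed.

Lemma nt_comp1r (A B : functor) (a : nattrans A B) : nt_comp a (nt_id A) = a.
Proof. exact: nattransP. Qed.

End NtAlgebra.

Section Resolutions.
Variables (F : functor) (P : projres F).

Lemma pr_ddE j : nt_comp (pr_d P j) (pr_d P j.+1) = 0.
Proof. by apply: nattransP => k x; apply: pr_dd. Qed.

Lemma pr_augd : nt_comp (pr_aug P) (pr_d P 0%N) = 0.
Proof. by apply: nattransP => k x; apply/pr_exact0; exists x. Qed.

Section Cocycles.
Variables (i : nat) (G : functor).
Implicit Types a b : nattrans (P i) G.

Definition is_coc a := nt_comp a (pr_d P i) = 0.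

Lemma is_cocP a : is_coc a <-> a \in cocycle_pred (P := P) (i := i) (G := G).
Proof.
split=> [a0|/asboolP a0]; last by apply: nattransP.
by apply/asboolP => k x; rewrite -[LHS]/(nt_comp a (pr_d P i) k x) a0.
Qed.

Lemma is_cocB a b : is_coc a -> is_coc b -> is_coc (a - b).
Proof. by rewrite /is_coc nt_compBl => -> ->; rewrite subr0. Qed.

Lemma is_cocD a b : is_coc a -> is_coc b -> is_coc (a + b).
Proof. by rewrite /is_coc nt_compDl => -> ->; rewrite addr0. Qed.

Lemma cob0 : coboundary (0 : nattrans (P i) G).
Proof. by case: i => [|j] //=; exists 0; rewrite nt_comp0l. Qed.

Lemma cobB a b : coboundary a -> coboundary b -> coboundary (a - b).
Proof.
move: a b; case: i => [|j] a b /=; first by move=> -> ->; rewrite subr0.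
by case=> x -> [y ->]; exists (x - y); rewrite nt_compBl.
Qed.

Lemma cobN a : coboundary a -> coboundary (- a).
Proof. by rewrite -sub0r; apply: cobB; apply: cob0. Qed.

Lemma cobD a b : coboundary a -> coboundary b -> coboundary (a + b).
Proof. by move=> ca cb; rewrite -[b]opprK; apply/cobB/cobN. Qed.

Lemma cocycle_valB (x y : cocycle P i G) : cocycle_val (x - y) = cocycle_val x - cocycle_val y.
Proof. exact: (raddfB val). Qed.

Lemma cocycle_valD (x y : cocycle P i G) : cocycle_val (x + y) = cocycle_val x + cocycle_val y.
Proof. exact: (raddfD val). Qed.

Lemma ext_class_eq a b : is_coc a -> is_coc b ->
  ext_class a = ext_class b <-> coboundary (a - b).
Proof.
move=> /is_cocP ca /is_cocP cb.
have va : cocycle_val (insubd (0 : cocycle P i G) a) = a by rewrite [LHS]insubdK.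
have vb : cocycle_val (insubd (0 : cocycle P i G) b) = b by rewrite [LHS]insubdK.
rewrite /ext_class; split=> [/qpiP|cab]; last first.
  by apply/qpiP; apply: zspan_gen; rewrite cocycle_valB va vb.
rewrite -{2}va -{2}vb -cocycle_valB; elim=> [|x y _ cx _ cy|x //].
  exact: cob0.
by rewrite cocycle_valB; apply: cobB.
Qed.

Lemma ext_classD a b : is_coc a -> is_coc b ->
  ext_class (a + b) = ext_class a + ext_class b.
Proof.
move=> ca cb; have cab := is_cocD ca cb.
move/is_cocP: ca => ca; move/is_cocP: cb => cb; move/is_cocP: cab => cab.
rewrite /ext_class -raddfD; congr (qpi _ _); apply: val_inj.
by rewrite -[RHS]/(cocycle_val _) cocycle_valD -[LHS]/(val _) !insubdK // -!/(val _) !insubdK.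
Qed.

Lemma ext_repr_coc (x : cohomology P i G) : is_coc (ext_repr x).
Proof. by apply: nattransP => k y; apply: ext_reprP. Qed.

Lemma ext_repr_class a : is_coc a -> coboundary (ext_repr (ext_class a) - a).
Proof. by move=> ca; apply/ext_class_eq => //; rewrite ?ext_reprK //; apply: ext_repr_coc. Qed.

End Cocycles.

Lemma cob_postcomp i G H (b : nattrans G H) (a : nattrans (P i) G) :
  coboundary a -> coboundary (nt_comp b a).
Proof.
move: a; case: i => [|j] a /=; first by move=> ->; rewrite nt_comp0r.
by case=> x ->; exists (nt_comp b x); rewrite nt_compA.
Qed.

End Resolutions.

Section Homotopy.
Variables (C : nat -> functor) (d : forall j, nattrans (C j.+1) (C j)).
Variables (G : functor) (Q : projres G) (a : nattrans (C 0%N) G).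
Hypothesis projC : forall j, projective (C j).
Hypothesis dd : forall j, nt_comp (d j) (d j.+1) = 0.
Variables h h' : forall j, nattrans (C j) (Q j).
Hypothesis hP : is_chain_lift d Q a h.
Hypothesis h'P : is_chain_lift d Q a h'.

Lemma projective_lift_nt (A B D : functor) (e : nattrans A B) (e' : nattrans B D) j
    (f : nattrans (C j) B) :
  (forall k x, e' k x = 0 <-> exists y, x = e k y) -> nt_comp e' f = 0 ->
  exists g, nt_comp e g = f.
Proof.
move=> ex e'f; apply: (@projective_lift _ _ _ _ e e' f (@projC j) ex) => k x.
by rewrite -[LHS]/(nt_comp e' f k x) e'f.
Qed.

Lemma homotopy0 : exists s, nt_comp (pr_d Q 0%N) s = h 0%N - h' 0%N.
Proof.
apply: projective_lift_nt; first exact: pr_exact0.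
by rewrite nt_compBr hP.1 h'P.1 subrr.
Qed.

(** A cocycle of degree j + 1 sees only two consecutive components of the homotopy, so no infinite
    family is chosen. The induction carries such a pair, because the equation satisfied by one
    component is what the next lift requires. *)
Lemma homotopyS j : exists s s',
  nt_comp (pr_d Q j.+1) s = h j.+1 - h' j.+1 - nt_comp s' (d j).
Proof.
have step j' (s' : nattrans (C j') (Q j'.+1)) :
    nt_comp (nt_comp (pr_d Q j') s') (d j') = nt_comp (h j' - h' j') (d j') ->
    exists s, nt_comp (pr_d Q j'.+1) s = h j'.+1 - h' j'.+1 - nt_comp s' (d j').
  move=> E; apply: projective_lift_nt; first exact: pr_exact.
  by rewrite !nt_compBr hP.2 h'P.2 nt_compA E nt_compBl subrr.
elim: j => [|j [s [s' E]]].
  by have [s' E] := homotopy0; have [s sE] := step _ s' (congr1 (fun u => nt_comp u _) E); exists s, s'.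
have [|s1 s1E] := step _ s; last by exists s1, s.
by rewrite E nt_compBl -nt_compA dd nt_comp0r subr0.
Qed.

Lemma lift_unique0 H (c : nattrans (Q 0%N) H) : is_coc c ->
  nt_comp c (h 0%N) = nt_comp c (h' 0%N).
Proof.
move=> c0; apply/eqP; rewrite -subr_eq0 -nt_compBr; have [s <-] := homotopy0.
by rewrite nt_compA c0 nt_comp0l.
Qed.

Lemma lift_uniqueS j H (c : nattrans (Q j.+1) H) : is_coc c ->
  exists b, nt_comp c (h j.+1) - nt_comp c (h' j.+1) = nt_comp b (d j).
Proof.
move=> c0; have [s [s' E]] := homotopyS j; exists (nt_comp c s').
rewrite -nt_compBr -nt_compA -[h _ - _](subrK (nt_comp s' (d j))) -E nt_compDr.
by rewrite nt_compA c0 nt_comp0l add0r.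
Qed.

End Homotopy.

Lemma chain_liftE (C : nat -> functor) (d : forall j, nattrans (C j.+1) (C j))
    (G : functor) (Q : projres G) (a : nattrans (C 0%N) G) :
  (forall j, projective (C j)) -> (forall j, nt_comp (d j) (d j.+1) = 0) ->
  nt_comp a (d 0%N) = 0 -> is_chain_lift d Q a (chain_lift d Q a).
Proof.
move=> pC dd ad; apply: chain_liftP => // [j k x|k x].
  by rewrite -[LHS]/(nt_comp (d j) (d j.+1) k x) dd.
by rewrite -[LHS]/(nt_comp a (d 0%N) k x) ad.
Qed.

Section Comparison.
Variables (F : functor) (P P' : projres F).

Definition cmp : forall j, nattrans (P j) (P' j) := chain_lift (pr_d P) P' (pr_aug P).

Lemma cmpP : is_chain_lift (pr_d P) P' (pr_aug P) cmp.
Proof. by apply: chain_liftE; [exact: pr_proj|exact: pr_ddE|exact: pr_augd]. Qed.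
End Comparison.

Lemma chain_lift_comp (C C' : nat -> functor) (d : forall j, nattrans (C j.+1) (C j))
   (d' : forall j, nattrans (C' j.+1) (C' j))
   (G : functor) (Q : projres G) (a : nattrans (C 0%N) G) h
   (f : forall j, nattrans (C' j) (C j)) :
  is_chain_lift d Q a h -> (forall j, nt_comp (d j) (f j.+1) = nt_comp (f j) (d' j)) ->
  is_chain_lift d' Q (nt_comp a (f 0%N)) (fun j => nt_comp (h j) (f j)).
Proof.
move=> [h0 hS] fS; split; first by rewrite nt_compA h0.
by move=> j; rewrite nt_compA hS -!nt_compA fS.
Qed.

Lemma cob_precomp (F F' : functor) (P : projres F) (P' : projres F')
    (f : forall j, nattrans (P' j) (P j)) i G (a : nattrans (P i) G) :
  (forall j, nt_comp (pr_d P j) (f j.+1) = nt_comp (f j) (pr_d P' j)) ->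
  coboundary a -> coboundary (nt_comp a (f i)).
Proof.
move=> fS; case: i a => [|i] a /=; first by move=> ->; rewrite nt_comp0l.
by case=> b ->; exists (nt_comp b (f i)); rewrite -!nt_compA fS.
Qed.

Lemma coc_precomp (F F' : functor) (P : projres F) (P' : projres F')
    (f : forall j, nattrans (P' j) (P j)) i G (a : nattrans (P i) G) :
  (forall j, nt_comp (pr_d P j) (f j.+1) = nt_comp (f j) (pr_d P' j)) ->
  is_coc a -> is_coc (nt_comp a (f i)).
Proof. by rewrite /is_coc => fS a0; rewrite -nt_compA -fS nt_compA a0 nt_comp0l. Qed.

Lemma lift_unique_cob (F : functor) (P : projres F) (i : nat) G (Q : projres G)
    (a : nattrans (P i) G) (h h' : forall j, nattrans (P (j + i)%N) (Q j)) j H (c : nattrans (Q j) H) :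
  is_chain_lift (C := fun j => P (j + i)%N) (fun j => pr_d P (j + i)) Q a h ->
  is_chain_lift (C := fun j => P (j + i)%N) (fun j => pr_d P (j + i)) Q a h' ->
  is_coc c -> coboundary (nt_comp c (h j) - nt_comp c (h' j)).
Proof.
move=> hP h'P; have pP j' : projective (P (j' + i)%N) by apply: pr_proj.
have dd j' : nt_comp (pr_d P (j' + i)) (pr_d P (j'.+1 + i)) = 0 by apply: pr_ddE.
case: j c => [|j] c c0.
  by rewrite (lift_unique0 pP hP h'P c0) subrr; apply: cob0.
by have [b bE] := lift_uniqueS pP dd hP h'P c0; exists b.
Qed.

Lemma lift_unique_cob0 (F F' : functor) (P : projres F) G (Q : projres G)
    (a : nattrans (P 0%N) G) (h h' : forall j, nattrans (P j) (Q j)) j H (c : nattrans (Q j) H) :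
  is_chain_lift (pr_d P) Q a h -> is_chain_lift (pr_d P) Q a h' ->
  is_coc c -> coboundary (nt_comp c (h j) - nt_comp c (h' j)).
Proof.
move=> hP h'P; have pP j' : projective (P j') by apply: pr_proj.
have dd j' : nt_comp (pr_d P j') (pr_d P (j'.+1)) = 0 by apply: pr_ddE.
case: j c => [|j] c c0.
  by rewrite (lift_unique0 pP hP h'P c0) subrr; apply: cob0.
by have [b bE] := lift_uniqueS pP dd hP h'P c0; exists b.
Qed.

Lemma nt_id_lift (F : functor) (P : projres F) :
  is_chain_lift (pr_d P) P (pr_aug P) (fun j => nt_id (P j)).
Proof. by split=> [|j]; rewrite ?nt_comp1r ?nt_comp1l. Qed.

Section Class.
Variables (F : functor) (P : projres F) (i : nat).
Local Notation S := (std_res F).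

(** The class, in the Ext group of the standard resolution, of a cocycle given on an arbitrary
    projective resolution. It allows every computation to be made on the bar resolution. *)
Definition cls G (a : nattrans (P i) G) : Ext i F G := ext_class (nt_comp a (cmp S P i)).

Lemma cmp_coc G (a : nattrans (P i) G) : is_coc a -> is_coc (nt_comp a (cmp S P i)).
Proof. by apply: coc_precomp; case: (cmpP S P). Qed.

Lemma clsD G (a b : nattrans (P i) G) : is_coc a -> is_coc b -> cls (a + b) = cls a + cls b.
Proof. by move=> ca cb; rewrite /cls nt_compDl ext_classD //; apply: cmp_coc. Qed.

(** The comparison maps in the two directions compose to a map homotopic to the identity. *)
Lemma cls_cob G (a b : nattrans (P i) G) : is_coc a -> is_coc b ->
  cls a = cls b <-> coboundary (a - b).
Proof.
move=> ca cb; rewrite /cls ext_class_eq; try exact: cmp_coc.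
rewrite -nt_compBl; split; last by apply: cob_precomp; case: (cmpP S P).
move=> /(cob_precomp (f := cmp P S)) -/(_ (cmpP P S).2).
rewrite -nt_compA => cab.
have lif : is_chain_lift (pr_d P) P (pr_aug P) (fun j => nt_comp (cmp S P j) (cmp P S j)).
  by have := chain_lift_comp (cmpP S P) (cmpP P S).2; rewrite (cmpP P S).1.
have cc := lift_unique_cob0 F (nt_id_lift P) lif (is_cocB ca cb).
by have := cobD cc cab; rewrite subrK nt_comp1r.
Qed.

Lemma cls_surj G (x : Ext i F G) : exists2 a : nattrans (P i) G, is_coc a & cls a = x.
Proof.
exists (nt_comp (ext_repr x) (cmp P S i)).
  by apply: coc_precomp (ext_repr_coc x); case: (cmpP P S).
rewrite /cls -nt_compA -[RHS]ext_reprK; apply/ext_class_eq.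
- rewrite nt_compA; apply: cmp_coc; apply: coc_precomp (ext_repr_coc x).
  by case: (cmpP P S).
- exact: ext_repr_coc.
have lif : is_chain_lift (pr_d S) S (pr_aug S) (fun j => nt_comp (cmp P S j) (cmp S P j)).
  by have := chain_lift_comp (cmpP P S) (cmpP S P).2; rewrite (cmpP S P).1.
have := lift_unique_cob0 F lif (nt_id_lift S) (ext_repr_coc x).
by rewrite nt_comp1r.
Qed.

Lemma ext_repr_cls G (a : nattrans (P i) G) : is_coc a ->
  coboundary (ext_repr (cls a) - nt_comp a (cmp S P i)).
Proof. by move=> ca; apply/ext_repr_class/cmp_coc. Qed.

Lemma ext_push_cls G G' (b : nattrans G G') (a : nattrans (P i) G) : is_coc a ->
  ext_push b (cls a) = cls (nt_comp b a).
Proof.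
move=> ca; apply/ext_class_eq.
- by rewrite /is_coc -nt_compA ext_repr_coc nt_comp0r.
- by apply: cmp_coc; rewrite /is_coc -nt_compA ca nt_comp0r.
by rewrite -nt_compA -nt_compBr; apply/cob_postcomp/ext_repr_cls.
Qed.

End Class.

Lemma ext_pull_cls (F F' : functor) (P : projres F) (P' : projres F') (b : nattrans F' F)
    (f : forall j, nattrans (P' j) (P j)) i G (a : nattrans (P i) G) :
  is_chain_lift (pr_d P') P (nt_comp b (pr_aug P')) f -> is_coc a ->
  ext_pull b (cls a) = cls (nt_comp a (f i)).
Proof.
move=> fP ca; set S := std_res F; set S' := std_res F'.
have LP : is_chain_lift (pr_d S') S (nt_comp b (pr_aug S'))
    (chain_lift (pr_d S') S (nt_comp b (pr_aug S'))).
  apply: chain_liftE; [exact: pr_proj|exact: pr_ddE|].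
  by rewrite -nt_compA pr_augd nt_comp0r.
rewrite /ext_pull -/S -/S'; move: (chain_lift _ _ _) LP => L LP.
apply/ext_class_eq.
- by apply: coc_precomp (ext_repr_coc _); case: LP.
- by apply: cmp_coc; apply: coc_precomp ca; case: fP.
have c1 := cob_precomp (f := L) LP.2 (ext_repr_cls ca).
have l1 := chain_lift_comp (cmpP S P) LP.2; rewrite (LP.1) in l1.
have l2 := chain_lift_comp fP (cmpP S' P').2.
rewrite -nt_compA (cmpP S' P').1 in l2.
have c2 := lift_unique_cob0 F' l1 l2 ca.
have := cobD c1 c2; rewrite nt_compBl -!nt_compA addrA subrK //.
Qed.

(** If r = a + b d, lift b through the augmentation to b' and add b' d to the lift in degree 0,
    leaving the other degrees alone; composing with [c] then adds the coboundary of c b'. *)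
Lemma lift_change_base (F G H : functor) (P : projres F) (Q : projres G) i j
    (r a : nattrans (P i) G) (c : nattrans (Q j) H) (A : forall j, nattrans (P (j + i)%N) (Q j)) :
  coboundary (r - a) ->
  is_chain_lift (C := fun j => P (j + i)%N) (fun j => pr_d P (j + i)) Q a A -> is_coc c ->
  exists2 A' : forall j, nattrans (P (j + i)%N) (Q j),
    is_chain_lift (C := fun j => P (j + i)%N) (fun j => pr_d P (j + i)) Q r A' &
    coboundary (P := P) (nt_comp c (A' j) - nt_comp c (A j)).
Proof.
case: i r a A => [|i] r a A.
  by move/eqP; rewrite subr_eq0 => /eqP ->; exists A => //; rewrite subrr; apply: cob0.
case=> b rE AP c0; have [b' b'E] := pr_proj (p := P) (i := i) b (@pr_surj _ Q).
pose A' j : nattrans (P (j + i.+1)%N) (Q j) :=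
  if j is 0%N return nattrans (P (j + i.+1)%N) (Q j) then A 0%N + nt_comp b' (pr_d P i) else A _.
exists A'.
  split=> [|[|j']] /=; rewrite ?nt_compDr ?AP.1 ?AP.2 //.
    by rewrite nt_compA b'E -rE addrC subrK.
  by rewrite nt_compDl -nt_compA pr_ddE nt_comp0r addr0.
case: j c c0 => [|j] c c0; last by rewrite subrr; apply: cob0.
rewrite /=.
by rewrite nt_compDr addrAC subrr add0r; exists (nt_comp c b'); rewrite nt_compA.
Qed.

Lemma cob_precomp_shift (F G H : functor) (S : projres F) (T : projres G) i
    (L : forall j, nattrans (S (j + i)%N) (T j)) j (e : nattrans (T j) H) :
  (forall j, nt_comp (pr_d T j) (L j.+1) = nt_comp (L j) (pr_d S (j + i))) ->
  coboundary e -> coboundary (P := S) (i := j + i) (nt_comp e (L j)).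
Proof.
move=> LS; case: j e => [|j] e; first by move=> /= ->; rewrite nt_comp0l; apply: cob0.
by case=> b ->; exists (nt_comp b (L j)); rewrite -!nt_compA LS.
Qed.

(** Three choices separate the definition from the right-hand side: the representatives of the two
    classes and the chain map. Changing each of them alters the result by a coboundary. *)
Lemma yoneda_cls (F G H : functor) (P : projres F) (Q : projres G) i j
    (a : nattrans (P i) G) (c : nattrans (Q j) H) (A : forall j, nattrans (P (j + i)%N) (Q j)) :
  is_chain_lift (C := fun j => P (j + i)%N) (fun j => pr_d P (j + i)) Q a A ->
  is_coc a -> is_coc c ->
  yoneda (cls a) (cls c) = cls (nt_comp c (A j)).
Proof.
move=> AP ca cc; set S := std_res F; set T := std_res G.
rewrite /yoneda -/S -/T; set r := ext_repr (cls a); set r' := ext_repr (cls c).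
have LP : is_chain_lift (C := fun j => S (j + i)%N) (fun j => pr_d S (j + i)) T r
    (chain_lift (C := fun j => S (j + i)%N) (fun j => pr_d S (j + i)) T r).
  apply: chain_liftE => [j'|j'|]; [exact: pr_proj|exact: pr_ddE|exact: ext_repr_coc].
move: (chain_lift _ _ _) LP => L LP.
have cA : is_coc (nt_comp c (A j)).
  by rewrite /is_coc -nt_compA -[nt_comp (A j) _]AP.2 nt_compA cc nt_comp0l.
apply/ext_class_eq.
- by rewrite /is_coc -nt_compA -[nt_comp (L j) _]LP.2 nt_compA ext_repr_coc nt_comp0l.
- exact: cmp_coc.
have c1 : coboundary (P := S) (i := j + i) (nt_comp (r' - nt_comp c (cmp T Q j)) (L j)).
  exact: cob_precomp_shift LP.2 (ext_repr_cls cc).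
have c2 : coboundary (P := S) (nt_comp (nt_comp c (cmp T Q j)) (L j) - nt_comp (nt_comp c (A j)) (cmp S P (j + i))).
  have l1 := chain_lift_comp (d := fun j => pr_d T j) (cmpP T Q) LP.2; rewrite LP.1 in l1.
  have aA : is_chain_lift (C := fun j => S (j + i)%N) (fun j => pr_d S (j + i)) Q
      (nt_comp a (cmp S P i)) (fun j => nt_comp (A j) (cmp S P (j + i))).
    exact: (chain_lift_comp (C' := fun j => S (j + i)%N) AP (fun j' => (cmpP S P).2 (j' + i)%N)).
  have := ext_repr_cls ca; rewrite -/r => rE.
  have [A' A'P A'c] := lift_change_base rE aA cc.
  have := cobD (lift_unique_cob l1 A'P cc) A'c.
  by rewrite addrA subrK !nt_compA.
by have := cobD c1 c2; rewrite nt_compBl addrA subrK.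
Qed.

(** * Cocycles on words of subsets *)

Section SetWords.
Variable m : nat.
Implicit Types (U T Z : {set 'I_m}) (x y : 'I_m).
Local Notation word := (seq (bool * {set 'I_m})).
Implicit Types (c : word -> int) (w v u : word).

(* Coefficients of products in the nonunital ring of the elements g - 1, seen *)
(* through squarefree monomials.                                              *)
Definition mlS U T : seq (int * {set 'I_m}) :=
  if U == set0 then (if T == set0 then [:: (-1, set0)] else [::])
  else if T == set0 then [::] else [:: (1, U :|: T)].

(** This is 1 - [U empty] - [T empty], the three terms of c(gh) - c(g) - c(h) in order: the value at
    g alone carries the factors of U and T only when T is empty, and symmetrically for h. *)
Definition chi U T : int :=
  if U == set0 then (if T == set0 then -1 else 0) else if T == set0 then 0 else 1.

Lemma wopS (M : zmodType) (c : {set 'I_m} -> M) U T : wop mlS c U T = c (U :|: T) *~ chi U T.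
Proof.
rewrite /wop /mlS /chi; case: eqVneq => [->|U0]; case: eqVneq => [->|T0];
  by rewrite unlock /= ?addr0 ?setU0.
Qed.

Lemma mlSA (M : zmodType) (c : {set 'I_m} -> M) U T Z :
  wop mlS (fun V : {set 'I_m} => wop mlS c V Z) U T = wop mlS (fun V : {set 'I_m} => wop mlS c U V) T Z.
Proof.
rewrite !wopS -!mulrzA setUA; congr (_ *~ _); rewrite /chi !setU_eq0.
by case: (U == set0); case: (T == set0); case: (Z == set0).
Qed.

Lemma chiC U T : chi U T = chi T U.
Proof. by rewrite /chi; case: (U == set0); case: (T == set0). Qed.

Local Notation wd := (wd mlS).
Local Notation mrg := (mrg mlS).

Lemma mrgE c b U T w :
  mrg c (b, U) ((false, T) :: w) = c ((b, U :|: T) :: w) *~ chi U T.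
Proof. exact: wopS. Qed.

Lemma mrg_true c z w : head true (unzip1 w) -> mrg c z w = 0.
Proof. by case: w => [|[[] ?] ?]. Qed.

Section Empty.

(** Doubles the first empty letter. As [chi set0 set0] is -1, merging the two copies gives back the
    word up to sign, which makes this a contraction on the words that contain an empty letter. *)
Fixpoint knull c w : int :=
  if w is (b, U) :: w' then
    if U == set0 then - sg b (c ((b, set0) :: (false, set0) :: w'))
    else sg b (knull (fun v => c ((b, U) :: v)) w')
  else 0.

Lemma knull_ext c c' w : (forall v, head true (unzip1 v) = head true (unzip1 w) -> c v = c' v) ->
  knull c w = knull c' w.
Proof.
elim: w c c' => //= -[b U] w IH c c' cc; rewrite (cc ((b, _) :: _)) //.
by rewrite (IH _ (fun v => c' ((b, U) :: v))) // => v _; apply: cc.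
Qed.

Lemma knullD c c' w : knull (fun v => c v + c' v) w = knull c w + knull c' w.
Proof.
elim: w c c' => [|[b U] w IH] c c' /=; first by rewrite addr0.
by case: ifP => _; rewrite ?IH sgD // opprD.
Qed.

Lemma knullN c w : knull (fun v => - c v) w = - knull c w.
Proof.
elim: w c => [|[b U] w IH] c /=; first by rewrite oppr0.
by case: ifP => _; rewrite ?IH sgN.
Qed.

Lemma knull_sg b c w : knull (fun v => sg b (c v)) w = sg b (knull c w).
Proof. by case: b => //=; rewrite knullN. Qed.

Lemma knull0 w : knull (fun=> 0) w = 0.
Proof. by elim: w => //= -[b U] w ->; rewrite !sg0 oppr0; case: ifP. Qed.

Lemma knullMz c k w : knull (fun v => c v *~ k) w = knull c w *~ k.
Proof.
elim: w c => [|[b U] w IH] c /=; first by rewrite mul0rz.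
by case: ifP => _; rewrite ?IH; case: b => /=; rewrite ?mulNrz.
Qed.

Lemma knull_wd c w : has (fun l => l.2 == set0) w -> wd (knull c) w + knull (wd c) w = c w.
Proof.
elim: w c => //= -[b U] w IH c /=; case: eqVneq => [-> _|U0 /= hw].
  rewrite wopS setUid /chi eqxx mulrN1z.
  rewrite wdN wd_sg.
  set W := wd _ w; rewrite sgD sgN !sgK.
  have -> : mrg (knull c) (b, set0) w = sg b (- mrg (fun v => c ((b, set0) :: v)) (false, set0) w).
    case: w {IH W} => [|[[] T] w]; rewrite ?sgN ?sg0 ?oppr0 // !mrgE set0U /chi eqxx.
    case: ifP => [/eqP ->|_]; rewrite ?mulr0z ?sg0 ?oppr0 //= eqxx !mulrN1z.
    by rewrite sgN.
  by rewrite sgK /=; ring.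
rewrite wd_sg knull_sg sgK knullD sgD sgK.
rewrite addrACA IH // -[RHS]add0r; congr (_ + _).
case: w hw {IH} => [|[[] T] w] // hw.
  rewrite -[RHS]addr0 sg0; congr (_ + _); rewrite -[RHS](knull0 ((true, T) :: w)).
  by apply: knull_ext => v hv; rewrite mrg_true.
rewrite mrgE /=.
case: (eqVneq T set0) => [T0|T0] /=.
  by rewrite wopS /chi (negbTE U0) T0 eqxx !mulr0z ?oppr0 ?sg0 ?addr0.
rewrite setU_eq0 (negbTE U0) /=.
have -> : knull (fun v => wop mlS (fun V => c ((b, V) :: v)) U T) w
    = knull (fun v => c ((b, U :|: T) :: v)) w *~ chi U T.
  by rewrite -knullMz; apply: knull_ext => v _; exact: wopS.
by case: b; rewrite /= ?mulNrz ?opprK subrr.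
Qed.

End Empty.

Section Insert.
Variable x : 'I_m.

(** The signed shuffle of the letter {x} with what remains of the current block. *)
Fixpoint ins c w : int :=
  c ((false, [set x]) :: w) -
  (if w is (false, T) :: w' then ins (fun v => c ((false, T) :: v)) w' else 0).

(** Takes x out of its letter and shuffles it into the part of the block behind that letter. *)
Fixpoint kx c w : int :=
  if w is (b, U) :: w' then
    if x \in U then sg b (ins (fun v => c ((b, U :\ x) :: v)) w')
    else sg b (kx (fun v => c ((b, U) :: v)) w')
  else 0.

Lemma ins_ext c c' w : (forall v, head true (unzip1 v) = false -> c v = c' v) ->
  ins c w = ins c' w.
Proof.
elim: w c c' => [|[b U] w IH] c c' cc /=; rewrite cc //; congr (_ - _).
by case: b => //; apply: IH => v _; apply: cc.
Qed.

Lemma insD c c' w : ins (fun v => c v + c' v) w = ins c w + ins c' w.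
Proof.
elim: w c c' => [|[[] U] w IH] c c' /=; rewrite ?IH ?subr0 //.
by rewrite opprD addrACA.
Qed.

Lemma insN c w : ins (fun v => - c v) w = - ins c w.
Proof.
elim: w c => [|[[] U] w IH] c /=; rewrite ?IH ?subr0 //.
by rewrite opprD.
Qed.

Lemma insMz c k w : ins (fun v => c v *~ k) w = ins c w *~ k.
Proof.
elim: w c => [|[[] U] w IH] c /=; rewrite ?IH ?subr0 //.
by rewrite mulrzBl.
Qed.

(** A neighbour T merges with {x} once from the left and once from the right, with opposite signs,
    and union is commutative. The other merges do not involve {x}. *)
Lemma ins_wd c w : wd (ins c) w + ins (wd c) w = 0.
Proof.
elim: w c => [|[[] T] u IH] c; first by rewrite /= !(addr0, add0r, oppr0, subr0).
  rewrite /= subr0 add0r.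
  rewrite (@wd_ext _ _ _ _ (fun v => c [:: (false, [set x]), (true, T) & v])) => [|v]; last first.
    by rewrite subr0.
  have -> : mrg (fun v => ins c v) (true, T) u = mrg (fun v => c ((false, [set x]) :: v)) (true, T) u.
    by case: u {IH} => [|[[] V] u] //=; apply: wop_ext => V' _; rewrite subr0.
  by rewrite subrr.
have -> : wd (ins c) ((false, T) :: u) = - (mrg (ins c) (false, T) u
   + wd (fun v => c [:: (false, [set x]), (false, T) & v]) u
   - wd (ins (fun v => c ((false, T) :: v))) u).
  by rewrite -addrA -wdB.
have -> : ins (wd c) ((false, T) :: u) = wd c [:: (false, [set x]), (false, T) & u]
   + (ins (mrg c (false, T)) u + ins (wd (fun v => c ((false, T) :: v))) u).
  by rewrite -insD [LHS]/=; congr (_ + _); rewrite insN opprK.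
have /eqP := IH (fun v => c ((false, T) :: v)); rewrite addr_eq0 => /eqP ->.
rewrite /= wopS.
set W := wd _ u; set I := ins (wd _) u.
have -> : ins (mrg c (false, T)) u = c ((false, [set x] :|: T) :: u) *~ chi [set x] T
   - (if u is (false, T') :: u' then ins (fun v => c ((false, T :|: T') :: v)) u' *~ chi T T' else 0).
  case: u {IH W I} => [|[[] T'] u] /=; rewrite wopS setUC chiC //; congr (_ - _).
  by rewrite -insMz; apply: ins_ext => v _; rewrite wopS.
have -> : mrg (ins c) (false, T) u = mrg (fun v => c ((false, [set x]) :: v)) (false, T) u
   - (if u is (false, T') :: u' then ins (fun v => c ((false, T :|: T') :: v)) u' *~ chi T T' else 0).
  case: u {IH W I} => [|[[] T'] u] //=; rewrite ?subr0 // !wopS.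
  by rewrite -mulrzBl.
ring.
Qed.

Lemma ins_sg b c w : ins (fun v => sg b (c v)) w = sg b (ins c w).
Proof. by case: b => //=; rewrite insN. Qed.

Lemma kx_ext c c' w : (forall v, head true (unzip1 v) = head true (unzip1 w) -> c v = c' v) ->
  kx c w = kx c' w.
Proof.
elim: w c c' => //= -[b U] w IH c c' cc; case: ifP => _; congr (sg _ _).
  by apply: ins_ext => v _; apply: cc.
by apply: IH => v _; apply: cc.
Qed.

Lemma kxD c c' w : kx (fun v => c v + c' v) w = kx c w + kx c' w.
Proof.
elim: w c c' => [|[b U] w IH] c c' /=; first by rewrite addr0.
by case: ifP => _; rewrite -sgD ?insD ?IH.
Qed.

Lemma kx_sg b c w : kx (fun v => sg b (c v)) w = sg b (kx c w).
Proof.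
elim: w c => [|[b' U] w IH] c /=; first by rewrite sg0.
case: ifP => _; rewrite ?ins_sg ?IH; by case: b {IH}; case: b'.
Qed.

Lemma ins0 w : ins (fun=> 0) w = 0.
Proof. by elim: w => [|[[] U] w IH] /=; rewrite ?IH subr0. Qed.

Lemma kx0 w : kx (fun=> 0) w = 0.
Proof.
elim: w => //= -[b U] w IH; case: ifP => _; last by rewrite IH sg0.
by rewrite ins0 sg0.
Qed.

Lemma kxMz c k w : kx (fun v => c v *~ k) w = kx c w *~ k.
Proof.
elim: w c => [|[b U] w IH] c /=; first by rewrite mul0rz.
by case: ifP => _; rewrite ?insMz ?IH; case: b => /=; rewrite ?mulNrz.
Qed.

Definition has_x (w : word) := has (fun l : bool * {set 'I_m} => x \in l.2) w.

(** When U = {x}, removing x leaves an empty letter and the coefficients [chi] change. The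
    insertions that remain are cancelled in [kx_wd] by those that come from merging {x} with the
    letter before it. *)
Lemma kx_wd_head c b U u : x \in U -> ~~ has_x u ->
  wd (kx c) ((b, U) :: u) + kx (wd c) ((b, U) :: u) =
  if U :\ x == set0 then
    (if u is (false, T) :: u' then ins (fun v => c ((b, T) :: v)) u' else 0)
  else c ((b, U) :: u).
Proof.
move=> xU nu; set Y := U :\ x.
have -> : wd (kx c) ((b, U) :: u) = sg b (mrg (kx c) (b, U) u) + wd (ins (fun v => c ((b, Y) :: v))) u.
  rewrite [LHS]/= sgD; congr (_ + _); rewrite -wd_sg; apply: wd_ext => v.
  by rewrite xU sgK.
have -> : kx (wd c) ((b, U) :: u) =
   ins (mrg c (b, Y)) u + ins (wd (fun v => c ((b, Y) :: v))) u.
  by rewrite [LHS]/= xU ins_sg sgK insD.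
rewrite addrACA ins_wd addr0.
have UY : U = x |: Y by rewrite setD1K.
have U0 : (U == set0) = false by apply/negbTE/set0Pn; exists x.
have x0 : ([set x] == set0) = false by apply/negbTE/set0Pn; exists x; rewrite inE.
case: u nu => [|[[] T] u] nu.
- by rewrite /= sg0 add0r subr0 wopS /chi x0; case: ifP => _; rewrite ?mulr0z // UY setUC.
- by rewrite /= sg0 add0r subr0 wopS /chi x0; case: ifP => _; rewrite ?mulr0z // UY setUC.
move: nu; rewrite /has_x /= negb_or => /andP[xT nu].
have YT : (U :|: T) :\ x = Y :|: T.
  by apply/setP => y; rewrite !inE; case: eqP => // ->; rewrite (negbTE xT).
rewrite !wopS inE xU /= YT.
have -> : ins (fun v => wop mlS (fun V => c ((b, V) :: v)) Y T) u =
    ins (fun v => c ((b, Y :|: T) :: v)) u *~ chi Y T.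
  by rewrite -insMz; apply: ins_ext => v _; rewrite wopS.
set I := ins _ u; have -> : sg b (sg b I *~ chi U T) = I *~ chi U T.
  by case: (b) => //=; rewrite mulNrz opprK.
rewrite /chi x0 U0; case: (eqVneq Y set0) => [Y0|_].
  rewrite mulr0z /I Y0 set0U.
  by case: (T == set0); rewrite ?mulr0z ?mulr1z ?mulrN1z; ring.
by rewrite UY setUC mulr1z; case: (T == set0); ring.
Qed.

(** If x stands alone inside a block, the word is recovered by merging {x} with the letter before it
    and taking x out again. This route is closed when {x} opens a block, which explains the two
    exclusions; the second one serves the words met in the recursion, whose first letter may be
    false. *)
Lemma kx_wd c w : count (fun l : bool * {set 'I_m} => x \in l.2) w = 1 ->
  (true, [set x]) \notin w -> (if w is (false, U) :: _ then U != [set x] else true) ->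
  wd (kx c) w + kx (wd c) w = c w.
Proof.
elim: w c => //= -[b Z] w IH c /=; case: (boolP (x \in Z)) => xZ.
  rewrite add1n => -[/eqP]; rewrite -leqn0 leqNgt -has_count => nw tx hx.
  have := kx_wd_head c b xZ nw; rewrite /= xZ => ->.
  case: eqP => // E; have ZE : Z = [set x] by rewrite -(setD1K xZ) E setU0.
  by move: tx hx; rewrite ZE inE negb_or; case: (b); rewrite eqxx.
rewrite add0n inE negb_or => ow /andP[_ tx] _.
have -> : wd (fun v => sg b (kx (fun v0 => c ((b, Z) :: v0)) v)) w =
    sg b (wd (kx (fun v => c ((b, Z) :: v))) w) by rewrite wd_sg.
rewrite kx_sg sgK kxD sgD sgK addrACA.
case: w IH ow tx => [//|[[] T] u] IH ow tx.
  rewrite (IH (fun v => c ((b, Z) :: v))) // mrg_true // sg0 add0r -[RHS]add0r; congr (_ + _).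
  by rewrite -[RHS](kx0 ((true, T) :: u)); apply: kx_ext => v hv; rewrite mrg_true.
rewrite mrgE.
have mrgZ V v : mrg c (b, Z) ((false, V) :: v) = c ((b, Z :|: V) :: v) *~ chi Z V by exact: mrgE.
case: (eqVneq T [set x]) => [TE|Tx].
  have xT : x \in T by rewrite TE inE.
  have nu : ~~ has_x u.
    by move: ow => /= /eqP; rewrite xT add1n eqSS -leqn0 leqNgt -has_count.
  have x0 : ([set x] == set0) = false by apply/negbTE/set0Pn; exists x; rewrite inE.
  rewrite kx_wd_head // TE /= setDv eqxx !inE eqxx orbT.
  have -> : ins (fun v => wop mlS (fun V => c ((b, V) :: v)) Z set0) u
      = ins (fun v => c ((b, Z) :: v)) u *~ chi Z set0.
    by rewrite -insMz; apply: ins_ext => v _; rewrite wopS setU0.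
  have ZE : (Z :|: [set x]) :\ x = Z.
    by apply/setP => y; rewrite !inE; case: eqP => //= [->|_]; rewrite ?(negbTE xZ) ?orbF.
  rewrite ZE /chi x0 eqxx.
  set I := ins _ u; set J := (if u is _ :: _ then _ else _).
  have -> : sg b (sg b I *~ (if Z == set0 then 0 else 1)) - I *~ (if Z == set0 then -1 else 0) = I.
    by case: ifP => _; case: (b) => /=; rewrite ?mulr0z ?mulrN1z ?mulr1z ?oppr0 ?opprK ?add0r ?subr0.
  rewrite /I /J; case: (u) => [|[[] V] u'] /=; rewrite ?subr0 ?addr0 // subrK //.
have E : sg b (kx c ((b, Z :|: T) :: u) *~ chi Z T) + kx (mrg c (b, Z)) ((false, T) :: u) = 0.
  rewrite /= inE (negbTE xZ) /=; case: (boolP (x \in T)) => xT.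
    have -> : (Z :|: T) :\ x = Z :|: (T :\ x).
      by apply/setP => y; rewrite !inE; case: eqP => //= ->; rewrite (negbTE xZ).
    have -> : ins (fun v => wop mlS (fun V => c ((b, V) :: v)) Z (T :\ x)) u
        = ins (fun v => c ((b, Z :|: (T :\ x)) :: v)) u *~ chi Z (T :\ x).
      by rewrite -insMz; apply: ins_ext => v _; rewrite wopS.
    have -> : chi Z (T :\ x) = chi Z T.
      have T0 : T :\ x != set0.
        by apply: contra Tx => /eqP TE; rewrite -(setD1K xT) TE setU0.
      have T0' : T != set0 by apply/set0Pn; exists x.
      by rewrite /chi (negbTE T0) (negbTE T0').
    by case: (b) => /=; rewrite ?mulNrz ?opprK subrr.
  have -> : kx (fun v => wop mlS (fun V => c ((b, V) :: v)) Z T) u = kx (fun v => c ((b, Z :|: T) :: v)) u *~ chi Z T.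
    by rewrite -kxMz; apply: kx_ext => v _; rewrite wopS.
  by case: (b) => /=; rewrite ?mulNrz ?opprK subrr.
by rewrite E add0r (IH (fun v => c ((b, Z) :: v))).
Qed.

End Insert.

Lemma mlS_supp U T Z : Z \in unzip2 (mlS U T) -> Z = U :|: T /\ (U == set0) = (T == set0).
Proof.
rewrite /mlS; case: eqVneq => [->|U0]; case: eqVneq => [->|T0] //=; rewrite inE => /eqP ->.
  by rewrite setU0.
by [].
Qed.

Definition mult x w := count (fun l : bool * {set 'I_m} => x \in l.2) w.

Lemma step_mult x w v : step mlS w v -> (mult x w <= 1)%N -> mult x v = mult x w.
Proof.
rewrite /mult; elim=> [b U T Z u /mlS_supp[-> _]|l u t _ IH] /=.
  by rewrite inE; case: (x \in U); case: (x \in T); rewrite //= ?addn0.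
by move=> h; rewrite IH // (leq_trans _ h) // leq_addl.
Qed.

(** The words at which a cochain with values in T^m has a coefficient: each of the m tensor factors
    is attributed to exactly one letter. *)
Definition good n j w := graded n j (unzip1 w) && [forall x, mult x w == 1%N].

Lemma good_mult n j w x : good n j w -> mult x w = 1%N.
Proof. by case/andP=> _ /forallP/(_ x)/eqP. Qed.

Lemma step_good n j w v : step mlS w v -> good n j.+1 w -> good n j v.
Proof.
move=> wv gw; case/andP: (gw) => /(step_graded wv)[_ gv] _; rewrite /good gv /=.
by apply/forallP => x; rewrite (step_mult wv) (good_mult x gw).
Qed.

Definition cocycleW n j c := forall w, good n j.+1 w -> wd c w = 0.

(** The words at which [knull] evaluates its cochain, as [step] lists those of the differential;
    [insR] and [kxR] do the same for [ins] and [kx]. *)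
Inductive nullR : word -> word -> Prop :=
| nullR_here b w : nullR ((b, set0) :: w) ((b, set0) :: (false, set0) :: w)
| nullR_there l w v : nullR w v -> nullR (l :: w) (l :: v).

Lemma knull_supp c c' w : (forall v, nullR w v -> c v = c' v) -> knull c w = knull c' w.
Proof.
elim: w c c' => //= -[b U] w IH c c' cc; case: eqVneq => [UE|_].
  by congr (- sg b _); apply: cc; rewrite UE; apply: nullR_here.
by congr (sg b _); apply: IH => v wv; apply/cc/nullR_there.
Qed.

Lemma nullR_good n j w v : nullR w v -> good n j w -> good n j.+1 v.
Proof.
move=> wv; suff [hE cE nE mE] : [/\ head true (unzip1 v) = head true (unzip1 w),
   count id (unzip1 v) = count id (unzip1 w), ndeg (unzip1 v) = (ndeg (unzip1 w)).+1
   & forall x, mult x v = mult x w].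
  rewrite /good /graded hE cE nE eqSS => /andP[-> /forallP h] /=.
  by apply/forallP => x; rewrite mE.
elim: wv => [b u|l u t _ [_ cE nE mE]].
  by split=> // [|x]; rewrite /ndeg /mult /= ?addnS // !inE !add0n.
by split=> // [||x]; rewrite /ndeg /mult /= -/(ndeg _) -/(mult _ _) ?cE ?nE ?mE ?addnS.
Qed.

Section InsR.
Variable x : 'I_m.

Inductive insR : word -> word -> Prop :=
| insR_here w : insR w ((false, [set x]) :: w)
| insR_there T w v : insR w v -> insR ((false, T) :: w) ((false, T) :: v).

Inductive kxR : word -> word -> Prop :=
| kxR_here b U w v : x \in U -> insR w v -> kxR ((b, U) :: w) ((b, U :\ x) :: v)
| kxR_there b U w v : x \notin U -> kxR w v -> kxR ((b, U) :: w) ((b, U) :: v).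

Lemma ins_supp c c' w : (forall v, insR w v -> c v = c' v) -> ins x c w = ins x c' w.
Proof.
elim: w c c' => [|[[] U] w IH] c c' cc /=; rewrite cc //; try exact: insR_here.
by congr (_ - _); apply: IH => v wv; apply/cc/insR_there.
Qed.

Lemma kx_supp c c' w : (forall v, kxR w v -> c v = c' v) -> kx x c w = kx x c' w.
Proof.
elim: w c c' => //= -[b U] w IH c c' cc; case: ifP => xU; congr (sg b _).
  by apply: ins_supp => v wv; apply/cc/kxR_here.
by apply: IH => v wv; apply/cc/kxR_there => //; rewrite xU.
Qed.

Lemma insR_count w v : insR w v -> [/\ count id (unzip1 v) = count id (unzip1 w),
   ndeg (unzip1 v) = (ndeg (unzip1 w)).+1
   & forall y, mult y v = ((y == x) + mult y w)%N].
Proof.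
elim=> [u|T u t _ [cE nE mE]]; first by split=> // y; rewrite /mult /= inE.
by split=> [||y]; rewrite /ndeg /mult /= -/(ndeg _) -?/(mult _ _) ?cE ?nE ?mE // addnCA.
Qed.

Lemma kxR_good n j w v : kxR w v -> good n j w -> good n j.+1 v.
Proof.
move=> wv; suff [hE cE nE mE] : [/\ head true (unzip1 v) = head true (unzip1 w),
   count id (unzip1 v) = count id (unzip1 w), ndeg (unzip1 v) = (ndeg (unzip1 w)).+1
   & forall y, mult y v = mult y w].
  rewrite /good /graded hE cE nE eqSS => /andP[-> /forallP h] /=.
  by apply/forallP => y; rewrite mE.
elim: wv => [b U u t xU /insR_count[cE nE mE]|b U u t xU _ [_ cE nE mE]].
  split=> // [||y]; rewrite /ndeg /mult /= -?/(ndeg _) -?/(mult _ _) ?cE ?nE ?mE ?addnS //.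
  by rewrite !inE addnA; case: eqP => [->|_]; rewrite ?xU ?addn0.
by split=> // [||y]; rewrite /ndeg /mult /= -?/(ndeg _) -?/(mult _ _) ?cE ?nE ?mE ?addnS.
Qed.

End InsR.

Section Stage.
Variable r : nat.
Implicit Types p : {set 'I_m}.

(* U follows p in a word whose elements less than r already stand alone, in    *)
(* increasing order in each block.                                            *)
Definition placed p b U (x : 'I_m) :=
  (U == [set x]) && (b || [exists y : 'I_m, (y < x)%N && (p == [set y])]).

Definition okl p b U := (U != set0) && [forall x in U, (x < r)%N ==> placed p b U x].

Fixpoint Qr p w := if w is (b, U) :: w' then okl p b U && Qr U w' else true.

Definition unfrozen p := forall y : 'I_m, (y < r)%N -> p != [set y].

(** Behind an unfrozen letter an element below r can only be placed by opening a block, and then the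
    letter in front is irrelevant. *)
Lemma okl_change p p' b U : unfrozen p -> okl p b U -> okl p' b U.
Proof.
move=> up /andP[U0 /forall_inP h]; rewrite /okl U0; apply/forall_inP => x xU.
apply/implyP => xr; have /implyP/(_ xr)/andP[Ux] := h x xU; rewrite /placed Ux /=.
case/orP => [->//|/existsP[y /andP[yx /eqP py]]].
by have := up y (ltn_trans yx xr); rewrite py eqxx.
Qed.

Lemma Qr_change p p' w : unfrozen p -> Qr p w -> Qr p' w.
Proof. by case: w => //= -[b U] w up /andP[/(okl_change p' up) -> ->]. Qed.

Lemma okl_sub p b U x : okl p b U -> x \in U -> (x < r)%N -> U = [set x].
Proof. by move=> /andP[_ /forall_inP h] xU xr; have /implyP/(_ xr)/andP[/eqP] := h x xU. Qed.

(** In v the merged letter has no element below r: such an element would be alone in the union,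
    hence lie in both U and T, against its multiplicity. Read backwards, the words that violate [Qr]
    are closed under the differential. *)
Lemma step_Qr p w v : step mlS w v -> (forall x, mult x w <= 1)%N -> Qr p v -> Qr p w.
Proof.
move=> wv; elim: wv p => [b U T Z u /mlS_supp[-> UT0]|[b U] u t _ IH] p mw /=; last first.
  case/andP=> -> /IH; apply=> x; apply: leq_trans (mw x).
  by rewrite /mult /= leq_addl.
case/andP=> oU Qu.
have UT0' : U :|: T != set0 by case/andP: oU.
have U0 : U != set0 by apply: contra UT0' => U0; rewrite setU_eq0 U0 -UT0.
have T0 : T != set0 by rewrite -UT0.
have nfz x : x \in U :|: T -> (x < r)%N = false.
  move=> xUT; apply/negP => xr; have UTx := okl_sub oU xUT xr.
  have sub (V : {set 'I_m}) : V \subset U :|: T -> V != set0 -> x \in V.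
    by rewrite UTx subset1 => /orP[/eqP->|/eqP ->]; rewrite ?inE ?eqxx.
  have := mw x; rewrite /mult /= (sub U) ?subsetUl // (sub T) ?subsetUr //.
have ok q b' (V : {set 'I_m}) : V \subset U :|: T -> V != set0 -> okl q b' V.
  move=> /subsetP sV V0; rewrite /okl V0; apply/forall_inP => x /sV /nfz ->.
  by [].
rewrite !ok ?subsetUl ?subsetUr //=; apply: Qr_change Qu => y yr.
apply/eqP => E; have := nfz y; rewrite E inE eqxx yr => /(_ isT).
by [].
Qed.

End Stage.

Section StageStep.
Variables (r : nat) (x : 'I_m).
Hypothesis xr : x = r :> nat.
Implicit Types p : {set 'I_m}.

(** Inside a block, a letter that follows an unfrozen letter is unfrozen, and so is {x} as x = r.
    Hence no placement relies on the inserted {x}, and it can be removed again. *)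
Lemma insR_Qr p p' w v : insR x w v -> unfrozen r p -> Qr r p v -> Qr r p' w.
Proof.
have nx : unfrozen r [set x].
  move=> y yr; apply: contraTneq yr => E.
  have : y \in [set x] by rewrite E inE.
  by rewrite inE => /eqP ->; rewrite xr ltnn.
move=> wv; elim: wv p p' => [u|T u t _ IH] p p' up /= /andP[ok Q].
  exact: Qr_change nx Q.
rewrite (okl_change p' up ok) /=; apply: IH Q => y yr; apply/eqP => E.
have yT : y \in T by rewrite E inE.
have /andP[_ /forall_inP/(_ y yT)/implyP/(_ yr)/andP[_ /= /existsP[z /andP[zy /eqP pz]]]] := ok.
by have := up z (ltn_trans zy yr); rewrite pz eqxx.
Qed.

(** Excludes the letters {y, x} with y treated earlier: taking x out of them would produce a
    singleton {y} and could turn a word that violates [Qr] into one that satisfies it. *)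
Definition clear_of w := forall l, l \in w -> forall y : 'I_m, (y < r)%N -> x \in l.2 -> l.2 :\ x != [set y].

Lemma kxR_Qr p w v : kxR x w v -> clear_of w -> Qr r p v -> Qr r p w.
Proof.
move=> wv; elim: wv p => [b U u t xU ut|b U u t xU _ IH] p cl /= /andP[ok Q]; last first.
  by rewrite ok; apply: IH Q => l lu; apply: cl; rewrite inE lu orbT.
have nf y : y \in U -> (y < r)%N = false.
  move=> yU; apply/negP => yr; have yx : y \in U :\ x.
    by rewrite !inE yU andbT; apply: contraTneq yr => ->; rewrite xr ltnn.
  by have := cl (b, U) (mem_head _ _) y yr xU; rewrite (okl_sub ok yx yr) eqxx.
apply/andP; split.
  apply/andP; split; first by apply/set0Pn; exists x.
  by apply/forall_inP => y /nf ->.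
apply: insR_Qr ut _ Q => y yr; apply/eqP => E.
have : y \in U :\ x by rewrite E inE.
by rewrite inE => /andP[_ /nf]; rewrite yr.
Qed.

Fixpoint pl p w := if w is (b, U) :: w' then ((x \in U) ==> placed p b U x) && pl U w' else true.

Lemma Qr_succ p w : Qr r.+1 p w = Qr r p w && pl p w.
Proof.
elim: w p => //= -[b U] w IH p /=; rewrite IH.
suff -> : okl r.+1 p b U = okl r p b U && ((x \in U) ==> placed p b U x).
  by rewrite andbACA.
rewrite /okl -andbA; congr (_ && _); apply/forall_inP/andP => [h|[/forall_inP h hx] y yU].
  split; first by apply/forall_inP => y /h/implyP hy; apply/implyP => yr; apply/hy/ltnW.
  by apply/implyP => xU; have /implyP := h x xU; apply; rewrite xr.
apply/implyP; rewrite ltnS leq_eqVlt => /orP[/eqP yr|yr]; last by have /implyP := h y yU; apply.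
have yx : y = x by apply: val_inj; rewrite /= yr xr.
by move: hx yU; rewrite yx => /implyP.
Qed.

Lemma pl_none p w : mult x w = 0%N -> pl p w.
Proof.
elim: w p => //= -[b U] w IH p; rewrite /mult /=.
by case: (x \in U) => //=; rewrite add0n => /IH.
Qed.

Lemma Qr_clear p w : Qr r p w -> clear_of w.
Proof.
elim: w p => //= -[b U] w IH p /andP[ok /IH cl] l; rewrite inE => /orP[/eqP ->|/cl //] y yr /= xU.
apply/eqP => E; have : y \in U :\ x by rewrite E inE.
rewrite !inE => /andP[yx yU]; have UE := okl_sub ok yU yr.
by move: xU; rewrite UE inE eq_sym (negbTE yx).
Qed.

(** A letter {y, x} could arise from {y} followed by {x}, but then x would already be placed because
    y < x; or from {x} followed by {y}, but y is placed, so the letter before it is a singleton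
    smaller than y. *)
Lemma step_clear p w v : step mlS w v -> (forall y, mult y w <= 1)%N ->
  Qr r p w -> ~~ pl p w -> clear_of v.
Proof.
move=> wv; elim: wv p => [b U T Z u /mlS_supp[-> UT0]|[b U] u t ut IH] p mw; last first.
  move=> /andP[ok Q] npl l; rewrite inE => /orP[/eqP ->|].
    by apply: (@Qr_clear p [:: (b, U)]); rewrite /= ?ok ?mem_head.
  have mu y : (mult y u <= 1)%N by apply: leq_trans (mw y); rewrite /mult /= leq_addl.
  case: (boolP (x \in U)) => xU; last first.
    by move: l; apply: (IH U) => //; move: npl; rewrite /= (negbTE xU).
  move=> lt y yr xl; have : (0 < mult x t)%N by rewrite -has_count; apply/hasP; exists l.
  rewrite (step_mult ut (mu x)); have := mw x; rewrite /mult /= xU.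
  by rewrite add1n ltnS leqn0 => /eqP ->.
move=> Q npl l; rewrite inE => /orP[/eqP ->|lu]; last first.
  by apply: (Qr_clear Q); rewrite !inE lu !orbT.
move=> y yr /= xUT; apply/eqP => E.
move: Q => /= /and3P[okU okT _].
have yx : y != x by apply: contraTneq yr => ->; rewrite xr ltnn.
have yUT : y \in U :|: T.
  have : y \in (U :|: T) :\ x by rewrite E inE.
  by rewrite in_setD1 => /andP[].
have UT2 z : z \in U :|: T -> z = x \/ z = y.
  move=> zUT; case: (eqVneq z x) => [->|zx]; [by left|right].
  have : z \in (U :|: T) :\ x by rewrite in_setD1 zx.
  by rewrite E inE => /eqP.
have disj z : z \in U -> z \in T -> False.
  by move=> zU zT; have := mw z; rewrite /mult /= zU zT.
case/setUP: yUT => [yU|yT].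
  have UE := okl_sub okU yU yr.
  have xT : x \in T.
    by case/setUP: xUT => //; rewrite UE inE eq_sym (negbTE yx).
  have TE : T = [set x].
    apply/setP => z; rewrite inE; apply/idP/eqP => [zT|->//].
    have zUT : z \in U :|: T by rewrite inE zT orbT.
    case: (UT2 z zUT) => // zy.
    by case: (disj y) => //; rewrite -zy.
  have xu : mult x u = 0%N.
    by apply/eqP; have := mw x; rewrite /mult /= xT UE inE eq_sym (negbTE yx) add0n add1n ltnS leqn0.
  case/negP: npl; rewrite /= pl_none // andbT UE inE eq_sym (negbTE yx) /=.
  apply/implyP => _; rewrite /placed TE eqxx /=; apply/existsP; exists y.
  by rewrite xr yr eqxx.
have TE := okl_sub okT yT yr.
have xU : x \in U by case/setUP: xUT => //; rewrite TE inE eq_sym (negbTE yx).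
move: okT => /andP[_ /forall_inP/(_ y yT)/implyP/(_ yr)/andP[_ /= /existsP[z /andP[zy /eqP UE]]]].
by move: xU; rewrite UE inE => /eqP xz; move: zy; rewrite -xz xr ltnNge ltnW.
Qed.

Lemma not_placed_true p w : mult x w = 1%N -> ~~ pl p w -> (true, [set x]) \notin w.
Proof.
elim: w p => //= -[b U] w IH p; rewrite /mult /= -/(mult _ _) negb_and inE negb_or.
case: (boolP (x \in U)) => xU /=.
  rewrite add1n => -[mw] h; have pw := pl_none U mw; move: h; rewrite pw orbF => npl.
  apply/andP; split.
    by apply: contra npl => /eqP[<- <-]; rewrite /placed eqxx.
  apply/negP => tw; have : (0 < mult x w)%N.
    by rewrite -has_count; apply/hasP; exists (true, [set x]); rewrite //= inE.
  by rewrite mw.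
rewrite add0n => mw npl; apply/andP; split; last exact: IH npl.
by apply: contra xU => /eqP[_ <-]; rewrite inE.
Qed.

Lemma stage n j c : cocycleW n j c ->
  (forall w, good n j w -> ~~ Qr r set0 w -> c w = 0) ->
  exists c', forall w, good n j w -> ~~ Qr r.+1 set0 w -> c w = wd c' w.
Proof.
move=> c0 cQ; pose c' w := if Qr r set0 w then kx x c w else 0.
(* [kx x c] is cut off outside [Qr r] so that its coboundary stays zero where c already vanishes. On
   a word of [Qr r] where x is not placed the cutoff is harmless: at the words of its differential
   that violate [Qr r], [kx x c] only evaluates c where c is zero. *)
exists c' => w gw; rewrite Qr_succ negb_and.
have m1 y : (mult y w <= 1)%N by rewrite (good_mult y gw).
case: (boolP (Qr r set0 w)) => [Qw /= npl|nQ _]; last first.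
  rewrite cQ // -[LHS](wd0 mlS _ w); apply: wd_step_ext => v wv; rewrite /c'.
  by case: ifP => // Qv; move: nQ; rewrite (step_Qr wv m1 Qv).
have -> : wd c' w = wd (kx x c) w.
  apply: wd_step_ext => v wv; rewrite /c'; case: ifP => // nQv.
  rewrite -[LHS](kx0 x v); apply: kx_supp => u vu; apply/esym.
  case: j c0 cQ gw => [|j] c0 cQ gw.
    by case/andP: gw => /(step_graded wv)[].
  rewrite cQ //; first by apply: kxR_good vu _; apply: step_good wv gw.
  by apply: contraFN nQv; apply: kxR_Qr vu (step_clear wv m1 Qw npl).
have kz : kx x (wd c) w = 0.
  rewrite -[RHS](kx0 x w); apply: kx_supp => u wu; apply: c0.
  exact: kxR_good wu gw.
rewrite -[RHS]addr0 -kz kx_wd //.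
- exact: (good_mult x gw).
- exact: not_placed_true (good_mult x gw) npl.
by case/andP: gw => /and3P[]; case: (w) => [|[[] ?] ?].
Qed.

End StageStep.

Lemma stage0 n j c : cocycleW n j c ->
  exists c', forall w, good n j w -> ~~ Qr 0 set0 w -> c w = wd c' w.
Proof.
move=> c0; exists (knull c) => w gw nQ.
have kz : knull (wd c) w = 0.
  by rewrite -[RHS](knull0 w); apply: knull_supp => u wu; apply: c0; apply: nullR_good wu gw.
rewrite -[RHS]addr0 -kz knull_wd //; apply: contraR nQ.
have suf p : ~~ has (fun l : bool * {set 'I_m} => l.2 == set0) w -> Qr 0 p w; last exact: suf.
elim: w p {gw kz} => //= -[b U] w IH p; rewrite negb_or => /andP[/= U0 /IH ->].
by rewrite /okl U0 andbT; apply/forall_inP.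
Qed.

Theorem cocycleW_std n j c : cocycleW n j c ->
  exists c', forall w, good n j w -> ~~ Qr m set0 w -> c w = wd c' w.
Proof.
move=> c0; suff : forall r, (r <= m)%N ->
    exists c', forall w, good n j w -> ~~ Qr r set0 w -> c w = wd c' w by apply.
elim=> [|r IH] rm; first exact: stage0.
have [c1 c1E] := IH (ltnW rm).
have [|w gw nQ|c2 c2E] := @stage r (Ordinal rm) erefl n j (fun v => c v - wd c1 v).
- by move=> w gw; rewrite wdB c0 // wdd ?subr0 //; apply: mlSA.
- by rewrite c1E ?subrr.
exists (fun v => c1 v + c2 v) => w gw nQ.
by rewrite wdD -c2E // addrC subrK.
Qed.

End SetWords.

(** * Coefficients of cochains *)

Section MultiFun.
Variables (m : nat) (A : zmodType) (F : 'I_m -> {additive A -> int}).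

Lemma mfun_subproof i (x y z : {ffun 'I_m -> A}) : z i = x i + y i ->
  (forall j, j != i -> x j = z j /\ y j = z j) ->
  \prod_(j < m) F j (z j) = \prod_(j < m) F j (x j) + \prod_(j < m) F j (y j) :> int.
Proof.
move=> zi xyz; rewrite !(bigD1 i (P := xpredT)) //= zi raddfD mulrDl.
by congr (_ * _ + _ * _); apply: eq_bigr => j /xyz[xz yz]; rewrite ?xz ?yz.
Qed.

Definition mfun : {additive tpow m A -> int} := tpow_lift mfun_subproof.

Lemma mfunE x : mfun (tpure x) = \prod_(j < m) F j (x j).
Proof. exact: tpow_liftE. Qed.

End MultiFun.

Lemma mfun_scale m (A : zmodType) (F G : 'I_m -> {additive A -> int}) (k : 'I_m -> int) z :
  (forall i a, F i a = k i * G i a) -> mfun F z = (\prod_i k i) * mfun G z.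
Proof.
move=> FG; rewrite mulrC -mulrzz.
elim/pres_ind: z => [|a b IHa IHb|x]; first by rewrite !raddf0 mul0rz.
  by rewrite !raddfB IHa IHb mulrzBl.
rewrite -[pgen _ x]/(tpure x) !mfunE mulrzz mulrC -big_split.
by apply: eq_bigr => i _; apply: FG.
Qed.

Lemma mfun_map m (A B : zmodType) (F : 'I_m -> {additive B -> int}) (g : {additive A -> B}) z :
  mfun F (tpow_map m g z) = mfun (fun i => F i \o g : {additive A -> int}) z.
Proof.
elim/pres_ind: z => [|a b IHa IHb|x]; first by rewrite !raddf0.
  by rewrite !raddfB IHa IHb.
rewrite -[pgen _ x]/(tpure x) tpow_mapE !mfunE; apply: eq_bigr => i _.
by rewrite ffunE.
Qed.

Definition cf N (q : nat) : {additive abF N -> int} := abev N (fun i => (i == q)%:R).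

Lemma cf_gen N q p : (p < N)%N -> cf N q (ab_pi (gen N p)) = (p == q)%:R.
Proof. by move=> pN; rewrite [LHS]abevE gsum_gen. Qed.

Definition coef m N (h : 'I_m -> nat) : {additive Ta m N -> int} := mfun (fun x => cf N (h x)).

Definition tgen m N (h : 'I_m -> nat) : Ta m N := tpure [ffun x => ab_pi (gen N (h x)) : abF N].

Lemma coef_tgen m N (h h' : 'I_m -> nat) : (forall x, (h' x < N)%N) ->
  coef N h (tgen N h') = [forall x, h' x == h x]%:R.
Proof.
move=> h'N; rewrite [LHS]mfunE; case: forallP => [E|E].
  by rewrite big1 // => x _; rewrite ffunE cf_gen // E.
have [x xE] : exists x, h' x != h x.
  by apply/existsP; rewrite -negb_forall; apply/negP => /forallP.
by rewrite (bigD1 x) //= ffunE cf_gen // (negbTE xE) mul0r.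
Qed.

Lemma coef_ext m N (h h' : 'I_m -> nat) z : h =1 h' -> coef N h z = coef N h' z.
Proof.
move=> hh; apply: (@tpow_ext _ _ _ (coef N h) (coef N h')) => x.
by rewrite !mfunE; apply: eq_bigr => i _; rewrite hh.
Qed.

Section TpureUpd.
Variables (n : nat) (A : zmodType) (i0 : 'I_n) (y : {ffun 'I_n -> A}).

Definition tupd (a : A) : tpow n A := tpure [ffun i => if i == i0 then a else y i].

Lemma tupdD a b : tupd (a + b) = tupd a + tupd b.
Proof.
apply: (tpureD (i := i0)); first by rewrite !ffunE eqxx.
by move=> j /negbTE ji; rewrite !ffunE ji.
Qed.

Lemma tupd0 : tupd 0 = 0.
Proof. by apply: (addrI (tupd 0)); rewrite -tupdD !addr0. Qed.

Lemma tupdB a b : tupd (a - b) = tupd a - tupd b.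
Proof. by apply/eqP; rewrite eq_sym subr_eq -tupdD subrK. Qed.

Lemma tupd_id : tupd (y i0) = tpure y.
Proof. by congr tpure; apply/ffunP => i; rewrite ffunE; case: eqP => [->|]. Qed.

End TpureUpd.

Lemma tgen_expand m N (z : Ta m N) :
  z = \sum_(h : {ffun 'I_m -> 'I_N}) tgen N (fun x => h x) *~ coef N (fun x => h x) z.
Proof.
pose P z := z = \sum_(h : {ffun 'I_m -> 'I_N}) tgen N (fun x => h x) *~ coef N (fun x => h x) z.
have P0 : P 0 by rewrite /P big1 // => h _; rewrite raddf0.
have PB a b : P a -> P b -> P (a - b).
  move=> Pa Pb; rewrite /P {1}Pa {1}Pb -sumrB; apply: eq_bigr => h _.
  by rewrite raddfB mulrzBr.
elim/pres_ind: z => // x; rewrite -/(P _) -[pgen _ x]/(tpure x).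
(* Induction on the number r of initial factors not yet known to be generators; each stage expands
   one factor linearly. *)
suff H (r : nat) (y : {ffun 'I_m -> abF N}) :
    (forall i : 'I_m, (r <= i)%N -> exists q : 'I_N, y i = ab_pi (gen N q)) -> P (tpure y).
  by apply: (H m) => i; rewrite leqNgt ltn_ord.
elim: r y => [|r IH] y yg.
  have [h hE] : {h : {ffun 'I_m -> 'I_N} & y = [ffun i => ab_pi (gen N (h i))]}.
    have s i : {q : 'I_N | y i = ab_pi (gen N q)} by apply/cid/yg.
    by exists [ffun i => sval (s i)]; apply/ffunP => i; rewrite !ffunE -(svalP (s i)).
  have -> : tpure y = tgen N (fun x => h x) by rewrite hE.
  rewrite /P (bigD1 h) // coef_tgen //.
  have -> : [forall x, h x == h x :> nat] by apply/forallP.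
  rewrite mulr1z big1 => [|h' hh']; first by rewrite [RHS]addr0.
  rewrite coef_tgen //.
  have -> : [forall x, h x == h' x :> nat] = false; last by rewrite mulr0z.
  apply: contraNF hh' => /forallP E.
  by apply/eqP/ffunP => i; apply/val_inj/esym/eqP/E.
case: (ltnP r m) => rm; last first.
  by apply: IH => i ri; move: (leq_trans rm ri); rewrite leqNgt ltn_ord.
pose i0 := Ordinal rm.
suff H a : P (tupd i0 y a) by rewrite -(tupd_id i0); apply: H.
elim/ab_gen_ind: a => [|a b Pa Pb|q]; first by rewrite tupd0.
  by rewrite tupdB; apply: PB.
apply: IH => i ri; rewrite ffunE; case: eqP => [_|/eqP ii0]; first by exists q.
by apply: yg; rewrite ltn_neqAle ri andbT eq_sym; apply: contra ii0 => /eqP e; apply/eqP/val_inj.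
Qed.

Section Coefficients.
Variable m : nat.
Local Notation word := (seq (bool * {set 'I_m})).

Definition pos (w : word) (x : 'I_m) : nat := find (fun l : bool * {set 'I_m} => x \in l.2) w.

Variables (n j : nat).

(** Naturality determines a cochain from universal words. There it is given by coefficients on basis
    tensors, and such a tensor is a distribution of the m factors among the letters, that is, a word
    of subsets. *)
Definition cof (phi : nattrans (barc n j) (Ta m)) (w : word) : int :=
  coef (size (unzip1 w)) (pos w) (hnat phi (uword (unzip1 w))).

Definition merge_pos (t q : nat) : nat := if (q <= t)%N then q else q.-1.

Lemma pos_merge (A : word) b U b' T C x :
  pos (A ++ (b, U :|: T) :: C) x = merge_pos (size A) (pos (A ++ (b, U) :: (b', T) :: C) x).
Proof.
rewrite /pos /merge_pos !find_cat /=; case: ifP => [h|_].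
  by rewrite leq_eqVlt -has_find h orbT.
rewrite inE; case: (x \in U) => /=; first by rewrite addn0 leqnn.
case: (x \in T) => /=; first by rewrite addn1 ltnn addn0.
by case: ifP; lia.
Qed.

Lemma lett_merge k (A C : wrd k) l1 l2 l p :
  lett (A ++ l :: C) p = if (p < size A)%N then lett (A ++ l1 :: l2 :: C) p
                         else if p == size A then l.2 else lett (A ++ l1 :: l2 :: C) p.+1.
Proof.
rewrite /lett !nth_cat; case: (ltngtP p (size A)) => // [Ap|->]; last by rewrite subnn.
rewrite ifN; last by rewrite -leqNgt leqW // ltnW.
by rewrite subSn 1?ltnW // -(subnSK Ap).
Qed.

Section MergeCoef.
Variables (o : seq bool) (A C : wrd (size o)) (b b' : bool).
Local Notation N := (size o).
Local Notation t := (size A).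
Hypothesis uE : uword o = A ++ (b, gen N t) :: (b', gen N t.+1) :: C.

Lemma lett_uword i : (i < N)%N -> lett (uword o) i = gen N i.
Proof. by move=> iN; rewrite /lett nth_mkseq. Qed.

Lemma size_merge : N = (size A + size C).+2.
Proof. by rewrite -[LHS](size_mkseq (fun i => (nth true o i, gen N i))) -/(uword o) uE size_cat /= !addnS. Qed.

(** The weight [kk] records which of the positions t and t + 1 contribute to g: it is constantly 1
    for the product of the two generators, and for a single generator it vanishes at the position of
    the other. *)
Lemma cf_merge (g : freegrp N) (kk : nat -> int) q (a : abF (size (unzip1 (A ++ (b, g) :: C)))) :
  (forall r, cf N r (ab_pi g) = kk r * (merge_pos t r == t)%:R) ->
  (forall r, merge_pos t r != t -> kk r = 1) ->
  (q < N)%N ->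
  cf N q (fmap abF (whom (size (unzip1 (A ++ (b, g) :: C))) (A ++ (b, g) :: C)) a)
  = kk q * cf _ (merge_pos t q) a.
Proof.
move=> gE kE qN; rewrite mulrC -mulrzz.
have := size_merge; set v := A ++ (b, g) :: C; move=> sN.
have vN : size (unzip1 v) = (size A + size C).+1.
  by rewrite size_map size_cat /= addnS.
elim/ab_gen_ind: a => [|a a' IHa IHa'|p]; first by rewrite !raddf0 mul0rz.
  by rewrite !raddfB IHa IHa' mulrzBl.
rewrite -[fmap abF _ _]/(ab_map _ _) ab_mapE /whom frhom_gen // mulrzz mulrC.
rewrite [in RHS]cf_gen //.
have pv : (p < (size A + size C).+1)%N by rewrite -vN.
rewrite (lett_merge _ _ (b, gen N t) (b', gen N t.+1)) -uE /=.
case: ltngtP => [pt|pt|->]; last by rewrite gE eq_sym.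
  rewrite lett_uword ?cf_gen; try lia.
  rewrite eq_sym; case: (eqVneq q p) => [->|qp].
    by rewrite kE /merge_pos ?mul1r; case: leqP; lia.
  by rewrite (_ : (p == _ :> nat) = false) ?mulr0 // /merge_pos; case: leqP => ?; apply/eqP; lia.
rewrite lett_uword ?cf_gen; try lia.
case: (eqVneq p.+1 q) => [<-|qp].
  by rewrite kE /merge_pos leqNgt ltnS (ltnW pt) /= ?eqxx ?mul1r //; lia.
by rewrite (_ : (p == _ :> nat) = false) ?mulr0 // /merge_pos; case: leqP => ?; apply/eqP; lia.
Qed.

Lemma coef_merge m' (g : freegrp N) (kk : nat -> int) (h : 'I_m' -> nat)
    (z : Ta m' (size (unzip1 (A ++ (b, g) :: C)))) :
  (forall r, cf N r (ab_pi g) = kk r * (merge_pos t r == t)%:R) ->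
  (forall r, merge_pos t r != t -> kk r = 1) ->
  (forall x, (h x < N)%N) ->
  coef N h (fmap (Ta m') (whom (size (unzip1 (A ++ (b, g) :: C))) (A ++ (b, g) :: C)) z)
  = (\prod_x kk (h x)) * coef _ (fun x => merge_pos t (h x)) z.
Proof.
move=> gE kE hN; rewrite -[fmap _ _ _]/(tpow_map _ _ _) [LHS]mfun_map.
by apply: mfun_scale => i a; apply: cf_merge.
Qed.

End MergeCoef.

Lemma pos_nth w x i l0 : mult x w = 1%N -> (i < size w)%N -> (pos w x == i) = (x \in (nth l0 w i).2).
Proof.
rewrite /mult /pos; elim: w i => //= l w IH [|i]; case: (x \in l.2) => //=.
  rewrite add1n => -[/eqP]; rewrite -leqn0 leqNgt -has_count => nw iw.
  by apply/esym/negP => xi; case/hasP: nw; exists (nth l0 w i); rewrite ?mem_nth.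
by rewrite add0n eqSS => mw; apply: IH.
Qed.

Lemma pos_lt w x : mult x w = 1%N -> (pos w x < size w)%N.
Proof. by rewrite /mult /pos -has_find has_count => ->. Qed.

Lemma cof_merge (phi : nattrans (barc n j) (Ta m)) (A C : word) b U T (A' C' : wrd (size (unzip1 (A ++ (b, U) :: (false, T) :: C)))) :
  let o := unzip1 (A ++ (b, U) :: (false, T) :: C) in
  let t := size A in
  (forall x, mult x (A ++ (b, U) :: (false, T) :: C) = 1%N) ->
  uword o = A' ++ (b, gen (size o) t) :: (false, gen (size o) t.+1) :: C' ->
  size A' = size A -> unzip1 A' = unzip1 A -> unzip1 C' = unzip1 C ->
  wop (@mlG _) (fun z => coef (size o) (pos (A ++ (b, U) :: (false, T) :: C)) (hnat phi (A' ++ (b, z) :: C')))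
    (gen (size o) t) (gen (size o) t.+1) =
  wop (@mlS m) (fun V => cof phi (A ++ (b, V) :: C)) U T.
Proof.
move=> o t mw uE sA fA fC; set w := A ++ _ in o mw uE *.
have wE : w = A ++ (b, U) :: (false, T) :: C by [].
have tw : (t.+1 < size w)%N by rewrite wE size_cat /= /t; lia.
have ow : size o = size w by rewrite size_map.
set h := pos w.
have hw x : (h x < size o)%N by rewrite ow; apply: pos_lt.
have E g kk : 
  (forall r, cf (size o) r (ab_pi g) = kk r * (merge_pos t r == t)%:R) ->
  (forall r, merge_pos t r != t -> kk r = 1) ->
  coef (size o) h (hnat phi (A' ++ (b, g) :: C')) = (\prod_x kk (h x)) * cof phi (A ++ (b, U :|: T) :: C).
  move=> gE kE; rewrite hnat_uword.
  have uE' : uword o = A' ++ (b, gen (size o) (size A')) :: (false, gen (size o) (size A').+1) :: C'.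
    by rewrite sA.
  rewrite (@coef_merge o A' C' b false uE' m g kk h) ?sA //.
  congr (_ * _); have -> : unzip1 (A' ++ (b, g) :: C') = unzip1 (A ++ (b, U :|: T) :: C).
    by rewrite /unzip1 map_cat [RHS]map_cat /= [map _ A']fA [map _ C']fC.
  by apply: coef_ext => x; rewrite (pos_merge _ _ _ false).
have tN : (t.+1 < size o)%N by rewrite ow.
have tN' : (t < size o)%N by apply: ltnW.
have mt r : ((merge_pos t r == t) = (t == r) || (t.+1 == r))%N.
  by rewrite /merge_pos; case: leqP => ?; lia.
have g1 r : cf (size o) r (ab_pi (gen (size o) t * gen (size o) t.+1)%g) = 1 * (merge_pos t r == t)%:R.
  by rewrite ab_piM raddfD !cf_gen // mt mul1r; case: (eqVneq t r) => [<-|_] /=; rewrite ?add0r // (gtn_eqF (leqnn _)) addr0.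
have g2 r : cf (size o) r (ab_pi (gen (size o) t)) = (r != t.+1)%:R * (merge_pos t r == t)%:R.
  rewrite cf_gen // mt [t.+1 == r]eq_sym; case: (eqVneq r t.+1) => [->|_]; last by rewrite mul1r orbF.
  by rewrite mul0r (ltn_eqF (leqnn _)).
have g3 r : cf (size o) r (ab_pi (gen (size o) t.+1)) = (r != t)%:R * (merge_pos t r == t)%:R.
  rewrite cf_gen // mt [t == r]eq_sym; case: (eqVneq r t) => [->|_]; last by rewrite mul1r.
  by rewrite mul0r (gtn_eqF (leqnn _)).
have k2 r : merge_pos t r != t -> (r != t.+1)%:R = 1 :> int.
  by rewrite mt; case: (eqVneq r t.+1) => [->|//]; rewrite orbT.
have k3 r : merge_pos t r != t -> (r != t)%:R = 1 :> int.
  by rewrite mt; case: (eqVneq r t) => [->|//].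
rewrite wopG (E _ (fun=> 1) g1) // (E _ _ g2 k2) (E _ _ g3 k3).
have hT x : (h x == t.+1) = (x \in T).
  by rewrite (pos_nth (false, set0 : {set 'I_m}) (mw x)) // wE nth_cat ltnNge leqnSn /= subSn // subnn.
have hU x : (h x == t) = (x \in U).
  by rewrite (pos_nth (false, set0 : {set 'I_m}) (mw x)) ?(ltnW tw) // wE nth_cat ltnn subnn.
(* A product of weights over all factors tests whether a set is empty, so the three terms of the
   merge combine to 1 - [T empty] - [U empty], which is [chi U T]. *)
have pr (V : {set 'I_m}) : \prod_x ((x \notin V)%:R : int) = (V == set0)%:R.
  case: (set_0Vmem V) => [->|[x xV]]; first by rewrite eqxx big1 // => x _; rewrite inE.
  rewrite (bigD1 x) //= xV mul0r; case: eqP => // V0; by rewrite V0 inE in xV.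
have -> : \prod_x ((h x != t.+1)%:R : int) = (T == set0)%:R.
  by rewrite -pr; apply: eq_bigr => x _; rewrite hT.
have -> : \prod_x ((h x != t)%:R : int) = (U == set0)%:R.
  by rewrite -pr; apply: eq_bigr => x _; rewrite hU.
rewrite wopS big1 // mulrzz /chi.
by case: (U == set0); case: (T == set0); rewrite /=; ring.
Qed.

(** The two differentials agree merge position by merge position, with the same sign; [wdt] isolates
    one position for this comparison. *)
Lemma cof_diff (phi : nattrans (barc n j) (Ta m)) w : good n j.+1 w ->
  coef (size (unzip1 w)) (pos w) (hnat (nt_comp phi (bdiff n j)) (uword (unzip1 w)))
  = wd (@mlS m) (cof phi) w.
Proof.
move=> gw; have gf : graded n j.+1 (unzip1 w) by case/andP: gw.
rewrite hnat_diff ?uword_flags // wd_mor !wdtE.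
have -> : size (uword (unzip1 w)) = size w by rewrite size_mkseq size_map.
apply: eq_bigr => -[t tw] _ /=.
pose l0 := (false, set0 : {set 'I_m}).
set o := unzip1 w; have ow : size o = size w by rewrite size_map.
have sz i : (i < size w)%N -> uword o = take i (uword o) ++ (nth true o i, gen (size o) i) :: drop i.+1 (uword o).
  move=> iw; rewrite -{1}(cat_take_drop i (uword o)) (drop_nth (true, 1%g)) ?size_mkseq ?ow //.
  by rewrite [nth _ (uword o) i]nth_mkseq ?ow.
have wE : w = take t w ++ nth l0 w t :: drop t.+1 w.
  by rewrite -drop_nth // cat_take_drop.
case: (ltnP t.+1 (size w)) => t1w; last first.
  have dn (T : Type) (s : seq T) : size s = size w -> drop t.+1 s = [::].
    by move=> sw; rewrite drop_oversize // sw.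
  have lastE (X : eqType) ml (c : seq (bool * X) -> int) v l : size v = t -> wdt ml t c (v ++ [:: l]) = 0.
    by move=> <-; apply: wdt_last.
  rewrite (sz t tw) wE !dn ?size_mkseq ?ow // !lastE //.
    by rewrite size_takel // ltnW.
  by rewrite size_takel // size_mkseq ow ltnW.
have wE2 : w = take t w ++ nth l0 w t :: nth l0 w t.+1 :: drop t.+2 w.
  by rewrite -!drop_nth // cat_take_drop.
have := sz t.+1 t1w; have szt := sz t tw.
rewrite {1}szt => szE; have uE : uword o = take t (uword o) ++ (nth true o t, gen (size o) t)
    :: (nth true o t.+1, gen (size o) t.+1) :: drop t.+2 (uword o).
  rewrite {1}szt; congr (_ ++ _ :: _).
  rewrite -{1}(cat_take_drop 1 (drop t.+1 (uword o))) drop_drop add1n.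
  rewrite (drop_nth (true, 1%g)) ?size_mkseq ?ow //= take0 /=; congr (_ :: _).
  by rewrite [nth _ (uword o) _]nth_mkseq ?ow.
have On i : (i < size w)%N -> nth true o i = (nth l0 w i).1 by move=> iw; rewrite (nth_map l0).
move: uE; rewrite !On // => uE.
have sA : size (take t (uword o)) = size (take t w) by rewrite !size_take size_mkseq ow.
have fA : unzip1 (take t (uword o)) = unzip1 (take t w).
  by rewrite /unzip1 !map_take -/(unzip1 _) uword_flags.
have fC : unzip1 (drop t.+2 (uword o)) = unzip1 (drop t.+2 w).
  by rewrite /unzip1 !map_drop -/(unzip1 _) uword_flags.
have sAt : size (take t w) = t by rewrite size_takel // ltnW.
have mw x : mult x w = 1%N by apply: good_mult gw.
move: (take t (uword o)) (drop t.+2 (uword o)) uE sA fA fC => A' C' uE sA fA fC.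
have catE (X : eqType) ml (c : seq (bool * X) -> int) v b x b' y u : size v = t ->
    wdt ml t c (v ++ (b, x) :: (b', y) :: u) =
    (if b' then 0 else wop ml (fun z => c (v ++ (b, z) :: u)) x y) *~ (-1) ^+ ndeg (rcons (unzip1 v) b).
  by move=> <-; apply: wdt_cat.
move: (drop t.+2 w) (take t w) wE2 sAt sA fA fC => C A wE2 sAt sA fA fC.
move: uE wE2; case: (nth l0 w t) (nth l0 w t.+1) => b U [b' T] /= uE wE2.
rewrite uE [in RHS]wE2 !catE //; last by rewrite sA.
rewrite fA; congr (_ *~ _); case: b' uE wE2 => // uE wE2.
have := @cof_merge phi A C b U T; rewrite -wE2 => /(_ A' C' mw).
by rewrite sAt => -> //; rewrite sA.
Qed.
End Coefficients.

(* The index of the block containing position i.                              *)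
Definition lab (o : seq bool) (i : nat) : nat := (count id (take i.+1 o)).-1.

Lemma count_takeS o i : (i < size o)%N ->
  count id (take i.+1 o) = (count id (take i o) + nth true o i)%N.
Proof. by move=> io; rewrite (take_nth true) // -cats1 count_cat /= addn0. Qed.

Lemma count_take_gt0 o i : head true o -> (i < size o)%N -> (0 < count id (take i.+1 o))%N.
Proof. by case: o => // -[]. Qed.

Lemma labS o i : head true o -> (i.+1 < size o)%N -> lab o i.+1 = (lab o i + nth true o i.+1)%N.
Proof.
move=> ho io; rewrite /lab (count_takeS io); have := count_take_gt0 ho (ltnW io).
by case: (count id _).
Qed.

Lemma lab0 o : head true o -> lab o 0 = 0%N.
Proof. by case: o => // -[] // o _; rewrite /lab /= take0. Qed.

Lemma lab_lt n j o i : graded n j o -> (i < size o)%N -> (lab o i < n)%N.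
Proof.
move=> /and3P[ho /eqP nE _] io; rewrite /lab prednK ?count_take_gt0 // -nE.
by rewrite -{2}(cat_take_drop i.+1 o) count_cat leq_addr.
Qed.

Lemma lab_mono o i i' : (i <= i')%N -> (lab o i <= lab o i')%N.
Proof.
move=> ii; rewrite /lab -!subn1; apply: leq_sub2r.
by rewrite -(cat_take_drop i.+1 (take i'.+1 o)) count_cat take_takel // leq_addr.
Qed.

Lemma lab_surj n j o q : graded n j o -> (q < n)%N -> exists2 i, (i < size o)%N & lab o i = q.
Proof.
move=> /and3P[ho /eqP nE _] qn.
suff H k : (k <= size o)%N -> (q < count id (take k o))%N ->
    exists2 i, (i < k)%N & lab o i = q by apply: H => //; rewrite take_size nE.
elim: k => [|k IH] ko; first by rewrite take0.
rewrite (count_takeS ko); case: (ltnP q (count id (take k o))) => [qi _|].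
  by have [i ik <-] := IH (ltnW ko) qi; exists i => //; apply: leqW.
by exists k => //; rewrite /lab (count_takeS ko); lia.
Qed.

(** * Surjections as words of singletons *)

Section Shape.
Variables (m n : nat) (f : surj m n).

Definition flt (y x : 'I_m) := (f y < f x)%N || ((f y == f x) && (y < x)%N).

Lemma flt_irr x : flt x x = false.
Proof. by rewrite /flt !ltnn andbF. Qed.

Lemma flt_trans y x z : flt x y -> flt y z -> flt x z.
Proof.
rewrite /flt => /orP[xy|/andP[/eqP -> xy]] /orP[yz|/andP[/eqP <- yz]].
- by rewrite (ltn_trans xy yz).
- by rewrite xy.
- by rewrite yz.
- by rewrite eqxx (ltn_trans xy yz) orbT.
Qed.

Lemma flt_total x y : x != y -> flt x y || flt y x.
Proof.
move=> xy; rewrite /flt; have [E|] := eqVneq (f x) (f y); last by rewrite neq_ltn => /orP[] ->; rewrite ?orbT.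
by rewrite E ltnn /= -neq_ltn.
Qed.

Definition sort_fun (x : 'I_m) : nat := #|[set y | flt y x]|.

Lemma sort_fun_lt x : (sort_fun x < m)%N.
Proof.
rewrite -[X in (_ < X)%N]card_ord -cardsT; apply: proper_card; apply/properP; split.
  exact: subsetT.
by exists x; rewrite // inE flt_irr.
Qed.

Lemma sort_fun_mono x y : flt x y -> (sort_fun x < sort_fun y)%N.
Proof.
move=> xy; apply: proper_card; apply/properP; split.
  by apply/subsetP => z; rewrite !inE => /flt_trans; apply.
by exists x; rewrite !inE ?xy ?flt_irr.
Qed.

Lemma sort_inj : injective (fun x => Ordinal (sort_fun_lt x)).
Proof.
move=> x y [E]; apply/eqP/negPn/negP => /flt_total /orP[] /sort_fun_mono; by rewrite E ltnn.
Qed.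

(* The position of x when the domain is sorted by the values of f.            *)
Definition srt : {perm 'I_m} := perm sort_inj.

Lemma srtE x : srt x = #|[set y | flt y x]| :> nat.
Proof. by rewrite permE. Qed.

Lemma srt_mono x y : (srt x < srt y)%N = flt x y.
Proof.
rewrite !srtE; apply/idP/idP => [|/sort_fun_mono //].
case: (eqVneq x y) => [->|/flt_total/orP[//|/sort_fun_mono]]; first by rewrite ltnn.
by rewrite /sort_fun => h1 h2; move: (ltn_trans h1 h2); rewrite ltnn.
Qed.

Lemma srt_val_mono x y : (srt x <= srt y)%N -> (f x <= f y)%N.
Proof.
rewrite leq_eqVlt srt_mono => /orP[/eqP/val_inj/perm_inj -> //|].
by rewrite /flt => /orP[/ltnW //|/andP[/eqP -> _]].
Qed.

Definition srt_val (i : nat) : nat := if insub i is Some i' then f ((srt^-1)%g i') else 0%N.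

Lemma srt_valE x : srt_val (srt x) = f x.
Proof. by rewrite /srt_val valK permK. Qed.

Lemma srt_val_ord (i : 'I_m) : srt_val i = f ((srt^-1)%g i).
Proof. by rewrite /srt_val valK. Qed.

Lemma srt_val_homo i i' : (i <= i')%N -> (i' < m)%N -> (srt_val i <= srt_val i')%N.
Proof.
move=> ii im'; have im := leq_ltn_trans ii im'.
rewrite (srt_val_ord (Ordinal im)) (srt_val_ord (Ordinal im')).
by apply: srt_val_mono; rewrite !permKV.
Qed.

(** The flags of the word that lists the fibers of f one after the other, each in increasing order;
    a block opens where the sorted values change. *)
Definition bshape : seq bool := mkseq (fun i => (i == 0)%N || (srt_val i.-1 != srt_val i)) m.

Lemma size_bshape : size bshape = m.
Proof. exact: size_mkseq. Qed.

Lemma bshape_head : head true bshape.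
Proof. by rewrite /bshape; case: (m). Qed.

(** Surjectivity enters here: where the sorted values change they grow by exactly one, since a
    skipped value would have to occur between two consecutive positions. *)
Lemma lab_bshape_sval i : (i < m)%N -> lab bshape i = srt_val i.
Proof.
elim: i => [|i IH] im.
  rewrite (lab0 bshape_head); apply/esym/eqP; rewrite -leqn0.
  have n0 : (0 < n)%N by apply: leq_ltn_trans (ltn_ord (f (Ordinal im))).
  have [x xE] := surjP f (Ordinal n0).
  by apply: leq_trans (@srt_val_homo 0 (srt x) _ _) _; rewrite ?srt_valE ?xE.
rewrite labS ?bshape_head ?size_bshape // (IH (ltnW im)) nth_mkseq //=.
have le := srt_val_homo (leqnSn i) im; case: eqVneq => [->|ne]; first by rewrite addn0.
apply/eqP; rewrite addn1 eqn_leq ltn_neqAle ne le /= leqNgt; apply/negP => lt.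
have qn : ((srt_val i).+1 < n)%N.
  by apply: ltn_trans lt _; rewrite (srt_val_ord (Ordinal im)).
have [x xE] := surjP f (Ordinal qn).
have := srt_valE x; rewrite xE /= => E.
case: (leqP (srt x) i) => xi.
  by have := srt_val_homo xi (ltnW im); rewrite E ltnn.
by have := srt_val_homo xi (ltn_ord _); rewrite E leqNgt lt.
Qed.

Lemma lab_bshape x : lab bshape (srt x) = f x.
Proof. by rewrite lab_bshape_sval // srt_valE. Qed.

Lemma count_bshape : count id bshape = n.
Proof.
case: (posnP m) => [m0|m0].
  have n0 : n = 0%N.
    by case: (posnP n) => // n0; have [x _] := surjP f (Ordinal n0); have := leq_ltn_trans (leq0n x) (ltn_ord x); rewrite [X in (_ < X)%N]m0.
  by rewrite /bshape m0 n0.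
have ml : (m.-1 < m)%N by rewrite prednK.
have tk : take m.-1.+1 bshape = bshape by rewrite prednK // -[X in take X](size_bshape) take_size.
have := lab_bshape_sval ml; rewrite /lab tk => E.
have n0 : (0 < n)%N by apply: leq_ltn_trans (ltn_ord (f (Ordinal m0))).
have c0 : (0 < count id bshape)%N.
  by have := @count_take_gt0 bshape m.-1 bshape_head; rewrite size_bshape tk; apply.
rewrite -(prednK c0) E (srt_val_ord (Ordinal ml)); apply/eqP; rewrite eqn_leq ltn_ord /=.
have nl : (n.-1 < n)%N by rewrite prednK.
have [x xE] := surjP f (Ordinal nl); have := srt_valE x; rewrite xE /= => /esym nE.
rewrite -[leqLHS](prednK n0) ltnS nE -(srt_val_ord (Ordinal ml)); apply: srt_val_homo => //=.
by rewrite -ltnS prednK.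
Qed.

Lemma graded_bshape j : (j + n)%N = m -> graded n j bshape.
Proof.
move=> jm; rewrite /graded bshape_head count_bshape eqxx /=; apply/eqP.
have := count_predC id bshape; rewrite count_bshape size_bshape /ndeg => E.
by apply/eqP; rewrite -(eqn_add2l n) [X in X == _]E -jm addnC.
Qed.

End Shape.

Lemma bshape_srt_inj m n (f g : surj m n) : bshape f = bshape g -> srt f = srt g -> f = g.
Proof.
move=> E1 E2; apply: val_inj; apply/ffunP => x; apply: val_inj => /=.
by rewrite -lab_bshape E1 E2 lab_bshape.
Qed.

Lemma card_ltn_ord m k : (k <= m)%N -> #|[pred i : 'I_m | (i < k)%N]| = k.
Proof.
move=> km; rewrite -[RHS](card_ord k) -(card_codom (f := widen_ord km)); last by move=> x y [/val_inj].
apply: eq_card => i; rewrite inE; apply/idP/codomP => [ik|[i' ->]]; last exact: ltn_ord i'.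
by exists (Ordinal ik); apply: val_inj.
Qed.

Section Unbshape.
Variables (m n j : nat) (o : seq bool) (s : {perm 'I_m}).
Hypothesis go : graded n j o.
Hypothesis om : size o = m.
Hypothesis inc : forall x y : 'I_m, (x < y)%N -> lab o (s x) = lab o (s y) -> (s x < s y)%N.

Let lt x : (lab o (s x) < n)%N.
Proof. by apply: lab_lt go _; rewrite om. Qed.

Let fs y : exists x, Ordinal (lt x) = y.
Proof.
have [i io iE] := lab_surj go (ltn_ord y); rewrite om in io.
by exists ((s^-1)%g (Ordinal io)); apply: val_inj; rewrite /= permKV.
Qed.

(** Inverse of the passage from f to its shape and sorting permutation. Because [s] increases inside
    each block, the order by label and then by index is the order of positions. *)
Lemma unbshape : exists f : surj m n, [/\ bshape f = o, srt f = s & forall x, f x = lab o (s x) :> nat].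
Proof.
exists (mksurj fs); set f := mksurj fs.
have fE x : f x = lab o (s x) :> nat by rewrite ffunE.
have fltE x y : flt f x y = (s x < s y)%N.
  rewrite /flt -val_eqE /= !fE; apply/idP/idP.
    case/orP => [|/andP[/eqP E /inc]]; last exact.
    by apply: contraTT; rewrite -!leqNgt; apply: lab_mono.
  move=> xy; case: ltngtP (lab_mono o (ltnW xy)) => //= E _.
  case: (ltngtP x y) => // [yx|/val_inj xyE]; last by rewrite xyE ltnn in xy.
  by have := inc yx (esym E); rewrite ltnNge (ltnW xy).
have sE : srt f = s.
  apply/permP => x; apply: val_inj; rewrite -[LHS]/(nat_of_ord (srt f x)) srtE.
  rewrite (_ : [set y | flt f y x] = s @^-1: [set i : 'I_m | (i < s x)%N]); last first.
    by apply/setP => y; rewrite !inE fltE.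
  have -> : #|s @^-1: [set i : 'I_m | (i < s x)%N]| = #|[set i : 'I_m | (i < s x)%N]|.
    rewrite -[RHS](card_imset _ (@perm_inj _ (s^-1)%g)); apply: eq_card => y; rewrite inE.
    apply/idP/imsetP => [ys|[i ii ->]]; last by rewrite permKV.
    by exists (s y); rewrite ?permK.
  by rewrite cardsE; apply: card_ltn_ord; apply: ltnW.
split=> //; apply: (@eq_from_nth _ true); first by rewrite size_bshape.
move=> i; rewrite size_bshape.
have labE k : (k < m)%N -> lab (bshape f) k = lab o k.
  move=> km; pose x := (s^-1)%g (Ordinal km).
  have := lab_bshape f x; rewrite sE permKV /= => ->.
  by rewrite fE permKV.
case: i => [|i] im.
  by case/and3P: go => + _ _; move: (bshape_head f); rewrite -om in im; case: (bshape f) (size_bshape f) => [|[] ?]; case: o im => [|[] ?].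
have := labE _ im; rewrite !labS ?bshape_head ?size_bshape ?om //; last by case/and3P: go.
by rewrite (labE _ (ltnW im)) => /eqP; rewrite eqn_add2l; case: nth; case: nth.
Qed.

End Unbshape.

(** * Cochains as functions on words of subsets *)

Section SetWords.
Variable m : nat.
Local Notation word := (seq (bool * {set 'I_m})).
Implicit Types (h : 'I_m -> nat) (o : seq bool) (w : word).

Definition sword o h : word := mkseq (fun i => (nth true o i, [set x | h x == i])) (size o).

Lemma size_sword o h : size (sword o h) = size o.
Proof. exact: size_mkseq. Qed.

Lemma unzip1_sword o h : unzip1 (sword o h) = o.
Proof. by rewrite /sword /unzip1 /mkseq -map_comp -[RHS](mkseq_nth true). Qed.

Lemma sword_ext o h h' : h =1 h' -> sword o h = sword o h'.
Proof.
move=> hh; apply: eq_map => i; congr (_, _).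
by apply/setP => x; rewrite !inE hh.
Qed.

Lemma mult_sword o h x : (h x < size o)%N -> mult x (sword o h) = 1%N.
Proof.
move=> hx; rewrite /mult /sword count_map.
rewrite (eq_count (a2 := pred1 (h x))); last by move=> i; rewrite /= inE eq_sym.
by rewrite count_uniq_mem ?iota_uniq // mem_iota /= add0n hx.
Qed.

Lemma pos_sword o h x : (h x < size o)%N -> pos (sword o h) x = h x.
Proof.
move=> hx; apply/eqP; rewrite (pos_nth (true, set0)) ?mult_sword ?size_sword //.
by rewrite nth_mkseq //= inE.
Qed.

Lemma good_sword n j o h : graded n j o -> (forall x, h x < size o)%N -> good n j (sword o h).
Proof.
move=> go hx; rewrite /good unzip1_sword go; apply/forallP => x.
by rewrite mult_sword.
Qed.

Lemma sword_pos n j w : good n j w -> sword (unzip1 w) (pos w) = w.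
Proof.
move=> gw; apply: (@eq_from_nth _ (true, set0)); first by rewrite size_sword size_map.
move=> i; rewrite size_sword size_map => iw; rewrite nth_mkseq ?size_map //.
rewrite (nth_map (true, set0)) // [RHS]surjective_pairing; congr (_, _).
by apply/setP => x; rewrite inE (pos_nth (true, set0)) // (good_mult x gw).
Qed.

Lemma pos_good_lt n j w x : good n j w -> (pos w x < size (unzip1 w))%N.
Proof. by move=> gw; rewrite size_map pos_lt // (good_mult x gw). Qed.

Variables (n j : nat).
Implicit Types (phi : nattrans (barc n j) (Ta m)).

Lemma cof_sword phi o h : (forall x, h x < size o)%N ->
  cof phi (sword o h) = coef (size o) h (hnat phi (uword o)).
Proof.
by move=> hx; rewrite /cof unzip1_sword; apply: coef_ext => x; apply: pos_sword.
Qed.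

Lemma cofD phi psi w : cof (phi + psi) w = cof phi w + cof psi w.
Proof. by rewrite /cof hnatD raddfD. Qed.

Lemma cofN phi w : cof (- phi) w = - cof phi w.
Proof. by rewrite /cof hnatN raddfN. Qed.

Lemma cof0 w : cof (0 : nattrans (barc n j) (Ta m)) w = 0.
Proof. by rewrite /cof hnat0 raddf0. Qed.

Lemma cofB phi psi w : cof (phi - psi) w = cof phi w - cof psi w.
Proof. by rewrite cofD cofN. Qed.

Definition cof_add w : {additive nattrans (barc n j) (Ta m) -> int} :=
  HB.pack (fun phi => cof phi w)
    (GRing.isZmodMorphism.Build _ _ (fun phi => cof phi w) (fun phi psi => cofB phi psi w)).

Lemma cofMz phi k w : cof (phi *~ k) w = cof phi w *~ k.
Proof. exact: (raddfMz (cof_add w)). Qed.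

Lemma cof_sum (I : Type) (r : seq I) (P : pred I) (F : I -> nattrans (barc n j) (Ta m)) w :
  cof (\sum_(i <- r | P i) F i) w = \sum_(i <- r | P i) cof (F i) w.
Proof. exact: (raddf_sum (cof_add w)). Qed.

(** Universal words determine a cochain by naturality, and its values there are determined by their
    coefficients through [tgen_expand]. *)
Lemma cof_inj phi psi : (forall w, good n j w -> cof phi w = cof psi w) -> phi = psi.
Proof.
move=> E; apply: hnat_ext => k w gw; rewrite (hnat_uword phi) (hnat_uword psi).
congr (fmap _ _ _); set o := unzip1 w.
rewrite (tgen_expand (hnat phi _)) (tgen_expand (hnat psi _)).
apply: eq_bigr => h _; rewrite -!cof_sword //; congr (_ *~ _); apply: E.
exact: good_sword.
Qed.

Section Build.
Variable b : word -> int.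

Let bfun k (v : wrd k) : Ta m k :=
  \sum_(h : {ffun 'I_m -> 'I_(n + j)})
    (tpure [ffun x => ab_pi (lett v (h x)) : abF k] : Ta m k) *~ b (sword (unzip1 v) (fun x => h x)).

Let bfun_nat k l (u : grhom k l) v : bfun (wmap u v) = fmap (Ta m) u (bfun v).
Proof.
rewrite /bfun raddf_sum; apply: eq_bigr => h _; rewrite raddfMz unzip1_wmap.
rewrite [X in _ = X *~ _]tpow_mapE; congr (tpure _ *~ _).
by apply/ffunP => x; rewrite !ffunE [RHS]ab_mapE lett_wmap.
Qed.

(** Prescribe the coefficients on universal words and extend by naturality. With [cof_inj], cochains
    become the same thing as functions on good words, so a primitive found among functions is a
    genuine cochain. *)
Lemma cof_build : exists phi, forall w, good n j w -> cof phi w = b w.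
Proof.
exists (bnat n j bfun_nat) => w gw.
have gu : graded n j (unzip1 w) by case/andP: gw.
rewrite -{1}(sword_pos gw) cof_sword; last by move=> x; apply: pos_good_lt gw.
have so := graded_size gu.
have hN x : (pos w x < n + j)%N by rewrite -so; apply: pos_good_lt gw.
pose h0 := [ffun x => Ordinal (hN x)].
rewrite hnat_bnat ?uword_flags // /bfun raddf_sum (bigD1 h0) // big1 ?addr0 => [|h hh0].
  rewrite raddfMz (_ : tpure _ = tgen _ (fun x => h0 x)); last first.
    by congr tpure; apply/ffunP => x; rewrite !ffunE lett_uword // so.
  rewrite coef_tgen; last by move=> x; rewrite so.
  have -> : [forall x, h0 x == pos w x :> nat] by apply/forallP => x; rewrite ffunE.
  rewrite [LHS]addr0 intz uword_flags -[RHS](congr1 b (sword_pos gw)); congr (b _); apply: sword_ext => x.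
  by rewrite ffunE.
rewrite raddfMz (_ : tpure _ = tgen _ (fun x => h x)); last first.
  by congr tpure; apply/ffunP => x; rewrite !ffunE lett_uword // so.
rewrite coef_tgen; last by move=> x; rewrite so.
case: forallP => [E|_]; last by rewrite mul0rz.
case/eqP: hh0; apply/ffunP => x; apply: val_inj; rewrite /= ffunE /=.
exact/eqP/E.
Qed.

End Build.

(** In terms of words, the multilinear cochains are the indicator functions of single words of
    singletons. *)
Lemma cof_bc o (s : {perm 'I_m}) w : good n j w ->
  cof (bc n j o s) w = ((unzip1 w == o) && [forall x, s x == pos w x :> nat])%:R.
Proof.
move=> gw; have gu : graded n j (unzip1 w) by case/andP: gw.
rewrite /cof hnat_bc ?uword_flags // /bcoch uword_flags.
case: (unzip1 w =P o) => [E|_]; last by rewrite andFb [LHS]raddf0.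
rewrite andTb; set f := finfun _.
case: (boolP [forall x : 'I_m, (s x < size (unzip1 w))%N]) => [/forallP sx|/forallPn[x xs]].
  have -> : tpure f = tgen (size (unzip1 w)) (fun x => s x).
    by congr tpure; apply/ffunP => x; rewrite !ffunE lett_uword.
  exact: coef_tgen.
have fx : f x = 0 by rewrite ffunE /lett nth_default ?ab_pi1 // size_mkseq leqNgt.
transitivity (0 : int).
  transitivity (\prod_x cf (size (unzip1 w)) (pos w x) (f x)); first exact: mfunE.
  by rewrite (bigD1 x) // fx raddf0; apply: mul0r.
case: forallP => // /(_ x)/eqP xE; case/negP: xs; rewrite xE; exact: pos_good_lt gw.
Qed.

End SetWords.

(** * Generators of the cohomology and their independence *)

Section Generation.
Variables (m n : nat).
Local Notation word := (seq (bool * {set 'I_m})).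
Local Notation l0 := (true, set0 : {set 'I_m}).

Lemma Qr_nth p (w : word) i : Qr m p w -> (i < size w)%N ->
  exists2 x, (nth l0 w i).2 = [set x]
  & (nth l0 w i).1 || [exists y : 'I_m, (y < x)%N && ((if i is i'.+1 then (nth l0 w i').2 else p) == [set y])].
Proof.
elim: w p i => //= -[b U] w IH p [|i] /andP[/andP[U0 /forall_inP h] Qw].
  by have [x xU] := set0Pn _ U0; exists x; have /implyP/(_ (ltn_ord x))/andP[/eqP UE] := h x xU.
by rewrite ltnS => iw; have [x xE h'] := IH U i Qw iw; exists x => //; case: i iw xE h'.
Qed.

(** After the last stage every letter is a singleton and every element occurs once, so there are m
    letters. This is what confines the cohomology to degree m - n. *)
Lemma Qr_surj j (w : word) : good n j w -> Qr m set0 w ->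
  (j + n)%N = m /\ exists f : surj m n, w = sword (bshape f) (fun x => srt f x).
Proof.
move=> gw Qw; have gu : graded n j (unzip1 w) by case/andP: gw.
have sw : size w = (n + j)%N by rewrite -(graded_size gu) size_map.
have pl x : (pos w x < size w)%N by have := pos_good_lt x gw; rewrite size_map.
have pn x i : (i < size w)%N -> (pos w x == i) = (x \in (nth l0 w i).2).
  by apply: pos_nth; apply: good_mult gw.
have pinj x y : pos w x = pos w y -> x = y.
  move=> E; have [z zE _] := Qr_nth Qw (pl x).
  have := pn x _ (pl x); rewrite eqxx zE inE => /esym/eqP ->.
  by have := pn y _ (pl x); rewrite -E eqxx zE inE => /esym/eqP ->.
have wm : size w = m.
  have ex (i : 'I_(size w)) : exists x, pos w x == i :> nat.
    have [x xE _] := Qr_nth Qw (ltn_ord i); exists x.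
    by rewrite pn // xE inE.
  pose q i := xchoose (ex i); have qK i : pos w (q i) = i by apply/eqP/(xchooseP (ex i)).
  apply/eqP; rewrite eqn_leq; apply/andP; split.
    rewrite -[leqRHS](card_ord m) -[leqLHS](card_ord (size w)).
    by apply: (@leq_card _ _ q) => x y /(congr1 (pos w)); rewrite !qK => /val_inj.
  rewrite -[leqLHS](card_ord m) -[leqRHS](card_ord (size w)).
  by apply: (@leq_card _ _ (fun x => Ordinal (pl x))) => x y [/pinj].
split; first by rewrite -wm sw addnC.
have ltm x : (pos w x < m)%N by rewrite -{2}wm.
have sinj : injective (fun x => Ordinal (ltm x)) by move=> x y [/pinj].
have so : size (unzip1 w) = m by rewrite size_map.
(* A letter inside a block is preceded by a smaller singleton, so the elements increase along the
   block. *)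
have inc i' : forall i x y, (i < i')%N -> (i' < size w)%N -> lab (unzip1 w) i = lab (unzip1 w) i' ->
    (nth l0 w i).2 = [set x] -> (nth l0 w i').2 = [set y] -> (x < y)%N.
  elim: i' => // i' IH i x y; rewrite ltnS => ii iw labE qi qi'.
  have hd : head true (unzip1 w) by case/and3P: gu.
  have labS' k : (k.+1 < size w)%N -> lab (unzip1 w) k.+1 = (lab (unzip1 w) k + nth true (unzip1 w) k.+1)%N.
    by move=> kw; apply: labS hd _; rewrite size_map.
  have E1 : lab (unzip1 w) i = lab (unzip1 w) i'.
    apply/eqP; rewrite eqn_leq lab_mono //= labE lab_mono //.
  have fl : (nth l0 w i'.+1).1 = false.
    have := labS' _ iw; rewrite -labE E1 (nth_map l0) // -{1}[lab _ _]addn0 => /eqP.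
    by rewrite eqn_add2l; case: (nth _ _ _).1.
  have [z zE] := Qr_nth Qw iw; rewrite fl /= => /existsP[y' /andP[y'z /eqP y'E]].
  have zy : z = y by apply: set1_inj; rewrite -zE.
  move: ii; rewrite leq_eqVlt => /orP[/eqP iE|ii].
    by have -> : x = y' by [apply: set1_inj; rewrite -y'E -iE]; rewrite -zy.
  by apply: ltn_trans (IH i x y' ii (ltnW iw) E1 qi y'E) _; rewrite -zy.
have pE (x : 'I_m) : (nth l0 w (pos w x)).2 = [set x].
  have [y yE _] := Qr_nth Qw (pl x).
  by have := pn x _ (pl x); rewrite eqxx yE inE => /esym/eqP ->.
have incs (x y : 'I_m) : (x < y)%N -> lab (unzip1 w) (perm sinj x) = lab (unzip1 w) (perm sinj y) ->
    (perm sinj x < perm sinj y)%N.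
  move=> xy; rewrite !permE /= => labE; rewrite ltnNge leq_eqVlt; apply/negP => /orP[/eqP/pinj E|yx].
    by rewrite E ltnn in xy.
  by have := inc _ _ _ _ yx (pl x) (esym labE) (pE y) (pE x); rewrite ltnNge (ltnW xy).
have [f [fo fs _]] := unbshape gu so incs.
exists f; rewrite fo fs -[LHS](sword_pos gw); apply: sword_ext => x.
by rewrite permE.
Qed.

Lemma sword_split o (h : 'I_m -> nat) i : (i.+1 < size o)%N ->
  sword o h = take i (sword o h) ++ (nth true o i, [set x | h x == i])
    :: (nth true o i.+1, [set x | h x == i.+1]) :: drop i.+2 (sword o h).
Proof.
move=> io; rewrite -{1}(cat_take_drop i (sword o h)); congr (_ ++ _).
rewrite (drop_nth l0) ?size_sword 1?ltnW // (drop_nth l0) ?size_sword //.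
by rewrite !nth_mkseq ?(ltnW io).
Qed.

Lemma sword_swap o (h h' : 'I_m -> nat) i :
  (forall x k, k != i -> k != i.+1 -> (h x == k) = (h' x == k)) ->
  take i (sword o h) = take i (sword o h') /\ drop i.+2 (sword o h) = drop i.+2 (sword o h').
Proof.
move=> hh; rewrite /sword /mkseq -!map_take -!map_drop take_iota drop_iota.
split; apply/eq_in_map => k; rewrite mem_iota => kE; congr (_, _); apply/setP => x;
  by rewrite !inE; apply: hh; lia.
Qed.

Lemma wdt_catE (c : word -> int) i (w v : word) b x b' y : size w = i ->
  wdt (@mlS m) i c (w ++ (b, x) :: (b', y) :: v) =
  (if b' then 0 else wop (@mlS m) (fun z => c (w ++ (b, z) :: v)) x y)
    *~ (-1) ^+ ndeg (rcons (unzip1 w) b).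
Proof. by move=> <-; apply: wdt_cat. Qed.

(** The merge at these positions depends only on the union of the two letters, so exchanging them
    has no effect on it. *)
Lemma wdt_swap (c : word -> int) o (s : {perm 'I_m}) (i i' : 'I_m) : size o = m -> i.+1 = i' ->
  nth true o i' = false ->
  wdt (@mlS m) i c (sword o (fun x => (s * tperm i i')%g x)) = wdt (@mlS m) i c (sword o (fun x => s x)).
Proof.
move=> om ii fl; have io : (i.+1 < size o)%N by rewrite om ii.
set h' := fun x => _; set h := fun x => _.
have nth_i x : ((h' x == i) = (h x == i.+1)) * ((h' x == i.+1) = (h x == i)).
  rewrite /h' /h permM ii /=; case: tpermP => [->|->|/eqP a /eqP b]; rewrite ?eqxx; try by rewrite eq_sym.
  by rewrite -!val_eqE in a b; rewrite (negbTE a) (negbTE b).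
have [tE dE] : take i (sword o h') = take i (sword o h) /\ drop i.+2 (sword o h') = drop i.+2 (sword o h).
  apply: sword_swap => x k ki ki'; rewrite ii in ki'; rewrite /h' /h permM.
  by case: tpermP => [->|->|//]; rewrite ![_ == k]eq_sym (negbTE ki) (negbTE ki').
have st : size (take i (sword o h)) = i by rewrite size_takel // size_sword ltnW // ltnW.
rewrite (sword_split h io) (sword_split h' io) tE dE !wdt_catE // [nth true o i.+1](_ : _ = false) ?ii //; congr (_ *~ _).
rewrite !wopS chiC setUC -ii.
have -> : [set x | h' x == i] = [set x | h x == i.+1] by apply/setP => x; rewrite !inE nth_i.
by have -> : [set x | h' x == i.+1] = [set x | h x == i] by apply/setP => x; rewrite !inE nth_i.
Qed.

Lemma wdt_true (c : word -> int) o (h : 'I_m -> nat) t : nth true o t.+1 -> (t < size o)%N ->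
  wdt (@mlS m) t c (sword o h) = 0.
Proof.
move=> fl to; have st : size (take t (sword o h)) = t by rewrite size_takel // size_sword ltnW.
case: (ltnP t.+1 (size o)) => t1o.
  by rewrite (sword_split h t1o) wdt_catE // fl mul0rz.
have E : t.+1 = size o by apply/eqP; rewrite eqn_leq to.
rewrite -(cat_take_drop t (sword o h)) -{1}st (drop_nth l0) ?size_sword // drop_oversize ?size_sword ?E //.
exact: wdt_last.
Qed.

Variable j : nat.
Implicit Types phi : nattrans (barc n j) (Ta m).

Definition eps (s : {perm 'I_m}) : int := (-1) ^+ odd_perm s.

(** Antisymmetrization over the orders of the letters inside the blocks of f. It kills coboundaries
    and takes the values 1 or -1 on representatives of f and 0 on those of other surjections. *)
Definition lam (f : surj m n) phi : int :=
  \sum_(s : {perm 'I_m} | [forall x, lab (bshape f) (s x) == f x])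
    cof phi (sword (bshape f) (fun x => s x)) *~ eps s.

Lemma lam_sum (I : Type) (r : seq I) (P : pred I) f (F : I -> nattrans (barc n j) (Ta m)) (e : I -> int) :
  lam f (\sum_(i <- r | P i) F i *~ e i) = \sum_(i <- r | P i) lam f (F i) *~ e i.
Proof.
rewrite /lam; under eq_bigr do rewrite cof_sum mulrz_suml.
rewrite exchange_big; apply: eq_bigr => i _; rewrite mulrz_suml; apply: eq_bigr => s _.
by rewrite cofMz -!mulrzA mulrC.
Qed.

Lemma lamB f phi psi : lam f (phi - psi) = lam f phi - lam f psi.
Proof.
by rewrite /lam -sumrB; apply: eq_bigr => s _; rewrite cofB mulrzBl.
Qed.

Lemma lam_bc (f f' : surj m n) (s : {perm 'I_m}) : (j + n)%N = m -> (forall x, lab (bshape f) (s x) = f x) ->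
  lam f' (bc n j (bshape f) s) = (f' == f)%:R *~ eps s.
Proof.
move=> jm sf; rewrite /lam.
have gs (f0 : surj m n) s0 : good n j (sword (bshape f0) (fun x : 'I_m => (s0 : {perm 'I_m}) x)).
  by apply: good_sword (graded_bshape f0 jm) _ => x; rewrite size_bshape.
under eq_bigr => s0 _ do rewrite cof_bc ?gs // unzip1_sword.
case: (eqVneq f' f) => [->|ff'].
  rewrite (bigD1 s) //=; last by apply/forallP => x; apply/eqP.
  rewrite big1 ?addr0 => [|s0 /andP[_ ne]].
    by congr (_ *~ _); rewrite eqxx /= (_ : [forall x, _] = true) //; apply/forallP => x; rewrite pos_sword ?size_bshape.
  rewrite (_ : [forall x, _] = false) ?andbF ?mul0rz //; apply/negP => /forallP h; case/eqP: ne.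
  by apply/permP => x; apply: val_inj; have /eqP := h x; rewrite pos_sword ?size_bshape.
rewrite mul0rz big1 // => s0 /forallP h0.
case: eqVneq => [E|_]; last by rewrite mul0rz.
rewrite (_ : [forall x, _] = false) ?andbF ?mul0rz //; apply/negP => /forallP h; case/eqP: ff'.
apply: val_inj; apply/ffunP => x; apply: val_inj; rewrite -[LHS]/(nat_of_ord (f' x)) -[RHS]/(nat_of_ord (f x)) -(eqP (h0 x)) -sf E.
by have /eqP := h x; rewrite pos_sword ?size_bshape // => ->.
Qed.

End Generation.

(** At a fixed merge position, multiplying [s] by the transposition of the two merged positions is
    an involution of the index set that keeps the merge and changes the signature. *)
Lemma lam_cob m n j (b : nattrans (barc n j) (Ta m)) (f : surj m n) : (j.+1 + n)%N = m ->
  lam f (nt_comp b (bdiff n j)) = 0.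
Proof.
move=> jm; rewrite /lam; set o := bshape f; have so : size o = m by apply: size_bshape.
transitivity (\sum_(t < m) \sum_(s : {perm 'I_m} | [forall x, lab o (s x) == f x])
   wdt (@mlS m) t (cof b) (sword o (fun x => s x)) *~ eps s).
  rewrite exchange_big; apply: eq_bigr => s _; rewrite /cof cof_diff; last first.
    by apply: good_sword (graded_bshape f jm) _ => x; rewrite so.
  rewrite wdtE -(big_mkord xpredT (fun t => wdt (@mlS m) t (cof b) _)) size_sword so big_mkord.
  by rewrite mulrz_suml.
rewrite big1 // => t _.
case ot: (nth true o t.+1); first by rewrite big1 // => s _; rewrite wdt_true ?so // mul0rz.
have tm : (t.+1 < m)%N by rewrite ltnNge; apply/negP => mt; rewrite nth_default ?so in ot.
set X := \sum_(s | _) _; suff : X = - X by lia.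
pose t1 := Ordinal tm; rewrite {1}/X (reindex_inj (mulIg (tperm t t1))) /= -sumrN.
have lt1 : lab o t1 = lab o t.
  by rewrite labS ?bshape_head ?so // ot addn0.
apply: eq_big => s.
  apply: eq_forallb => x; rewrite permM; case: tpermP => [->|->|//]; by rewrite lt1.
move=> _; rewrite wdt_swap // /eps odd_permM odd_tperm.
have -> : t != t1 by rewrite -val_eqE neq_ltn leqnn.
by rewrite signr_addb /= expr1 mulrN1 mulrNz.
Qed.

Section Generation2.
Variables m n j : nat.

Definition bphi (f : surj m n) : nattrans (barc n j) (Ta m) := bc n j (bshape f) (srt f).

Lemma normalize (phi : nattrans (barc n j) (Ta m)) : nt_comp phi (bdiff n j) = 0 ->
  exists2 psi, coboundary (P := bres n) (i := j) (phi - psi) &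
    forall w, good n j w -> ~~ Qr m set0 w -> cof psi w = 0.
Proof.
move=> phi0; have phic : cocycleW n j (cof phi).
  by move=> w gw; rewrite -cof_diff // phi0 hnat0 raddf0.
have [c' c'E] := cocycleW_std phic.
case: j phi phi0 phic c' c'E => [|i] phi phi0 phic c' c'E.
  exists phi; first by rewrite subrr.
  move=> w gw nQ; rewrite c'E //; case/andP: gw => gw _; exact: wd_deg0 gw.
have [psi psiE] := @cof_build m n i c'.
exists (phi - nt_comp psi (bdiff n i)); first by exists psi; rewrite subKr.
move=> w gw nQ; rewrite cofB c'E // [X in _ - X]cof_diff //.
rewrite (@wd_step_ext _ _ _ (cof psi) c') ?subrr // => v wv.
by apply/psiE/(step_good wv gw).
Qed.

Lemma generate (phi : nattrans (barc n j) (Ta m)) : nt_comp phi (bdiff n j) = 0 ->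
  exists e : surj m n -> int, coboundary (P := bres n) (i := j) (phi - \sum_f bphi f *~ e f).
Proof.
move=> /normalize[psi cob psi0]; exists (fun f => cof psi (sword (bshape f) (fun x => srt f x))).
suff <- : psi = \sum_f bphi f *~ cof psi (sword (bshape f) (fun x => srt f x)) by [].
apply: cof_inj => w gw; rewrite cof_sum.
have E (f : surj m n) : cof (bphi f *~ cof psi (sword (bshape f) (fun x => srt f x))) w
   = (w == sword (bshape f) (fun x => srt f x))%:R *~ cof psi w.
  rewrite cofMz cof_bc //; case: (eqVneq w (sword (bshape f) (fun x => srt f x))) => [->|ne].
    have ps x : pos (sword (bshape f) (fun x => srt f x)) x = srt f x by rewrite pos_sword ?size_bshape.
    by rewrite unzip1_sword eqxx (_ : [forall x, _] = true) //; apply/forallP => x; rewrite ps.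
  case: eqVneq => [E1|_]; rewrite ?mul0rz //=; case: forallP => [h|_]; rewrite ?mul0rz //.
  case/eqP: ne; rewrite -(sword_pos gw) E1; apply: sword_ext => x.
  by rewrite (eqP (h x)).
under eq_bigr do rewrite E.
case Q: (Qr m set0 w); last first.
  by rewrite psi0 ?Q // big1 // => f _; rewrite mulr0z.
have [_ [f fE]] := Qr_surj gw Q.
rewrite (bigD1 f) //= -fE eqxx big1 ?addr0 ?intz // => g gf.
case: eqVneq => [wg|_]; last by rewrite mul0rz.
case/eqP: gf; apply: bshape_srt_inj.
  by rewrite -[LHS](unzip1_sword _ (fun x => srt g x)) -wg fE unzip1_sword.
apply/permP => x; apply: val_inj; rewrite -[LHS]/(nat_of_ord (srt g x)) -[RHS]/(nat_of_ord (srt f x)).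
have := pos_sword (o := bshape g) (h := fun x => srt g x) (x := x); rewrite size_bshape => /(_ (ltn_ord _)) <-.
by rewrite -wg fE pos_sword ?size_bshape.
Qed.

Lemma vanish (phi : nattrans (barc n j) (Ta m)) : (j + n)%N <> m -> nt_comp phi (bdiff n j) = 0 ->
  coboundary (P := bres n) (i := j) phi.
Proof.
move=> jm /normalize[psi cob psi0]; suff E : psi = 0 by rewrite E subr0 in cob.
apply: cof_inj => w gw; rewrite cof0; apply: psi0 => //; apply/negP => Q.
by have [] := Qr_surj gw Q.
Qed.

Hypothesis jm : (j + n)%N = m.

Lemma lam_coboundary (phi : nattrans (barc n j) (Ta m)) f :
  coboundary (P := bres n) (i := j) phi -> lam f phi = 0.
Proof.
case: j jm phi => [|i] im phi /=; last by case=> b ->; apply: lam_cob.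
by move=> ->; rewrite /lam big1 // => s _; rewrite cof0 mul0rz.
Qed.

Lemma bphi_cocycle f : nt_comp (bphi f) (bdiff n j) = 0.
Proof. by apply: bc_cocycle; rewrite size_bshape. Qed.

Lemma eps_sq (s : {perm 'I_m}) : eps s * eps s = 1.
Proof. by rewrite /eps -signr_addb addbb. Qed.

Lemma bphi_indep (e : surj m n -> int) :
  coboundary (P := bres n) (i := j) (\sum_f bphi f *~ e f) -> forall f, e f = 0.
Proof.
move=> cob f; have := lam_coboundary f cob; rewrite lam_sum (bigD1 f) //=.
rewrite lam_bc //; last exact: lab_bshape.
rewrite eqxx big1 => [|g gf]; last first.
  rewrite lam_bc //; last exact: lab_bshape.
  by rewrite eq_sym (negbTE gf) !mul0rz.
rewrite addr0 -mulrzA intz => E.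
by rewrite -[e f]mul1r -(eps_sq (srt f)) -mulrA E mulr0.
Qed.

(* Any representative of the class is obtained by permuting the factors        *)
(* inside the blocks, up to the corresponding signature.                       *)
Lemma bc_class (f : surj m n) (s : {perm 'I_m}) : (forall x, lab (bshape f) (s x) = f x) ->
  coboundary (P := bres n) (i := j) (bc n j (bshape f) s - bphi f *~ (eps s * eps (srt f))).
Proof.
move=> sf; have c : nt_comp (bc n j (bshape f) s) (bdiff n j) = 0 by apply: bc_cocycle; rewrite size_bshape.
have [e eE] := generate c.
(* The coefficients are read off by applying [lam] for each surjection, which annihilates the
   coboundary. *)
have eE' g : e g = (g == f)%:R * eps s * eps (srt g).
  have := lam_coboundary g eE; rewrite lamB lam_sum (bigD1 g) //= big1 => [|g' g'g]; last first.
    by rewrite lam_bc //; [rewrite eq_sym (negbTE g'g) !mul0rz | exact: lab_bshape].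
  rewrite !lam_bc //; last exact: lab_bshape.
  rewrite addr0 => /eqP; rewrite subr_eq0 => /eqP E.
  rewrite eqxx !mulrzz mul1r in E.
  by rewrite E mulrAC eps_sq mul1r.
rewrite (_ : \sum_g bphi g *~ e g = bphi f *~ (eps s * eps (srt f))) // in eE.
rewrite (bigD1 f) //= big1 ?addr0 => [|g gf]; last by rewrite eE' (negbTE gf) !mul0r mulr0z.
by rewrite eE' eqxx mul1r.
Qed.

End Generation2.

(** * Signs *)

Lemma eps_mul m (s t : {perm 'I_m}) : eps (s * t)%g = eps s * eps t.
Proof. by rewrite /eps odd_permM signr_addb. Qed.

Lemma eps_inv m (s : {perm 'I_m}) : eps (s^-1)%g = eps s.
Proof. by rewrite /eps odd_permV. Qed.

(* Comparison of two Vandermonde determinants.                                *)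
Lemma eps_inversions m (s : {perm 'I_m}) :
  eps s = (-1) ^+ #|[set p : 'I_m * 'I_m | (p.1 < p.2)%N && (s p.2 < s p.1)%N]|.
Proof.
pose a : 'rV[int]_m := \row_i (i : nat)%:Z.
have E : \det (col_perm s (Vandermonde m a)) = \det (Vandermonde m a) * eps s.
  by rewrite col_permE det_mulmx det_perm odd_permV.
have E1 : col_perm s (Vandermonde m a) = Vandermonde m (col_perm s a).
  by apply/matrixP => i j; rewrite !mxE.
move: E; rewrite {}E1 !det_Vandermonde !pair_big_dep /= => /(congr1 (@sgz int)).
rewrite sgzM !(big_morph (@sgz int) (@sgzM _) (sgz1 _)).
rewrite [X in _ = X * _]big1 => [|p pp]; last by rewrite gtr0_sgz // !mxE subr_gt0 ltz_nat.
have -> : sgz (eps s) = eps s by rewrite /eps; case: odd_perm.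
rewrite mul1r => <-; rewrite (bigID (fun p : 'I_m * 'I_m => (s p.2 < s p.1)%N)) /=.
rewrite [X in _ * X]big1 => [|p /andP[pp]]; last first.
  rewrite -leqNgt leq_eqVlt => /orP[/eqP/val_inj/perm_inj E|sp].
    by rewrite E ltnn in pp.
  by rewrite gtr0_sgz // !mxE subr_gt0 ltz_nat.
rewrite mulr1 (eq_bigr (fun=> -1)) => [|p /andP[_ sp]]; last first.
  by rewrite ltr0_sgz // !mxE subr_lt0 ltz_nat.
by rewrite prodr_const cardsE.
Qed.

(** The inversions of [srt h] are the pairs x < y with h y < h x. As s preserves the order, those of
    s o f are among those of f, and the others are the pairs that s identifies. *)
Lemma eps_srt_comp m n l (f : surj m n) (s : surj n l) : {homo s : a b / (a <= b)%N} ->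
  eps (srt f) * eps (srt (surj_comp s f)) =
  (-1) ^+ #|[set xy : 'I_m * 'I_m |
      [&& xy.1 < xy.2, f xy.2 < f xy.1 & s (f xy.1) == s (f xy.2)]%N]|.
Proof.
move=> sm; rewrite !eps_inversions.
have invE k (h : surj m k) (p : 'I_m * 'I_m) : (p.1 < p.2)%N -> (srt h p.2 < srt h p.1)%N = (h p.2 < h p.1)%N.
  move=> pp; rewrite srt_mono /flt; case: (ltnP (h p.2) (h p.1)) => //= _.
  by rewrite [(p.2 < p.1)%N]ltnNge (ltnW pp) andbF.
set A := [set p | _]; set B := [set p | _]; set C := [set p | _].
have BA : B \subset A.
  apply/subsetP => p; rewrite !inE => /andP[pp]; rewrite pp !invE // !ffunE /= => h.
  by rewrite ltnNge; apply: contraL h => h; rewrite -leqNgt; apply: sm.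
have -> : C = A :\: B.
  apply/setP => p; rewrite !inE; case: (ltnP p.1 p.2) => //= pp.
  rewrite !invE // !ffunE andbC; case: (ltnP (f p.2) (f p.1)) => [h|_]; rewrite ?andbF //= andbT.
  by rewrite andbT -leqNgt -val_eqE /= eqn_leq (sm _ _ (ltnW h)) andbT.
rewrite -[#|A|](cardsID B) (setIidPr BA) exprD mulrAC.
by rewrite -expr2 -exprM mulnC exprM sqrrN expr1n mul1r.
Qed.

Lemma lab_inj o o' : head true o -> head true o' -> size o = size o' ->
  (forall i, (i < size o)%N -> lab o i = lab o' i) -> o = o'.
Proof.
move=> ho ho' so labE; apply: (@eq_from_nth _ true) => // -[|i] io.
  by move: ho ho' so io; case: o {labE} => [|[] ?] //; case: o' => [|[] ?].
have := labE _ io; rewrite !labS -?so // (labE _ (ltnW io)) => /eqP.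
by rewrite eqn_add2l; case: nth; case: nth.
Qed.

(** The labels of both shapes form sorted lists with the same entries, namely the values of g, and
    labels determine flags. *)
Lemma bshape_unique m n j (g : surj m n) o (s : {perm 'I_m}) : graded n j o -> size o = m ->
  (forall x, lab o (s x) = g x) -> bshape g = o.
Proof.
move=> go so sg.
have labs (o' : seq bool) (s' : {perm 'I_m}) : (forall x, lab o' (s' x) = g x) ->
    perm_eq (mkseq (lab o') m) [seq nat_of_ord (g x) | x <- enum 'I_m].
  move=> s'g; have -> : [seq nat_of_ord (g x) | x <- enum 'I_m] = [seq lab o' i | i <- [seq val i | i <- [seq s' x | x <- enum 'I_m]]].
    by rewrite -!map_comp; apply: eq_map => x; rewrite /= s'g.
  rewrite /mkseq -val_enum_ord; do 2!apply: perm_map; apply: uniq_perm; first exact: enum_uniq.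
    by rewrite map_inj_uniq ?enum_uniq //; apply: perm_inj.
  move=> x; rewrite mem_enum; apply/esym/mapP; exists ((s'^-1)%g x); rewrite ?permKV //.
  by rewrite mem_enum.
have srtd o' : sorted leq (mkseq (lab o') m).
  rewrite /mkseq sorted_map; apply: sub_sorted (iota_sorted 0 m) => i i'; exact: lab_mono.
have E : mkseq (lab (bshape g)) m = mkseq (lab o) m.
  apply: (sorted_eq leq_trans anti_leq) => //.
  rewrite (permPl (labs _ (srt g) _)); last by move=> x; apply: lab_bshape.
  by rewrite perm_sym (labs o s).
apply: lab_inj; rewrite ?bshape_head ?size_bshape ?so //; first by case/and3P: go.
move=> i im; have := congr1 (fun q => nth 0%N q i) E; by rewrite !nth_mkseq.
Qed.

Section FiberSign.
Variables (m n : nat) (F : 'I_m -> 'I_n) (s : {perm 'I_m}) (b : 'I_n -> {perm 'I_m}).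
Hypothesis Fs : forall y, F (s y) = F y.
Hypothesis bE : forall q y, b q y = if F y == q then s y else y.

(** A permutation that preserves the fibers is the product of its restrictions to them, each
    extended by the identity. *)
Lemma eps_fibers : \prod_q eps (b q) = eps s.
Proof.
have E (r : seq 'I_n) : uniq r -> forall y, (\prod_(q <- r) b q)%g y = if F y \in r then s y else y.
  elim: r => [|q r IH] /=; first by move=> _ y; rewrite big_nil perm1.
  case/andP=> qr ur y; rewrite big_cons permM IH // bE inE; case: eqVneq => [Fy|_] //=.
  by rewrite Fs Fy (negbTE qr).
have <- : (\prod_q b q)%g = s.
  apply/permP => y; rewrite -[LHS]/((\prod_(q <- index_enum _) b q)%g y) E ?index_enum_uniq //.
  by rewrite mem_index_enum.
by rewrite (big_morph (@eps m) (@eps_mul m) (_ : _ = 1)) // /eps odd_perm1.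
Qed.

End FiberSign.

Lemma sorted_enum_ord m (A : {set 'I_m}) : sorted (fun x y : 'I_m => (x < y)%N) (enum A).
Proof.
have -> : enum A = [seq x <- enum 'I_m | x \in A] by rewrite enumT.
apply: sorted_filter => [x y z|]; first exact: ltn_trans.
by have := iota_ltn_sorted 0 m; rewrite -val_enum_ord sorted_map.
Qed.

(** The order preserving bijection from A onto its image is unique, so any permutation that
    restricts to it can express [bar]. *)
Lemma bar_mono m (s v : {perm 'I_m}) (A : {set 'I_m}) :
  v @: A = s @: A -> {in A &, {homo v : x y / (x < y)%N}} ->
  forall y, bar s A y = if y \in s @: A then s ((v^-1)%g y) else y.
Proof.
move=> vA vm y; have enE : enum (s @: A) = [seq v x | x <- enum A].
  apply: (@irr_sorted_eq _ (fun x y : 'I_m => (x < y)%N)).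
  - by move=> ? ? ?; apply: ltn_trans.
  - by move=> ?; apply: ltnn.
  - exact: sorted_enum_ord.
  - apply: (homo_sorted_in _ _ (sorted_enum_ord A)); first exact: vm.
    by apply/allP => x; rewrite mem_enum.
  by move=> x; rewrite mem_enum -vA; apply/imsetP/mapP => -[z zA ->]; exists z; rewrite // ?mem_enum // -mem_enum.
case: ifP => yA; last by rewrite permE /bar_fun yA.
have /imsetP[x xA yE] : y \in v @: A by rewrite vA.
have xe : x \in enum A by rewrite mem_enum.
rewrite yE permK -[x](nth_index x xe); set i := index x _.
have iA : (i < #|A|)%N by rewrite cardE index_mem.
have := barE s iA x; rewrite enE (nth_map x) ?nth_index -?cardE //.
Qed.

Lemma bar_sign m n (f : surj m n) (s : {perm 'I_m}) :
  \prod_(q < n) (-1) ^+ odd_perm (bar s (fiber (surj_comp f (surj_perm s)) q)) =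
  eps (s * srt f)%g * eps (srt (surj_comp f (surj_perm s))) :> int.
Proof.
set g := surj_comp f _; have gE x : g x = f (s x) by rewrite !ffunE.
(* Both surjections have the same shape, so v maps each fiber of g increasingly onto the fiber of f
   over the same point. Then v^-1 followed by [s] preserves the fibers of f, and its restrictions
   are the permutations [bar]. *)
pose v := (srt g * (srt f)^-1)%g.
have fsh : (m = (m - n) + n)%N.
  rewrite subnK //; rewrite -(count_bshape f) -{2}(size_bshape f); exact: count_size.
have shE : bshape g = bshape f.
  apply: (bshape_unique (j := m - n) (s := (s * srt f)%g)); rewrite ?size_bshape ?graded_bshape //.
  by move=> x; rewrite permM lab_bshape gE.
have fv x : f (v x) = g x.
  by apply: val_inj; rewrite -[LHS]/(nat_of_ord _) -lab_bshape permM permKV -shE lab_bshape.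
have -> : eps (s * srt f)%g * eps (srt g) = eps (v^-1 * s)%g.
  by rewrite /v !eps_mul !(eps_inv, eps_mul); ring.
rewrite -(@eps_fibers m n f (v^-1 * s)%g (fun q => bar s (fiber g q))) // => [y|q y].
  by rewrite permM -gE -fv permKV.
have im (u : {perm 'I_m}) : (forall x, f (u x) = g x) -> u @: fiber g q = fiber f q.
  move=> fu; apply/setP => z; rewrite inE; apply/imsetP/eqP => [[x]|zq].
    by rewrite inE -fu => /eqP <- ->.
  by exists ((u^-1)%g z); rewrite ?permKV // inE -fu permKV zq.
rewrite (@bar_mono m s v).
- by rewrite im ?inE ?permM // => x; rewrite gE.
- by rewrite !im // => x; rewrite gE.
move=> x x'; rewrite !inE => /eqP xq /eqP x'q xx'.
have := srt_mono g x x'; rewrite /flt xq x'q ltnn eqxx xx' /= => h.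
have := srt_mono f (v x) (v x'); rewrite !permM !permKV h /flt -!(permM (srt g)) !fv.
by rewrite xq x'q ltnn eqxx.
Qed.

(** * Computation of the Ext groups *)

Section ClassSums.
Variables (F : functor) (P : projres F) (i : nat) (G : functor).

Lemma is_coc0 : is_coc (0 : nattrans (P i) G).
Proof. exact: nt_comp0l. Qed.

Lemma is_cocMz (a : nattrans (P i) G) k : is_coc a -> is_coc (a *~ k).
Proof.
move=> ca; have cn q : is_coc (a *+ q).
  by elim: q => [|q IH]; rewrite ?mulr0n ?mulrS; [apply: is_coc0 | apply: is_cocD].
case: k => q; first exact: cn.
by rewrite NegzE mulrNz -sub0r; apply: is_cocB is_coc0 (cn _).
Qed.

Lemma cls0 : cls (0 : nattrans (P i) G) = 0.
Proof. by apply: (addrI (cls (0 : nattrans (P i) G))); rewrite -clsD ?addr0 //; apply: is_coc0. Qed.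

Lemma clsMz (a : nattrans (P i) G) k : is_coc a -> cls (a *~ k) = cls a *~ k.
Proof.
move=> ca; have cn q : cls (a *+ q) = cls a *+ q.
  elim: q => [|q IH]; rewrite ?mulr0n ?cls0 // !mulrS clsD ?IH //.
  exact: (is_cocMz q%:Z ca).
case: k => q; first exact: cn.
rewrite NegzE !mulrNz; apply/eqP; rewrite -addr_eq0; apply/eqP.
have cq : is_coc (a *+ q.+1) by apply: (is_cocMz q.+1%:Z ca).
rewrite -[X in _ + X]cn -clsD ?addNr ?cls0 // -sub0r; exact: is_cocB is_coc0 cq.
Qed.

Lemma is_coc_sum (I : Type) (r : seq I) (Q : pred I) (a : I -> nattrans (P i) G) :
  (forall x, is_coc (a x)) -> is_coc (\sum_(x <- r | Q x) a x).
Proof.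
by move=> ca; apply: big_ind; [exact: is_coc0 | exact: is_cocD | move=> x _; exact: ca].
Qed.

Lemma cls_sum (I : Type) (r : seq I) (Q : pred I) (a : I -> nattrans (P i) G) :
  (forall x, is_coc (a x)) -> cls (\sum_(x <- r | Q x) a x) = \sum_(x <- r | Q x) cls (a x).
Proof.
move=> ca; elim: r => [|x r IH]; first by rewrite !big_nil cls0.
rewrite !big_cons; case: (Q x); rewrite // clsD ?IH //; exact: is_coc_sum.
Qed.

End ClassSums.

Section Phi.
Variables n m i : nat.

Definition phi_fun (x : 'Z_Surj(m, n)) : Ext i (Ta n) (Ta m) :=
  \sum_f cls (P := bres n) (i := i) (bphi i f) *~ x f.

Lemma phi_additive : zmod_morphism phi_fun.
Proof.
by move=> x y; rewrite /phi_fun -sumrB; apply: eq_bigr => f _; rewrite !ffunE mulrzBr.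
Qed.

Definition phi : {additive 'Z_Surj(m, n) -> Ext i (Ta n) (Ta m)} :=
  HB.pack phi_fun (GRing.isZmodMorphism.Build _ _ phi_fun phi_additive).

Lemma phi_basis f : phi (surj_basis f) = cls (P := bres n) (i := i) (bphi i f).
Proof.
rewrite -[LHS]/(phi_fun _) /phi_fun (bigD1 f) //= big1 => [|g gf]; rewrite ffunE.
  by rewrite eqxx addr0.
by rewrite (negbTE gf) mulr0z.
Qed.

Lemma bphi_coc (f : surj m n) : is_coc (P := bres n) (i := i) (bphi i f).
Proof. exact: bphi_cocycle. Qed.

Lemma phi_cls x : phi x = cls (P := bres n) (i := i) (\sum_f bphi i f *~ x f).
Proof.
rewrite cls_sum => [|f]; last exact: (is_cocMz _ (bphi_coc f)).
by apply: eq_bigr => f _; rewrite clsMz //; apply: bphi_coc.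
Qed.

Lemma phi_zero : (i + n)%N <> m -> forall x : Ext i (Ta n) (Ta m), x = 0.
Proof.
move=> im x; have [a ca <-] := cls_surj (bres n) x.
rewrite -(cls0 (bres n)); apply/cls_cob => //; first exact: is_coc0.
by rewrite subr0; apply: vanish.
Qed.

Hypothesis im : (i + n)%N = m.

Lemma phi_bij : bijective phi.
Proof.
have inj : injective phi.
  apply: raddf_inj => x; rewrite phi_cls -(cls0 (bres n)) => /cls_cob.
  rewrite subr0 => cob; apply/ffunP => f; rewrite ffunE; apply: (bphi_indep im) f.
  apply: cob; last exact: is_coc0.
  by apply: is_coc_sum => f; apply: (is_cocMz _ (bphi_coc f)).
have surj y : exists x, phi x = y.
  have [a ca <-] := cls_surj (bres n) y; have [e eE] := generate ca.
  exists (finfun e); rewrite phi_cls; apply/cls_cob => //.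
    by apply: is_coc_sum => f; apply: (is_cocMz _ (bphi_coc f)).
  rewrite -opprB; apply: cobN; move: eE; congr (coboundary (_ - _)).
  by apply: eq_bigr => f _; rewrite ffunE.
exists (fun y => sval (cid (surj y))) => [x|y]; last exact: svalP (cid (surj y)).
by apply: inj; apply: svalP (cid (surj _)).
Qed.

Lemma bc_coc o (s : {perm 'I_m}) : size o = m -> is_coc (P := bres n) (i := i) (bc n i o s).
Proof. exact: bc_cocycle. Qed.

(** The normal form for signs: any order of the letters inside the blocks represents the same class
    up to the signature of the resorting. *)
Lemma cls_bc o (s : {perm 'I_m}) (f : surj m n) : graded n i o -> (forall x, lab o (s x) = f x) ->
  cls (P := bres n) (i := i) (bc n i o s) = phi (surj_basis f) *~ (eps s * eps (srt f)).
Proof.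
move=> go sf; have so : size o = m by rewrite (graded_size go) addnC.
rewrite phi_basis -clsMz; last exact: bphi_coc.
have oE := bshape_unique go so sf; rewrite -oE in sf *.
apply/cls_cob; first by apply: bc_coc; rewrite size_bshape.
  by apply: (is_cocMz _ (bphi_coc f)).
exact: bc_class.
Qed.

Lemma push_bc o (s t : {perm 'I_m}) : nt_comp (Ta_perm s) (bc n i o t) = bc n i o (s * t)%g.
Proof.
apply: hnat_ext => k w gw; rewrite hnat_comp !hnat_bc // /bcoch.
case: ifP => _; last by rewrite raddf0.
by rewrite [LHS]tpow_permE; congr tpure; apply/ffunP => x; rewrite !ffunE permM.
Qed.

Lemma push_phi (f : surj m n) (s : {perm 'I_m}) :
  ext_push (Ta_perm s) (phi (surj_basis f)) =
  phi (surj_basis (surj_comp f (surj_perm s)) *~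
    \prod_(q < n) (-1) ^+ odd_perm (bar s (fiber (surj_comp f (surj_perm s)) q))).
Proof.
rewrite phi_basis ext_push_cls; last exact: bphi_coc.
rewrite push_bc (@cls_bc _ _ (surj_comp f (surj_perm s))) ?graded_bshape //.
  by rewrite raddfMz bar_sign.
by move=> x; rewrite permM lab_bshape !ffunE.
Qed.

End Phi.

(** * The Yoneda product *)

Section Flip.
Variables (X : eqType) (ml : X -> X -> seq (int * X)).
Local Notation word := (seq (bool * X)).

(* Sum over all ways of turning false flags of w into true flags so that the   *)
(* letters with a true flag carry, in order, the original flags p.             *)
Fixpoint flip (M : zmodType) (p : seq bool) (c : word -> M) (w : word) : M :=
  if w is (b, x) :: w' then
    if b then (if p is true :: p' then flip p' (fun v => c ((true, x) :: v)) w' else 0)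
    else flip p (fun v => c ((false, x) :: v)) w' *~ (-1) ^+ ndeg p +
      (if p is false :: p' then flip p' (fun v => c ((true, x) :: v)) w' else 0)
  else if p is [::] then c [::] else 0.

Lemma flip_ext (M : zmodType) p (c c' : word -> M) w :
  (forall v, size v = size w -> count id (unzip1 v) = size p ->
     (head true (unzip1 w) -> head true (unzip1 v)) -> c v = c' v) ->
  flip p c w = flip p c' w.
Proof.
elim: w p c c' => [|[b x] w IH] p c c' cc /=; first by case: p cc => // cc; apply: cc.
have H b' p' : (if b' then size p = (size p').+1 else p = p') -> (b -> b') ->
   flip p' (fun v => c ((b', x) :: v)) w = flip p' (fun v => c' ((b', x) :: v)) w.
  move=> pp bb; apply: IH => v vw vp _; apply: cc; rewrite /= ?vw ?vp //.
  by case: b' pp {bb} => ->.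
case: b H {cc} => H; first by case: p H => // -[] // p H; apply: H.
by rewrite (H false) //; congr (_ + _); case: p H => // -[] // p H; apply: H.
Qed.

Lemma flip0 (M : zmodType) p w : flip p (fun=> 0 : M) w = 0.
Proof.
elim: w p => [|[b x] w IH] p /=; first by case: p.
case: b; first by case: p => // -[].
by rewrite IH mul0rz add0r; case: p => // -[].
Qed.

Lemma flip_mor (M M' : zmodType) (f : {additive M -> M'}) p c w :
  f (flip p c w) = flip p (fun v => f (c v)) w.
Proof.
elim: w p c => [|[b x] w IH] p c /=; first by case: p => //=; rewrite raddf0.
case: b; first by case: p => [|[] p]; rewrite ?raddf0.
rewrite raddfD raddfMz IH; congr (_ + _).
by case: p => [|[] p]; rewrite ?raddf0.
Qed.

Lemma flipD (M : zmodType) p (c c' : word -> M) w :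
  flip p (fun v => c v + c' v) w = flip p c w + flip p c' w.
Proof.
elim: w p c c' => [|[b x] w IH] p c c' /=; first by case: p => //=; rewrite addr0.
case: b; first by case: p => [|[] p]; rewrite ?addr0.
rewrite IH mulrzDl addrACA; congr (_ + _).
by case: p => [|[] p]; rewrite ?addr0.
Qed.

Lemma flipMz (M : zmodType) p (c : word -> M) k w :
  flip p (fun v => c v *~ k) w = flip p c w *~ k.
Proof.
elim: w p c => [|[b x] w IH] p c /=; first by case: p => //=; rewrite mul0rz.
case: b; first by case: p => [|[] p]; rewrite ?mul0rz.
rewrite IH mulrzDl -!mulrzA mulrC; congr (_ + _).
by case: p => [|[] p]; rewrite ?mul0rz.
Qed.

Lemma flipN (M : zmodType) p (c : word -> M) w : flip p (fun v => - c v) w = - flip p c w.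
Proof. by have := flipMz p c (-1) w; rewrite mulrNz mulr1z => <-; apply: flip_ext => v *; rewrite mulrNz. Qed.

Lemma flip_sg (M : zmodType) p b (c : word -> M) w : flip p (fun v => sg b (c v)) w = sg b (flip p c w).
Proof. by case: b => //=; rewrite flipN. Qed.

Lemma wopMz (M : zmodType) (g : X -> M) k x y : wop ml (fun z => g z *~ k) x y = wop ml g x y *~ k.
Proof. by rewrite /wop mulrz_suml; apply: eq_bigr => q _; rewrite mulrzAC. Qed.

Lemma flip_wop (M : zmodType) p (c : X -> word -> M) x y w :
  flip p (fun v => wop ml (fun z => c z v) x y) w = wop ml (fun z => flip p (c z) w) x y.
Proof.
rewrite /wop; elim: (ml x y) => [|q s IH]; rewrite ?(big_nil, big_cons).
  by rewrite -[RHS](flip0 M p w); apply: flip_ext => v *; rewrite big_nil.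
rewrite -IH -flipMz -flipD; apply: flip_ext => v *; by rewrite big_cons.
Qed.

(** Merges on the two sides correspond: a letter merges with the one before it exactly when its own
    flag stays false, whether or not the left flag is turned. The sign at an unturned letter is the
    Koszul sign for passing it over the remaining flags, so [flip p] behaves as a map of degree
    [ndeg p]. *)
Lemma flip_wd (M : zmodType) p (c : word -> M) w :
  flip p (wd ml c) w = wd ml (flip p c) w *~ (-1) ^+ ndeg p.
Proof.
elim: w p c => [|[b x] w IH] p c /=; first by case: p => [|a p]; rewrite mul0rz.
have flipE p' b' : flip p' (fun v => sg b' (mrg ml c (b', x) v + wd ml (fun u => c ((b', x) :: u)) v)) w =
   sg b' (flip p' (mrg ml c (b', x)) w + wd ml (flip p' (fun u => c ((b', x) :: u))) w *~ (-1) ^+ ndeg p').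
  by rewrite flip_sg flipD IH.
have mE p' b' : flip p' (mrg ml c (b', x)) w =
   (if w is (false, y) :: u then wop ml (fun z => flip p' (fun v => c ((b', z) :: v)) u) x y *~ (-1) ^+ ndeg p' else 0).
  case: w {IH flipE} => [|[[] y] u] /=.
  - by case: p'.
  - by case: p' => // -[] // p'; apply: flip0.
  by rewrite flip_wop; case: p' => [|[] p']; rewrite ?flip0 addr0.
have ET p' := flipE p' true; have EF p' := flipE p' false; rewrite /= in ET EF.
have sq k (a : M) : a *~ (-1) ^+ k *~ (-1) ^+ k = a by rewrite -mulrzA -signr_odd -expr2 sqrr_sign.
case: b {flipE} => /=.
  case: p => [|[] p].
  - by rewrite wd0 addr0 mulr1z; case: w {IH mE ET EF} => // -[[] y] u //=; rewrite wopE0.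
  - rewrite ET mE mulrzDl /= /ndeg /= add0n; congr (_ + _).
    by case: w {IH mE ET EF} => [|[[] y] u] /=; rewrite ?mul0rz.
  - by rewrite wd0 addr0; case: w {IH mE ET EF} => [|[[] y] u] /=; rewrite ?wopE0 mul0rz.
have [t [tE tD]] : exists t : option (seq bool),
   (forall c' v, (if p is false :: p' then flip p' c' v else 0) = (if t is Some p' then flip p' c' v else 0 : M))
   /\ (if t is Some p' then ndeg p = (ndeg p').+1 else True).
  by case: p {IH} => [|[] p]; [exists None | exists None | exists (Some p)].
have -> : wd ml (fun v => flip p (fun u => c ((false, x) :: u)) v *~ (-1) ^+ ndeg p
    + (if p is false :: p' then flip p' (fun u => c ((true, x) :: u)) v else 0)) w =
  wd ml (fun v => flip p (fun u => c ((false, x) :: u)) v *~ (-1) ^+ ndeg p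
    + (if t is Some p' then flip p' (fun u => c ((true, x) :: u)) v else 0)) w.
  by apply: wd_ext => v; rewrite tE.
rewrite EF tE.
have mR : mrg ml (flip p c) (false, x) w = if w is (false, y) :: u then
    wop ml (fun z => flip p (fun v => c ((false, z) :: v)) u) x y *~ (-1) ^+ ndeg p +
    (if t is Some p' then wop ml (fun z => flip p' (fun v => c ((true, z) :: v)) u) x y else 0) else 0.
  case: w {IH mE ET EF} => [|[[] y] u] //=.
  have <- : wop ml (fun z => if t is Some p' then flip p' (fun v => c ((true, z) :: v)) u else 0) x y =
     if t is Some p' then wop ml (fun z => flip p' (fun v => c ((true, z) :: v)) u) x y else 0.
    by case: (t) => //; rewrite wopE0.
  rewrite -wopMz.
  by rewrite -wopD; apply: wop_ext => z _; rewrite tE.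
rewrite mR mE wdD wdMz; move: (wd ml (flip p _) w) => D1; case: t tE tD {mR} => [p'|] tE tD.
  rewrite ET mE tD exprS mulN1r; move: (wd ml (flip p' _) w) => D2; case: w {IH mE ET EF} => [|[[] y] u];
  rewrite ?(mulNrz, mulrNz, mulrzDl, sq, opprD, opprK, oppr0, add0r, addr0, mul0rz, add0r) //.
  by rewrite addrACA.
rewrite wd0; case: w {IH mE ET EF} => [|[[] y] u];
  by rewrite ?(mulNrz, mulrNz, mulrzDl, sq, opprD, opprK, oppr0, add0r, addr0, mul0rz, add0r).
Qed.

End Flip.

(** The flags of a composite surjection: the openings of [o] receive the flags of [p] one after the
    other, the other letters stay inside their block. *)
Fixpoint mrgf (o p : seq bool) : seq bool :=
  if o is b :: o' then
    if b then head true p :: mrgf o' (behead p) else false :: mrgf o' p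
  else [::].

(** Koszul exponent: each false flag of [o] passes the false flags of [p] that have not been used
    yet. *)
Fixpoint fsgn (o p : seq bool) : nat :=
  if o is b :: o' then (if b then fsgn o' (behead p) else ndeg p + fsgn o' p)%N else 0%N.

Lemma flip_word (X : eqType) (M : zmodType) (G : seq X -> M) (p o : seq bool) (w : seq (bool * X)) :
  size p = count id o ->
  flip p (fun v => if unzip1 v == o then G (unzip2 v) else 0) w =
  (if unzip1 w == mrgf o p then G (unzip2 w) else 0) *~ (-1) ^+ fsgn o p.
Proof.
elim: w p o G => [|[b x] w IH] p o G.
  by case: o p => [|b o] [|[] p] //=; rewrite ?mulr1z // ?mul0rz //; case: b; rewrite mul0rz.
have z0 b1 o' p' : flip p' (fun v : seq (bool * X) => if b1 :: unzip1 v == ~~ b1 :: o' then G (x :: unzip2 v) else 0) w = 0.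
  rewrite -[RHS](flip0 M p' w); apply: flip_ext => v *.
  by case: b1.
case: o => [|[] o] /= so.
- by case: p so => //= _; case: b; rewrite ?mul0rz // addr0 flip0 mul0rz.
- case: p so => // s p [so] /=; have IH' := IH p o (fun u => G (x :: u)) so.
  case: b; case: s; rewrite ?mul0rz //=; rewrite ?(z0 false o) ?mul0rz ?add0r //;
  by rewrite IH'.
have IH' := IH p o (fun u => G (x :: u)) so.
case: b => /=.
  by case: p so {IH'} => [|[] p] so; rewrite ?mul0rz // (z0 true o).
have -> : (if p is false :: p' then flip p' (fun v : seq (bool * X) => if true :: unzip1 v == false :: o then G (x :: unzip2 v) else 0) w else 0) = 0.
  by case: p {so IH'} => // -[] // p; rewrite (z0 true o).
by rewrite addr0 IH' -mulrzA -exprD addnC.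
Qed.

Lemma size_mrgf o p : size (mrgf o p) = size o.
Proof. by elim: o p => //= -[] o IH p /=; rewrite IH. Qed.

Lemma count_take_mrgf o p i : (count id o <= size p)%N ->
  count id (take i (mrgf o p)) = count id (take (count id (take i o)) p).
Proof.
elim: o p i => [|[] o IH] p i /= op; first by case: i => [|i]; rewrite take0.
  by case: p op => // s p op; case: i => [|i] //=; rewrite IH.
by case: i => [|i] /=; rewrite ?take0 // IH.
Qed.

(** Composition of labels: this is where the Yoneda product becomes composition of surjections. *)
Lemma lab_mrgf o p i : head true o -> size p = count id o -> (i < size o)%N ->
  lab (mrgf o p) i = lab p (lab o i).
Proof.
move=> ho so io; rewrite /lab count_take_mrgf ?so // prednK //; exact: count_take_gt0.
Qed.

Lemma head_mrgf o p : head true o -> head true p -> head true (mrgf o p).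
Proof. by case: o => [|[] o] //; case: p. Qed.

Lemma graded_mrgf o p m l q j : graded m q o -> graded l j p -> size p = m -> graded l (q + j) (mrgf o p).
Proof.
move=> /and3P[ho /eqP mE /eqP qE] /and3P[hp /eqP lE /eqP jE] pm.
have cE : count id (mrgf o p) = l.
  have := @count_take_mrgf o p (size o); rewrite mE pm leqnn take_size => /(_ isT).
  by rewrite -{1}(size_mrgf o p) take_size mE -pm take_size lE.
rewrite /graded head_mrgf // cE eqxx /= -(eqn_add2l l).
have := count_predC id (mrgf o p); rewrite cE size_mrgf => ->.
have := count_predC id o; have := count_predC id p; rewrite -/(ndeg p) -/(ndeg o) mE qE lE jE pm.
by move=> <- <-; apply/eqP; lia.
Qed.

(* Sum of h over the labels of the false positions of o, when q true flags    *)
(* precede o.                                                                  *)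
Fixpoint fsum (q : nat) (o : seq bool) (h : nat -> nat) : nat :=
  if o is b :: o' then (if b then fsum q.+1 o' h else h q.-1 + fsum q o' h)%N else 0%N.

Lemma fsumE q o h :
  (fsum q o h + \sum_(q <= r < q + count id o) h r =
   \sum_(i < size o) h (q + count id (take i.+1 o)).-1)%N.
Proof.
elim: o q => [|b o IH] q /=; first by rewrite addn0 big_geq // big_ord0.
rewrite big_ord_recl /= take0 /= addn0; case: b => /=.
  rewrite addnA addn1 addSn big_ltn ?ltnS ?leq_addr // addnCA -addSn IH; congr (_ + _)%N.
  by apply: eq_bigr => i _; rewrite /= addnA addn1.
by rewrite addn0 add0n -addnA IH; congr (_ + _)%N; apply: eq_bigr => i _; rewrite /= add0n.
Qed.

Lemma fsgn_fsum o p q : (q > 0)%N || head true o ->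
  fsgn o (drop q p) = fsum q o (fun r => ndeg (drop r.+1 p)).
Proof.
elim: o q => //= -[] o IH q h; first by rewrite -[behead _]drop1 drop_drop add1n IH.
by case: q h => //= q _; rewrite IH.
Qed.

(** In the shape of f the block q has one letter for each element of the fiber over q, and all but
    the first are false. *)
Lemma fsum_bshape m n (f : surj m n) h : fsum 0 (bshape f) h = (\sum_(q < n) fdeg f q * h q)%N.
Proof.
have := fsumE 0 (bshape f) h; rewrite add0n count_bshape size_bshape big_mkord => E.
apply/eqP; rewrite -(eqn_add2r (\sum_(q < n) h q)) E -big_split /=; apply/eqP.
rewrite (reindex_inj (@perm_inj _ (srt f))) /= (partition_big f xpredT) //=.
apply: eq_bigr => q _; rewrite (eq_bigr (fun=> h q)) => [|x /eqP <-]; last first.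
  by rewrite -lab_bshape /lab add0n.
rewrite sum_nat_const -mulSnr /fdeg prednK; last first.
  by have [x xq] := surjP f q; apply/card_gt0P; exists x; rewrite inE xq.
by congr (_ * _)%N; apply: eq_card => x; rewrite inE.
Qed.

Lemma sum_fdeg m n (f : surj m n) : (\sum_(q < n) fdeg f q + n)%N = m.
Proof.
have := fsum_bshape f (fun=> 1%N).
under eq_bigr do rewrite muln1.
move=> <-; have := fsumE 0 (bshape f) (fun=> 1%N).
by rewrite add0n count_bshape size_bshape !sum_nat_const_nat sum_nat_const card_ord !muln1 subn0.
Qed.

Lemma nt_compMzr (F G H : functor) (a : nattrans G H) (b : nattrans F G) k :
  nt_comp a (b *~ k) = nt_comp a b *~ k.
Proof.
exact: (raddfMz (HB.pack (nt_comp a) (GRing.isZmodMorphism.Build _ _ (nt_comp a) (@nt_compBr _ _ _ a))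
  : {additive nattrans F G -> nattrans F H})).
Qed.

Lemma nt_compMzl (F G H : functor) (a : nattrans G H) (b : nattrans F G) k :
  nt_comp (a *~ k) b = nt_comp a b *~ k.
Proof.
exact: (raddfMz (HB.pack (fun c => nt_comp c b) (GRing.isZmodMorphism.Build _ _ (fun c => nt_comp c b)
   (fun a a' => nt_compBl a a' b)) : {additive nattrans G H -> nattrans F H})).
Qed.

Lemma hnatMz n j F (a : nattrans (barc n j) F) z k (w : wrd k) : hnat (a *~ z) w = hnat a w *~ z.
Proof.
have hB (b c : nattrans (barc n j) F) : hnat (b - c) w = hnat b w - hnat c w by rewrite hnatD hnatN.
exact: (raddfMz (HB.pack (fun c => hnat c w) (GRing.isZmodMorphism.Build _ _ (fun c => hnat c w) hB)
  : {additive nattrans (barc n j) F -> F k})).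
Qed.

Lemma sgn_odd a b : odd a = odd b -> (-1) ^+ a = (-1) ^+ b :> int.
Proof. by rewrite -(signr_odd _ a) => ->; rewrite signr_odd. Qed.

Section YonedaChain.
Variables (l m p : nat) (o : seq bool).
Hypothesis go : graded l p o.
Hypothesis so : size o = m.

Lemma flip_wmap k k' (u : grhom k k') (M : zmodType) (c : wrd k' -> M) w :
  flip o c (wmap u w) = flip o (fun v => c (wmap u v)) w.
Proof.
elim: w o c => [|[b x] w IH] q c //=; case: b => /=; first by case: q => // -[] q //; rewrite IH.
by rewrite IH; congr (_ + _); case: q => // -[] // q; rewrite IH.
Qed.

Lemma flip_graded_ext j k (M : zmodType) (c c' : wrd k -> M) w :
  graded l (j + p) (unzip1 w) ->
  (forall v, graded m j (unzip1 v) -> c v = c' v) -> flip o c w = flip o c' w.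
Proof.
move=> gw cc; apply: flip_ext => v vw vo vh; apply: cc; rewrite /graded vh; last by case/and3P: gw.
rewrite vo so eqxx /=; have := count_predC id (unzip1 v); rewrite vo so size_map vw.
have := graded_size gw; rewrite size_map => -> E.
have lp : (l + p)%N = m by rewrite -so (graded_size go).
by rewrite -(eqn_add2l m) E; apply/eqP; lia.
Qed.

(** [flip o] commutes with the differentials up to (-1)^p; the factor (-1)^(p j) in degree j makes
    it a chain map. *)
Definition ychain j : nattrans (barc l (j + p)) (barc m j) :=
  oper (n := l) (j := j + p) (n' := m) (j' := j)
    (th := fun k M => @flip (freegrp k) M o) (fun k M M' f => flip_mor f o)
    flip_wmap (@flip_graded_ext j) *~ (-1) ^+ (p * j).

Lemma hnat_ychain j F (a : nattrans (barc m j) F) k (w : wrd k) :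
  graded l (j + p) (unzip1 w) ->
  hnat (nt_comp a (ychain j)) w = flip o (hnat a (k := k)) w *~ (-1) ^+ (p * j).
Proof.
by move=> gw; rewrite nt_compMzr hnatMz hnat_oper.
Qed.

Lemma flip_bcoch (o' : seq bool) m' (s : {perm 'I_m'}) k (w : wrd k) : count id o' = m ->
  flip o (bcoch o' s (k := k)) w = bcoch (mrgf o' o) s w *~ (-1) ^+ fsgn o' o.
Proof.
move=> co; pose G (u : seq (freegrp k)) : Ta m' k := tpure [ffun x => ab_pi (nth 1%g u (s x)) : abF k].
have bE (q : seq bool) (v : wrd k) : bcoch q s v = if unzip1 v == q then G (unzip2 v) else 0.
  rewrite /bcoch; case: ifP => // _; congr tpure; apply/ffunP => x; rewrite !ffunE /lett.
  case: (ltnP (s x) (size v)) => sv; first by rewrite (nth_map (true, 1%g)).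
  by rewrite !nth_default ?size_map.
rewrite bE -flip_word ?so ?co //; apply: flip_ext => v *; exact: bE.
Qed.

Lemma mrgf_nseq q : mrgf (nseq (size q) true) q = q.
Proof. by elim: q => //= b q ->. Qed.

Lemma fsgn_nseq k q : fsgn (nseq k true) q = 0%N.
Proof. by elim: k q => //= k IH q; rewrite IH. Qed.

Lemma ychain_lift : is_chain_lift (C := fun j => bres l (j + p)) (fun j => pr_d (bres l) (j + p))
  (bres m) (bc l p o (1 : {perm 'I_m})%g) ychain.
Proof.
split=> [|j].
  apply: hnat_ext => k w gw; rewrite hnat_ychain // muln0 mulr1z hnat_bc //.
  rewrite (@flip_graded_ext 0 _ _ _ (bcoch (nseq m true) 1%g (k := k))) //; last first.
    by move=> v gv; exact: hnat_bc.
  by rewrite flip_bcoch ?count_nseq ?mul1n // fsgn_nseq mulr1z -so mrgf_nseq.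
have gS k (w : wrd k) : graded l (j.+1 + p) (unzip1 w) = graded l (j + p).+1 (unzip1 w) by [].
rewrite -[LHS]nt_comp1l -[RHS]nt_comp1l !nt_compA; apply: hnat_ext => k w gw.
rewrite hnat_ychain // -[X in _ = hnat X _]/(nt_comp (nt_comp (nt_id _) (ychain j)) (bdiff l (j + p))).
rewrite (hnat_diff (nt_comp (nt_id _) (ychain j))) //.
rewrite (@wd_graded_ext _ _ _ _ (fun v => flip o (hnat (nt_id (barc m j)) (k := k)) v *~ (-1) ^+ (p * j)) _ _ _ gw); last first.
  by move=> v gv; rewrite hnat_ychain.
rewrite wdMz (@flip_graded_ext j.+1 _ _ _ (wd (@mlG k) (hnat (nt_id (barc m j)) (k := k)))) //; last first.
  by move=> v gv; exact: hnat_diff.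
rewrite flip_wd -mulrzA -exprD; congr (_ *~ _).
have -> : ndeg o = p by case/and3P: go => _ _ /eqP.
by apply: sgn_odd; rewrite mulnS !oddD addKb.
Qed.

(** The left factor carries the identity permutation because the explicit lift lies over such a
    representative, which is the one of an order preserving surjection. *)
Lemma yoneda_bc q n (o' : seq bool) (s : {perm 'I_n}) : graded m q o' -> size o' = n ->
  yoneda (cls (P := bres l) (i := p) (bc l p o (1 : {perm 'I_m})%g))
    (cls (P := bres m) (i := q) (bc m q o' s)) =
  cls (P := bres l) (i := q + p) (bc l (q + p) (mrgf o' o) s *~ (-1) ^+ (p * q + fsgn o' o)).
Proof.
move=> go' so'; rewrite (yoneda_cls ychain_lift); last 2 first.
- exact: bc_coc.
- exact: bc_coc.
congr (cls _); apply: hnat_ext => k w gw; rewrite hnat_ychain //.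
rewrite (@flip_graded_ext q _ _ _ (bcoch o' s (k := k))) //; last first.
  by move=> v gv; exact: hnat_bc.
rewrite flip_bcoch; last by case/and3P: go' => _ /eqP.
by rewrite hnatMz hnat_bc // exprD mulrC mulrzA.
Qed.
End YonedaChain.

Section YonedaBasis.
Variables (l m n p q : nat) (s : surj m l) (f : surj n m).
Hypothesis pm : (p + l)%N = m.
Hypothesis qn : (q + m)%N = n.
Hypothesis sm : {homo s : a b / (a <= b)%N}.

Lemma srt_mono1 : srt s = 1%g.
Proof.
apply/permP => x; apply: val_inj; rewrite -[LHS]/(nat_of_ord (srt s x)) srtE perm1.
rewrite -[RHS](card_ltn_ord (ltnW (ltn_ord x))); apply: eq_card => y; rewrite !inE /flt.
case: (ltnP y x) => xy; last by rewrite ltnNge (sm xy) andbF.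
by have := sm (ltnW xy); rewrite andbT orbC leq_eqVlt.
Qed.

Lemma yoneda_basis :
  yoneda (phi l m p (surj_basis s)) (phi m n q (surj_basis f)) =
  phi l n (q + p) (surj_basis (surj_comp s f) *~ comp_sign s f).
Proof.
rewrite !phi_basis /bphi srt_mono1.
have gs := graded_bshape s pm; have gf := graded_bshape f qn.
rewrite (yoneda_bc gs (size_bshape s) _ gf (size_bshape f)).
have E x : lab (mrgf (bshape f) (bshape s)) (srt f x) = surj_comp s f x.
  rewrite lab_mrgf ?bshape_head ?size_bshape ?count_bshape // lab_bshape !ffunE.
  by rewrite -[f x](perm1 (f x)) -srt_mono1 lab_bshape srt_mono1 perm1.
have gsf : graded l (q + p) (mrgf (bshape f) (bshape s)).
  exact: graded_mrgf gf gs (size_bshape s).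
rewrite clsMz; last by apply: bc_coc; rewrite size_mrgf size_bshape.
rewrite (cls_bc _ gsf E); last by rewrite -addnA pm.
rewrite eps_srt_comp // raddfMz -mulrzA mulrC; congr (_ *~ (_ * _)).
rewrite -[bshape s]drop0 fsgn_fsum ?bshape_head // fsum_bshape.
(* Up to position j, the shape of s has j + 1 flags of which s j + 1 are true, hence j - s j false
   ones; the remaining false flags come after j, and there are p in all. *)
have D (j : 'I_m) : ((j - s j) + ndeg (drop j.+1 (bshape s)) = p)%N.
  have /and3P[hs _ /eqP dp] := gs; have jm : (j < size (bshape s))%N by rewrite size_bshape.
  have labj : (count id (take j.+1 (bshape s))).-1 = s j.
    by have := lab_bshape s j; rewrite srt_mono1 perm1.
  have c0 := count_take_gt0 hs jm.
  have cE : (count id (take j.+1 (bshape s)) + ndeg (take j.+1 (bshape s)) = j.+1)%N.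
    by rewrite -[RHS](size_takel jm); exact: count_predC.
  rewrite -dp -[in RHS](cat_take_drop j.+1 (bshape s)) /ndeg count_cat; congr (_ + _)%N.
  by rewrite -labj -/(ndeg _); lia.
(* The degrees [fdeg f j] add up to q, so the two sums are complementary in q p; modulo 2 the factor
   (-1)^(p q) exchanges one for the other, which gives the exponent of [comp_sign]. *)
have AB : (\sum_(j < m) fdeg f j * (j - s j) + \sum_(j < m) fdeg f j * ndeg (drop j.+1 (bshape s)) = q * p)%N.
  rewrite -big_split /=; under eq_bigr => j _ do rewrite -mulnDr D.
  by rewrite -big_distrl /=; congr (_ * _)%N; apply/eqP; rewrite -(eqn_add2r m) sum_fdeg qn.
by apply: sgn_odd; rewrite mulnC -AB -addnA oddD addnn odd_double addbF.
Qed.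
End YonedaBasis.

(** * Permutation of the first variable *)

(* The position of the true flag number q.                                     *)
Fixpoint bcut (q : nat) (o : seq bool) : nat :=
  if o is b :: o' then
    if b then (if q is q'.+1 then (bcut q' o').+1 else 0%N) else (bcut q o').+1
  else 0%N.

Lemma bcut_cat (A v : seq bool) q : count id A = q -> head true v -> bcut q (A ++ v) = size A.
Proof.
by move=> <- hv; elim: A => [|[] A IH] /=; [case: v hv => // -[] | rewrite IH | rewrite IH].
Qed.

Lemma bcut_exists (T : Type) q (w : seq (bool * T)) : (q <= count id (unzip1 w))%N ->
  exists A v, [/\ w = A ++ v, count id (unzip1 A) = q & head true (unzip1 v)].
Proof.
elim: w q => [|[b x] w IH] q /=; first by rewrite leqn0 => /eqP ->; exists [::], [::].
case: b => /=.
  case: q => [|q] qw; first by exists [::], ((true, x) :: w).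
  by have [A [v [-> <- hv]]] := IH q qw; exists ((true, x) :: A), v.
by move=> qw; have [A [v [-> <- hv]]] := IH q qw; exists ((false, x) :: A), v.
Qed.

Lemma head_cat (A v : seq bool) : head true A -> head true v -> head true (A ++ v).
Proof. by case: A. Qed.

Lemma head_catl (A v : seq bool) : head true (A ++ v) -> head true A.
Proof. by case: A. Qed.

Lemma lab_cat A v i : head true v -> (i < size (A ++ v))%N ->
  lab (A ++ v) i = if (i < size A)%N then lab A i else (count id A + lab v (i - size A))%N.
Proof.
move=> hv; rewrite size_cat /lab => iA; case: ltnP => iA'; first by rewrite takel_cat.
rewrite take_cat ltnNge (leqW iA') /= count_cat subSn //.
have io : (i - size A < size v)%N by rewrite ltn_subLR.
by have := count_take_gt0 hv io; case: (count id (take _ v)) => // c _; rewrite addnS.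
Qed.

Section FsumMore.
Variable h : nat -> nat.

Lemma fsum_cat q o o' : fsum q (o ++ o') h = (fsum q o h + fsum (q + count id o) o' h)%N.
Proof.
elim: o q => [|[] o IH] q /=; first by rewrite addn0.
  by rewrite IH add1n addnS.
by rewrite IH add0n addnA.
Qed.

Lemma fsum_const q o c : head true o -> (forall r, (q <= r < q + count id o)%N -> h r = c) ->
  fsum q o h = (ndeg o * c)%N.
Proof.
have H o' q' : h q'.-1 = c -> (forall r, (q' <= r < q' + count id o')%N -> h r = c) ->
    fsum q' o' h = (ndeg o' * c)%N.
  elim: o' q' => [|[] o' IH] q' //= hq hr; rewrite /ndeg /= -/(ndeg o').
    by rewrite add0n IH //=; [apply: hr; lia | move=> r rr; apply: hr; lia].
  by rewrite hq mulnDl mul1n IH.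
case: o => [|[] o] //= _ hr; rewrite /ndeg /= -/(ndeg o) add0n H //=; first by apply: hr; lia.
by move=> r rr; apply: hr; lia.
Qed.
End FsumMore.

Lemma nth_cat_add (T : Type) (x0 : T) u v r : nth x0 (u ++ v) (size u + r) = nth x0 v r.
Proof. by rewrite nth_cat ltnNge leq_addr /= addKn. Qed.

Lemma nth_catl (T : Type) (x0 : T) u v r : (r < size u)%N -> nth x0 (u ++ v) r = nth x0 u r.
Proof. by move=> ru; rewrite nth_cat ru. Qed.

Section Transport.
Variables a b c b' d : nat.

(** Sends a position in A B' M B C to the position of the same letter in A B M B' C, for parts of
    sizes a, b, c, b', d in the latter order. *)
Definition gpos (i : nat) : nat :=
  if (i < a)%N then i else if (i < a + b')%N then (i + b + c)%N else
  if (i < a + b' + c)%N then (i - b' + b)%N else if (i < a + b' + c + b)%N then (i - b' - c)%N else i.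

Variant gpos_spec : nat -> nat -> Prop :=
| Gpos1 r of (r < a)%N : gpos_spec r r
| Gpos2 r of (r < b')%N : gpos_spec (a + r) (a + (b + (c + r)))
| Gpos3 r of (r < c)%N : gpos_spec (a + (b' + r)) (a + (b + r))
| Gpos4 r of (r < b)%N : gpos_spec (a + (b' + (c + r))) (a + r)
| Gpos5 r of (r < d)%N : gpos_spec (a + (b' + (c + (b + r)))) (a + (b + (c + (b' + r)))).

Lemma gposP i : (i < a + (b' + (c + (b + d))))%N -> gpos_spec i (gpos i).
Proof.
move=> im; rewrite /gpos; case: ltnP => i1; first exact: Gpos1.
case: ltnP => i2.
  by rewrite (_ : i + b + c = a + (b + (c + (i - a))))%N -1?{1}(subnKC i1); [apply: Gpos2; lia | lia].
case: ltnP => i3.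
  have -> : (i - b' + b = a + (b + (i - a - b')))%N by lia.
  by have {1}-> : i = (a + (b' + (i - a - b')))%N by [lia]; apply: Gpos3; lia.
case: ltnP => i4.
  have -> : (i - b' - c = a + (i - a - b' - c))%N by lia.
  by have {1}-> : i = (a + (b' + (c + (i - a - b' - c))))%N by [lia]; apply: Gpos4; lia.
have {2}-> : i = (a + (b + (c + (b' + (i - a - b' - c - b)))))%N by lia.
by have {1}-> : i = (a + (b' + (c + (b + (i - a - b' - c - b)))))%N by [lia]; apply: Gpos5; lia.
Qed.

Lemma gpos_lt i : (i < a + (b' + (c + (b + d))))%N -> (gpos i < a + (b + (c + (b' + d))))%N.
Proof. by case/gposP => r rr; lia. Qed.

Lemma gpos_inj i i' : (i < a + (b' + (c + (b + d))))%N -> (i' < a + (b' + (c + (b + d))))%N ->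
  gpos i = gpos i' -> i = i'.
Proof. by case/gposP => r rr; case/gposP => r' rr'; lia. Qed.

End Transport.

Lemma lab_catl A v r : (r < size A)%N -> lab (A ++ v) r = lab A r.
Proof. by move=> rA; rewrite /lab takel_cat. Qed.

Lemma lab_catr A v r : head true v -> (r < size v)%N -> lab (A ++ v) (size A + r) = (count id A + lab v r)%N.
Proof.
move=> hv rv; have iA : (size A + r < size (A ++ v))%N by rewrite size_cat ltn_add2l.
by rewrite lab_cat // ltnNge leq_addr /= addKn.
Qed.

Section Swap.
Variables k l : nat.

Definition swp (T : Type) (w : seq (bool * T)) : seq (bool * T) :=
  let o := unzip1 w in
  let sli p q := drop p (take q w) in
  take (bcut k o) w ++ sli (bcut l o) (bcut l.+1 o) ++ sli (bcut k.+1 o) (bcut l o)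
    ++ sli (bcut k o) (bcut k.+1 o) ++ drop (bcut l.+1 o) w.

(* Exponent of the Koszul sign.                                               *)
Definition swps (o : seq bool) : nat :=
  let b := fsum 0 o (fun r => r == k) in
  let b' := fsum 0 o (fun r => r == l) in
  (b * b' + (b + b') * fsum 0 o (fun r => (k < r < l)%N))%N.

(** B and B' are the blocks k and l, M lies between them, A before and C after. Each part is empty
    or opens a block, so no merge crosses a cut. *)
Definition cut5 (A B M B' C : seq bool) :=
  [/\ head true A, head true B, head true M, head true B' & head true C] /\
  [/\ count id A = k, count id B = 1%N, (k.+1 + count id M)%N = l & count id B' = 1%N].

Lemma cut5_exists (T : Type) (w : seq (bool * T)) : head true (unzip1 w) -> (k < l)%N ->
  (l < count id (unzip1 w))%N -> exists A B M B' C, w = A ++ B ++ M ++ B' ++ C /\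
    cut5 (unzip1 A) (unzip1 B) (unzip1 M) (unzip1 B') (unzip1 C).
Proof.
move=> hw kl ln.
have [A [v [wE cA hv]]] := bcut_exists (ltnW (ltn_trans kl ln)).
have cw : count id (unzip1 w) = (k + count id (unzip1 v))%N by rewrite wE /unzip1 map_cat count_cat cA.
have [B [v2 [vE cB hv2]]] : exists B v2, [/\ v = B ++ v2, count id (unzip1 B) = 1%N & head true (unzip1 v2)].
  by apply: bcut_exists; lia.
have cv : count id (unzip1 v) = (1 + count id (unzip1 v2))%N by rewrite vE /unzip1 map_cat count_cat cB.
have [M [v3 [v2E cM hv3]]] : exists M v3, [/\ v2 = M ++ v3, count id (unzip1 M) = (l - k.+1)%N & head true (unzip1 v3)].
  by apply: bcut_exists; lia.
have cv2 : count id (unzip1 v2) = (l - k.+1 + count id (unzip1 v3))%N by rewrite v2E /unzip1 map_cat count_cat cM.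
have [B' [C [v3E cB' hC]]] : exists B' C, [/\ v3 = B' ++ C, count id (unzip1 B') = 1%N & head true (unzip1 C)].
  by apply: bcut_exists; lia.
exists A, B, M, B', C; rewrite wE vE v2E v3E; split=> //; split; split=> //.
- by move: hw; rewrite wE /unzip1 map_cat; apply: head_catl.
- by move: hv; rewrite vE /unzip1 map_cat; apply: head_catl.
- by move: hv2; rewrite v2E /unzip1 map_cat; apply: head_catl.
- by move: hv3; rewrite v3E /unzip1 map_cat; apply: head_catl.
by rewrite cM; lia.
Qed.

Lemma unzip1_cat (S T : Type) (u v : seq (S * T)) : unzip1 (u ++ v) = unzip1 u ++ unzip1 v.
Proof. exact: map_cat. Qed.

Lemma bcut5 A B M B' C : cut5 A B M B' C -> let o := A ++ B ++ M ++ B' ++ C in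
  [/\ bcut k o = size A, bcut k.+1 o = size (A ++ B), bcut l o = size (A ++ B ++ M)
    & bcut l.+1 o = size (A ++ B ++ M ++ B')].
Proof.
case=> -[hA hB hM hB' hC] [cA cB cM cB'] o; rewrite /o; split.
- by apply: bcut_cat => //; do !apply: head_cat.
- by rewrite catA; apply: bcut_cat; rewrite ?count_cat ?cA ?cB ?addn1 //; do !apply: head_cat.
- rewrite catA catA -[(A ++ B) ++ M]catA; apply: bcut_cat; rewrite ?count_cat ?cA ?cB -?cM; first by lia.
  by apply: head_cat.
rewrite (_ : A ++ _ = (A ++ B ++ M ++ B') ++ C); last by rewrite -!catA.
by apply: bcut_cat; rewrite // !count_cat cA cB cB' -cM; lia.
Qed.

Lemma swp_cat (T : Type) (A B M B' C : seq (bool * T)) :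
  cut5 (unzip1 A) (unzip1 B) (unzip1 M) (unzip1 B') (unzip1 C) ->
  swp (A ++ B ++ M ++ B' ++ C) = A ++ B' ++ M ++ B ++ C.
Proof.
move=> /bcut5[]; rewrite -!unzip1_cat !size_map /swp => -> -> -> ->.
rewrite take_size_cat //; congr (_ ++ _).
have sliE (u v x y : seq (bool * T)) p q : u ++ v ++ x = y -> size u = p -> size (u ++ v) = q ->
    drop p (take q y) = v.
  by move=> <- <- <-; rewrite catA take_size_cat // drop_size_cat.
have s3 : size ((A ++ B ++ M) ++ B') = size (A ++ B ++ M ++ B') by rewrite -!catA.
have s2 : size ((A ++ B) ++ M) = size (A ++ B ++ M) by rewrite -!catA.
rewrite (sliE (A ++ B ++ M) B' C _ _ _ _ (erefl _) s3); last by rewrite -!catA.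
rewrite (sliE (A ++ B) M (B' ++ C) _ _ _ _ (erefl _) s2); last by rewrite -!catA.
rewrite (sliE A B (M ++ B' ++ C) _ _ _ (erefl _) (erefl _) (erefl _)).
have -> : A ++ B ++ M ++ B' ++ C = (A ++ B ++ M ++ B') ++ C by rewrite -!catA.
by rewrite drop_size_cat.
Qed.

Lemma swps_cat A B M B' C : cut5 A B M B' C ->
  swps (A ++ B ++ M ++ B' ++ C) = (ndeg B * ndeg B' + (ndeg B + ndeg B') * ndeg M)%N.
Proof.
case=> -[hA hB hM hB' hC] [cA cB cM cB'].
have F h c0 c1 c2 c3 c4 : (forall r, r < k -> h r = c0)%N -> h k = c1 -> (forall r, k < r < l -> h r = c2)%N ->
    h l = c3 -> (forall r, l < r -> h r = c4)%N ->
    fsum 0 (A ++ B ++ M ++ B' ++ C) h = (ndeg A * c0 + ndeg B * c1 + ndeg M * c2 + ndeg B' * c3 + ndeg C * c4)%N.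
  move=> h0 h1 h2 h3 h4; rewrite !fsum_cat !cA !cB !cB' !addn1 !add0n cM.
  rewrite (fsum_const (c := c0) hA) ?(fsum_const (q := k) (c := c1) hB) ?(fsum_const (q := k.+1) (c := c2) hM) ?(fsum_const (q := l) (c := c3) hB') ?(fsum_const (q := l.+1) (c := c4) hC) ?addnA //.
  - by move=> r rr; apply: h4; lia.
  - by move=> r rr; rewrite (_ : r = l) //; lia.
  - by move=> r rr; apply: h2; lia.
  - by move=> r rr; rewrite (_ : r = k) //; lia.
  - by move=> r rr; apply: h0; lia.
have kl : (k < l)%N by rewrite -cM leq_addr.
have b2n (h : nat -> bool) r (c : bool) : h r = c -> (h r : nat) = c by move=> ->.
rewrite /swps (F (fun r => r == k : nat) 0%N 1%N 0%N 0%N 0%N) ?eqxx //; try by move=> *; apply: (b2n (fun r => r == k) _ false); lia.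
  rewrite (F (fun r => r == l : nat) 0%N 0%N 0%N 1%N 0%N) ?eqxx //; try by move=> *; apply: (b2n (fun r => r == l) _ false); lia.
    rewrite (F (fun r => (k < r < l)%N : nat) 0%N 0%N 1%N 0%N 0%N) //.
    - by rewrite !muln0 !muln1 !addn0 !add0n.
    - by move=> r rr; apply: (b2n (fun r => (k < r < l)%N) _ false); lia.
    - by rewrite ltnn.
    - by move=> r ->.
    - by rewrite ltnn andbF.
    by move=> r rr; apply: (b2n (fun r => (k < r < l)%N) _ false); lia.
Qed.

Lemma cut5_swap A B M B' C : cut5 A B M B' C -> cut5 A B' M B C.
Proof. by case=> -[? ? ? ? ?] [? ? ? ?]. Qed.

Section FiveLabels.
Variables A B M B' C : seq bool.
Hypothesis cut : cut5 A B M B' C.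
Local Notation o := (A ++ B ++ M ++ B' ++ C).

Lemma label_lt W r : head true W -> (r < size W)%N -> (lab W r < count id W)%N.
Proof.
by move=> hW; apply: (lab_lt (j := ndeg W)); rewrite /graded hW !eqxx.
Qed.

Lemma label1 r : (r < size A)%N -> (lab o r < k)%N /\ lab o r = lab A r.
Proof.
case: cut => -[hA _ _ _ _] [<- _ _ _] rA; rewrite lab_catl //; split=> //; exact: label_lt.
Qed.

Lemma label2 r : (r < size B)%N -> lab o (size A + r) = k.
Proof.
case: cut => -[_ hB hM hB' hC] [<- cB _ _] rB; have := label_lt hB rB; rewrite cB => lB.
rewrite lab_catr ?lab_catl //; [lia | by do !apply: head_cat | by rewrite size_cat; apply: ltn_addr].
Qed.

Lemma label3 r : (r < size M)%N -> lab o (size A + (size B + r)) = (k.+1 + lab M r)%N /\ (k.+1 + lab M r < l)%N.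
Proof.
case: cut => -[_ hB hM hB' hC] [<- cB <- _] rM; have := label_lt hM rM => lM.
rewrite lab_catr; [|by do !apply: head_cat|by rewrite !size_cat; lia].
rewrite lab_catr; [|by do !apply: head_cat|by rewrite !size_cat; lia].
by rewrite lab_catl // cB; split; lia.
Qed.

Lemma label4 r : (r < size B')%N -> lab o (size A + (size B + (size M + r))) = l.
Proof.
case: cut => -[_ hB hM hB' hC] [<- cB <- cB'] rB; have := label_lt hB' rB; rewrite cB' => lB.
rewrite lab_catr; [|by do !apply: head_cat|by rewrite !size_cat; lia].
rewrite lab_catr; [|by do !apply: head_cat|by rewrite !size_cat; lia].
rewrite lab_catr; [|by apply: head_cat|by rewrite !size_cat; lia].
by rewrite lab_catl // cB; lia.
Qed.

Lemma label5 r : (r < size C)%N -> lab o (size A + (size B + (size M + (size B' + r)))) = (l.+1 + lab C r)%N.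
Proof.
case: cut => -[_ hB hM hB' hC] [<- cB <- cB'] rC.
rewrite lab_catr; [|by do !apply: head_cat|by rewrite !size_cat; lia].
rewrite lab_catr; [|by do !apply: head_cat|by rewrite !size_cat; lia].
rewrite lab_catr; [|by apply: head_cat|by rewrite !size_cat; lia].
by rewrite lab_catr // cB cB'; lia.
Qed.
End FiveLabels.

Section SwapDiff.
Variables (X : eqType) (ml : X -> X -> seq (int * X)) (M : zmodType).
Implicit Types (c : seq (bool * X) -> M) (w : seq (bool * X)).

Definition thswp c w : M := c (swp w) *~ (-1) ^+ swps (unzip1 w).

Lemma thswp_cat c (A B N B' C : seq (bool * X)) :
  cut5 (unzip1 A) (unzip1 B) (unzip1 N) (unzip1 B') (unzip1 C) ->
  thswp c (A ++ B ++ N ++ B' ++ C) = c (A ++ B' ++ N ++ B ++ C) *~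
    (-1) ^+ (ndeg (unzip1 B) * ndeg (unzip1 B') + (ndeg (unzip1 B) + ndeg (unzip1 B')) * ndeg (unzip1 N)).
Proof. by move=> cut; rewrite /thswp swp_cat // !unzip1_cat swps_cat. Qed.

Lemma step_inv w v : step ml w v -> [/\ count id (unzip1 v) = count id (unzip1 w),
  head true (unzip1 v) = head true (unzip1 w) & ndeg (unzip1 w) = (ndeg (unzip1 v)).+1].
Proof.
move=> /step_flags[A [b [C [-> ->]]]]; rewrite /ndeg !count_cat /= add0n; split=> //; last by lia.
by case: A.
Qed.

Lemma wd_cat5 c (A B N B' C : seq (bool * X)) :
  cut5 (unzip1 A) (unzip1 B) (unzip1 N) (unzip1 B') (unzip1 C) ->
  let a := ndeg (unzip1 A) in let b := ndeg (unzip1 B) in let n := ndeg (unzip1 N) in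
  let b' := ndeg (unzip1 B') in
  wd ml c (A ++ B ++ N ++ B' ++ C) =
  wd ml (fun u => c (u ++ B ++ N ++ B' ++ C)) A +
  wd ml (fun u => c (A ++ u ++ N ++ B' ++ C)) B *~ (-1) ^+ a +
  wd ml (fun u => c (A ++ B ++ u ++ B' ++ C)) N *~ (-1) ^+ (a + b) +
  wd ml (fun u => c (A ++ B ++ N ++ u ++ C)) B' *~ (-1) ^+ (a + b + n) +
  wd ml (fun u => c (A ++ B ++ N ++ B' ++ u)) C *~ (-1) ^+ (a + b + n + b').
Proof.
case=> -[hA hB hN hB' hC] _ a b n b'; rewrite wd_cat; last by rewrite !unzip1_cat; do !apply: head_cat.
rewrite wd_cat; last by rewrite !unzip1_cat; do !apply: head_cat.
rewrite wd_cat; last by rewrite !unzip1_cat; do !apply: head_cat.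
rewrite wd_cat //.
by rewrite !mulrzDl -!mulrzA -!exprD !addrA -/a -/b -/n -/b' ![(n + _)%N]addnC ![(b + _)%N]addnC ![(b' + _)%N]addnC ?addnA ![(a + _)%N]addnC.
Qed.

(** The Leibniz rule splits the differential over the five parts. A merge inside one part changes
    its degree by one, and the Koszul exponent changes accordingly, so the signs of the two sides
    match part by part. *)
Lemma thswp_wd c (A B N B' C : seq (bool * X)) :
  cut5 (unzip1 A) (unzip1 B) (unzip1 N) (unzip1 B') (unzip1 C) ->
  wd ml (thswp c) (A ++ B ++ N ++ B' ++ C) = thswp (wd ml c) (A ++ B ++ N ++ B' ++ C).
Proof.
move=> cut; rewrite thswp_cat // !wd_cat5 //; last exact: cut5_swap.
have /= := cut; case=> -[hA hB hN hB' hC] [cA cB cN cB'].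
rewrite !mulrzDl -!mulrzA -!exprD -!wdMz.
set b := ndeg (unzip1 B); set b' := ndeg (unzip1 B'); set n := ndeg (unzip1 N); set a := ndeg (unzip1 A).
have sg2 x y z : y = (x + (z + z))%N -> (-1) ^+ x = (-1) ^+ y :> int.
  by move=> ->; apply: sgn_odd; rewrite oddD addnn odd_double addbF.
rewrite [RHS](ACl (1*4*3*2*5))%AC /=.
congr (_ + _ + _ + _ + _); apply: wd_step_ext => v /step_inv[cv hv dv];
  (rewrite thswp_cat; last by split; split; rewrite ?cv ?hv); rewrite -?mulrzA -?exprD; congr (_ *~ _);
  rewrite -/b -/b' -/n -?/a.
- by rewrite [b]dv; apply: (sg2 _ _ (b' + n)%N); ring.
- rewrite [n]dv; apply: sgn_odd; rewrite !(oddD, oddM, oddS).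
  by move: (odd a) (odd b) (odd b') (odd (ndeg _)) => [] [] [] [].
- rewrite [b']dv; apply: sgn_odd; rewrite !(oddD, oddM, oddS).
  by move: (odd a) (odd b) (odd n) (odd (ndeg _)) => [] [] [] [].
apply: sgn_odd; rewrite !(oddD, oddM).
by move: (odd a) (odd b) (odd n) (odd b') => [] [] [] [].
Qed.

End SwapDiff.

Section SwapChain.
Variable n : nat.
Hypothesis kl : (k < l)%N.
Hypothesis ln : (l < n)%N.

Lemma swp_graded (T : Type) (w : seq (bool * T)) j : graded n j (unzip1 w) -> graded n j (unzip1 (swp w)).
Proof.
case/and3P=> hw /eqP cw dw.
have [|A [B [N [B' [C [wE cut]]]]]] := @cut5_exists _ w hw kl; first by rewrite cw.
have [[hA hB hN hB' hC] _] := cut.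
rewrite wE in cw dw; rewrite wE swp_cat // /graded !unzip1_cat; apply/and3P; split.
- by do !apply: head_cat.
- by move: cw; rewrite !unzip1_cat !count_cat => <-; apply/eqP; lia.
by move: dw; rewrite /ndeg !unzip1_cat !count_cat => /eqP <-; apply/eqP; lia.
Qed.

Lemma thswp_wmap i j (u : grhom i j) (M : zmodType) (c : wrd j -> M) w :
  thswp c (wmap u w) = thswp (fun v => c (wmap u v)) w.
Proof.
rewrite /thswp unzip1_wmap; congr (c _ *~ _).
by rewrite /swp unzip1_wmap /wmap !map_cat !(map_take, map_drop).
Qed.

Definition swpn j : nattrans (barc n j) (barc n j) :=
  oper (n := n) (j := j) (n' := n) (j' := j) (th := fun k M => @thswp (freegrp k) M)
    (fun k M M' f c w => raddfMz f _ _) thswp_wmap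
    (fun k M c c' w gw cc => congr1 (fun x => x *~ _) (cc _ (swp_graded gw))).

Lemma hnat_swpn j F (a : nattrans (barc n j) F) i (w : wrd i) : graded n j (unzip1 w) ->
  hnat (nt_comp a (swpn j)) w = thswp (hnat a (k := i)) w.
Proof. exact: hnat_oper. Qed.

Lemma swpn_diff j : nt_comp (bdiff n j) (swpn j.+1) = nt_comp (swpn j) (bdiff n j).
Proof.
rewrite -[LHS]nt_comp1l -[RHS]nt_comp1l !nt_compA; apply: hnat_ext => i w gw.
rewrite hnat_swpn // (hnat_diff (nt_comp (nt_id _) (swpn j))) //.
rewrite (@wd_graded_ext _ _ _ _ (thswp (hnat (nt_id (barc n j)) (k := i))) _ _ _ gw); last first.
  by move=> v gv; rewrite hnat_swpn.
rewrite {1}/thswp hnat_diff ?swp_graded //.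
have /and3P[hw /eqP cw _] := gw.
have [|A [B [N [B' [C [wE cut]]]]]] := @cut5_exists _ w hw kl; first by rewrite cw.
by rewrite wE thswp_wd.
Qed.

Definition tpn (q : nat) : nat := if q == k then l else if q == l then k else q.

(** The exchange as a permutation of positions. The computations below use that it acts by [tpn] on
    labels and keeps the order inside each block. *)
Lemma swp_position j i0 m (w : wrd i0) : graded n j (unzip1 w) -> size w = m ->
  exists g : {perm 'I_m}, [/\ forall i : 'I_m, lett (swp w) i = lett w (g i) :> freegrp i0,
     forall i : 'I_m, lab (unzip1 w) (g i) = tpn (lab (unzip1 (swp w)) i)
   & forall i i' : 'I_m, (i < i')%N -> lab (unzip1 (swp w)) i = lab (unzip1 (swp w)) i' -> (g i < g i')%N].
Proof.
case/and3P=> hw /eqP cw _.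
have [|A [B [N [B' [C [wE cut]]]]]] := @cut5_exists _ w hw kl; first by rewrite cw.
have [[hA hB hN hB' hC] [cA cB cN cB']] := cut.
rewrite wE swp_cat // !size_cat => mE; subst w.
have cut' := cut5_swap cut.
have im (i : 'I_m) : (i < size A + (size B' + (size N + (size B + size C))))%N by rewrite (leq_trans (ltn_ord i)) // -mE; lia.
have g0m (i : 'I_m) : (gpos (size A) (size B) (size N) (size B') i < m)%N by have := gpos_lt (im i); rewrite mE.
have g0i : injective (fun i => Ordinal (g0m i)).
  by move=> i i' [/gpos_inj E]; apply: val_inj; apply: E; apply: im.
have L1 := label1 cut; have L2 := label2 cut; have L3 := label3 cut; have L4 := label4 cut; have L5 := label5 cut.
have K1 := label1 cut'; have K2 := label2 cut'; have K3 := label3 cut'; have K4 := label4 cut'; have K5 := label5 cut'.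
rewrite !size_map -!unzip1_cat in L1 L2 L3 L4 L5 K1 K2 K3 K4 K5.
exists (perm g0i); split.
- move=> i; rewrite permE /= /lett; case: (gposP (im i)) => r rr; congr _.2.
  + by rewrite !nth_cat rr.
  + by rewrite !nth_cat_add ?nth_catl //.
  + by rewrite !nth_cat_add ?nth_catl //.
  + by rewrite !nth_cat_add ?nth_catl //.
  by rewrite !nth_cat_add.
- move=> i; rewrite permE /= /tpn; case: (gposP (im i)) => r rr.
  + have [lt ->] := K1 r rr; have [_ ->] := L1 r rr; move: (lt); have [_ <-] := K1 r rr => lt'.
    by rewrite !ltn_eqF // (ltn_trans lt').
  + by rewrite K2 // L4 // eqxx.
  + by have [-> lt] := K3 r rr; have [-> _] := L3 r rr; rewrite (gtn_eqF (_ : k < _)%N) ?ltn_eqF // addSn ltnS leq_addr.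
  + by rewrite K4 // L2 // gtn_eqF // eqxx.
  by rewrite K5 // L5 // !gtn_eqF // ?addSn ?ltnS ?leq_addr // (leq_trans (ltnW kl)) ?leq_addr.
have D (i : 'I_m) : let e := lab (unzip1 (A ++ B' ++ N ++ B ++ C)) i in
    let g := gpos (size A) (size B) (size N) (size B') i in
  (((e < k)%N /\ g = i) \/ (e = k /\ g = i + (size B + size N))%N \/ ((k < e < l)%N /\ (g + size B' = i + size B)%N)
   \/ (e = l /\ (g + (size B' + size N) = i)%N) \/ ((l < e)%N /\ g = i)).
  move=> /=; case: (gposP (im i)) => r rr.
  - by have [] := K1 r rr; lia.
  - by rewrite K2 //; lia.
  - by have [-> lt] := K3 r rr; lia.
  - by rewrite K4 //; lia.
  by rewrite K5 //; lia.
move=> i i' ii E; rewrite !permE /=; have /= d := D i; have /= d' := D i'.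
by clear -kl d d' ii E; lia.
Qed.

End SwapChain.
End Swap.

Section SwapBasis.
Variables (n m j : nat) (f : surj m n) (k l : 'I_n).
Hypothesis kl : (k < l)%N.
Hypothesis jm : (j + n)%N = m.
Let g := surj_comp (surj_perm (tperm k l)) f.

Lemma tpn_tperm (q : 'I_n) : tpn k l q = tperm k l q.
Proof.
rewrite /tpn; case: tpermP => [->|->|/eqP qk /eqP ql]; rewrite ?eqxx //.
  by case: eqVneq => // ->.
by rewrite -!val_eqE /= in qk ql; rewrite (negbTE qk) (negbTE ql).
Qed.

Lemma tpnK q : tpn k l (tpn k l q) = q.
Proof.
rewrite /tpn; case: (eqVneq q k) => [->|qk]; first by rewrite eqxx (gtn_eqF kl).
case: (eqVneq q l) => [->|ql]; first by rewrite eqxx.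
by rewrite (negbTE qk) (negbTE ql).
Qed.

Lemma swp_fdeg : (-1) ^+ swps k l (bshape g) = (-1) ^+ (fdeg f k * fdeg f l) * between_sign f k l :> int.
Proof.
have fdE q : fdeg g q = fdeg f (tperm k l q).
  rewrite /fdeg; congr _.-1; apply: eq_card => x; rewrite !inE !ffunE.
  by rewrite -(inj_eq (@perm_inj _ (tperm k l))) tpermK.
have F1 (q : 'I_n) : fsum 0 (bshape g) (fun r => r == q) = fdeg g q.
  rewrite fsum_bshape (bigD1 q) //= eqxx muln1 big1 ?addn0 // => r rq.
  by rewrite val_eqE (negbTE rq) muln0.
rewrite /swps !F1 !fdE tpermL tpermR /between_sign -exprD fsum_bshape.
rewrite mulnC [(fdeg f l + _)%N]addnC; congr (_ ^+ (_ + _ * _))%N.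
rewrite [RHS]big_mkcond; apply: eq_bigr => q _; case: ifP => [/andP[kq ql]|_]; last by rewrite muln0.
by rewrite muln1 fdE tpermD // -val_eqE /= ?(ltn_eqF kq) ?(gtn_eqF ql).
Qed.

(** An equality of cochains: exchanging whole blocks keeps each of them sorted, so no resorting
    signature appears and only the Koszul sign remains. *)
Lemma bphi_swp : nt_comp (bphi j f) (swpn kl (ltn_ord l) j) =
  bphi j g *~ ((-1) ^+ (fdeg f k * fdeg f l) * between_sign f k l).
Proof.
apply: hnat_ext => i w gw; rewrite hnat_swpn // hnatMz hnat_bc // /thswp hnat_bc ?swp_graded //.
have sw : size w = m by rewrite -(size_map fst) (graded_size gw) addnC.
have [s [s1 s2 s3]] := swp_position kl (ltn_ord l) gw sw.
have gw' : graded n j (unzip1 (swp k l w)) by apply: swp_graded.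
have so : size (unzip1 w) = m by rewrite size_map.
have so' : size (unzip1 (swp k l w)) = m by rewrite (graded_size gw') addnC.
rewrite /bcoch; case: (unzip1 (swp k l w) =P bshape f) => [E|E]; last first.
  rewrite mul0rz; case: eqP => [E'|]; rewrite ?mul0rz //; case: E; apply/esym.
  apply: (bshape_unique (s := (srt g * s^-1)%g) gw' so') => x; rewrite permM.
  rewrite -[LHS]tpnK -s2 permKV E' lab_bshape tpn_tperm !ffunE.
  by rewrite tpermK.
have [g' [g'o g's g'E]] : exists g' : surj m n, [/\ bshape g' = unzip1 w, srt g' = (srt f * s)%g
    & forall x, g' x = lab (unzip1 w) ((srt f * s)%g x) :> nat].
  apply: (unbshape gw so) => x y xy; rewrite !permM !s2 => /(congr1 (tpn k l)); rewrite !tpnK => le.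
  apply: s3 => //; rewrite srt_mono /flt xy andbT -val_eqE /=.
  by move: le; rewrite E !lab_bshape => ->; rewrite eqxx orbT.
have g'g : g' = g.
  apply: val_inj; apply/ffunP => x; apply: val_inj; rewrite -[LHS]/(nat_of_ord (g' x)) g'E permM s2 E lab_bshape.
  by rewrite tpn_tperm -[RHS]/(nat_of_ord (g x)) !ffunE.
rewrite -g'g g'o eqxx -swp_fdeg -/g -g'g g'o; congr (tpure _ *~ _).
by apply/ffunP => x; rewrite !ffunE s1 g's permM.
Qed.

Lemma pull_phi :
  ext_pull (Ta_perm (tperm k l)) (phi n m j (surj_basis f)) =
  phi n m j (surj_basis g *~ ((-1) ^+ (fdeg f k * fdeg f l) * between_sign f k l)).
Proof.
have lift : is_chain_lift (pr_d (bres n)) (bres n) (nt_comp (Ta_perm (tperm k l)) (pr_aug (bres n)))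
    (swpn kl (ltn_ord l)).
  split=> [|i]; last exact: swpn_diff.
  apply: hnat_ext => i w gw; rewrite hnat_swpn // hnat_comp.
  have E0 v : graded n 0 (unzip1 v) -> hnat (pr_aug (bres n)) v = tpure [ffun x : 'I_n => ab_pi (lett v x) : abF i].
    exact: hnat_aug.
  have sw : size w = n by rewrite -(size_map fst) (graded_size gw) addn0.
  have [s [s1 s2 _]] := swp_position kl (ltn_ord l) gw sw.
  have gw' : graded n 0 (unzip1 (swp k l w)) by apply: swp_graded.
  rewrite /thswp !E0 // [RHS]tpow_permE.
  have labn q : (q < n)%N -> lab (nseq n true) q = q.
    by move=> qn; rewrite /lab take_nseq // count_nseq mul1n.
  (* In degree 0 there are no false flags, so the exchange of blocks carries no sign and lies over
     the transposition. *)
  have fn h q c : fsum q (nseq c true) h = 0%N by elim: c q => //= c IH q.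
  rewrite (graded0_nseq gw) /swps !fn muln0 addn0 mulr1z.
  congr tpure; apply/ffunP => x; rewrite !ffunE s1.
  have := s2 x; rewrite (graded0_nseq gw) (graded0_nseq gw') !labn // tpn_tperm => /val_inj ->.
  by [].
rewrite phi_basis (ext_pull_cls lift); last exact: bphi_coc.
by rewrite bphi_swp raddfMz phi_basis clsMz //; apply: bphi_coc.
Qed.

End SwapBasis.

(** * The external product *)

Section TensorAdd.
Variables A B : zmodType.

Lemma tensorBl (a a' : A) (b : B) : tensor (a - a') b = tensor a b - tensor a' b.
Proof. by apply/eqP; rewrite eq_sym subr_eq -tensorDl subrK. Qed.

Lemma tensorBr (a : A) (b b' : B) : tensor a (b - b') = tensor a b - tensor a b'.
Proof. by apply/eqP; rewrite eq_sym subr_eq -tensorDr subrK. Qed.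

Definition tensl (b : B) : {additive A -> tens A B} :=
  HB.pack (fun a => tensor a b)
    (GRing.isZmodMorphism.Build A (tens A B) (fun a => tensor a b) (fun a a' => tensorBl a a' b)).

Definition tensr (a : A) : {additive B -> tens A B} :=
  HB.pack (tensor a) (GRing.isZmodMorphism.Build B (tens A B) (tensor a) (tensorBr a)).

Lemma tensor0l (b : B) : tensor (0 : A) b = 0.
Proof. exact: (raddf0 (tensl b)). Qed.

Lemma tensor0r (a : A) : tensor a (0 : B) = 0.
Proof. exact: (raddf0 (tensr a)). Qed.

End TensorAdd.

Lemma tensNE (F F' G G' : functor) (a : nattrans F F') (b : nattrans G G') k x y :
  tensN a b k (tensor x y) = tensor (a k x) (b k y).
Proof. exact: tens_mapE. Qed.

Lemma tensF_mapE (F G : functor) k k' (u : grhom k k') x y :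
  fmap (tensF F G) u (tensor x y) = tensor (fmap F u x) (fmap G u y).
Proof. exact: tens_mapE. Qed.

Section TensorNatMore.
Variables F F1 F2 G G1 G2 : functor.

Lemma tensN_comp (a : nattrans F F1) (a' : nattrans F1 F2) (b : nattrans G G1) (b' : nattrans G1 G2) :
  tensN (nt_comp a' a) (nt_comp b' b) = nt_comp (tensN a' b') (tensN a b).
Proof.
apply: nattransP => k; apply: (@tens_ext _ _ _ (tensN _ _ k) (tensN a' b' k \o tensN a b k : {additive _ -> _})) => x y.
by rewrite -[RHS]/(tensN a' b' k (tensN a b k (tensor x y))) !tensNE.
Qed.

Lemma tensNBl (a a' : nattrans F F1) (b : nattrans G G1) : tensN (a - a') b = tensN a b - tensN a' b.
Proof.
apply: nattransP => k; apply: (@tens_ext _ _ _ (tensN _ _ k) ((tensN a b - tensN a' b) k)) => x y.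
have -> : (tensN a b - tensN a' b) k (tensor x y) = tensN a b k (tensor x y) - tensN a' b k (tensor x y) by [].
by rewrite !tensNE -tensorBl.
Qed.

Lemma tensNBr (a : nattrans F F1) (b b' : nattrans G G1) : tensN a (b - b') = tensN a b - tensN a b'.
Proof.
apply: nattransP => k; apply: (@tens_ext _ _ _ (tensN _ _ k) ((tensN a b - tensN a b') k)) => x y.
have -> : (tensN a b - tensN a b') k (tensor x y) = tensN a b k (tensor x y) - tensN a b' k (tensor x y) by [].
by rewrite !tensNE -tensorBr.
Qed.
End TensorNatMore.

Section BarTensor.
Variables l p : nat.

Lemma tensb_ext0 i j k (M : zmodType) (a b : {additive tens (barc l i k) (barc p j k) -> M}) :
  (forall (x : bgen l i k) (y : bgen p j k), a (tensor << x >> << y >>) = b (tensor << x >> << y >>)) -> a =1 b.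
Proof.
move=> ab; apply: tens_ext => x y.
have E1 (x1 : bgen l i k) : a \o tensr (barc p j k) (<< x1 >> : barc l i k) =1 b \o tensr (barc p j k) (<< x1 >> : barc l i k).
  by apply: (@freeg_ext _ _ (a \o tensr (barc p j k) (<< x1 >> : barc l i k) : {additive _ -> _})
    (b \o tensr (barc p j k) (<< x1 >> : barc l i k) : {additive _ -> _})); apply: ab.
have E2 : a \o tensl (barc l i k) y =1 b \o tensl (barc l i k) y.
  apply: (@freeg_ext _ _ (a \o tensl (barc l i k) y : {additive _ -> _})
    (b \o tensl (barc l i k) y : {additive _ -> _})) => x1; exact: E1.
exact: E2.
Qed.

Lemma tensb_ext i j (F : functor) (a b : nattrans (tensF (barc l i) (barc p j)) F) :
  (forall k (x : bgen l i k) (y : bgen p j k), a k (tensor << x >> << y >>) = b k (tensor << x >> << y >>)) -> a = b.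
Proof.
by move=> ab; apply: nattransP => k; apply: tensb_ext0; apply: ab.
Qed.

Section Cat.
Variables n i j : nat.

Definition bcat_r k (x : bgen l i k) : homZ (barc p j k) (barc (l + p) n k) :=
  zlift (fun y : bgen p j k => unit (l + p) n k (val x ++ val y)).

Definition bcat_l k : {additive barc l i k -> homZ (barc p j k) (barc (l + p) n k)} := zlift (@bcat_r k).

Lemma bcat_Dl k a a' b : bcat_l k (a + a') b = bcat_l k a b + bcat_l k a' b.
Proof. by rewrite raddfD. Qed.

Lemma bcat_Dr k a b b' : bcat_l k a (b + b') = bcat_l k a b + bcat_l k a b'.
Proof. by rewrite raddfD. Qed.

Definition bcat_app k : {additive tensF (barc l i) (barc p j) k -> barc (l + p) n k} :=
  tens_lift (@bcat_Dl k) (@bcat_Dr k).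

Lemma bcat_appE k (x : bgen l i k) (y : bgen p j k) :
  bcat_app k (tensor << x >> << y >>) = unit (l + p) n k (val x ++ val y).
Proof. by rewrite [LHS]tens_liftE /bcat_l zliftE /bcat_r zliftE. Qed.

Lemma bcat_natural k k' (u : grhom k k') x :
  bcat_app k' (fmap (tensF (barc l i) (barc p j)) u x) = fmap (barc (l + p) n) u (bcat_app k x).
Proof.
apply: (@tensb_ext0 i j k _ (bcat_app k' \o fmap (tensF (barc l i) (barc p j)) u : {additive _ -> _})
  (fmap (barc (l + p) n) u \o bcat_app k : {additive _ -> _})) => {}x y.
change (bcat_app k' (fmap (tensF (barc l i) (barc p j)) u (tensor (<< x >> : barc l i k) (<< y >> : barc p j k)))
  = fmap (barc (l + p) n) u (bcat_app k (tensor (<< x >> : barc l i k) (<< y >> : barc p j k)))).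
rewrite tensF_mapE !barcE !bcat_appE -unit_wmap.
by rewrite /wmap map_cat.
Qed.

Definition bcat : nattrans (tensF (barc l i) (barc p j)) (barc (l + p) n) := NatTrans bcat_natural.

Lemma bcatE k (x : bgen l i k) (y : bgen p j k) :
  bcat k (tensor << x >> << y >>) = unit (l + p) n k (val x ++ val y).
Proof. exact: bcat_appE. Qed.

(** Cuts the word before block l. The two [unit] factors discard the words whose parts do not have
    degrees i and j, so a word contributes to one bidegree only. *)
Definition bsplit_fun k (w : wrd k) : tensF (barc l i) (barc p j) k :=
  tensor (unit l i k (take (bcut l (unzip1 w)) w)) (unit p j k (drop (bcut l (unzip1 w)) w)).

Lemma bsplit_nat k k' (u : grhom k k') w :
  bsplit_fun (wmap u w) = fmap (tensF (barc l i) (barc p j)) u (bsplit_fun w).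
Proof. by rewrite tensF_mapE /bsplit_fun unzip1_wmap -!unit_wmap /wmap map_take map_drop. Qed.

Definition bsplit : nattrans (barc (l + p) n) (tensF (barc l i) (barc p j)) := bnat _ _ bsplit_nat.
End Cat.

Lemma wd_unit n i k (A : wrd k) : head true (unzip1 A) -> count id (unzip1 A) = n ->
  wd (@mlG k) (unit n i k) A = bdiff n i k (unit n i.+1 k A).
Proof.
move=> hA cA; case gA: (graded n i.+1 (unzip1 A)).
  by have := hnat_diff (nt_id (barc n i)) gA => /esym.
rewrite [unit n i.+1 k A](_ : _ = 0); last by rewrite /unit /hat insubF.
rewrite raddf0 (@wd_step_ext _ _ _ _ (fun=> 0)) ?wd0 // => v /step_inv[cv hv dv].
rewrite /unit /hat insubF //; apply: contraFF gA => /and3P[_ _ /eqP nv].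
by rewrite /graded hA cA dv nv !eqxx.
Qed.

Lemma unit0 n i k (A : wrd k) : ~~ graded n i (unzip1 A) -> unit n i k A = 0.
Proof. by move=> gA; rewrite /unit /hat insubF //; apply: negbTE. Qed.

Lemma bsplit_cat k i j (A v : wrd k) : count id (unzip1 A) = l -> head true (unzip1 v) ->
  bsplit_fun i j (A ++ v) = tensor (unit l i k A) (unit p j k v).
Proof.
move=> cA hv; rewrite /bsplit_fun unzip1_cat (bcut_cat cA hv) size_map.
by rewrite take_size_cat // drop_size_cat.
Qed.

Lemma bcut_graded n k (w : wrd k) : graded (l + p) n (unzip1 w) -> exists A v,
  [/\ w = A ++ v, head true (unzip1 A), count id (unzip1 A) = l & graded p (ndeg (unzip1 v)) (unzip1 v)].
Proof.
case/and3P=> hw /eqP cw _; have [A [v [wE cA hv]]] : exists A v, [/\ w = A ++ v, count id (unzip1 A) = l & head true (unzip1 v)].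
  by apply: bcut_exists; rewrite cw leq_addr.
exists A, v; split=> //; first by move: hw; rewrite wE unzip1_cat; apply: head_catl.
rewrite /graded hv eqxx andbT; move: cw; rewrite wE unzip1_cat count_cat cA => /eqP.
by rewrite eqn_add2l.
Qed.

(** Leibniz rule for the cut before block l, where nothing merges. *)
Lemma bsplit_diff n i j :
  nt_comp (tensN (bdiff l i) (nt_id (barc p j))) (bsplit n.+1 i.+1 j)
  + nt_comp (tensN (nt_id (barc l i)) (bdiff p j)) (bsplit n.+1 i j.+1) *~ (-1) ^+ i
  = nt_comp (bsplit n i j) (bdiff (l + p) n).
Proof.
apply: hnat_ext => k w gw; rewrite hnatD hnatMz (hnat_diff (bsplit n i j)) // !hnat_comp.
rewrite (@wd_graded_ext _ _ _ _ (bsplit_fun i j (k := k)) _ _ _ gw); last by move=> v gv; rewrite hnat_bnat.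
rewrite !hnat_bnat //; have [A [v [-> hA cA gv]]] := bcut_graded gw.
have /and3P[hv /eqP cv _] := gv.
rewrite !bsplit_cat // !tensNE wd_cat //.
rewrite (@wd_step_ext _ _ _ _ (fun u => tensl _ (unit p j k v) (unit l i k u))); last first.
  by move=> u /step_inv[cu hu _]; rewrite bsplit_cat ?cu.
rewrite -wd_mor wd_unit // [X in _ = _ + X *~ _](@wd_step_ext _ _ _ _ (fun u => tensr _ (unit l i k A) (unit p j k u))); last first.
  by move=> u /step_inv[cu hu _]; rewrite bsplit_cat ?hu.
rewrite -[X in _ = _ + X *~ _]wd_mor wd_unit //; congr (_ + _).
case gA: (graded l i (unzip1 A)); last by rewrite unit0 ?gA // /= !tensor0l !mul0rz.
by have /and3P[_ _ /eqP ->] := gA.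
Qed.

(** One half of the differential of the tensor product, composed with concatenation; it is zero in
    degree 0, where there is no differential. [bcat_dr] is the other half. *)
Definition bcat_dl n i j : nattrans (tensF (barc l i) (barc p j)) (barc (l + p) n) :=
  match i return nattrans (tensF (barc l i) (barc p j)) (barc (l + p) n) with
  | 0%N => 0
  | i'.+1 => nt_comp (bcat n i' j) (tensN (bdiff l i') (nt_id (barc p j)))
  end.

Definition bcat_dr n i j : nattrans (tensF (barc l i) (barc p j)) (barc (l + p) n) :=
  match j return nattrans (tensF (barc l i) (barc p j)) (barc (l + p) n) with
  | 0%N => 0
  | j'.+1 => nt_comp (bcat n i j') (tensN (nt_id (barc l i)) (bdiff p j'))
  end.

Lemma graded_cat i j o o' : graded l i o -> graded p j o' -> graded (l + p) (i + j) (o ++ o').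
Proof.
move=> /and3P[ho /eqP co /eqP no] /and3P[ho' /eqP co' /eqP no'].
by rewrite /graded head_cat // count_cat co co' /ndeg count_cat -/(ndeg o) -/(ndeg o') no no' !eqxx.
Qed.

Lemma bdiff_unit n j k (x : bgen n j.+1 k) : bdiff n j k << x >> = wd (@mlG k) (unit n j k) (val x).
Proof. by have := hnat_diff (nt_id (barc n j)) (valP x); rewrite hnat_val. Qed.

Lemma bcat_diff n i j : (i + j)%N = n.+1 ->
  nt_comp (bdiff (l + p) n) (bcat n.+1 i j) = bcat_dl n i j + bcat_dr n i j *~ (-1) ^+ i.
Proof.
move=> ij; apply: tensb_ext => k x y; have gx := valP x; have gy := valP y.
have /and3P[hx /eqP cx /eqP nx] := gx; have /and3P[hy /eqP cy /eqP ny] := gy.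
set e := tensor _ _.
have -> : (bcat_dl n i j + bcat_dr n i j *~ (-1) ^+ i) k e = bcat_dl n i j k e + bcat_dr n i j k e *~ (-1) ^+ i.
  rewrite nt_addE; congr (_ + _).
  exact: (raddfMz (HB.pack (fun a : nattrans (tensF (barc l i) (barc p j)) (barc (l + p) n) => a k e)
    (GRing.isZmodMorphism.Build _ _ (fun a : nattrans (tensF (barc l i) (barc p j)) (barc (l + p) n) => a k e)
      (fun a b => erefl)) : {additive _ -> _})).
rewrite -[LHS]/(bdiff (l + p) n k (bcat n.+1 i j k e)) bcatE.
have gxy : graded (l + p) n.+1 (unzip1 (val x ++ val y)) by rewrite unzip1_cat -ij graded_cat.
have := hnat_diff (nt_id (barc (l + p) n)) gxy; rewrite -[LHS]/(bdiff (l + p) n k (unit _ _ _ _)) => ->.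
rewrite wd_cat // nx; congr (_ + _ *~ _).
  rewrite /e; case: i x ij e gx nx cx hx gxy => [|i'] x ij e gx nx cx hx gxy; first by rewrite (wd_deg0 _ _ gx).
  rewrite -[RHS]/(bcat n i' j k (tensN (bdiff l i') (nt_id (barc p j)) k _)) tensNE bdiff_unit.
  rewrite -[tensor _ _]/(tensl (barc l i' k) (<< y >> : barc p j k) _) !wd_mor.
  apply: wd_graded_ext gx _ => u /bgenP[x' <-]; rewrite unit_val.
  by rewrite -[RHS]/(bcat n i' j k (tensor _ _)) bcatE.
rewrite /e; case: j y ij e gy ny cy hy gxy => [|j'] y ij e gy ny cy hy gxy; first by rewrite (wd_deg0 _ _ gy).
rewrite -[RHS]/(bcat n i j' k (tensN (nt_id (barc l i)) (bdiff p j') k _)) tensNE bdiff_unit.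
rewrite -[tensor _ _]/(tensr (barc p j' k) (<< x >> : barc l i k) _) !wd_mor.
apply: wd_graded_ext gy _ => u /bgenP[y' <-]; rewrite unit_val.
by rewrite -[RHS]/(bcat n i j' k (tensor _ _)) bcatE.
Qed.

Lemma bsplit_unit n i j k (w : wrd k) : graded (l + p) n (unzip1 w) ->
  bsplit n i j k (unit (l + p) n k w) = bsplit_fun i j w.
Proof. by move=> gw; apply: (hnat_bnat (bsplit_nat i j) gw). Qed.

Lemma bsplit_bcat_id n i j : (i + j)%N = n -> nt_comp (bsplit n i j) (bcat n i j) = nt_id _.
Proof.
move=> <-; apply: tensb_ext => k x y; have gx := valP x; have gy := valP y.
rewrite -[LHS]/(bsplit (i + j) i j k (bcat _ i j k (tensor _ _))) bcatE.
rewrite bsplit_unit; last by rewrite unzip1_cat graded_cat.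
rewrite bsplit_cat; [|by case/and3P: gx => _ /eqP|by case/and3P: gy].
by rewrite !unit_val.
Qed.

Lemma bsplit_bcat0 n i j i' j' : (i' + j')%N = n -> i != i' -> nt_comp (bsplit n i j) (bcat n i' j') = 0.
Proof.
move=> <- ii; apply: tensb_ext => k x y; have gx := valP x; have gy := valP y.
rewrite -[LHS]/(bsplit (i' + j') i j k (bcat _ i' j' k (tensor _ _))) bcatE.
rewrite bsplit_unit; last by rewrite unzip1_cat graded_cat.
rewrite bsplit_cat; [|by case/and3P: gx => _ /eqP|by case/and3P: gy].
rewrite unit0 ?tensor0l //; apply: contra ii => /and3P[_ _ /eqP <-].
by case/and3P: gx => _ _ /eqP ->.
Qed.

Lemma cat_aug_word k (A v : wrd k) : graded l 0 (unzip1 A) -> graded p 0 (unzip1 v) ->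
  Ta_cat l p k (tensor (hnat (baug l) A) (hnat (baug p) v)) = hnat (baug (l + p)) (A ++ v).
Proof.
move=> gA gv; rewrite !hnat_aug //; last by rewrite unzip1_cat (graded_cat gA gv).
have sA : size A = l by rewrite -(size_map fst) (graded_size gA) addn0.
rewrite [LHS]tpow_catE; congr tpure; apply/ffunP => x; rewrite !ffunE.
by case: (split_ordP x) => y ->; rewrite ffunE /lett /= nth_cat sA ?ltn_ord // ltnNge leq_addr /= addKn.
Qed.

Lemma bcat_aug : nt_comp (baug (l + p)) (bcat 0 0 0) = nt_comp (Ta_cat l p) (tensN (baug l) (baug p)).
Proof.
apply: tensb_ext => k x y; have gx := valP x; have gy := valP y.
rewrite -[LHS]/(baug (l + p) k (bcat 0 0 0 k (tensor _ _))) bcatE.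
rewrite -[RHS]/(Ta_cat l p k (tensN _ _ k (tensor _ _))) tensNE -!unit_val.
by rewrite -[RHS]/(Ta_cat l p k (tensor (hnat (baug l) (val x)) (hnat (baug p) (val y)))) cat_aug_word.
Qed.

Lemma bsplit_aug : nt_comp (Ta_cat l p) (nt_comp (tensN (baug l) (baug p)) (bsplit 0 0 0)) = baug (l + p).
Proof.
apply: hnat_ext => k w gw; rewrite !hnat_comp -[X in tensN _ _ k X]/(bsplit 0 0 0 k (unit _ _ _ w)).
rewrite bsplit_unit //; have [A [v [wE hA cA gv]]] := bcut_graded gw; rewrite {}wE in gw *.
move: gw; rewrite unzip1_cat => /and3P[_ _]; rewrite /ndeg count_cat addn_eq0 => /andP[nA nv].
rewrite /ndeg (eqP nv) in gv; have gA : graded l 0 (unzip1 A) by rewrite /graded hA cA eqxx.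
rewrite bsplit_cat //; last by case/and3P: gv.
by rewrite tensNE cat_aug_word.
Qed.

End BarTensor.

Section ExtProduct.
Variables l p : nat.
Local Notation P := (std_res (Ta l)).
Local Notation Q := (std_res (Ta p)).
Local Notation R := (std_res (Ta (l + p))).
Local Notation c := (Ta_cat l p).

Lemma cmp_aug (F : functor) (P1 P2 : projres F) : nt_comp (pr_aug P2) (cmp P1 P2 0) = pr_aug P1.
Proof. by case: (cmpP P1 P2). Qed.

Lemma cmp_d (F : functor) (P1 P2 : projres F) j :
  nt_comp (pr_d P2 j) (cmp P1 P2 j.+1) = nt_comp (cmp P1 P2 j) (pr_d P1 j).
Proof. by case: (cmpP P1 P2). Qed.

Definition tot_chain (P1 : projres (Ta l)) (Q1 : projres (Ta p)) (t : forall n i j, nattrans (R n) (tensF (P1 i) (Q1 j))) :=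
  forall n i j, (i + j)%N = n ->
      nt_comp (tensN (pr_d P1 i) (nt_id (Q1 j))) (t n.+1 i.+1 j)
      + nt_comp (tensN (nt_id (P1 i)) (pr_d Q1 j)) (t n.+1 i j.+1) *~ (-1) ^+ i
      = nt_comp (t n i j) (pr_d R n).

Lemma tot_chain_map (P1 P2 : projres (Ta l)) (Q1 Q2 : projres (Ta p)) t : @tot_chain P1 Q1 t ->
  @tot_chain P2 Q2 (fun n i j => nt_comp (tensN (cmp P1 P2 i) (cmp Q1 Q2 j)) (t n i j)).
Proof.
move=> tt n i j ij; rewrite !nt_compA -!tensN_comp !nt_comp1l !cmp_d.
rewrite -[cmp Q1 Q2 j]nt_comp1r -{2}[cmp P1 P2 i]nt_comp1r !tensN_comp !nt_comp1r -!nt_compA -tt //.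
by rewrite nt_compDr nt_compMzr.
Qed.

(** On bar resolutions the cutting of words is such a chain map, and comparison maps carry it to the
    standard resolutions. Hence the chosen [tensor_lift] has the required properties. *)
Lemma tensor_lift_exists : exists t, is_tensor_lift c t.
Proof.
pose t n i j := nt_comp (bsplit l p n i j) (cmp R (bres (l + p)) n).
have tt : @tot_chain (bres l) (bres p) t.
  move=> n i j ij; rewrite /t !nt_compA -nt_compMzl -nt_compDl bsplit_diff -!nt_compA.
  by congr (nt_comp _ _); exact: (cmp_d R (bres (l + p)) n).
exists (fun n i j => nt_comp (tensN (cmp (bres l) P i) (cmp (bres p) Q j)) (t n i j)).
split; last exact: (@tot_chain_map (bres l) P (bres p) Q t tt).
rewrite (nt_compA (tensN _ _)) -tensN_comp !cmp_aug /t (nt_compA _ (bsplit _ _ _ _ _)) nt_compA bsplit_aug.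
exact: (cmp_aug R (bres (l + p))).
Qed.

Let t : forall n i j, nattrans (R n) (tensF (P i) (Q j)) := tensor_lift c.

Let tP : is_tensor_lift c t.
Proof. exact: classical_sets.xgetPex tensor_lift_exists. Qed.

Let t_chain : tot_chain t.
Proof. by case: tP. Qed.

Let T n i j := nt_comp (tensN (cmp P (bres l) i) (cmp Q (bres p) j)) (t n i j).

Let T_chain : @tot_chain (bres l) (bres p) T.
Proof. exact: (@tot_chain_map P (bres l) Q (bres p) t t_chain). Qed.

(* A chain map over the identity. Since split o cat = 1, splitting it gives    *)
(* back the tensor lift, which is thereby known up to homotopy.                *)
Definition total n : nattrans (R n) (barc (l + p) n) :=
  \sum_(i < n.+1) nt_comp (bcat l p n i (n - i)) (T n i (n - i)).

Lemma nt_comp_sumr (F G H : functor) (a : nattrans G H) (I : finType) (b : I -> nattrans F G) :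
  nt_comp a (\sum_x b x) = \sum_x nt_comp a (b x).
Proof. by apply: (big_morph (fun b => nt_comp a b)) => [x y|]; rewrite ?nt_compDr ?nt_comp0r. Qed.

Lemma nt_comp_suml (F G H : functor) (a : nattrans F G) (I : finType) (b : I -> nattrans G H) :
  nt_comp (\sum_x b x) a = \sum_x nt_comp (b x) a.
Proof. by apply: (big_morph (fun b => nt_comp b a)) => [x y|]; rewrite ?nt_compDl ?nt_comp0l. Qed.

Lemma total_chain n : nt_comp (bdiff (l + p) n) (total n.+1) = nt_comp (total n) (pr_d R n).
Proof.
rewrite /total nt_comp_sumr nt_comp_suml.
under eq_bigr => i _ do rewrite nt_compA bcat_diff ?subnKC -1?ltnS // nt_compDl nt_compMzl.
rewrite big_split /= big_ord_recl nt_comp0l add0r [X in _ + X]big_ord_recr subnn nt_comp0l mul0rz [X in _ + X = _]addr0.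
rewrite -big_split /=; apply: eq_bigr => i _; rewrite -nt_compA -(T_chain (j := (n - i)%N)); last first.
  by rewrite subnKC // -ltnS.
rewrite /= subSS subSn; last by rewrite -ltnS.
by rewrite nt_compDr nt_compMzr !nt_compA.
Qed.

Lemma split_total n i j : (i + j)%N = n -> nt_comp (bsplit l p n i j) (total n) = T n i j.
Proof.
move=> ij; have im : (i < n.+1)%N by rewrite ltnS -ij leq_addr.
have jE : (n - i)%N = j by rewrite -ij addKn.
rewrite /total nt_comp_sumr (bigD1 (Ordinal im)) // big1 ?addr0 => [|i' ii].
  by rewrite [nat_of_ord (Ordinal im)]/= jE nt_compA bsplit_bcat_id // nt_comp1l ?[LHS]addr0.
rewrite nt_compA bsplit_bcat0 ?nt_comp0l //; first by rewrite subnKC // -ltnS.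
by rewrite eq_sym -val_eqE in ii *.
Qed.

Lemma total_lift : is_chain_lift (pr_d R) (bres (l + p)) (pr_aug R) total.
Proof.
split=> [|n]; last exact: total_chain.
rewrite /total big_ord1 nt_compA bcat_aug /T -nt_compA (nt_compA (tensN _ _)) -tensN_comp.
by rewrite (cmp_aug P (bres l)) (cmp_aug Q (bres p)); case: tP.
Qed.

Lemma tensN0l (F G F' G' : functor) (b : nattrans G G') : tensN (0 : nattrans F F') b = 0.
Proof. by rewrite -(subrr (0 : nattrans F F')) tensNBl subrr. Qed.

Lemma tensN0r (F G F' G' : functor) (a : nattrans F F') : tensN a (0 : nattrans G G') = 0.
Proof. by rewrite -(subrr (0 : nattrans G G')) tensNBr subrr. Qed.

Section Cocycles.
Variables (G G' G'' : functor) (d : nattrans (tensF G G') G'').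

Lemma tens_coc n i j (x : nattrans (P i) G) (y : nattrans (Q j) G') : (i + j)%N = n ->
  is_coc x -> is_coc y -> is_coc (P := R) (i := n) (nt_comp d (nt_comp (tensN x y) (t n i j))).
Proof.
move=> ij cx cy; rewrite /is_coc -!nt_compA -t_chain // nt_compDr nt_compMzr.
rewrite !(nt_compA (tensN x y)) -!tensN_comp !nt_comp1r cx cy tensN0l tensN0r.
by rewrite !nt_comp0l mul0rz addr0 nt_comp0r.
Qed.

Lemma tens_cobl n i j (x : nattrans (P i) G) (y : nattrans (Q j) G') : (i + j)%N = n ->
  coboundary x -> is_coc y -> coboundary (P := R) (i := n) (nt_comp d (nt_comp (tensN x y) (t n i j))).
Proof.
case: i x => [|i] x; first by move=> _ /= -> _; rewrite tensN0l nt_comp0l nt_comp0r; apply: cob0.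
case: n => // n [ij] [e ->] cy; exists (nt_comp d (nt_comp (tensN e y) (t n i j))).
rewrite -!nt_compA -t_chain // nt_compDr nt_compMzr (nt_compA (tensN e y) (tensN (nt_id _) _)).
rewrite -tensN_comp nt_comp1r cy tensN0r nt_comp0l mul0rz addr0.
by rewrite (nt_compA (tensN e y)) -tensN_comp nt_comp1r.
Qed.

Lemma tens_cobr n i j (x : nattrans (P i) G) (y : nattrans (Q j) G') : (i + j)%N = n ->
  is_coc x -> coboundary y -> coboundary (P := R) (i := n) (nt_comp d (nt_comp (tensN x y) (t n i j))).
Proof.
case: j y => [|j] y; first by move=> _ _ /= ->; rewrite tensN0r nt_comp0l nt_comp0r; apply: cob0.
case: n => [|n]; rewrite addnS // => -[ij] cx [e ->].
exists (nt_comp d (nt_comp (tensN x e) (t n i j)) *~ (-1) ^+ i).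
rewrite nt_compMzl -!nt_compA -t_chain // nt_compDr nt_compMzr (nt_compA (tensN x e) (tensN _ (nt_id _))).
rewrite -tensN_comp nt_comp1r cx tensN0l nt_comp0l add0r nt_compMzr -mulrzA -expr2 sqrr_sign.
by rewrite (nt_compA (tensN x e)) -tensN_comp nt_comp1r.
Qed.

(** Uniqueness of lifts is applied to [total] with values in the bar resolution of T^(l + p) o a
    rather than to the tensor product of two resolutions. The three coboundaries account for the two
    representatives and for [total]. *)
Lemma ext_prod_cls i j (a : nattrans (bres l i) G) (b : nattrans (bres p j) G') : is_coc a -> is_coc b ->
  ext_prod c d (cls a) (cls b) =
  cls (P := bres (l + p)) (i := i + j) (nt_comp d (nt_comp (tensN a b) (bsplit l p (i + j) i j))).
Proof.
move=> ca cb; set g := nt_comp d _.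
have gE : nt_comp g (total (i + j)) = nt_comp d (nt_comp (tensN (nt_comp a (cmp P (bres l) i)) (nt_comp b (cmp Q (bres p) j))) (t (i + j) i j)).
  by rewrite /g -!nt_compA split_total // /T (nt_compA (tensN a b)) -tensN_comp.
have cg : is_coc (P := bres (l + p)) (i := i + j) g.
  rewrite /is_coc /g -!nt_compA; have /= <- := @bsplit_diff l p (i + j) i j.
  rewrite nt_compDr nt_compMzr !(nt_compA (tensN a b)) -!tensN_comp !nt_comp1r.
  by rewrite [nt_comp a _]ca [nt_comp b _]cb tensN0l tensN0r !nt_comp0l mul0rz addr0 nt_comp0r.
rewrite /ext_prod -/t; apply/ext_class_eq.
- exact: tens_coc (ext_repr_coc _) (ext_repr_coc _).
- exact: cmp_coc.
have H1 : coboundary (P := R) (i := i + j) (nt_comp g (total (i + j)) - nt_comp g (cmp R (bres (l + p)) (i + j))).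
  exact: lift_unique_cob0 total_lift (cmpP R (bres (l + p))) cg.
have H2 := tens_cobl (erefl (i + j)%N) (ext_repr_cls ca) (ext_repr_coc (cls b)).
have H3 := tens_cobr (erefl (i + j)%N) (cmp_coc ca) (ext_repr_cls cb).
have := cobD (cobD H2 H3) H1; rewrite gE tensNBl tensNBr !nt_compBl !nt_compBr.
by rewrite !addrA !addrNK.
Qed.
End Cocycles.
End ExtProduct.

Section SurjSum.
Variables (l m p n i j : nat) (g : surj m l) (f : surj n p).
Hypothesis im : (i + l)%N = m.
Hypothesis jn : (j + p)%N = n.

Let sum_fun (x : 'I_(m + n)) : 'I_(m + n) :=
  match split x with inl a => lshift n (srt g a) | inr b => rshift m (srt f b) end.

Let sum_inj : injective sum_fun.
Proof.
move=> x y; rewrite /sum_fun; case: (split_ordP x) => a ->; case: (split_ordP y) => b ->.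
- by move=> /lshift_inj/perm_inj ->.
- by move=> /eqP; rewrite eq_lrshift.
- by move=> /eqP; rewrite eq_rlshift.
by move=> /rshift_inj/perm_inj ->.
Qed.

Lemma surj_sum_shape : bshape (surj_sum g f) = bshape g ++ bshape f /\
  (forall a, srt (surj_sum g f) (lshift n a) = srt g a :> nat) /\
  (forall b, srt (surj_sum g f) (rshift m b) = (m + srt f b)%N :> nat).
Proof.
pose o := bshape g ++ bshape f; pose s := perm sum_inj.
have gg := graded_bshape g im; have gf := graded_bshape f jn.
have go : graded (l + p) (i + j) o by apply: graded_cat.
have so : size o = (m + n)%N by rewrite size_cat !size_bshape.
have sl a : s (lshift n a) = srt g a :> nat by rewrite permE /sum_fun (unsplitK (inl _ a)).
have sr b : s (rshift m b) = (m + srt f b)%N :> nat by rewrite permE /sum_fun (unsplitK (inr _ b)).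
have labl a : lab o (s (lshift n a)) = g a by rewrite sl lab_catl ?size_bshape // lab_bshape.
have labr b : lab o (s (rshift m b)) = (l + f b)%N.
  by rewrite sr -{1}(size_bshape g) lab_catr ?bshape_head ?size_bshape // lab_bshape count_bshape.
have inc (x y : 'I_(m + n)) : (x < y)%N -> lab o (s x) = lab o (s y) -> (s x < s y)%N.
  case: (split_ordP x) => a ->; case: (split_ordP y) => b ->; rewrite ?labl ?labr ?sl ?sr /=.
  - by move=> ab E; rewrite srt_mono /flt ab andbT -val_eqE /= E eqxx orbT.
  - by move=> _ E; have := ltn_ord (g a); rewrite E ltnNge leq_addr.
  - by rewrite ltnNge (leq_trans (ltnW (ltn_ord b))) ?leq_addr.
  by rewrite !ltn_add2l => ab /addnI E; rewrite srt_mono /flt ab andbT -val_eqE /= E eqxx orbT.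
have [h [hs ht hE]] := unbshape go so inc.
have -> : surj_sum g f = h; last by rewrite hs ht.
apply: val_inj; apply/ffunP => x; apply: val_inj; rewrite -[RHS]/(nat_of_ord (h x)) hE -[LHS]/(nat_of_ord (surj_sum g f x)) ffunE.
by rewrite /surj_sum_fun; case: (split_ordP x) => a ->; rewrite ?(unsplitK (inl _ a)) ?(unsplitK (inr _ a)) ?labl ?labr.
Qed.

(** The sorted word of a disjoint union is the concatenation of the sorted words, so the cochains
    agree and no sign appears. *)
Lemma bphi_sum :
  nt_comp (Ta_cat m n) (nt_comp (tensN (bphi i g) (bphi j f)) (bsplit l p (i + j) i j)) =
  bphi (i + j) (surj_sum g f).
Proof.
have [shE [srl srr]] := surj_sum_shape.
apply: hnat_ext => k w gw; rewrite hnat_bc // !hnat_comp.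
rewrite -[X in tensN _ _ k X]/(bsplit l p (i + j) i j k (unit _ _ _ w)) bsplit_unit //.
have [A [v [wE hA cA gv]]] := bcut_graded gw; have hv : head true (unzip1 v) by case/and3P: gv.
rewrite {}wE in gw *; rewrite bsplit_cat // tensNE /bcoch shE unzip1_cat.
have -> : (unzip1 A ++ unzip1 v == bshape g ++ bshape f) = (unzip1 A == bshape g) && (unzip1 v == bshape f).
  apply/eqP/andP => [E|[/eqP -> /eqP ->] //].
  have sA : size (unzip1 A) = size (bshape g).
    by rewrite -(bcut_cat cA hv) E (bcut_cat (count_bshape g) (bshape_head f)).
  by move/eqP: E; rewrite eqseq_cat // => /andP.
have bE q q' r (h : surj r q) (z : wrd k) : (q' + q)%N = r -> bphi q' h k (unit q q' k z) = if unzip1 z == bshape h then bcoch (bshape h) (srt h) z else 0.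
  move=> qr; case gz: (graded q q' (unzip1 z)).
    rewrite -[LHS]/(hnat (bphi q' h) z) hnat_bc //; case: ifP => // zE.
    by rewrite /bcoch zE.
  rewrite unit0 ?gz // raddf0; case: eqP => // E; move: gz; rewrite E graded_bshape //.
rewrite !bE //; case: eqP => [EA|_]; last by rewrite tensor0l raddf0.
case: eqP => [Ev|_]; last by rewrite tensor0r raddf0.
rewrite /bcoch EA Ev !eqxx [LHS]tpow_catE; congr tpure; apply/ffunP => x; rewrite !ffunE.
have sA : size A = m by rewrite -(size_map fst) -/(unzip1 A) EA size_bshape.
case: (split_ordP x) => a ->; rewrite ffunE /lett ?srl ?srr nth_cat sA ?ltn_ord //.
by rewrite ltnNge leq_addr /= addKn.
Qed.
End SurjSum.

(** * Bilinearity of the products *)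

Lemma shift_lift i (F G : functor) (a : nattrans (std_res F i) G) : is_coc a ->
  is_chain_lift (C := fun j => std_res F (j + i)) (fun j => pr_d (std_res F) (j + i)) (std_res G) a
    (chain_lift (C := fun j => std_res F (j + i)) (fun j => pr_d (std_res F) (j + i)) (std_res G) a).
Proof.
by move=> ca; apply: chain_liftE; [move=> j; exact: pr_proj | move=> j; exact: pr_ddE | exact: ca].
Qed.

Lemma yoneda_Dr (i j : nat) (F G H : functor) (x : Ext i F G) (y y' : Ext j G H) :
  yoneda x (y + y') = yoneda x y + yoneda x y'.
Proof.
have [a ca <-] := cls_surj (std_res F) x; have [b cb <-] := cls_surj (std_res G) y.
have [b' cb' <-] := cls_surj (std_res G) y'.
have lift := shift_lift ca.
have coc e : is_coc (P := std_res G) (i := j) e -> is_coc (P := std_res F) (i := j + i)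
    (nt_comp e (chain_lift (C := fun j => std_res F (j + i)) (fun j => pr_d (std_res F) (j + i)) (std_res G) a j)).
  by move=> ce; rewrite /is_coc -nt_compA -(proj2 lift) nt_compA ce nt_comp0l.
rewrite -clsD // !(yoneda_cls lift) //; last exact: is_cocD.
by rewrite nt_compDl clsD //; apply: coc.
Qed.

Lemma yoneda_Dl (i j : nat) (F G H : functor) (x x' : Ext i F G) (y : Ext j G H) :
  yoneda (x + x') y = yoneda x y + yoneda x' y.
Proof.
have [a ca <-] := cls_surj (std_res F) x; have [a' ca' <-] := cls_surj (std_res F) x'.
have [b cb <-] := cls_surj (std_res G) y.
have la := shift_lift ca; have la' := shift_lift ca'.
set A := chain_lift _ _ a in la; set A' := chain_lift _ _ a' in la'.
have laa : is_chain_lift (C := fun j => std_res F (j + i)) (fun j => pr_d (std_res F) (j + i)) (std_res G)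
    (a + a') (fun j => A j + A' j).
  split=> [|q]; first by rewrite nt_compDr (proj1 la) (proj1 la').
  by rewrite nt_compDr nt_compDl (proj2 la) (proj2 la').
have coc B e : is_chain_lift (C := fun j => std_res F (j + i)) (fun j => pr_d (std_res F) (j + i)) (std_res G) e B ->
    is_coc (P := std_res F) (i := j + i) (nt_comp b (B j)).
  by move=> lB; rewrite /is_coc -nt_compA -(proj2 lB) nt_compA cb nt_comp0l.
rewrite -clsD // (yoneda_cls laa) // ?(yoneda_cls la) ?(yoneda_cls la') //; last exact: is_cocD.
by rewrite nt_compDr clsD //; [apply: coc la | apply: coc la'].
Qed.

(** Composing the lift of a with a lift of b gives a lift of b a, so both products have the same
    representative. It serves to move a permutation from the left factor to the right one. *)
Lemma yoneda_push_pull (i j : nat) (F G H : functor) (b : nattrans G G) (x : Ext i F G) (y : Ext j G H) :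
  yoneda (ext_push b x) y = yoneda x (ext_pull b y).
Proof.
have [a ca <-] := cls_surj (std_res F) x; have [e ce <-] := cls_surj (std_res G) y.
have lift := shift_lift ca.
set A := chain_lift _ _ a in lift.
have lb : is_chain_lift (pr_d (std_res G)) (std_res G) (nt_comp b (pr_aug (std_res G)))
    (chain_lift (pr_d (std_res G)) (std_res G) (nt_comp b (pr_aug (std_res G)))).
  apply: chain_liftE; [move=> q; exact: pr_proj | move=> q; exact: pr_ddE |].
  by rewrite -nt_compA pr_augd nt_comp0r.
set B := chain_lift _ _ (nt_comp b _) in lb.
have cB : is_coc (P := std_res G) (i := j) (nt_comp e (B j)).
  by rewrite /is_coc -nt_compA -(proj2 lb) nt_compA ce nt_comp0l.
rewrite ext_push_cls // (ext_pull_cls lb) // (yoneda_cls lift) //.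
have lBA : is_chain_lift (C := fun j => std_res F (j + i)) (fun j => pr_d (std_res F) (j + i)) (std_res G)
    (nt_comp b a) (fun j => nt_comp (B j) (A j)).
  split=> [|q]; first by rewrite nt_compA (proj1 lb) -nt_compA (proj1 lift).
  by rewrite nt_compA (proj2 lb) -nt_compA (proj2 lift) nt_compA.
rewrite (yoneda_cls lBA) //; first by rewrite nt_compA.
by rewrite /is_coc -nt_compA ca nt_comp0r.
Qed.

Lemma biadditive_Mzl (A B C : zmodType) (h : A -> B -> C) : biadditive h ->
  forall a b k, h (a *~ k) b = h a b *~ k.
Proof.
move=> [hl _] a b k; have hB : zmod_morphism (h^~ b).
  by move=> x y; apply/eqP; rewrite eq_sym subr_eq -hl subrK.
exact: (raddfMz (HB.pack (h^~ b) (GRing.isZmodMorphism.Build _ _ (h^~ b) hB) : {additive A -> C})).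
Qed.

Lemma biadditive_Mzr (A B C : zmodType) (h : A -> B -> C) : biadditive h ->
  forall a b k, h a (b *~ k) = h a b *~ k.
Proof. by move=> [hl hr] a b k; apply: (@biadditive_Mzl B A C (fun y x => h x y)). Qed.

Section ExtBasis.
Variables (l m p n i j : nat).
Hypothesis im : (i + l)%N = m.
Hypothesis jn : (j + p)%N = n.

Definition ext_table (x : 'Z_Surj(m, l)) (y : 'Z_Surj(n, p)) : 'Z_Surj((m + n)%N, (l + p)%N) :=
  \sum_g \sum_f surj_basis (surj_sum g f) *~ (x g * y f).

Lemma ext_table_biadditive : biadditive ext_table.
Proof.
split=> [x x' y|x y y']; rewrite -big_split; apply: eq_bigr => g _; rewrite -big_split;
  by apply: eq_bigr => f _; rewrite ffunE ?mulrDl ?mulrDr mulrzDr.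
Qed.

Lemma ext_table_basis g f : ext_table (surj_basis g) (surj_basis f) = surj_basis (surj_sum g f).
Proof.
rewrite /ext_table (bigD1 g) //= [X in _ + X]big1 => [|g' g'g]; last first.
  by rewrite big1 // => f' _; rewrite ffunE (negbTE g'g) mul0r mulr0z.
rewrite [LHS]addr0 (bigD1 f) //= [X in _ + X]big1 => [|f' f'f].
  by rewrite [LHS]addr0 !ffunE !eqxx.
by rewrite !ffunE (negbTE f'f) mulr0 mulr0z.
Qed.

Let c (a : nattrans (barc l i) (Ta m)) (b : nattrans (barc p j) (Ta n)) :=
  nt_comp (Ta_cat m n) (nt_comp (tensN a b) (bsplit l p (i + j) i j)).

Let c_biadditive : biadditive c.
Proof.
have cB a b : (forall a', c (a - a') b = c a b - c a' b) by move=> a'; rewrite /c tensNBl nt_compBl nt_compBr.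
have cB' a b : (forall b', c a (b - b') = c a b - c a b') by move=> b'; rewrite /c tensNBr nt_compBl nt_compBr.
split=> [a a' b|a b b'].
  by apply/eqP; rewrite -subr_eq -cB addrK.
by apply/eqP; rewrite -subr_eq -cB' addrK.
Qed.

Let c_sum (x : 'Z_Surj(m, l)) (y : 'Z_Surj(n, p)) : c (\sum_g bphi i g *~ x g) (\sum_f bphi j f *~ y f) =
  \sum_g \sum_f bphi (i + j) (surj_sum g f) *~ (x g * y f).
Proof.
have [cl cr] := c_biadditive.
have c0l b : c 0 b = 0 by apply: (addrI (c 0 b)); rewrite -cl !addr0.
have c0r a : c a 0 = 0 by apply: (addrI (c a 0)); rewrite -cr !addr0.
rewrite (big_morph (fun a => c a _) (fun a a' => cl a a' _) (c0l _)); apply: eq_bigr => g _.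
rewrite (big_morph (c _) (cr _) (c0r _)); apply: eq_bigr => f _.
by rewrite (biadditive_Mzl c_biadditive) (biadditive_Mzr c_biadditive) /c (bphi_sum g f im jn) -mulrzA mulrC.
Qed.

Lemma ext_prod_phi x y :
  ext_prod (Ta_cat l p) (Ta_cat m n) (phi l m i x) (phi p n j y) = phi (l + p) (m + n) (i + j) (ext_table x y).
Proof.
have cc q r s (z : 'Z_Surj(r, q)) : is_coc (P := bres q) (i := s) (\sum_f bphi s f *~ z f).
  by apply: is_coc_sum => f; apply: (is_cocMz _ (bphi_coc _ f)).
rewrite !phi_cls ext_prod_cls // -/(c _ _) c_sum -phi_cls /ext_table raddf_sum.
rewrite cls_sum => [|g]; last by apply: is_coc_sum => f; apply: (is_cocMz _ (bphi_coc _ _)).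
apply: eq_bigr => g _; rewrite raddf_sum cls_sum => [|f]; last by apply: (is_cocMz _ (bphi_coc _ _)).
by apply: eq_bigr => f _; rewrite raddfMz phi_basis clsMz //; apply: bphi_coc.
Qed.
End ExtBasis.

Theorem theorem1 :
  exists phi : forall n m i : nat, {additive 'Z_Surj(m, n) -> Ext i (Ta n) (Ta m)},
    (* Ext^* (T^n o a, T^m o a) is Z[Surj(m, n)] in degree m - n, and 0 otherwise *)
    (forall n m i : nat, (i + n)%N = m -> bijective (phi n m i)) /\
    (forall n m i : nat, (i + n)%N <> m -> forall x : Ext i (Ta n) (Ta m), x = 0) /\
    (* (1) actions of the symmetric groups *)
    (forall (n m i : nat) (f : surj m n) (s : {perm 'I_m}), (i + n)%N = m ->
       ext_push (Ta_perm s) (phi n m i (surj_basis f)) =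
       phi n m i (surj_basis (surj_comp f (surj_perm s)) *~
         \prod_(q < n) (-1) ^+ odd_perm (bar s (fiber (surj_comp f (surj_perm s)) q)))) /\
    (forall (n m i : nat) (f : surj m n) (k l : 'I_n), (i + n)%N = m -> (k < l)%N ->
       ext_pull (Ta_perm (tperm k l)) (phi n m i (surj_basis f)) =
       phi n m i (surj_basis (surj_comp (surj_perm (tperm k l)) f) *~
         ((-1) ^+ (fdeg f k * fdeg f l) * between_sign f k l))) /\
    (* (2) Yoneda product *)
    (forall l m n p q : nat, (p + l)%N = m -> (q + m)%N = n ->
       exists2 Y : 'Z_Surj(m, l) -> 'Z_Surj(n, m) -> 'Z_Surj(n, l), biadditive Y &
         [/\ forall x y, yoneda (phi l m p x) (phi m n q y) = phi l n (q + p)%N (Y x y),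
             forall (s : surj m l) (f : surj n m),
               {homo s : a b / (a <= b)%N} ->
               Y (surj_basis s) (surj_basis f) =
               surj_basis (surj_comp s f) *~ comp_sign s f
           & forall (s g : surj m l) (f : surj n m) (i j : 'I_m),
               {homo s : a b / (a <= b)%N} -> (i < j)%N ->
               g = surj_comp s (surj_perm (tperm i j)) ->
               Y (surj_basis g) (surj_basis f) =
               surj_basis (surj_comp g f) *~
                 ((\prod_(k < l) (-1) ^+ odd_perm (bar (tperm i j) (fiber g k))) *
                  ((-1) ^+ (fdeg f i * fdeg f j) * between_sign f i j) *
                  comp_sign s (surj_comp (surj_perm (tperm i j)) f))]) /\
    (* (3) external product *)
    (forall l m p n i j : nat, (i + l)%N = m -> (j + p)%N = n ->
       exists2 E : 'Z_Surj(m, l) -> 'Z_Surj(n, p) -> 'Z_Surj((m + n)%N, (l + p)%N),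
         biadditive E &
         (forall x y, ext_prod (Ta_cat l p) (Ta_cat m n) (phi l m i x) (phi p n j y) =
            phi (l + p)%N (m + n)%N (i + j)%N (E x y)) /\
         (forall (g : surj m l) (f : surj n p),
            E (surj_basis g) (surj_basis f) = surj_basis (surj_sum g f))).

Proof.
exists phi; split; first exact: phi_bij.
split; first exact: phi_zero.
split; first by move=> n m i f s im; exact: push_phi.
split; first by move=> n m i f k l im kl; exact: pull_phi.
split; last first.
  move=> l m p n i j im jn; exists (@ext_table l m p n); first exact: ext_table_biadditive.
  by split; [exact: ext_prod_phi | exact: ext_table_basis].
move=> l m n p q pm qn; have qpn : (q + p + l)%N = n by rewrite -addnA pm.
have [inv phiK invK] := phi_bij qpn.
pose Y x y := inv (yoneda (phi l m p x) (phi m n q y)).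
have Yb : biadditive Y.
  split=> [x x' y|x y y']; apply: (can_inj phiK); rewrite [RHS]raddfD /Y !invK [phi _ _ _ (_ + _)]raddfD.
    exact: yoneda_Dl.
  exact: yoneda_Dr.
have Ys (s : surj m l) (f : surj n m) : {homo s : a b / (a <= b)%N} ->
    Y (surj_basis s) (surj_basis f) = surj_basis (surj_comp s f) *~ comp_sign s f.
  by move=> sm; rewrite /Y (yoneda_basis f pm qn sm) phiK.
exists Y => //; split; [by move=> x y; rewrite /Y invK | exact: Ys |].
move=> s g f i j sm ij ->; set t := tperm i j.
(* This sign is its own inverse, so it can be moved to the other side of [E]. *)
set e := \prod_(k < l) _; have ee : e * e = 1.
  by rewrite /e bar_sign mulrACA !eps_sq.
(* Up to the sign e, the class of g is that of s acted upon by the transposition. The transposition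
   is moved across the product to the class of f, where its action is known, and the order
   preserving case applies to s. *)
have E : Y (surj_basis (surj_comp s (surj_perm t)) *~ e) (surj_basis f) =
    Y (surj_basis s) (surj_basis (surj_comp (surj_perm t) f) *~ ((-1) ^+ (fdeg f i * fdeg f j) * between_sign f i j)).
  rewrite /Y -(push_phi pm s t) yoneda_push_pull; congr (inv (yoneda _ _)).
  exact: pull_phi.
rewrite (biadditive_Mzl Yb) (biadditive_Mzr Yb) (Ys _ _ sm) in E.
have -> : surj_comp (surj_comp s (surj_perm t)) f = surj_comp s (surj_comp (surj_perm t) f).
  by apply: val_inj; apply/ffunP => x; rewrite !ffunE.
have := congr1 (fun z => z *~ e) E; rewrite -mulrzA ee mulr1z => ->.
by rewrite -!mulrzA; congr (_ *~ _); ring.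
Qed.
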